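(* The moduli space $\mathbb M_3(\mathbb C)$ for complex cubic curves is canonically isomorphic to the moduli space $\mathfrak M_4(\mathbb C)$ for divisors of degree four. In particular both spaces have one point with ramification index two, and one point with ramification index three, as well as one improper point, which is nonetheless weakly proper.
   Context: $\mathfrak M_4(\mathbb C)=\widehat{\mathfrak D}_4^{\mathsf{fs}}/\mathrm{PGL}_2(\mathbb C)$: here $\widehat{\mathfrak D}_4\cong\mathbb P^4(\mathbb C)$ is the space of effective divisors of degree 4 on $\mathbb P^1(\mathbb C)$ (formal sums $\sum m_j\langle\mathbf p_j\rangle$, $m_j\ge1$, $\sum m_j=4$, identified with binary quartic forms up to constants), and $\widehat{\mathfrak D}_4^{\mathsf{fs}}$ is the open subset of divisors with finite stabilizer, equivalently with at least three distinct points. $\mathbb M_3(\mathbb C)=\widehat{\mathfrak C}_3^{\mathsf{fs}}/\mathrm{PGL}_3(\mathbb C)$: here $\widehat{\mathfrak C}_3$ is the projective space of nonzero homogeneous cubic polynomials in $x,y,z$ over $\mathbb C$ up to constants (effective 1-cycles of degree 3 in $\mathbb P^2(\mathbb C)$), and $\widehat{\mathfrak C}_3^{\mathsf{fs}}$ is the open set of those with finite stabilizer in $\mathrm{PGL}_3(\mathbb C)$ (these are irreducible cubics). Both quotients $\mathbf X/\mathbf G$ carry the quotient topology, and the analytic structure in which a function $f$ on an open set $Y'$ is analytic iff $f\circ\pi$ is analytic on $\pi^{-1}(Y')$, $\pi$ being the projection. The action of $\mathbf G$ on $\mathbf X$ is locally proper at $\mathbf x$ if there is a neighborhood $U$ of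 $\mathbf x$ with $\{g\in\mathbf G:g(U)\cap U\neq\emptyset\}$ of compact closure (equivalently, the action is proper on some $\mathbf G$-invariant open neighborhood of $\mathbf x$). It is weakly proper at $\mathbf x$ if there are a neighborhood $U$ and a compact $K\subset\mathbf G$ such that $\mathbf x_1,\mathbf x_2\in U$ lie in the same orbit iff $\mathbf x_2=g(\mathbf x_1)$ for at least one $g\in K$. A point of $\mathbf X/\mathbf G$ is improper if the action is not locally proper at corresponding points of $\mathbf X$, and is weakly proper if the action is weakly proper there. Ramification index at $\mathbf x$: $|\mathbf G_{\mathbf x}/\mathbf H_{\mathbf x}|$, where $\mathbf G_{\mathbf x}$ is the stabilizer and $\mathbf H_{\mathbf x}$ the subgroup acting as the identity on $T_{\mathbf x}\mathbf X/T_{\mathbf x}\mathbf F$, with $\mathbf F$ the orbit of $\mathbf x$. *)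

(* Defs.v *)
From HB Require Import structures.
From mathcomp Require Import all_boot all_order all_algebra.
From mathcomp Require Import generic_quotient.
From mathcomp Require Import all_classical all_reals all_analysis.
(* The notations of mpoly clash with those of mathcomp-analysis. *)
From mathcomp Require Import -(notations) mpoly.
From mathcomp Require Export complex.

Set Implicit Arguments.
Unset Strict Implicit.
Unset Printing Implicit Defensive.

Import Order.TTheory GRing.Theory Num.Theory VectorInternalTheory.
Import numFieldNormedType.Exports numFieldTopology.Exports.

Local Open Scope classical_set_scope.
Local Open Scope ring_scope.
Local Open Scope quotient_scope.

Section Lines.
Context {C : numClosedFieldType} {V : normedModType C} (A : set V).

Definition proportional : rel A :=
  fun v w => `[< exists2 c : C, c != 0 & \val w = c *: \val v >].

Lemma proportional_refl : reflexive proportional.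
Proof. by move=> v; apply/asboolP; exists 1; rewrite ?oner_eq0 ?scale1r. Qed.

Lemma proportional_sym : ssrbool.symmetric proportional.
Proof.
suff H v w : proportional v w -> proportional w v.
  by move=> v w; apply/idP/idP; exact: H.
move=> /asboolP[c c0 e]; apply/asboolP; exists c^-1; first by rewrite invr_eq0.
by rewrite e scalerA mulVf// scale1r.
Qed.

Lemma proportional_trans : transitive proportional.
Proof.
move=> w v u /asboolP[c c0 e] /asboolP[c' c'0 e']; apply/asboolP.
by exists (c' * c); rewrite ?mulf_neq0// e' e scalerA.
Qed.

Canonical proportional_equiv :=
  EquivRel proportional proportional_refl proportional_sym proportional_trans.

(* A modulo nonzero scalars, with the quotient topology: the projective space
   of V when A = V \ {0}, and PGL when A is the group of invertible matrices *)
Definition lines := quotient_topology {eq_quot proportional_equiv}.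

HB.instance Definition _ := Quotient.on lines.
HB.instance Definition _ := Choice.on lines.
HB.instance Definition _ := Topological.on lines.

Lemma lines_eqP (v w : A) :
  \pi_lines v = \pi_lines w <-> exists2 c : C, c != 0 & \val w = c *: \val v.
Proof.
have H := @eqmodP _ proportional_equiv v w.
by split=> [e|e]; [apply/asboolP; exact/H | apply/H/asboolP].
Qed.

End Lines.

Section PGL.
Context (C : numClosedFieldType) (n : nat).

Definition GL : set 'M[C]_n.+1 := [set M | M \in unitmx].

Definition toGL (M : 'M[C]_n.+1) (hM : M \in unitmx) : GL :=
  exist _ M (mem_set hM).

Lemma GL_unit (M : GL) : \val M \in unitmx.
Proof. by case: M => M /= /set_mem. Qed.

Lemma GL_mul_unit (M N : GL) : \val M *m \val N \in unitmx.
Proof. by rewrite unitmx_mul !GL_unit. Qed.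

Lemma GL_inv_unit (M : GL) : invmx (\val M) \in unitmx.
Proof. by rewrite unitmx_inv GL_unit. Qed.

Definition PGL := lines GL.

HB.instance Definition _ := Quotient.on PGL.
HB.instance Definition _ := Choice.on PGL.
HB.instance Definition _ := Topological.on PGL.

Definition pgl_one : PGL := \pi_PGL (toGL (unitmx1 C n.+1)).
Definition pgl_mul (g h : PGL) : PGL :=
  \pi_PGL (toGL (GL_mul_unit (repr g) (repr h))).
Definition pgl_inv (g : PGL) : PGL := \pi_PGL (toGL (GL_inv_unit (repr g))).

Lemma pgl_repr (M : GL) :
  exists2 c : C, c != 0 & \val (repr (\pi_PGL M)) = c *: \val M.
Proof. by apply/lines_eqP; rewrite reprK. Qed.

Lemma pgl_ext (M N : GL) : \val M = \val N -> \pi_PGL M = \pi_PGL N.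
Proof. by move=> e; congr (\pi_PGL _); apply/val_inj. Qed.

Lemma pgl_ind (P : PGL -> Prop) : (forall M : GL, P (\pi_PGL M)) -> forall g, P g.
Proof. by move=> H g; rewrite -[g]reprK; exact: H. Qed.

Lemma pgl_mulE (M N : GL) :
  pgl_mul (\pi_PGL M) (\pi_PGL N) = \pi_PGL (toGL (GL_mul_unit M N)).
Proof.
have [c c0 ec] := pgl_repr M; have [d d0 ed] := pgl_repr N.
apply/esym/lines_eqP; exists (c * d); first by rewrite mulf_neq0.
by rewrite /= ec ed -scalemxAl -scalemxAr scalerA.
Qed.

Lemma pgl_invE (M : GL) : pgl_inv (\pi_PGL M) = \pi_PGL (toGL (GL_inv_unit M)).
Proof.
have [c c0 ec] := pgl_repr M.
apply/esym/lines_eqP; exists c^-1; first by rewrite invr_eq0.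
by rewrite /= ec invmxZ// unitmxZ ?unitfE// GL_unit.
Qed.

Lemma pgl_mulA : associative pgl_mul.
Proof.
apply: pgl_ind => M; apply: pgl_ind => N; apply: pgl_ind => P.
by rewrite !pgl_mulE; apply: pgl_ext; rewrite /= mulmxA.
Qed.

Lemma pgl_mul1 : left_id pgl_one pgl_mul.
Proof. by apply: pgl_ind => M; rewrite pgl_mulE; apply: pgl_ext; rewrite /= mul1mx. Qed.

Lemma pgl_mulr1 : right_id pgl_one pgl_mul.
Proof. by apply: pgl_ind => M; rewrite pgl_mulE; apply: pgl_ext; rewrite /= mulmx1. Qed.

Lemma pgl_mulV : left_inverse pgl_one pgl_inv pgl_mul.
Proof.
apply: pgl_ind => M; rewrite pgl_invE pgl_mulE; apply: pgl_ext => /=.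
by rewrite mulVmx// GL_unit.
Qed.

Lemma pgl_mulrV : right_inverse pgl_one pgl_inv pgl_mul.
Proof.
apply: pgl_ind => M; rewrite pgl_invE pgl_mulE; apply: pgl_ext => /=.
by rewrite mulmxV// GL_unit.
Qed.

HB.instance Definition _ := isGroup.Build PGL
  pgl_mulA pgl_mul1 pgl_mulr1 pgl_mulV pgl_mulrV.

End PGL.

Arguments GL : clear implicits.

Section Forms.
Context (C : numClosedFieldType) (n d : nat).

(* Homogeneous polynomials of degree d in n + 1 variables over C, given by
   their coordinates in a basis, so that they form a normed space. *)
Definition form := 'rV[C]_(dim (dhomog n.+1 C d)).

HB.instance Definition _ := NormedModule.on form.

(* Junk value 0 if p is not homogeneous of degree d. *)
Definition form_of (p : mpoly n.+1 C) : form := v2r (indhomog d p).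
Definition poly_of (F : form) : mpoly n.+1 C := mpoly_of_dhomog (r2v F).

Definition linear_forms (A : 'M[C]_n.+1) : n.+1.-tuple (mpoly n.+1 C) :=
  [tuple \sum_j A i j *: mpolyX C (mnm1 j) | i < n.+1].

(* F(A x) *)
Definition substitute (A : 'M[C]_n.+1) (F : form) : form :=
  form_of (comp_mpoly (linear_forms A) (poly_of F)).

(* The left action of GL: the zero locus of [transform A F] is the image under
   A of the zero locus of F. *)
Definition transform (A : 'M[C]_n.+1) (F : form) : form :=
  substitute (invmx A) F.

Lemma poly_ofK : cancel poly_of form_of.
Proof. by move=> F; rewrite /form_of /indhomog /poly_of valKd r2vK. Qed.

Lemma form_ofK p : p \is ishomog1 d mdeg -> poly_of (form_of p) = p.
Proof. by move=> hp; rewrite /poly_of v2rK [LHS]insubdK. Qed.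

Lemma poly_of_homog F : poly_of F \is ishomog1 d mdeg.
Proof. exact: dhomog_is_dhomog. Qed.

Lemma homog_exp (p : mpoly n.+1 C) k :
  p \is ishomog1 1 mdeg -> p ^+ k \is ishomog1 k mdeg.
Proof. by move=> hp; rewrite -[X in ishomog1 X]mul1n; exact: dhomogMn. Qed.

Lemma comp_homog (p : mpoly n.+1 C) A : p \is ishomog1 d mdeg ->
  comp_mpoly (linear_forms A) p \is ishomog1 d mdeg.
Proof.
move=> hp; rewrite comp_mpolyEX big_seq; apply: rpred_sum => m hm; apply: rpredZ.
have {hp hm} <- : mdeg m = d by exact: dhomogP hp _ hm.
rewrite comp_mpolyX mdegE.
elim/big_rec2: _ => [|i k q _ hq]; first exact: dhomog1.
apply: dhomogM => //; apply: homog_exp; rewrite tnth_mktuple.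
by apply: rpred_sum => j _; apply: rpredZ; rewrite dhomogX /= mdeg1.
Qed.

Lemma comp_mpoly_comp (p : mpoly n.+1 C) (A B : 'M[C]_n.+1) :
  comp_mpoly (linear_forms B) (comp_mpoly (linear_forms A) p) =
  comp_mpoly (linear_forms (A *m B)) p.
Proof.
rewrite (comp_mpolyEX p (linear_forms A)) (comp_mpolyEX p (linear_forms (_ *m _))).
rewrite linear_sum /=; apply: eq_bigr => m _; rewrite linearZ /=; congr (_ *: _).
rewrite !comp_mpolyX rmorph_prod; apply: eq_bigr => i _ /=.
rewrite rmorphXn /=; congr (_ ^+ _); rewrite !tnth_mktuple linear_sum /=.
under eq_bigr => j _.
  rewrite linearZ /= comp_mpolyXU -tnth_nth tnth_mktuple scaler_sumr; over.
rewrite exchange_big /=; apply: eq_bigr => k _.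
by rewrite mxE scaler_suml; apply: eq_bigr => j _; rewrite scalerA.
Qed.

Lemma substituteM A B F : substitute B (substitute A F) = substitute (A *m B) F.
Proof.
rewrite /substitute form_ofK ?comp_mpoly_comp//.
exact/comp_homog/poly_of_homog.
Qed.

Lemma substitute1 F : substitute 1%:M F = F.
Proof.
rewrite /substitute -[RHS]poly_ofK -[in RHS](comp_mpoly_id (poly_of F)).
congr (form_of (comp_mpoly _ _)); apply: eq_from_tnth => i; rewrite !tnth_mktuple.
rewrite (bigD1 i)//= mxE eqxx scale1r big1 ?addr0// => j /negPf ji.
by rewrite mxE eq_sym ji scale0r.
Qed.

Lemma poly_ofZ (c : C) F : poly_of (c *: F) = c *: poly_of F.
Proof. by rewrite /poly_of !linearZ. Qed.

Lemma substituteZr A (c : C) F : substitute A (c *: F) = c *: substitute A F.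
Proof.
rewrite -[RHS]poly_ofK /substitute; congr form_of.
by rewrite !poly_ofZ linearZ /= form_ofK//; exact/comp_homog/poly_of_homog.
Qed.

Lemma substitute_scalar (c : C) F : substitute c%:M F = c ^+ d *: F.
Proof.
rewrite -[RHS]poly_ofK /substitute; congr form_of.
rewrite comp_mpolyEX poly_ofZ.
rewrite [in RHS](mpolyE (poly_of F)) scaler_sumr !big_seq.
apply: eq_bigr => m hm.
have {hm} <- : mdeg m = d by exact: dhomogP (poly_of_homog F) _ hm.
rewrite comp_mpolyX scalerA [_ * mcoeff _ _]mulrC -scalerA; congr (_ *: _).
rewrite mdegE -prodrXr mpolyXE_id -scaler_prod; apply: eq_bigr => i _.
rewrite tnth_mktuple (bigD1 i)//= mxE eqxx mulr1n big1 ?addr0 ?exprZn//.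
by move=> j /negPf ji; rewrite mxE eq_sym ji scale0r.
Qed.

End Forms.

Section Moduli.
Context (C : numClosedFieldType) (n d : nat).

Lemma transform1 (F : form C n d) : transform 1%:M F = F.
Proof. by rewrite /transform invmx1 substitute1. Qed.

Lemma transformM (A B : GL C n) (F : form C n d) :
  transform (\val A *m \val B) F = transform (\val A) (transform (\val B) F).
Proof.
rewrite /transform substituteM; congr substitute; apply/eqP.
rewrite -(inj_eq (can_inj (mulKmx (GL_mul_unit A B)))) mulmxV ?GL_mul_unit//.
by rewrite mulmxA mulmxK ?GL_unit// mulmxV ?GL_unit.
Qed.

Lemma transformZr A (c : C) (F : form C n d) :
  transform A (c *: F) = c *: transform A F.
Proof. exact: substituteZr. Qed.

Lemma transform0 A : transform A 0 = 0 :> form C n d.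
Proof. by have := transformZr A 0 0; rewrite !scale0r. Qed.

Definition nonzero_forms : set (form C n d) := [set F | F != 0].

Lemma transform_neq0 (A : GL C n) (F : nonzero_forms) :
  transform (\val A) (\val F) != 0.
Proof.
case: F => F /= /set_mem F0; apply: contraNN F0 => /eqP e.
have := transform1 F; rewrite -(mulVmx (GL_unit A)).
rewrite -[invmx _]/(\val (toGL (GL_inv_unit A))) transformM e.
by rewrite transform0 => ->.
Qed.

Definition to_nonzero (F : form C n d) (F0 : F != 0) : nonzero_forms :=
  exist _ F (mem_set F0).

(* effective divisors of degree d on the projective line if n = 1, plane
   curves of degree d (with multiplicities) if n = 2 *)
Definition hypersurfaces := lines nonzero_forms.

HB.instance Definition _ := Quotient.on hypersurfaces.
HB.instance Definition _ := Choice.on hypersurfaces.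
HB.instance Definition _ := Topological.on hypersurfaces.

Definition act (g : PGL C n) (x : hypersurfaces) : hypersurfaces :=
  \pi_hypersurfaces (to_nonzero (transform_neq0 (repr g) (repr x))).

Lemma hyp_ind (P : hypersurfaces -> Prop) :
  (forall F : nonzero_forms, P (\pi_hypersurfaces F)) -> forall x, P x.
Proof. by move=> H x; rewrite -[x]reprK; exact: H. Qed.

Lemma hyp_ext (F G : nonzero_forms) :
  \val F = \val G -> \pi_hypersurfaces F = \pi_hypersurfaces G.
Proof. by move=> e; congr (\pi_hypersurfaces _); apply/val_inj. Qed.

Lemma transform_scale (c : C) (A : 'M[C]_n.+1) (F : form C n d) :
  c != 0 -> A \in unitmx ->
  exists2 c' : C, c' != 0 & transform (c *: A) F = c' *: transform A F.
Proof.
move=> c0 uA; exists (c^-1 ^+ d); first by rewrite expf_neq0// invr_eq0.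
rewrite /transform invmxZ ?unitmxZ ?unitfE// -mul_scalar_mx -substituteM.
by rewrite substitute_scalar substituteZr.
Qed.

Lemma actE (M : GL C n) (F : nonzero_forms) :
  act (\pi_(PGL C n) M) (\pi_hypersurfaces F) =
  \pi_hypersurfaces (to_nonzero (transform_neq0 M F)).
Proof.
have [c c0 ec] := pgl_repr M.
have [b b0 eb] : exists2 b : C, b != 0 &
    \val (repr (\pi_hypersurfaces F)) = b *: \val F.
  by apply/lines_eqP; rewrite reprK.
apply/esym/lines_eqP => /=; rewrite ec eb transformZr.
have [c' c'0 ->] := transform_scale (\val F) c0 (GL_unit M).
by exists (b * c'); rewrite ?mulf_neq0// scalerA.
Qed.

Lemma act1 x : act 1%g x = x.
Proof. by elim/hyp_ind: x => F; rewrite actE; apply: hyp_ext; exact: transform1. Qed.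

Lemma actM g h x : act (g * h)%g x = act g (act h x).
Proof.
elim/pgl_ind: g => M; elim/pgl_ind: h => N; elim/hyp_ind: x => F.
by rewrite [(_ * _)%g]pgl_mulE !actE; apply: hyp_ext; exact: transformM.
Qed.

Definition stabilizer (x : hypersurfaces) : set (PGL C n) :=
  [set g | act g x = x].

Definition finite_stabilizer : set hypersurfaces :=
  [set x | finite_set (stabilizer x)].

Lemma finite_stabilizer_act g x :
  finite_stabilizer x -> finite_stabilizer (act g x).
Proof.
move=> fx; apply: (@sub_finite_set _ _ [set (g * h * g^-1)%g | h in stabilizer x]).
  move=> h hx; exists (g^-1 * h * g)%g.
    by rewrite /stabilizer /= !actM hx -actM mulVg act1.
  by rewrite !mulgA mulgV mul1g -mulgA mulgV mulg1.
exact: finite_image.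
Qed.

Definition to_fs (x : hypersurfaces) (fx : finite_stabilizer x) :
  finite_stabilizer := exist _ x (mem_set fx).

Definition act_fs (g : PGL C n) (x : finite_stabilizer) : finite_stabilizer :=
  to_fs (finite_stabilizer_act g (set_mem (valP x))).

Definition same_orbit : rel finite_stabilizer :=
  fun x y => `[< exists g, y = act_fs g x >].

Lemma same_orbit_refl : reflexive same_orbit.
Proof. by move=> x; apply/asboolP; exists 1%g; apply/val_inj; rewrite /= act1. Qed.

Lemma same_orbit_sym : ssrbool.symmetric same_orbit.
Proof.
suff H x y : same_orbit x y -> same_orbit y x.
  by move=> x y; apply/idP/idP; exact: H.
move=> /asboolP[g ->]; apply/asboolP; exists g^-1%g; apply/val_inj.
by rewrite /= -actM mulVg act1.
Qed.

Lemma same_orbit_trans : transitive same_orbit.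
Proof.
move=> y x z /asboolP[g ->] /asboolP[h ->]; apply/asboolP.
by exists (h * g)%g; apply/val_inj; rewrite /= actM.
Qed.

Canonical same_orbit_equiv :=
  EquivRel same_orbit same_orbit_refl same_orbit_sym same_orbit_trans.

Definition moduli := quotient_topology {eq_quot same_orbit_equiv}.

HB.instance Definition _ := Quotient.on moduli.
HB.instance Definition _ := Choice.on moduli.
HB.instance Definition _ := Topological.on moduli.

(* The class of the form F in the moduli space, provided that F is nonzero and
   has finite stabilizer. *)
Definition class_of (F : form C n d) : option moduli :=
  omap \pi_moduli
    (obind (fun G : nonzero_forms => insub (\pi_hypersurfaces G)) (insub F)).

Definition locally_proper (x : finite_stabilizer) : Prop :=
  exists2 U, nbhs x U &
    compact (closure [set g | (act_fs g @` U) `&` U !=set0]).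

Definition weakly_proper (x : finite_stabilizer) : Prop :=
  exists U K, [/\ nbhs x U, compact K &
    forall x1 x2, U x1 -> U x2 ->
      (same_orbit x1 x2 <-> exists2 g, K g & x2 = act_fs g x1)].

(* T_[F] of the projective space is form / C F, and the tangent space of the
   orbit of [F] is the image there of the differential at 1 of the orbit map
   A |-> F(A x) = A^-1 F. *)
Definition orbit_tangent (F : form C n d) : set (form C n d) :=
  [set G | exists (c : C) (B : 'M[C]_n.+1),
     G = c *: F + 'D_B (fun A : 'M[C]_n.+1 => substitute A F) 1%:M].

(* The subgroup of the stabilizer that acts trivially on T_x X / T_x F: if the
   matrix M sends F to c F, then it acts on form / C F, the tangent space at
   [F], by G |-> c^-1 (M G). *)
Definition normal_kernel (x : hypersurfaces) : set (PGL C n) :=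
  [set g | exists (M : GL C n) (F : nonzero_forms) (c : C),
     [/\ g = \pi_(PGL C n) M, x = \pi_hypersurfaces F, c != 0,
         transform (\val M) (\val F) = c *: \val F &
         forall G, orbit_tangent (\val F) (c^-1 *: transform (\val M) G - G)]].

Definition left_coset (H : set (PGL C n)) (g : PGL C n) : set (PGL C n) :=
  [set (g * h)%g | h in H].

Definition has_ramification_index (k : nat) (x : finite_stabilizer) : Prop :=
  (left_coset (normal_kernel (\val x)) @` stabilizer (\val x) #= `I_k)%card.

Definition ramification_point (k : nat) (p : moduli) : Prop :=
  forall x, \pi_moduli x = p -> has_ramification_index k x.

Definition improper_point (p : moduli) : Prop :=
  forall x, \pi_moduli x = p -> ~ locally_proper x.

Definition weakly_proper_point (p : moduli) : Prop :=
  forall x, \pi_moduli x = p -> weakly_proper x.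

(* f o pi is holomorphic on the inverse image of Y, read on the cone of nonzero
   forms, which is a holomorphic C^*-bundle over the projective space. The
   value 0 off the (open) set of forms with finite stabilizer is immaterial. *)
Definition analytic_on (Y : set moduli) (f : moduli -> C) : Prop :=
  forall F p, class_of F = Some p -> Y p ->
    differentiable (fun G => oapp f 0 (class_of G)) F.

End Moduli.

Arguments moduli : clear implicits.

Definition analytic_isomorphism (C : numClosedFieldType) (n d n' d' : nat)
    (phi : moduli C n d -> moduli C n' d') : Prop :=
  [/\ exists psi, [/\ cancel phi psi, cancel psi phi & continuous psi],
      continuous phi &
      forall (Y : set (moduli C n' d')) (f : moduli C n' d' -> C), open Y ->
        (analytic_on Y f <-> analytic_on (phi @^-1` Y) (f \o phi))].

Definition special_points (C : numClosedFieldType) (n d : nat) : Prop :=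
  [/\ exists! p : moduli C n d, ramification_point 2 p,
      exists! p : moduli C n d, ramification_point 3 p,
      exists! p : moduli C n d, improper_point p &
      forall p : moduli C n d, improper_point p -> weakly_proper_point p].

Definition weierstrass_cubic (C : numClosedFieldType) (a b : C) : form C 2 3 :=
  let x := mpolyX C (mnm1 0) in
  let y := mpolyX C (mnm1 1) in
  let z := mpolyX C (mnm1 (2 : 'I_3)) in
  form_of 3 (y ^+ 2 * z - x ^+ 3 - a *: (x * z ^+ 2) - b *: z ^+ 3).

(* The divisor consisting of the roots of x^3 + a x + b and of the point at
   infinity, that is, of the tangent lines to the Weierstrass cubic through its
   flex point at infinity, or of the branch points of (x, y) |-> x. *)
Definition weierstrass_quartic (C : numClosedFieldType) (a b : C) :
    form C 1 4 :=
  let x := mpolyX C (mnm1 0) in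
  let z := mpolyX C (mnm1 (1 : 'I_2)) in
  form_of 4 (z * (x ^+ 3 + a *: (x * z ^+ 2) + b *: z ^+ 3)).

(* Main.v *)
From HB Require Import structures.
From mathcomp Require Import all_boot all_order all_algebra perm.
From mathcomp Require Import generic_quotient.
From mathcomp Require Import all_classical all_reals all_analysis.
From mathcomp Require Import -(notations) mpoly.
From mathcomp Require Import complex ring lra zify.
Require Import Defs.
Set Implicit Arguments. Unset Strict Implicit. Unset Printing Implicit Defensive.
Import Order.TTheory GRing.Theory Num.Theory VectorInternalTheory.
Import numFieldNormedType.Exports numFieldTopology.Exports.
Local Open Scope classical_set_scope.
Local Open Scope ring_scope.
Local Open Scope quotient_scope.

(** Both moduli spaces are the weighted projective line of weights 2 and 3. A binary quartic with finite
    stabilizer has a simple root; with this root at infinity, and after a translation, it becomes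
    [z (x^3 + a x z^2 + b z^3)]. A plane cubic with finite stabilizer has a smooth flex; with the flex
    at (0:1:0) and its tangent line at z = 0 it becomes [y^2 z - x^3 - a x z^2 - b z^3]. In both cases
    [(a, b) != (0, 0)], and every such pair occurs. The classical invariants, normalized as [S] and [T]
    so that they take the values [a] and [b] on the normal forms, satisfy [S (F o A) = det A ^ 4 S F]
    and [T (F o A) = det A ^ 6 T F]. Hence equivalent forms have invariants [(S, T)] and
    [(s^2 S, s^3 T)] for some [s != 0], and conversely normal forms with parameters so related are
    equivalent under a diagonal matrix. The map that sends [F] to the normal form of the other family
    with parameters [S F] and [T F] is therefore a bijection of classes. It is given by polynomials,
    and so is its inverse: this is the isomorphism ([isomorphism_family]).

    The local statements are proved once, for all families of forms with these properties
    ([weierstrass_family]), and then the properties are checked for quartics and for cubics.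

    Slices. The two parameters of the normal form, together with the directions tangent to the orbit,
    span the space of forms. By the inverse function theorem every form near [W a b] is
    [W a' b' o A] with [a'], [b'] near [a], [b] and [A] near 1 ([local_normal_form]). For two such
    forms in one orbit, [(a'', b'') = (s^2 a', s^3 b')] with all these pairs near [(a, b) != 0]
    bounds [s] and its inverse, so that a compact part of the group joins them
    ([weakly_proper_everywhere]).

    Ramification. An element of the stabilizer, represented by [A] and [c] with [c (F o A) = F],
    multiplies [S] and [T] by the square and the cube of a number [z] which must fix [(S, T)], and it
    acts on the normal line to the orbit by [z^5]. Hence [z] is a character of the stabilizer, and its
    kernel consists of the elements that act trivially on the normal line. Its values are the [z] with
    [z^2 S = S] and [z^3 T = T], so that the index is 1, except that it is 2 where [T = 0] and 3 where
    [S = 0] ([ramification_index]).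

    Improper points. If [4 S^3 + 27 T^2 = 0], the form is, up to equivalence, the quartic with one
    double root or the nodal cubic, and arbitrarily close to it there are forms with a symmetry arbitrarily
    far from the identity. If the discriminant does not vanish and A maps a form near F to another
    one, Gaussian elimination with complete pivoting writes A as a diagonal matrix between two bounded
    factors. Were A nearly singular, this diagonal matrix would connect two bounded forms, the first of
    which would lack almost entirely the coefficients that prevent a multiple root, a singular point or
    a line; its discriminant would be close to 0, a contradiction ([stable_of_flat]). *)

(** * Complex numbers with real norms *)

(** What the analysis below uses of the complex numbers: the embedding [rl] of the reals, a map [re]
    back that is constrained on real elements only, and the compactness of closed discs. Keeping the
    field abstract prevents computations from unfolding the operations on pairs of reals. *)
Structure complexField (R : realType) := ComplexField {
  csort :> numClosedFieldType;
  rl : R -> csort;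
  re : csort -> R;
  le_rl : forall x y, (rl x <= rl y) = (x <= y);
  rlD : forall x y, rl (x + y) = rl x + rl y;
  rlM : forall x y, rl (x * y) = rl x * rl y;
  rl_re : forall z, z \is Num.real -> rl (re z) = z;
  disc_compact : forall r : R, compact [set z : csort | `|z| <= rl r]
}.

Arguments rl {R c}.
Arguments re {R c}.

Section RealNorm.
Context {R : realType} {C : complexField R}.

Lemma rl_inj : injective (@rl R C).
Proof. by move=> x y e; apply/eqP; rewrite eq_le -!(@le_rl R C) e lexx. Qed.

Lemma lt_rl x y : ((rl x : C) < rl y) = (x < y).
Proof. by rewrite !lt_neqAle le_rl (inj_eq rl_inj). Qed.

Lemma rl0 : rl 0 = 0 :> C.
Proof. by apply: (addrI (rl 0 : C)); rewrite -rlD !addr0. Qed.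

Lemma rlN x : rl (- x) = - rl x :> C.
Proof. by apply: (addrI (rl x : C)); rewrite -rlD !subrr rl0. Qed.

Lemma rlB x y : rl (x - y) = rl x - rl y :> C.
Proof. by rewrite rlD rlN. Qed.

Lemma rl1 : rl 1 = 1 :> C.
Proof.
have n0 : rl 1 != 0 :> C by rewrite -[X in _ != X]rl0 (inj_eq rl_inj) oner_eq0.
by apply: (mulfI n0); rewrite -rlM !mulr1.
Qed.

(** The norm of a normed space over [C] takes its values in [C]; this is the same norm, read in [R]. *)
Definition nrm {V : normedZmodType C} (v : V) : R := re `|v|.

Lemma nrmE (V : normedZmodType C) (v : V) : `|v| = rl (nrm v).
Proof. by rewrite /nrm rl_re ?normr_real. Qed.

Lemma nrm_ge0 (V : normedZmodType C) (v : V) : 0 <= nrm v.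
Proof. by rewrite -(@le_rl R C) -nrmE rl0. Qed.

Lemma nrm0 (V : normedZmodType C) : nrm (0 : V) = 0.
Proof. by apply: rl_inj; rewrite -nrmE normr0 rl0. Qed.

Lemma nrm_eq0 (V : normedZmodType C) (v : V) : (nrm v == 0) = (v == 0).
Proof. by rewrite -[RHS]normr_eq0 nrmE -rl0 (inj_eq rl_inj). Qed.

Lemma nrm_gt0 (V : normedZmodType C) (v : V) : (0 < nrm v) = (v != 0).
Proof. by rewrite lt_neqAle nrm_ge0 andbT eq_sym nrm_eq0. Qed.

Lemma nrmN (V : normedZmodType C) (v : V) : nrm (- v) = nrm v.
Proof. by rewrite /nrm normrN. Qed.

Lemma nrmB_sym (V : normedZmodType C) (v w : V) : nrm (v - w) = nrm (w - v).
Proof. by rewrite /nrm distrC. Qed.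

Lemma nrmD (V : normedZmodType C) (v w : V) : nrm (v + w) <= nrm v + nrm w.
Proof. by rewrite -(@le_rl R C) rlD -!nrmE ler_normD. Qed.

Lemma nrmZ (V : normedModType C) (c : C) (v : V) : nrm (c *: v) = nrm c * nrm v.
Proof. by apply: rl_inj; rewrite rlM -!nrmE normrZ. Qed.

Lemma nrmM (a b : C) : nrm (a * b) = nrm a * nrm b.
Proof. by apply: rl_inj; rewrite rlM -!nrmE normrM. Qed.

Lemma nrm1 : nrm (1 : C) = 1.
Proof. by apply: rl_inj; rewrite -nrmE normr1 rl1. Qed.

Lemma nrmX (a : C) n : nrm (a ^+ n) = nrm a ^+ n.
Proof. by elim: n => [|n IH]; rewrite ?nrm1// !exprS nrmM IH. Qed.

Lemma nrmV (a : C) : nrm a^-1 = (nrm a)^-1.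
Proof.
have [->|a0] := eqVneq a 0; first by rewrite invr0 nrm0 invr0.
have n0 : nrm a != 0 by rewrite nrm_eq0.
by apply: (mulfI n0); rewrite -nrmM !divff// nrm1.
Qed.

Lemma nrm_real (r : R) : nrm (rl r : C) = `|r|.
Proof.
apply: rl_inj; rewrite -nrmE; have [r0|r0] := leP 0 r.
  have h : 0 <= rl r :> C by rewrite -rl0 le_rl.
  by rewrite (ger0_norm h) (ger0_norm r0).
have h : rl r < 0 :> C by rewrite -rl0 lt_rl.
by rewrite (ltr0_norm h) (ltr0_norm r0) rlN.
Qed.

Lemma nrm_sum (V : normedZmodType C) I (s : seq I) (P : pred I) (F : I -> V) :
  nrm (\sum_(i <- s | P i) F i) <= \sum_(i <- s | P i) nrm (F i).
Proof.
elim/big_rec2: _ => [|i x y _ h]; first by rewrite nrm0.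
by apply: le_trans (nrmD _ _) _; rewrite lerD2l.
Qed.

Lemma nrm_mx_le m n (M : 'M[C]_(m, n)) (r : R) : 0 <= r ->
  (nrm M <= r <-> forall i j, nrm (M i j) <= r).
Proof.
move=> r0; split => [h i j|h]; last first.
  rewrite -(@le_rl R C) -nrmE; have [->|] := eqVneq `|M| 0; first by rewrite -rl0 le_rl.
  by move=> /mx_norm_neq0[[i j] e]; rewrite {1}/Num.norm /= e nrmE le_rl.
apply: le_trans h; rewrite -(@le_rl R C) -!nrmE.
rewrite [leRHS]/Num.norm /= mx_normE -[leLHS]nngE num_le.
exact: (@le_bigmax _ _ _ _ (fun k : 'I_m * 'I_n => `|M k.1 k.2|%:nng) (i, j)).
Qed.

Lemma nrm_mx_entry m n (M : 'M[C]_(m, n)) i j : nrm (M i j) <= nrm M.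
Proof. by have := (nrm_mx_le M (nrm_ge0 M)).1 (lexx _) i j. Qed.

Lemma nbhs_nrmP (V : normedModType C) (x : V) (A : set V) :
  nbhs x A <-> exists2 e : R, 0 < e & forall y, nrm (y - x) < e -> A y.
Proof.
split => [/nbhs_ballP[e /= e0 h]|[e e0 h]].
  exists (re e).
    by rewrite -lt_rl rl0 rl_re ?gtr0_real.
  move=> y hy; apply: h; rewrite -ball_normE /= distrC nrmE.
  by rewrite -(rl_re (gtr0_real e0)) lt_rl.
apply/nbhs_ballP; exists (rl e) => /=; first by rewrite -rl0 lt_rl.
by move=> y; rewrite -ball_normE /= distrC nrmE lt_rl; exact: h.
Qed.

Lemma nbhs_nrm (V : normedModType C) (x : V) (e : R) : 0 < e ->
  nbhs x [set y | nrm (y - x) < e].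
Proof. by move=> e0; apply/nbhs_nrmP; exists e. Qed.

Lemma continuous_nrmP (V W : normedModType C) (f : V -> W) x :
  {for x, continuous f} <->
  forall e : R, 0 < e -> exists2 d : R, 0 < d &
    forall y, nrm (y - x) < d -> nrm (f y - f x) < e.
Proof.
split => [cf e e0|h A /nbhs_nrmP[e e0 he]].
  by have /nbhs_nrmP := cf _ (nbhs_nrm (f x) e0).
by have [d d0 hd] := h _ e0; apply/nbhs_nrmP; exists d => // y /hd /he.
Qed.

Lemma nrm_continuous (V : normedModType C) : continuous (@nrm V).
Proof.
move=> x A /nbhs_ballP[e /= e0 h]; apply/nbhs_nrmP; exists e => // y hy.
apply: h; rewrite -ball_normE /=; apply: le_lt_trans hy.
have h1 := nrmD (x - y) y; have h2 := nrmD (y - x) x; rewrite !subrK in h1 h2.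
by rewrite nrmB_sym in h1; rewrite ler_norml; lra.
Qed.

Lemma mx_compact m n (r : R) : compact [set M : 'M[C]_(m, n) | nrm M <= r].
Proof.
have cv : continuous (@vec_mx C m n).
  move=> v; apply/continuous_nrmP => e e0; exists e => // w hw.
  apply: le_lt_trans hw; rewrite -linearB /=; apply/nrm_mx_le; first exact: nrm_ge0.
  by move=> i j; rewrite mxE; exact: nrm_mx_entry.
have cK : compact (vec_mx @` [set v : 'rV[C]_(m * n) | forall i, nrm (v ord0 i) <= r]).
  apply: continuous_compact; first exact: continuous_subspaceT.
  apply: (@rV_compact C _ (fun=> [set z : C | nrm z <= r])) => _.
  rewrite (_ : [set z | _] = [set z : C | `|z| <= rl r]); first exact: disc_compact.
  by apply/seteqP; split=> z /=; rewrite nrmE le_rl.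
apply: subclosed_compact cK _.
  have -> : [set M : 'M[C]_(m, n) | nrm M <= r] = nrm @^-1` [set x | x <= r] by [].
  by apply: preimage_closed; [move=> x _; exact: nrm_continuous|exact: closed_le].
move=> M hM; exists (mxvec M); last exact: mxvecK.
move=> k /=; case/mxvec_indexP: k => i j; rewrite mxvecE.
by apply: le_trans (nrm_mx_entry _ _ _) hM.
Qed.

End RealNorm.

Section ComplexInstance.
Variable R : realType.
Let C : numClosedFieldType := R[i].
Let rlc (x : R) : C := x%:C%C.

Lemma nbhs_complexP (x : C) (A : set C) : nbhs x A <->
  exists2 e : R, 0 < e & forall y, `|y - x| < rlc e -> A y.
Proof.
split => [/nbhs_ballP[e /= e0 h]|[e e0 h]].
  have re : (complex.Re e)%:C%C = e by exact: (RRe_real (gtr0_real e0)).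
  exists (complex.Re e); first by rewrite -ltcR re.
  move=> y hy; apply: h; rewrite -ball_normE /= distrC.
  by move: hy; rewrite /rlc re.
apply/nbhs_ballP; exists (rlc e) => /=; first by rewrite ltcR.
by move=> y; rewrite -ball_normE /= distrC; exact: h.
Qed.

Lemma complex_disc_compact (r : R) : compact [set z : C | `|z| <= rlc r].
Proof.
have crl : continuous rlc.
  move=> x A /nbhs_complexP[e e0 h]; apply/nbhs_ballP; exists e => //= y.
  rewrite -ball_normE /= => hy; apply: h; rewrite /rlc -rmorphB normc_def /=.
  by rewrite expr0n addr0 sqrtr_sqr ltcR distrC.
pose f (p : R * R) : C := rlc p.1 + 'i * rlc p.2.
have cf : continuous f.
  move=> p; apply: cvgD.
    by apply: continuous_comp; [exact: cvg_fst|exact: crl].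
  apply: cvgM; first exact: cvg_cst.
  by apply: continuous_comp; [exact: cvg_snd|exact: crl].
have cK : compact (f @` (`[-r, r]%classic `*` `[-r, r]%classic)).
  apply: continuous_compact; first exact: continuous_subspaceT.
  by apply: compact_setX; exact: segment_compact.
apply: subclosed_compact cK _.
  rewrite -[X in closed X]setCK; apply: open_closedC; rewrite openE => z /= hz.
  have hz' : complex.Re `|z| > r.
    by move: hz => /negP; rewrite /rlc -[`|z|](RRe_real (normr_real z)) lecR -ltNge.
  apply/nbhs_complexP; exists (complex.Re `|z| - r); first by rewrite subr_gt0.
  move=> y hy /= hy2.
  have h := ler_normD (z - y) y; rewrite subrK in h.
  have : `|z - y| + `|y| < rlc (complex.Re `|z| - r) + rlc r.
    by rewrite distrC; exact: ltr_leD.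
  have -> : rlc (complex.Re `|z| - r) + rlc r = `|z|.
    by rewrite -[LHS](rmorphD (real_complex R)) subrK; exact: RRe_real (normr_real z).
  by move=> /(le_lt_trans h); rewrite ltxx.
move=> z hz; exists (complex.Re z, complex.Im z); last first.
  by rewrite /f /=; case: z {hz} => a b; rewrite /GRing.add/GRing.mul /=; simpc.
have hr0 : 0 <= r by rewrite -ler0c; exact: le_trans (normr_ge0 z) hz.
have hr : complex.Re z ^+ 2 + complex.Im z ^+ 2 <= r ^+ 2.
  move: hz; rewrite /= (normc_def z) /= lecR => hz.
  by rewrite -[X in X <= _]sqr_sqrtr ?addr_ge0 ?sqr_ge0// lerXn2r ?nnegrE.
by split; rewrite /= in_itv /= -ler_norml -ler_sqr ?nnegrE// real_normK ?num_real//;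
  apply: le_trans hr; rewrite ?lerDl ?lerDr sqr_ge0.
Qed.

Definition complex_field : complexField R :=
  @ComplexField R C rlc (@complex.Re R) (@lecR R)
    (fun x y => rmorphD _ x y) (fun x y => rmorphM _ x y) (@RRe_real R)
    complex_disc_compact.

End ComplexInstance.

(** * Strict differentiability *)

Section StrictDifferentiability.
Context {R : realType} {C : complexField R}.

(** Strict differentiability: the linear map approximates all increments between points near [x],
    not only those from [x]. This gives Lipschitz bounds near [x] and, unlike plain
    differentiability at one point, it suffices for the inverse function theorem. *)
Definition sdiff {V W : normedModType C} (f : V -> W) (x : V) (l : V -> W) :=
  [/\ linear l, exists K : R, forall v, nrm (l v) <= K * nrm v &
    forall e : R, 0 < e -> exists2 d : R, 0 < d &
      forall v w, nrm (v - x) < d -> nrm (w - x) < d ->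
        nrm (f v - f w - l (v - w)) <= e * nrm (v - w)].

Lemma sdiff_eq (V W : normedModType C) (f g : V -> W) x l k :
  sdiff f x l -> f =1 g -> l =1 k -> sdiff g x k.
Proof. by move=> h /funext <- /funext <-. Qed.

Lemma linear_bounded m n (W : normedModType C) (l : 'M[C]_(m, n) -> W) :
  linear l -> exists K : R, forall v, nrm (l v) <= K * nrm v.
Proof.
move=> ll; pose L : {linear _ -> _} := HB.pack l (GRing.isLinear.Build _ _ _ _ _ ll).
exists (\sum_i \sum_j nrm (L (delta_mx i j))) => v.
have -> : l v = L v by [].
rewrite [v in L v]matrix_sum_delta linear_sum; apply: le_trans (nrm_sum _ _ _) _.
rewrite mulr_suml; apply: ler_sum => i _; rewrite linear_sum.
apply: le_trans (nrm_sum _ _ _) _; rewrite mulr_suml; apply: ler_sum => j _.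
by rewrite linearZ nrmZ mulrC ler_wpM2l ?nrm_ge0 ?nrm_mx_entry.
Qed.

Lemma sdiff_lin (V W : normedModType C) (l : V -> W) x :
  linear l -> (exists K : R, forall v, nrm (l v) <= K * nrm v) -> sdiff l x l.
Proof.
move=> ll bl; split=> // e e0; exists 1 => // v w _ _.
have -> : l v - l w = l (v - w).
  by have := ll (-1) w v; rewrite !scaleN1r [- w + v]addrC => ->; rewrite addrC.
by rewrite subrr nrm0 mulr_ge0 ?nrm_ge0 ?ltW.
Qed.

Lemma sdiff_mx m n (W : normedModType C) (l : 'M[C]_(m, n) -> W) x :
  linear l -> sdiff l x l.
Proof. by move=> ll; apply: sdiff_lin => //; exact: linear_bounded. Qed.

Lemma sdiff_cst (V W : normedModType C) (c : W) (x : V) :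
  sdiff (fun=> c) x (fun=> 0).
Proof.
split; first by move=> a u v; rewrite scaler0 addr0.
  by exists 0 => v; rewrite mul0r nrm0.
by move=> e e0; exists 1 => // v w _ _; rewrite !subrr nrm0 mulr_ge0 ?nrm_ge0 ?ltW.
Qed.

Lemma sdiffD (V W : normedModType C) (f g : V -> W) x l k :
  sdiff f x l -> sdiff g x k ->
  sdiff (fun v => f v + g v) x (fun v => l v + k v).
Proof.
move=> [ll [K hK] hf] [lk [K' hK'] hg]; split.
- by move=> a u v; rewrite ll lk scalerDr addrACA.
- exists (K + K') => v; apply: le_trans (nrmD _ _) _.
  by rewrite mulrDl lerD.
move=> e e0; have e20 : 0 < e / 2 by rewrite divr_gt0.
have [d d0 hd] := hf _ e20; have [d' d'0 hd'] := hg _ e20.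
exists (Num.min d d'); first by rewrite lt_min d0.
move=> v w; rewrite !lt_min => /andP[v1 v2] /andP[w1 w2].
have -> : f v + g v - (f w + g w) - (l (v - w) + k (v - w)) =
    (f v - f w - l (v - w)) + (g v - g w - k (v - w)).
  by rewrite opprD [- (l _ + _)]opprD (addrACA (f v)) [LHS]addrACA.
apply: le_trans (nrmD _ _) _; have := hd _ _ v1 w1; have := hd' _ _ v2 w2; lra.
Qed.

Lemma sdiff_lipschitz (V W : normedModType C) (f : V -> W) x l :
  sdiff f x l -> exists2 K : R, 0 < K & exists2 d : R, 0 < d &
    forall v w, nrm (v - x) < d -> nrm (w - x) < d ->
      nrm (f v - f w) <= K * nrm (v - w).
Proof.
move=> [_ [K hK] /(_ 1 ltr01)[d d0 hd]]; exists (1 + `|K|).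
  by rewrite ltr_wpDr.
exists d => // v w hv hw; have := hd _ _ hv hw => h.
have := nrmD (f v - f w - l (v - w)) (l (v - w)); rewrite subrK => h2.
have h3 := hK (v - w).
have : K * nrm (v - w) <= `|K| * nrm (v - w) by rewrite ler_wpM2r ?nrm_ge0 ?ler_norm.
lra.
Qed.

Lemma sdiff_near (V W : normedModType C) (f : V -> W) x l :
  sdiff f x l -> forall e : R, 0 < e -> exists2 d : R, 0 < d &
    forall v, nrm (v - x) < d -> nrm (f v - f x) < e.
Proof.
move=> /sdiff_lipschitz[K K0 [d d0 h]] e e0.
exists (Num.min d (e / K)); first by rewrite lt_min d0 divr_gt0.
move=> v; rewrite lt_min => /andP[h1 h2].
apply: le_lt_trans (h _ _ h1 _) _; first by rewrite subrr nrm0.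
by rewrite mulrC -ltr_pdivlMr.
Qed.

Lemma sdiff_continuous (V W : normedModType C) (f : V -> W) x l :
  sdiff f x l -> {for x, continuous f}.
Proof. by move=> h; apply/continuous_nrmP; exact: sdiff_near h. Qed.

Lemma sdiffM (V : normedModType C) (f g : V -> C) x l k :
  sdiff f x l -> sdiff g x k ->
  sdiff (fun v => f v * g v) x (fun v => f x * k v + g x * l v).
Proof.
move=> sf sg; case: (sf) => [ll [K hK] hf]; case: (sg) => [lk [K' hK'] hg]; split.
- by move=> a u v; rewrite ll lk /GRing.scale /=; ring.
- exists (nrm (f x) * K' + nrm (g x) * K) => v; apply: le_trans (nrmD _ _) _.
  by rewrite mulrDl !nrmM -!mulrA lerD// ler_wpM2l ?nrm_ge0.
move=> e e0.
pose A := nrm (f x) + 1; pose B := nrm (g x) + 1.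
have A0 : 0 < A by rewrite ltr_wpDl ?nrm_ge0.
have B0 : 0 < B by rewrite ltr_wpDl ?nrm_ge0.
pose P := A + B + `|K| + `|K'|; have P0 : 0 < P by rewrite ltr_wpDr// ltr_wpDr// addr_gt0.
pose h := e / P; have h0 : 0 < h by rewrite divr_gt0.
pose m := Num.min h 1; have m0 : 0 < m by rewrite lt_min h0 ltr01.
have [d1 d10 h1] := hf _ h0; have [d2 d20 h2] := hg _ h0.
have [d3 d30 h3] := sdiff_near sf m0; have [d4 d40 h4] := sdiff_near sg m0.
exists (Num.min (Num.min d1 d2) (Num.min d3 d4)).
  by rewrite !lt_min d10 d20 d30 d40.
move=> v w; rewrite !lt_min => /andP[/andP[v1 v2] /andP[v3 v4]].
move=> /andP[/andP[w1 w2] /andP[w3 w4]].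
set u := v - w.
have -> : f v * g v - f w * g w - (f x * k u + g x * l u) =
  (f v * (g v - g w - k u) + g w * (f v - f w - l u)) +
  ((f v - f x) * k u + (g w - g x) * l u) by ring.
apply: le_trans (nrmD _ _) _.
apply: le_trans (lerD (nrmD _ _) (nrmD _ _)) _; rewrite !nrmM.
have e1 : e = (A + B + `|K| + `|K'|) * h by rewrite /h mulrC divfK// gt_eqF.
have fv := h3 _ v3; have gw := h4 _ w4.
have [mh m1] : m <= h /\ m <= 1 by rewrite !ge_min lexx /= lexx orbT.
have fvA : nrm (f v) <= A.
  have := nrmD (f v - f x) (f x); rewrite subrK => /le_trans; apply.
  by rewrite addrC lerD2l (le_trans (ltW fv)).
have gwB : nrm (g w) <= B.
  have := nrmD (g w - g x) (g x); rewrite subrK => /le_trans; apply.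
  by rewrite addrC lerD2l (le_trans (ltW gw)).
have u0 := nrm_ge0 u.
have b1 : nrm (f v) * nrm (g v - g w - k u) <= A * (h * nrm u).
  by apply: ler_pM; rewrite ?nrm_ge0 ?h2.
have b2 : nrm (g w) * nrm (f v - f w - l u) <= B * (h * nrm u).
  by apply: ler_pM; rewrite ?nrm_ge0 ?h1.
have K1 : K * nrm u <= `|K| * nrm u by rewrite ler_wpM2r ?ler_norm.
have K2 : K' * nrm u <= `|K'| * nrm u by rewrite ler_wpM2r ?ler_norm.
have b3 : nrm (f v - f x) * nrm (k u) <= h * (`|K'| * nrm u).
  by apply: ler_pM; rewrite ?nrm_ge0//; [exact: le_trans (ltW fv) mh|exact: le_trans (hK' _) K2].
have b4 : nrm (g w - g x) * nrm (l u) <= h * (`|K| * nrm u).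
  by apply: ler_pM; rewrite ?nrm_ge0//; [exact: le_trans (ltW gw) mh|exact: le_trans (hK _) K1].
have -> : e * nrm u = (A * (h * nrm u) + B * (h * nrm u)) +
    (h * (`|K'| * nrm u) + h * (`|K| * nrm u)) by rewrite e1; ring.
by rewrite lerD ?lerD.
Qed.

Lemma sdiffZ (V W : normedModType C) (f : V -> C) (e : W) x l :
  sdiff f x l -> sdiff (fun v => f v *: e) x (fun v => l v *: e).
Proof.
move=> [ll [K hK] hf]; split.
- by move=> a u v; rewrite ll scalerDl scalerA.
- by exists (K * nrm e) => v; rewrite nrmZ mulrAC ler_wpM2r ?nrm_ge0.
move=> r r0; have r1 : 0 < r / (nrm e + 1) by rewrite divr_gt0 ?ltr_wpDl ?nrm_ge0.
have [d d0 hd] := hf _ r1; exists d => // v w hv hw.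
rewrite -!scalerBl nrmZ; apply: le_trans (ler_wpM2r (nrm_ge0 _) (hd _ _ hv hw)) _.
rewrite mulrAC ler_wpM2r ?nrm_ge0// mulrAC -mulrA.
by rewrite ler_piMr ?(ltW r0)// ler_pdivrMr ?mul1r ?lerDl// ltr_wpDl ?nrm_ge0.
Qed.

Lemma sdiff_sum (V W : normedModType C) I (s : seq I) (f l : I -> V -> W) x :
  (forall i, sdiff (f i) x (l i)) ->
  sdiff (fun v => \sum_(i <- s) f i v) x (fun v => \sum_(i <- s) l i v).
Proof.
move=> h; elim: s => [|i s IH].
  by apply: sdiff_eq (sdiff_cst 0 x) _ _ => v; rewrite big_nil.
by apply: sdiff_eq (sdiffD (h i) IH) _ _ => v; rewrite big_cons.
Qed.

(** The bridge to the derivatives in terms of which orbits and analytic functions are defined. *)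
Lemma sdiff_diff (V W : normedModType C) (f : V -> W) x l :
  sdiff f x l -> differentiable f x /\ forall v, 'D_v f x = l v.
Proof.
move=> [ll [K hK] hf].
pose L : {linear V -> W} := HB.pack l (GRing.isLinear.Build _ _ _ _ _ ll).
have cL : continuous L.
  move=> v; apply: (@sdiff_continuous _ _ _ _ l); apply: sdiff_lin => //.
  by exists K.
have eL : f \o shift x = cst (f x) + L +o_ 0 id.
  apply/eqaddoP => e e0; apply/nbhs_nrmP.
  have e1 : 0 < re e by rewrite -(@lt_rl R C) rl0 rl_re ?gtr0_real.
  have [d d0 hd] := hf _ e1; exists d => // v; rewrite subr0 => hv.
  have -> : (f \o shift x - (cst (f x) + L)) v = f (v + x) - f x - l (v + x - x).
    by rewrite /= addrK /cst /= opprD addrA.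
  rewrite !nrmE /= -(rl_re (gtr0_real e0)) -rlM le_rl -[X in _ * nrm X](addrK x v).
  by apply: hd; rewrite ?addrK// subrr nrm0.
have dL := diff_unique cL eL.
have df : differentiable f x by apply/diff_locallyP; rewrite dL.
by split => // v; rewrite deriveE// dL.
Qed.

Definition sdiffable {V W : normedModType C} (f : V -> W) x := exists l, sdiff f x l.

Lemma sdiffable_cst (V W : normedModType C) (c : W) (x : V) : sdiffable (fun=> c) x.
Proof. by eexists; exact: sdiff_cst. Qed.

Lemma sdiffableD (V W : normedModType C) (f g : V -> W) x :
  sdiffable f x -> sdiffable g x -> sdiffable (fun v => f v + g v) x.
Proof. by move=> [l hl] [k hk]; eexists; exact: sdiffD hl hk. Qed.

Lemma sdiffableM (V : normedModType C) (f g : V -> C) x :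
  sdiffable f x -> sdiffable g x -> sdiffable (fun v => f v * g v) x.
Proof. by move=> [l hl] [k hk]; eexists; exact: sdiffM hl hk. Qed.

Lemma sdiffableX (V : normedModType C) (f : V -> C) n x :
  sdiffable f x -> sdiffable (fun v => f v ^+ n) x.
Proof.
move=> h; elim: n => [|n IH]; first exact: sdiffable_cst.
have -> : (fun v => f v ^+ n.+1) = (fun v => f v * f v ^+ n).
  by apply/funext => v; rewrite exprS.
exact: sdiffableM.
Qed.

Lemma sdiffable_sum (V W : normedModType C) I (s : seq I) (f : I -> V -> W) x :
  (forall i, sdiffable (f i) x) -> sdiffable (fun v => \sum_(i <- s) f i v) x.
Proof.
by move=> /choice[l hl]; eexists; exact: sdiff_sum hl.
Qed.

Lemma sdiffable_prod (V : normedModType C) I (s : seq I) (f : I -> V -> C) x :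
  (forall i, sdiffable (f i) x) -> sdiffable (fun v => \prod_(i <- s) f i v) x.
Proof.
move=> h; elim: s => [|i s IH].
  have -> : (fun v => \prod_(i <- [::]) f i v) = (fun=> 1).
    by apply/funext => v; rewrite big_nil.
  exact: sdiffable_cst.
have -> : (fun v => \prod_(j <- i :: s) f j v) =
    (fun v => f i v * \prod_(j <- s) f j v).
  by apply/funext => v; rewrite big_cons.
exact: sdiffableM.
Qed.

Lemma sdiffable_det n (A : 'M[C]_n) : sdiffable (fun M : 'M[C]_n => \det M) A.
Proof.
apply: sdiffable_sum => s; apply: sdiffableM; first exact: sdiffable_cst.
apply: sdiffable_prod => i; eexists; apply: sdiff_mx => c u v.
by rewrite !mxE.
Qed.

Lemma det_continuous n : continuous (fun M : 'M[C]_n => \det M).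
Proof. by move=> A; have [l] := sdiffable_det A; exact: sdiff_continuous. Qed.

End StrictDifferentiability.

Section Matrices.
Context {R : realType} {C : complexField R}.

Lemma nrm_mulmx m n p (A : 'M[C]_(m, n)) (B : 'M[C]_(n, p)) :
  nrm (A *m B) <= n%:R * (nrm A * nrm B).
Proof.
apply/nrm_mx_le; first by rewrite !mulr_ge0 ?nrm_ge0 ?ler0n.
move=> i j; rewrite mxE; apply: le_trans (nrm_sum _ _ _) _.
apply: (@le_trans _ _ (\sum_(k < n) nrm A * nrm B)).
  apply: ler_sum => k _; rewrite nrmM.
  by apply: ler_pM; rewrite ?nrm_ge0 ?nrm_mx_entry.
by rewrite sumr_const card_ord -[_ *+ n]mulr_natl.
Qed.

Lemma nrm_det n (A : 'M[C]_n) : nrm (\det A) <= n`!%:R * nrm A ^+ n.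
Proof.
apply: le_trans (nrm_sum _ _ _) _.
apply: (@le_trans _ _ (\sum_(s : 'S_n) nrm A ^+ n)).
  apply: ler_sum => s _; rewrite nrmM nrmX nrmN nrm1 expr1n mul1r.
  have -> : nrm A ^+ n = \prod_(i < n) nrm A by rewrite prodr_const card_ord.
  elim/big_rec2: _ => [|i x y _ h]; first by rewrite nrm1.
  by rewrite nrmM ler_pM ?nrm_ge0 ?nrm_mx_entry.
by rewrite sumr_const card_Sn -[_ *+ _]mulr_natl.
Qed.

Lemma nrm_scalar1 n : nrm (1%:M : 'M[C]_n) <= 1.
Proof. by apply/nrm_mx_le => // i j; rewrite mxE; case: eqP => _; rewrite ?nrm1 ?nrm0. Qed.

(** The identity [A^-1 = 1 - (A - 1) A^-1] bounds the norm of the inverse by itself. *)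
Lemma nrm_invmx_near1 n (A : 'M[C]_n) : A \in unitmx ->
  n%:R * nrm (A - 1%:M) <= 1 / 2 -> nrm (invmx A) <= 2.
Proof.
move=> uA h.
have e : invmx A = 1%:M - (A - 1%:M) *m invmx A.
  by rewrite mulmxBl mulmxV// mul1mx opprB addrC subrK.
have h1 := nrm_scalar1 n.
have := nrmD 1%:M (- ((A - 1%:M) *m invmx A)); rewrite -e nrmN.
have := nrm_mulmx (A - 1%:M) (invmx A).
have : n%:R * nrm (A - 1%:M) * nrm (invmx A) <= 1 / 2 * nrm (invmx A).
  by rewrite ler_wpM2r ?nrm_ge0.
rewrite mulrA; lra.
Qed.

Lemma nrm_dist (V : normedZmodType C) (v w : V) : `|nrm v - nrm w| <= nrm (v - w).
Proof.
have h1 := nrmD (v - w) w; have h2 := nrmD (w - v) v; rewrite !subrK in h1 h2.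
rewrite nrmB_sym in h2; move: h1 h2; move: (nrm _) (nrm _) (nrm _) => a b c.
by move=> h1 h2; rewrite ler_norml; lra.
Qed.

(** Surjectivity in the inverse function theorem, by compactness instead of iteration. A point [c]
    of the ball where [nrm (g c - y)] is minimal lies in the interior, because [y] is near the image
    of 0. If [g c != y], a small step from [c] in the direction of [y - g c] would decrease the
    distance, since [g] is close to a translation. *)
Lemma local_onto (V : normedModType C) (g : V -> V) (r : R) : 0 < r ->
  compact [set v : V | nrm v <= r] ->
  (forall v w, nrm v <= r -> nrm w <= r ->
     nrm (g v - g w - (v - w)) <= 1 / 2 * nrm (v - w)) ->
  forall y, nrm (y - g 0) < r / 4 -> exists2 v, nrm v <= r & g v = y.
Proof.
have aux (a b d e : R) : a <= b -> 0 < e -> d <= 1 / 2 * e -> b <= d + (a - e) ->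
  False by move=> *; lra.
move=> r0 cK hg y hy; pose K := [set v : V | nrm v <= r].
have K0 : K 0 by rewrite /K /= nrm0 ltW.
have lip v w : K v -> K w -> nrm (g v - g w) <= 3 / 2 * nrm (v - w) /\
    1 / 2 * nrm (v - w) <= nrm (g v - g w).
  move=> Kv Kw; have h := hg v w Kv Kw.
  have h1 := nrmD (g v - g w - (v - w)) (v - w); rewrite subrK in h1.
  have h2 := nrmD (g v - g w) (- (g v - g w - (v - w))).
  rewrite nrmN opprB addrCA subrr addr0 in h2.
  move: h h1 h2; move: (nrm (_ - _ - _)) (nrm (v - w)) (nrm (g v - g w)) => a b c.
  by move=> h h1 h2; split; lra.
have cf : {within K, continuous (fun v => nrm (g v - y))}.
  apply/subspace_continuousP => x Kx A /nbhs_ballP[e /= e0 hA].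
  have : nbhs x [set w | nrm (w - x) < e / 2] by apply: nbhs_nrm; rewrite divr_gt0.
  apply: filterS => w hw Kw; apply: hA; rewrite -ball_normE /=.
  apply: le_lt_trans (nrm_dist (g x - y) (g w - y)) _; rewrite opprB subrKA.
  apply: le_lt_trans (lip x w Kx Kw).1 _; rewrite nrmB_sym.
  by move: hw; rewrite /=; move: (nrm _) => a ha; lra.
have [c /set_mem Kc hc] := compact_EVT_min (ex_intro _ 0 K0) cK cf.
exists c => //; apply/eqP; rewrite -subr_eq0 -nrm_eq0; apply/eqP/le_anti.
rewrite nrm_ge0 andbT leNgt; apply/negP => q0.
have hc0 := hc _ (mem_set K0); rewrite (nrmB_sym (g 0)) in hc0.
have cr : nrm c < r.
  have [_] := lip c 0 Kc K0; rewrite subr0.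
  have := nrmD (g c - y) (y - g 0); rewrite subrKA; move: hy hc0.
  by move: (nrm _) (nrm _) (nrm _) (nrm _) => a b c' d; lra.
pose q := y - g c; have qn : nrm q = nrm (g c - y) by rewrite nrmB_sym.
pose s : R := Num.min 1 ((r - nrm c) / nrm q).
have s0 : 0 < s by rewrite lt_min ltr01 divr_gt0 ?qn// subr_gt0.
have s1 : s <= 1 by rewrite ge_min lexx.
have Kd : K (c + rl s *: q).
  rewrite /K /=; apply: le_trans (nrmD _ _) _; rewrite nrmZ nrm_real gtr0_norm//.
  have : s <= (r - nrm c) / nrm q by rewrite /s ge_min lexx orbT.
  rewrite ler_pdivlMr ?qn//.
  by move: (s * _) => a; lra.
have := hc _ (mem_set Kd).
have h := hg _ _ Kd Kc; rewrite [c + _]addrC addrK in h.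
have e : g (c + rl s *: q) - y =
    (g (rl s *: q + c) - g c - rl s *: q) - rl (1 - s) *: q.
  rewrite rlB scalerBl opprB rl1 scale1r [c + _]addrC /q.
  by rewrite [RHS]addrA subrK opprB addrA subrK.
rewrite e => h2; have := nrmD (g (rl s *: q + c) - g c - rl s *: q) (- (rl (1 - s) *: q)).
rewrite nrmN; move: h; rewrite !nrmZ !nrm_real (gtr0_norm s0) ger0_norm ?subr_ge0// qn.
rewrite [(1 - s) * _]mulrBl [1 * nrm _]mul1r; exact: (aux _ _ _ _ h2 (mulr_gt0 s0 q0)).
Qed.

End Matrices.

(** * Forms as functions, and their classes *)

Section Evaluation.
Context {C : numClosedFieldType} {n d : nat}.
Implicit Types (F G : form C n d) (A : 'M[C]_n.+1) (v : 'cV[C]_n.+1).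

Definition ev F v : C := meval (fun i => v i 0) (poly_of F).

Lemma poly_ofD F G : poly_of (F + G) = poly_of F + poly_of G.
Proof. by rewrite /poly_of !linearD. Qed.

Lemma evD F G v : ev (F + G) v = ev F v + ev G v.
Proof. by rewrite /ev poly_ofD; exact: mevalD. Qed.

Lemma evZ c F v : ev (c *: F) v = c * ev F v.
Proof. by rewrite /ev poly_ofZ mevalZ. Qed.

Lemma ev0 v : ev 0 v = 0.
Proof. by have := evZ 0 0 v; rewrite scale0r mul0r. Qed.

Lemma evN F v : ev (- F) v = - ev F v.
Proof. by rewrite -scaleN1r evZ mulN1r. Qed.

Lemma evB F G v : ev (F - G) v = ev F v - ev G v.
Proof. by rewrite evD evN. Qed.

Lemma ev_sum I (s : seq I) (F : I -> form C n d) v :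
  ev (\sum_(i <- s) F i) v = \sum_(i <- s) ev (F i) v.
Proof.
by elim: s => [|i s IH]; rewrite ?big_nil ?ev0// !big_cons evD IH.
Qed.

Lemma ev_subst A F v : ev (substitute A F) v = ev F (A *m v).
Proof.
rewrite /ev /substitute form_ofK ?comp_homog ?poly_of_homog//.
rewrite comp_mpoly_meval; apply: meval_eq => i.
rewrite tnth_mktuple linear_sum /= mxE; apply: eq_bigr => j _.
by rewrite mevalZ mevalXU.
Qed.

Lemma ev_act c A F v : ev (c *: substitute A F) v = c * ev F (A *m v).
Proof. by rewrite evZ ev_subst. Qed.

Lemma substituteD A F G : substitute A (F + G) = substitute A F + substitute A G.
Proof.
rewrite /substitute -[RHS]poly_ofK; congr form_of.
by rewrite !poly_ofD !linearD /= !form_ofK ?comp_homog ?poly_of_homog.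
Qed.

Lemma substitute_linear A : linear (@substitute C n d A).
Proof. by move=> c F G; rewrite substituteD substituteZr. Qed.

Lemma substituteK A : A \in unitmx ->
  cancel (@substitute C n d A) (substitute (invmx A)).
Proof. by move=> uA F; rewrite substituteM mulmxV// substitute1. Qed.

Lemma substituteVK A : A \in unitmx ->
  cancel (@substitute C n d (invmx A)) (substitute A).
Proof. by move=> uA F; rewrite substituteM mulVmx// substitute1. Qed.

Lemma substitute0 A : substitute A 0 = 0 :> form C n d.
Proof. by have := substituteZr A 0 (0 : form C n d); rewrite !scale0r. Qed.

Lemma ev_form_of p v : p \is ishomog1 d mdeg ->
  ev (form_of d p) v = meval (fun i => v i 0) p.
Proof. by move=> hp; rewrite /ev form_ofK. Qed.

(** On forms with finite stabilizer this is equality of classes ([class_of_eqP]). *)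
Definition equivalent F G :=
  exists (c : C) (A : 'M[C]_n.+1),
    [/\ c != 0, A \in unitmx & G = c *: substitute A F].

Lemma equivalent_refl F : equivalent F F.
Proof. by exists 1, 1%:M; rewrite oner_eq0 unitmx1 substitute1 scale1r. Qed.

Lemma equivalent_sym F G : equivalent F G -> equivalent G F.
Proof.
move=> [c [A [c0 uA ->]]]; exists c^-1, (invmx A).
by rewrite invr_eq0 unitmx_inv substituteZr substituteK// scalerA mulVf// scale1r.
Qed.

Lemma equivalent_trans F G H : equivalent F G -> equivalent G H -> equivalent F H.
Proof.
move=> [c [A [c0 uA ->]]] [b [B [b0 uB ->]]]; exists (b * c), (A *m B).
split; [exact: mulf_neq0|by rewrite unitmx_mul uA|].
by rewrite substituteZr substituteM scalerA.
Qed.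

Lemma equivalent_sub A F : A \in unitmx -> equivalent F (substitute A F).
Proof. by move=> uA; exists 1, A; rewrite oner_eq0 scale1r. Qed.

Lemma equivalent_neq0 F G : equivalent F G -> F != 0 -> G != 0.
Proof.
move=> /equivalent_sym[c [A [_ _ ->]]]; apply: contraNneq => ->.
by rewrite substitute0 scaler0.
Qed.

(** A description of [class_of] without partial functions, on which the next lemmas rely. *)
Lemma class_ofP F p : class_of F = Some p <->
  exists (F0 : F != 0) (fs : finite_stabilizer
    (\pi_(hypersurfaces C n d) (to_nonzero F0))), p = \pi_(moduli C n d) (to_fs fs).
Proof.
rewrite /class_of; case: insubP => /= [G _ eG|]; last first.
  by move=> h; split => // -[F0]; case/negP: h; exact: mem_set.
subst F; case: insubP => /= [x hx ex|]; last first.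
  move=> h; split => // -[F0 [fs _]]; case/negP: h; apply: mem_set.
  by rewrite (_ : G = to_nonzero F0) //; exact: val_inj.
split=> [[<-]|[F0 [fs ->]]].
  have F0 : \val G != 0 by have /set_mem := valP G.
  have e : to_nonzero F0 = G by exact: val_inj.
  have fs : finite_stabilizer (\pi_(hypersurfaces C n d) (to_nonzero F0)).
    by rewrite e; exact/set_mem.
  by exists F0, fs; congr (\pi _); apply: val_inj; rewrite /= ex e.
congr (Some (\pi _)); apply: val_inj; apply: (etrans ex) => /=.
by congr (\pi _); exact: val_inj.
Qed.

Lemma act_piP F G (F0 : F != 0) (G0 : G != 0) :
  (exists g, \pi_(hypersurfaces C n d) (to_nonzero G0) =
     act g (\pi_(hypersurfaces C n d) (to_nonzero F0))) <-> equivalent F G.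
Proof.
split=> [[g]|[c [A [c0 uA e]]]].
  elim/pgl_ind: g => M; rewrite actE => /esym/lines_eqP[c c0 /= e].
  exists c, (invmx (\val M)); split=> //; by rewrite unitmx_inv GL_unit.
have uV : invmx A \in unitmx by rewrite unitmx_inv.
exists (\pi_(PGL C n) (toGL uV)); rewrite actE; apply/esym/lines_eqP.
by exists c; [|rewrite /= /transform invmxK].
Qed.

Lemma class_of_eqP F G p : class_of F = Some p ->
  (class_of G = Some p <-> equivalent F G).
Proof.
move=> /class_ofP[F0 [fF ->]]; split=> [/class_ofP[G0 [fG /eqmodP/asboolP[g eg]]]|e].
  by apply/(act_piP F0 G0); exists g; have /= := congr1 val eg.
have G0 := equivalent_neq0 e F0; have [g eg] := (act_piP F0 G0).2 e.
have fG : finite_stabilizer (\pi_(hypersurfaces C n d) (to_nonzero G0)).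
  by rewrite eg; exact: finite_stabilizer_act.
apply/class_ofP; exists G0, fG; apply/eqmodP/asboolP; exists g.
exact: val_inj.
Qed.

Lemma class_of_equivalent F G : equivalent F G -> class_of F = class_of G.
Proof.
move=> e; case eF: (class_of F) => [p|].
  by symmetry; apply/(class_of_eqP G eF).
case eG: (class_of G) => [p|] //.
by rewrite -eF; apply/(class_of_eqP F eG); exact: equivalent_sym.
Qed.

Lemma class_of_surj (p : moduli C n d) : exists F, class_of F = Some p.
Proof.
rewrite -[p]reprK; case: (repr p) => x hx.
have [G eG] : exists G : @nonzero_forms C n d, x = \pi_(hypersurfaces C n d) G.
  by exists (repr x); rewrite reprK.
subst x; exists (\val G); have F0 := set_mem (valP G).
have e : to_nonzero F0 = G by exact: val_inj.
have fs : finite_stabilizer (\pi_(hypersurfaces C n d) (to_nonzero F0)).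
  by rewrite e; exact/set_mem.
by apply/class_ofP; exists F0, fs; congr (\pi _); apply: val_inj; rewrite /= e.
Qed.

Lemma stabilizerP F (F0 : F != 0) (A : GL C n) :
  stabilizer (\pi_(hypersurfaces C n d) (to_nonzero F0)) (\pi_(PGL C n) A) <->
  exists c : C, substitute (\val A) F = c *: F.
Proof.
rewrite /stabilizer /= actE; split=> [/lines_eqP[c c0 /= e]|[c e]].
  exists c; rewrite {1}e substituteZr; congr (_ *: _).
  by rewrite /transform substituteVK ?GL_unit.
have c0 : c != 0.
  apply: contraNneq F0 => c0; rewrite -(substituteK (GL_unit A) F) e c0 scale0r.
  by rewrite substitute0.
apply/lines_eqP; exists c => //=.
by rewrite -substituteZr -e /transform substituteK ?GL_unit.
Qed.

Lemma stabilizer_inv F A (c : C) : F != 0 -> A \in unitmx ->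
  substitute A F = c *: F -> substitute (invmx A) F = c^-1 *: F /\ c != 0.
Proof.
move=> F0 uA h; have c0 : c != 0.
  by apply: contraNneq F0 => c0; rewrite -(substituteK uA F) h c0 scale0r substitute0.
by split=> //; rewrite -{2}(substituteK uA F) h substituteZr scalerA mulVf// scale1r.
Qed.

(** The matrices [A k] represent infinitely many elements of the stabilizer. In the applications
    they run through a one-parameter subgroup. *)
Lemma class_of_None F : F != 0 ->
  (exists (A : nat -> 'M[C]_n.+1), [/\ forall k, A k \in unitmx,
     forall k, exists c : C, substitute (A k) F = c *: F &
     forall k l (c : C), A k = c *: A l -> k = l]) -> class_of F = None.
Proof.
move=> F0 [A [uA sA iA]]; case e: (class_of F) => [p|] //.
have [F1 [fs _]] := (class_ofP F p).1 e.
have inj : injective (fun k => \pi_(PGL C n) (toGL (uA k))).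
  by move=> k l /lines_eqP[c _ /= ec]; apply/esym/(iA _ _ c).
case: infinite_nat; apply: sub_finite_set (finite_preimage (in2W inj) fs).
by move=> k _; exact/(stabilizerP F1 (toGL (uA k)))/sA.
Qed.

(** Finiteness of the stabilizer by counting. [Q] is a finite set of marked points of the
    hypersurface, and [kappa A q] says that the inverse of [A] moves a chosen marked point to [q].
    Two matrices with the same [q] differ by a matrix that fixes the chosen point, and up to a
    scalar there are only finitely many of these, those in [T]. *)
Lemma class_of_Some F : F != 0 ->
  (exists (P : Type) (Q : set P) (T : set 'M[C]_n.+1) (kappa : 'M[C]_n.+1 -> P -> Prop),
   [/\ finite_set Q, finite_set T,
     forall A (c : C), A \in unitmx -> substitute A F = c *: F ->
       exists2 q, Q q & kappa A q &
     forall A B (c b : C) q, A \in unitmx -> substitute A F = c *: F ->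
       B \in unitmx -> substitute B F = b *: F -> Q q -> kappa A q -> kappa B q ->
       exists2 M, T M & exists2 k : C, k != 0 & B = k *: (M *m A)]) ->
  exists p, class_of F = Some p.
Proof.
move=> F0 [P [Q [T [kappa [fQ fT h1 h2]]]]].
suff fs : finite_stabilizer (\pi_(hypersurfaces C n d) (to_nonzero F0)).
  by eexists; apply/class_ofP; exists F0, fs.
pose st q (A : 'M[C]_n.+1) := [/\ A \in unitmx, exists c : C, substitute A F = c *: F & kappa A q].
pose r q := xget (1%:M : 'M[C]_n.+1) (st q).
pose f q M : PGL C n :=
  if pselect (M *m r q \in unitmx) is left u then \pi_(PGL C n) (toGL u) else 1%g.
apply: (@sub_finite_set _ _ [set f q M | q in Q & M in T]); last exact: finite_image2.
elim/pgl_ind => A /stabilizerP[c sA].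
have [q Qq kq] := h1 _ _ (GL_unit A) sA; exists q => //.
have [uR [b sR] kR] : st q (r q).
  by apply: (@xgetPex _ 1%:M (st q)); exists (\val A); split=> //; [exact: GL_unit|exists c].
have [M TM [k k0 e]] := h2 _ _ _ _ _ uR sR (GL_unit A) sA Qq kR kq.
exists M => //; rewrite /f; case: pselect => [u|[]].
  by apply/lines_eqP; exists k.
have := GL_unit A; rewrite e unitmxZ ?unitfE//.
Qed.

End Evaluation.

(** * The topology of the quotients *)

Section LinesTopology.
Context {C : numClosedFieldType} {V : normedModType C} (A : set V).
Hypothesis A_scale : forall (c : C) v, c != 0 -> A v -> A (c *: v).

(** The saturation of an open set of vectors under scaling is open, because scaling by a nonzero
    constant is a homeomorphism. So neighborhoods in the quotient can be tested on representatives. *)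
Lemma nbhs_linesP (v : A) (U : set (lines A)) :
  nbhs (\pi_(lines A) v) U <->
  nbhs (\val v) [set w | forall hw : w \in A, U (\pi_(lines A) (exist _ w hw))].
Proof.
split=> [|h].
  move=> hU; have {hU} : nbhs v (\pi_(lines A) @^-1` U) by exact: pi_continuous hU.
  rewrite nbhsE => -[B [oB Bv] BU]; case: oB => P oO eO; rewrite nbhsE; exists P.
    by split=> //; have : (set_val @^-1` P) v by rewrite eO.
  move=> w Ow hw; apply: BU; rewrite -eO; exact: Ow.
move: h; rewrite nbhsE => -[P [oO Ov] OU].
pose S := [set w | exists2 c : C, c != 0 & P (c *: w)].
have oS : open S.
  rewrite openE => w [c c0 Ocw]; rewrite /interior /=.
  have : nbhs w ((fun w => c *: w) @^-1` P).
    by apply: (@scaler_continuous _ _ c w); exact: open_nbhs_nbhs.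
  by apply: filterS => u Ou; exists c.
rewrite nbhsE; exists [set \pi_(lines A) w | w in [set w : A | S (\val w)]].
  split; last by exists v => //; exists 1; rewrite ?oner_eq0// scale1r.
  rewrite /open /= /quotient_open; exists S => //.
  apply/seteqP; split=> [w Sw|w [u [c c0 Ou] /lines_eqP[b b0 e]]]; first by exists w.
  exists (c / b); first by rewrite mulf_neq0// invr_eq0.
  by rewrite -[set_val w]/(\val w) e scalerA divfK.
move=> _ [w [c c0 Ow] <-].
have hw : c *: \val w \in A by apply/mem_set/A_scale => //; exact: set_mem (valP w).
have := OU _ Ow hw; congr (U _); apply/lines_eqP; exists c^-1; first by rewrite invr_eq0.
by rewrite scalerA mulVf// scale1r.
Qed.

End LinesTopology.

Section ModuliTopology.
Context {C : numClosedFieldType} {n d : nat}.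

Lemma nonzero_scale (c : C) (F : form C n d) : c != 0 ->
  nonzero_forms F -> nonzero_forms (c *: F).
Proof. by move=> c0 F0; rewrite /nonzero_forms /= scaler_eq0 negb_or c0. Qed.

Lemma GL_scale (c : C) (M : 'M[C]_n.+1) : c != 0 -> GL C n M -> GL C n (c *: M).
Proof. by move=> c0 uM; rewrite /GL /= unitmxZ// unitfE. Qed.

Lemma nbhs_PGLP (M : GL C n) (U : set (PGL C n)) :
  nbhs (\pi_(PGL C n) M) U <->
  nbhs (\val M) [set N | forall uN : N \in unitmx, U (\pi_(PGL C n) (toGL uN))].
Proof.
apply: (iff_trans (nbhs_linesP GL_scale M U)); split; apply: filterS => N h hN.
  exact: h.
have := h (set_mem hN); congr (U (\pi _)); exact: val_inj.
Qed.

Lemma nbhs_fsP (x : @finite_stabilizer C n d) F (F0 : F != 0)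
    (U : set (@finite_stabilizer C n d)) :
  \val x = \pi_(hypersurfaces C n d) (to_nonzero F0) ->
  nbhs x U <->
  nbhs F [set G | forall (G0 : G != 0)
    (fG : finite_stabilizer (\pi_(hypersurfaces C n d) (to_nonzero G0))), U (to_fs fG)].
Proof.
move=> ex.
have H := nbhs_linesP nonzero_scale (to_nonzero F0).
split=> [|/= h].
  rewrite nbhsE => -[B [oB Bx] BU]; case: oB => P oO eO.
  have /H : nbhs (\pi_(hypersurfaces C n d) (to_nonzero F0)) P.
    apply: open_nbhs_nbhs; split=> //; rewrite -ex.
    by have : (set_val @^-1` P) x by rewrite eO.
  apply: filterS => G h G0 fG; apply: BU; rewrite -eO.
  by have := h (mem_set G0); congr (P (\pi _)); exact: val_inj.
pose V := [set y : hypersurfaces C n d | forall fy : finite_stabilizer y, U (to_fs fy)].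
have : nbhs (\val x) V.
  rewrite ex; apply/H; apply: filterS h => G h hG fy.
  have fG : finite_stabilizer (\pi_(hypersurfaces C n d) (to_nonzero (set_mem hG))).
    rewrite (_ : to_nonzero _ = exist _ G hG)//; exact: val_inj.
  have := h (set_mem hG) fG; congr U; apply: val_inj => /=; congr (\pi _).
  exact: val_inj.
rewrite nbhsE => -[P [oO Ox] OV]; rewrite nbhsE; exists (set_val @^-1` P).
  by split=> //; exists P.
move=> y Oy; have := OV _ Oy (set_mem (valP y)).
by congr U; exact: val_inj.
Qed.

(** The topology of the moduli space, read on forms; it avoids working with a quotient of a subspace
    of a quotient. *)
Lemma open_moduliP (V : set (moduli C n d)) : open V <->
  forall (F : form C n d) p, class_of F = Some p -> V p ->
    nbhs F [set G | forall q, class_of G = Some q -> V q].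
Proof.
split=> [oV F p eF Vp|h].
  have [F0 [fF ep]] := (class_ofP F p).1 eF.
  have : nbhs (to_fs fF) (\pi_(moduli C n d) @^-1` V).
    by apply: open_nbhs_nbhs; split=> //=; rewrite -ep.
  move=> /(@nbhs_fsP (to_fs fF) F F0 _ (erefl _)); apply: filterS => G hG q /class_ofP[G0 [fG ->]].
  exact: hG.
rewrite /open /= /quotient_open openE => x Vx.
have [F0 ex] : exists F (F0 : F != 0), \val x = \pi_(hypersurfaces C n d) (to_nonzero F0).
  pose G := repr (\val x); exists (\val G), (set_mem (valP G)).
  rewrite -[LHS]reprK; congr (\pi _); exact: val_inj.
have [F01 ex1] := ex; apply/(nbhs_fsP _ ex1).
have cF : class_of F0 = Some (\pi_(moduli C n d) x).
  apply/class_ofP; exists F01.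
  have fF : finite_stabilizer (\pi_(hypersurfaces C n d) (to_nonzero F01)).
    by rewrite -ex1; exact: set_mem (valP x).
  exists fF; congr (\pi _); exact: val_inj.
apply: filterS (h _ _ cF Vx) => G hG G0 fG; apply: hG.
by apply/class_ofP; exists G0, fG.
Qed.

End ModuliTopology.

Section ProjectiveGroupCompactness.
Context {R : realType} {C : complexField R} {n : nat}.

(** The ratio of [nrm (\det M)] and [nrm M ^+ n.+1] does not change when [M] is scaled, so it
    defines a positive function on PGL. Its superlevel sets are compact ([PGL_exhaustion_compact])
    and every set with compact closure lies in one of them ([compact_sub_PGL_exhaustion]). *)
Definition PGL_exhaustion (eta : R) : set (PGL C n) :=
  [set g | exists2 M : GL C n, g = \pi_(PGL C n) M &
     eta * nrm (\val M) ^+ n.+1 <= nrm (\det (\val M))].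

Lemma PGL_exhaustionP eta (M : GL C n) :
  PGL_exhaustion eta (\pi_(PGL C n) M) <-> eta * nrm (\val M) ^+ n.+1 <= nrm (\det (\val M)).
Proof.
split=> [[N /lines_eqP[c c0 e] h]|h]; last by exists M.
have := h; rewrite /= e detZ nrmM nrmZ nrmX exprMn mulrCA ler_pM2l// exprn_gt0//.
by rewrite nrm_gt0.
Qed.

Lemma PGL_exhaustion_le (a b : R) : a <= b -> PGL_exhaustion b `<=` PGL_exhaustion a.
Proof.
move=> ab g [M -> h]; exists M => //; apply: le_trans h.
by rewrite ler_wpM2r ?exprn_ge0 ?nrm_ge0.
Qed.

Lemma ratio_continuous (eta : R) : continuous (fun M : 'M[C]_n.+1 =>
  nrm (\det M) - eta * nrm M ^+ n.+1).
Proof.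
move=> M; apply: (@continuousB _ _ _ (fun M : 'M[C]_n.+1 => nrm (\det M))
  (fun M : 'M[C]_n.+1 => eta * nrm M ^+ n.+1)).
  exact: (@continuous_comp _ _ _ (fun M : 'M[C]_n.+1 => \det M) nrm M
    (@det_continuous _ _ _ M) (@nrm_continuous _ _ _ _)).
apply: (@continuousM _ _ (fun=> eta) (fun M : 'M[C]_n.+1 => nrm M ^+ n.+1)).
  exact: cst_continuous.
exact: (@continuous_comp _ _ _ nrm (fun x : R => x ^+ n.+1) M
  (@nrm_continuous _ _ _ _) (@exprn_continuous _ _ _)).
Qed.

Lemma PGL_exhaustion_closed (eta : R) : closed (PGL_exhaustion eta).
Proof.
rewrite -[PGL_exhaustion eta]setCK; apply: open_closedC; rewrite openE => g.
elim/pgl_ind: g => M; rewrite /setC /= PGL_exhaustionP => /negP; rewrite -ltNge => h.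
rewrite /interior /=; apply/nbhs_PGLP.
have : nbhs (\val M) ((fun M : 'M[C]_n.+1 => nrm (\det M) - eta * nrm M ^+ n.+1)
    @^-1` [set x | x < 0]).
  apply: ratio_continuous; apply: open_nbhs_nbhs; split; first exact: open_lt.
  by rewrite /= subr_lt0.
apply: filterS => N /= hN uN /PGL_exhaustionP /=; rewrite leNgt -subr_lt0 hN.
by [].
Qed.

Lemma PGL_exhaustion_nbhs (eta : R) (M : GL C n) :
  eta * nrm (\val M) ^+ n.+1 < nrm (\det (\val M)) ->
  nbhs (\pi_(PGL C n) M) (PGL_exhaustion eta).
Proof.
move=> h; apply/nbhs_PGLP.
have : nbhs (\val M) ((fun M : 'M[C]_n.+1 => nrm (\det M) - eta * nrm M ^+ n.+1)
    @^-1` [set x | 0 < x]).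
  apply: ratio_continuous; apply: open_nbhs_nbhs; split; first exact: open_gt.
  by rewrite /= subr_gt0.
apply: filterS => N /= hN uN; apply/PGL_exhaustionP => /=; rewrite -subr_ge0; exact: ltW.
Qed.

(** Matrices of norm at most 1 with determinant bounded away from 0 form a compact set, which maps
    onto this one: each class has a representative of norm 1. *)
Lemma PGL_exhaustion_compact (eta : R) : 0 < eta -> compact (PGL_exhaustion eta).
Proof.
move=> eta0.
pose f (M : 'M[C]_n.+1) : PGL C n :=
  if pselect (M \in unitmx) is left u then \pi_(PGL C n) (toGL u) else 1%g.
pose K := [set M : 'M[C]_n.+1 | nrm M <= 1] `&` [set M | eta <= nrm (\det M)].
have uK M : K M -> M \in unitmx.
  by move=> [_ /= h]; rewrite unitmxE unitfE -nrm_gt0; exact: lt_le_trans h.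
have cK : compact K.
  apply: subclosed_compact (@mx_compact R C _ _ 1) _; last by move=> M [].
  apply: closedI.
    have -> : [set M : 'M[C]_n.+1 | nrm M <= 1] = nrm @^-1` [set x | x <= 1] by [].
    by apply: preimage_closed; [move=> x _; exact: nrm_continuous|exact: closed_le].
  have -> : [set M : 'M[C]_n.+1 | eta <= nrm (\det M)] =
    (nrm \o (fun M : 'M[C]_n.+1 => \det M)) @^-1` [set x | eta <= x] by [].
  apply: preimage_closed; last exact: closed_ge.
  move=> x _; apply: continuous_comp; [exact: det_continuous|exact: nrm_continuous].
have -> : PGL_exhaustion eta = f @` K.
  apply/seteqP; split=> [g [M -> h]|_ [M KM <-]].
    have n0 : 0 < nrm (\val M).
      rewrite nrm_gt0; apply: contraTneq (GL_unit M) => ->.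
      by rewrite unitmxE det0 unitr0.
    pose c : C := rl (nrm (\val M))^-1.
    have c0 : c != 0 by rewrite -nrm_gt0 nrm_real gtr0_norm invr_gt0.
    have nc : nrm c = (nrm (\val M))^-1 by rewrite nrm_real gtr0_norm ?invr_gt0.
    have KM : K (c *: \val M).
      split; rewrite /= ?detZ ?nrmZ ?nrmM ?nrmX nc; first by rewrite mulVf ?gt_eqF.
      by rewrite exprVn mulrC ler_pdivlMr// exprn_gt0.
    exists (c *: \val M) => //; rewrite /f; case: pselect => [u|]; last by move/uK: KM.
    by apply/esym/lines_eqP; exists c.
  have u := uK M KM; rewrite /f; case: pselect => // u'; apply/PGL_exhaustionP => /=.
  case: KM => h1 h2; apply: le_trans h2; rewrite ler_piMr ?(ltW eta0)//.
  by rewrite exprn_ile1 ?nrm_ge0.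
apply: continuous_compact => //; apply/subspace_continuousP => M KM U.
have u := uK M KM.
have efM : f M = \pi_(PGL C n) (toGL u).
  by rewrite /f; case: pselect => // u'; apply/lines_eqP; exists 1; rewrite ?oner_eq0 ?scale1r.
move=> hU; have {hU} : nbhs (f M) U by [].
rewrite efM => /nbhs_PGLP; apply: filterS => N hN KN /=.
rewrite -[from_subspace K f N]/(f N) /f.
by case: pselect => [u'|]; [exact: hN|move/uK: KN].
Qed.

(** Otherwise some sequence in [S] leaves all sets of the exhaustion; but it has a cluster point,
    and one of these sets is a neighborhood of that point. *)
Lemma compact_sub_PGL_exhaustion (S : set (PGL C n)) : compact (closure S) ->
  exists2 eta, 0 < eta & S `<=` PGL_exhaustion eta.
Proof.
move=> cS; apply: contrapT => no.
have ex (k : nat) : exists g, S g /\ ~ PGL_exhaustion k.+1%:R^-1 g.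
  apply: contrapT => nk; apply: no; exists k.+1%:R^-1; first by rewrite invr_gt0.
  by move=> g Sg; apply: contrapT => ng; apply: nk; exists g.
have [g hg] := choice ex.
have FF : ProperFilter (g @ \oo) by exact: fmap_proper_filter.
have [|p [_ clp]] := cS (g @ \oo) FF.
  by exists 0%N => // k _; apply: subset_closure; case: (hg k).
elim/pgl_ind: p clp => M clp.
have n0 : 0 < nrm (\det (\val M)).
  by rewrite nrm_gt0 -unitfE -unitmxE GL_unit.
pose q := nrm (\val M) ^+ n.+1 + 1.
have q0 : 0 < q by rewrite ltr_wpDl// exprn_ge0// nrm_ge0.
pose eta := nrm (\det (\val M)) / q.
have eta0 : 0 < eta by rewrite divr_gt0.
have nb : nbhs (\pi_(PGL C n) M) (PGL_exhaustion eta).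
  apply: PGL_exhaustion_nbhs; rewrite /eta mulrAC ltr_pdivrMr// ltr_pM2l// /q ltrDl.
  exact: ltr01.
have gN : (g @ \oo) (~` PGL_exhaustion eta).
  have [N hN] : exists N : nat, N.+1%:R^-1 <= eta.
    exists (Num.Def.archi_bound eta^-1).
    rewrite invf_ple ?posrE ?ltr0n//; apply: ltW.
    apply: lt_trans (archi_boundP _) _; first by rewrite invr_ge0 ltW.
    by rewrite ltr_nat.
  exists N => // k /= Nk /PGL_exhaustion_le h; case: (hg k) => _; apply; apply: h.
  apply: le_trans hN; rewrite lef_pV2 ?posrE ?ltr0n// ler_nat; exact: Nk.
by have [x [hx /hx]] := clp _ _ gN nb.
Qed.

End ProjectiveGroupCompactness.

(** * Differentials of forms, and interpolation *)

(** Properties of evaluations are proved along this induction, by closure under sums and products. *)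
Lemma mpoly_ring_ind (C : numClosedFieldType) m (P : mpoly m C -> Prop) :
  (forall c, P (mpolyC m c)) -> (forall i, P (mpolyX C (mnm1 i))) ->
  (forall p q, P p -> P q -> P (p + q)) -> (forall p q, P p -> P q -> P (p * q)) ->
  forall p, P p.
Proof.
move=> PC PX PD PM.
have PXm k : P (mpolyX C k).
  rewrite mpolyXE_id; apply: (big_ind P) => [||i _]; [exact: PC|exact: PM|].
  by elim: (k i) => [|e IH]; [exact: PC|rewrite exprS; exact: PM].
elim/mpolyind => [|c k p _ _ hp]; first exact: PC.
by apply: PD => //; rewrite -mul_mpolyC; apply: PM => //; exact: PC.
Qed.

Section EvaluationCalculus.
Context {R : realType} {C : complexField R}.

Lemma sdiff_unique (V W : normedModType C) (f : V -> W) x l k :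
  sdiff f x l -> sdiff f x k -> l =1 k.
Proof.
by move=> /sdiff_diff[_ hl] /sdiff_diff[_ hk] v; rewrite -hl -hk.
Qed.

Lemma sdiff_id (V : normedModType C) (x : V) : sdiff id x id.
Proof. by apply: sdiff_lin => //; exists 1 => v; rewrite mul1r. Qed.

Lemma sdiffC (g : C -> C) (c : C) : sdiffable g 0 ->
  sdiff (fun h : C => c + h * g h) 0 (fun h : C => g 0 * h).
Proof.
move=> [l hl]; apply: sdiff_eq (sdiffD (sdiff_cst c 0) (sdiffM (sdiff_id 0) hl)) _ _ => //.
by move=> h; rewrite add0r mul0r add0r.
Qed.

Lemma sdiff_meval m (V : normedModType C) (p : mpoly m C) (y l : 'I_m -> V -> C) x :
  (forall i, sdiff (y i) x (l i)) ->
  sdiff (fun u => meval (fun i => y i u) p) x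
        (fun u => \sum_i meval (fun i => y i x) (mderiv i p) * l i u).
Proof.
move=> hy.
pose P (p : mpoly m C) := sdiff (fun u => meval (fun i => y i u) p) x
        (fun u => \sum_i meval (fun i => y i x) (mderiv i p) * l i u).
apply: (@mpoly_ring_ind _ m P) => [c|j|q r hq hr|q r hq hr].
- apply: sdiff_eq (sdiff_cst c x) _ _ => u; first by rewrite mevalC.
  by rewrite big1// => i _; rewrite mderivC meval0 mul0r.
- apply: sdiff_eq (hy j) _ _ => u; first by rewrite mevalXU.
  rewrite (bigD1 j)//= mderivX mnm1E eqxx scale1r.
  rewrite (_ : mnm_sub _ _ = @mnm0 m) ?mevalX; last first.
    by apply/mnmP => k; rewrite mnmBE subnn mnm0E.
  rewrite big1 => [|k _]; last by rewrite mnm0E expr0.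
  rewrite mul1r big1 ?addr0// => i /negPf ij.
  by rewrite mderivX mnm1E eq_sym ij scale0r meval0 mul0r.
- apply: sdiff_eq (sdiffD hq hr) _ _ => u; first by rewrite mevalD.
  rewrite -big_split; apply: eq_bigr => i _ /=.
  by rewrite mderivD mevalD mulrDl.
- apply: sdiff_eq (sdiffM hq hr) _ _ => u; first by rewrite mevalM.
  rewrite !mulr_sumr -big_split; apply: eq_bigr => i _ /=.
  by rewrite mderivM mevalD !mevalM mulrDl addrC mulrCA !mulrA.
Qed.

Context {n d : nat}.
Implicit Types (F G : form C n d) (v w : 'cV[C]_n.+1).

(** The differential of [F] at [v] in the direction [w]. *)
Definition dev F v w : C :=
  \sum_i meval (fun i => v i 0) (mderiv i (poly_of F)) * w i 0.

Lemma sdiff_ev (V : normedModType C) F (y l : V -> 'cV[C]_n.+1) x :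
  (forall i, sdiff (fun u => y u i 0) x (fun u => l u i 0)) ->
  sdiff (fun u => ev F (y u)) x (fun u => dev F (y x) (l u)).
Proof. exact: (sdiff_meval (poly_of F)). Qed.

Lemma sdiff_line v w i :
  sdiff (fun h : C => (v + h *: w) i 0) 0 (fun h => (h *: w) i 0).
Proof.
apply: (@sdiff_eq _ _ _ _ (fun h : C => v i 0 + h * w i 0)).
- apply: (sdiffC (g := fun=> w i 0)); exact: sdiffable_cst.
- by move=> h; rewrite !mxE.
- by move=> h; rewrite !mxE mulrC.
Qed.

Lemma devZr F v c w : dev F v (c *: w) = c * dev F v w.
Proof. by rewrite mulr_sumr; apply: eq_bigr => i _; rewrite !mxE; ring. Qed.

Lemma devDr F v w w' : dev F v (w + w') = dev F v w + dev F v w'.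
Proof. by rewrite -big_split; apply: eq_bigr => i _; rewrite !mxE mulrDr. Qed.

(** Differentials of concrete forms are read off the expansion of [F (v + h w)] in powers of [h]. *)
Lemma dev_unique F v w (c : C) (g : C -> C) : sdiffable g 0 ->
  (forall h, ev F (v + h *: w) = c + h * g h) -> dev F v w = g 0.
Proof.
move=> sg e.
have h1 := sdiff_ev F (sdiff_line v w).
have h2 := sdiff_eq (sdiffC c sg) (fun h => esym (e h)) (fun=> erefl).
have := sdiff_unique h1 h2 1; rewrite /= !scale0r addr0 scale1r mulr1.
by [].
Qed.

Lemma dev_substitute A F v w : dev (substitute A F) v w = dev F (A *m v) (A *m w).
Proof.
have h1 := sdiff_ev (substitute A F) (sdiff_line v w).
have h2 := sdiff_ev F (sdiff_line (A *m v) (A *m w)).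
have e h : ev F (A *m v + h *: (A *m w)) = ev (substitute A F) (v + h *: w).
  by rewrite ev_subst mulmxDr -scalemxAr.
have := sdiff_unique h1 (sdiff_eq h2 e (fun=> erefl)) 1.
by rewrite /= !scale0r !addr0 !scale1r.
Qed.

Lemma devD F G v w : dev (F + G) v w = dev F v w + dev G v w.
Proof.
rewrite -big_split; apply: eq_bigr => i _ /=.
by rewrite poly_ofD mderivD mevalD mulrDl.
Qed.

Lemma devZ c F v w : dev (c *: F) v w = c * dev F v w.
Proof.
rewrite mulr_sumr; apply: eq_bigr => i _ /=.
by rewrite poly_ofZ mderivZ mevalZ mulrA.
Qed.

Definition separates_forms := forall F G, ev F =1 ev G -> F = G.

Section Interpolation.
Hypothesis ev_inj : separates_forms.

Definition evcol v : 'cV[C]_(dim (dhomog n.+1 C d)) := \col_k ev (delta_mx 0 k : form C n d) v.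

Lemma evcolE F v : ev F v = ((F : 'rV_ _) *m evcol v) 0 0.
Proof.
rewrite mxE [in LHS](row_sum_delta F) ev_sum; apply: eq_bigr => k _.
by rewrite evZ mxE.
Qed.

(** As long as the evaluations at the points chosen so far do not span the dual of the space of
    forms, some nonzero form vanishes at all of them, and a point where it does not vanish increases
    the rank. This turns a map into the space of forms into a finite sum of scalar functions times
    fixed forms, and so reduces its differentiability to that of evaluations. *)
Lemma interpolation : exists N (P : 'I_N -> 'cV[C]_n.+1) (E : 'I_N -> form C n d),
  forall F, F = \sum_k ev F (P k) *: E k.
Proof.
set m := dim (dhomog n.+1 C d).
have rk (r : nat) : (r <= m)%N -> exists N (P : 'I_N -> 'cV[C]_n.+1),
    (r <= \rank (\matrix_(i < m, k < N) evcol (P k) i 0%R))%N.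
  elim: r => [_|r IH rm]; first by exists 0%N, (fun=> 0).
  have [N [P hP]] := IH (ltnW rm); set M := \matrix_(i, k) _ in hP.
  have [h|h] := leqP r.+1 (\rank M); first by exists N, P.
  have rM : \rank M = r by apply/eqP; rewrite eqn_leq hP andbT -ltnS.
  have [G /sub_kermxP GM G0] : exists2 G : 'rV_m, (G <= kermx M)%MS & G != 0.
    apply/rowV0Pn; rewrite -mxrank_eq0 mxrank_ker rM -lt0n subn_gt0.
    exact: rm.
  have [v hv] : exists v, ev (G : form C n d) v != 0.
    apply: contrapT => h0; case/negP: G0; apply/eqP.
    apply: ev_inj => v; rewrite ev0; apply: contrapT => /eqP h1.
    by apply: h0; exists v.
  exists (N + 1)%N, (fun k => match fintype.split k with inl k => P k | inr _ => v end).
  have -> : \matrix_(i < m, k < N + 1) evcol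
      (match fintype.split k with inl k => P k | inr _ => v end) i 0 = row_mx M (evcol v).
    apply/matrixP => i k; rewrite !mxE; by case: (fintype.split k) => j; rewrite !mxE.
  rewrite -mxrank_tr tr_row_mx -rM -(mxrank_tr M).
  apply: (rank_ltmx (A := M^T) (B := col_mx M^T (evcol v)^T)).
  rewrite ltmxE -{1}addsmxE addsmxSl /=.
  rewrite col_mx_sub submx_refl /=; apply/negP => /submxP[D eD].
  have {}eD : evcol v = M *m D^T by rewrite -[M]trmxK -trmx_mul -eD trmxK.
  by case/negP: hv; rewrite evcolE eD mulmxA GM mul0mx mxE.
have [N [P hP]] := rk m (leqnn m); exists N, P.
set M := \matrix_(i, k) _ in hP.
have /row_freeP[B hB] : row_free M by rewrite /row_free eqn_leq rank_leq_row.
exists (fun k => row k B) => F.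
rewrite -[LHS](mulmx1 (F : 'rV_m)) -hB mulmxA mulmx_sum_row.
apply: eq_bigr => k _; congr (_ *: _); rewrite evcolE !mxE.
by apply: eq_bigr => i _; rewrite !mxE.
Qed.

End Interpolation.

End EvaluationCalculus.

(** * Families with a Weierstrass normal form *)

(** A family [fW a b] of normal forms, with invariants [fS] and [fT] that recover the parameters.
    The exponent [e] is the one for which [c ^+ e * \det A ^+ 2] is 1 when [A] is the scalar matrix
    [k] and [c = k ^- d], a pair that fixes every form; this is [de_eq]. [torus] relates the members
    of the family, with bounds on the matrices that are uniform for [s] in a compact set. [W_span]
    says that the parameters and the directions tangent to the orbit span the space of forms, and
    [W_euler] that the orbit is tangent to the curve of parameters [(s^2 a, s^3 b)]. In [stable] and
    [unstable] the discriminant decides whether matrices joining forms near a given one can be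
    nearly singular. *)
Record weierstrass_family (R : realType) (C : complexField R)
  (n d e : nat) := WeierstrassFamily {
  fW0 : form C n d;
  fW1 : form C n d;
  fW2 : form C n d;
  fS : form C n d -> C;
  fT : form C n d -> C;
  fW := fun a b : C => fW0 + a *: fW1 + b *: fW2;
  fdisc := fun F => 4 * fS F ^+ 3 + 27 * fT F ^+ 2;
  ev_inj : @separates_forms R C n d;
  e_gt0 : (0 < e)%N;
  de_eq : (d * e = 2 * n.+1)%N;
  S_sdiff : forall F, sdiffable fS F;
  T_sdiff : forall F, sdiffable fT F;
  S_sub : forall A F, fS (substitute A F) = \det A ^+ 4 * fS F;
  T_sub : forall A F, fT (substitute A F) = \det A ^+ 6 * fT F;
  SZ : forall c F, fS (c *: F) = (c ^+ e) ^+ 2 * fS F;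
  TZ : forall c F, fT (c *: F) = (c ^+ e) ^+ 3 * fT F;
  S_W : forall a b, fS (fW a b) = a;
  T_W : forall a b, fT (fW a b) = b;
  torus : forall r : R, exists K : R, forall s : C, s != 0 ->
    nrm s <= r -> nrm s^-1 <= r -> exists (A : 'M[C]_n.+1) (c : C),
    [/\ c != 0, A \in unitmx, nrm A <= K /\ nrm (invmx A) <= K,
        c ^+ e * \det A ^+ 2 = s &
        forall a b, c *: substitute A (fW a b) = fW (s ^+ 2 * a) (s ^+ 3 * b)];
  normal_form : forall F p, class_of F = Some p -> exists a b : C,
    ((a != 0) || (b != 0)) /\ equivalent F (fW a b);
  W_class : forall a b : C, (a != 0) || (b != 0) -> exists p, class_of (fW a b) = Some p;
  W_span : forall a b (G : form C n d), exists (B : 'M[C]_n.+1) (x y : C), forall v,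
    ev G v = dev (fW a b) v (B *m v) + x * ev fW1 v + y * ev fW2 v;
  W_euler : forall a b, exists (c : C) (B : 'M[C]_n.+1), forall v,
    2 * a * ev fW1 v + 3 * b * ev fW2 v =
    c * ev (fW a b) v + dev (fW a b) v (B *m v);
  stable : forall F, fdisc F != 0 -> exists2 delta : R, 0 < delta &
    exists2 eta : R, 0 < eta & forall F1 F2 (A : 'M[C]_n.+1) (c : C),
      nrm (F1 - F) < delta -> nrm (F2 - F) < delta -> A \in unitmx -> c != 0 ->
      F2 = c *: substitute A F1 -> eta * nrm A ^+ n.+1 <= nrm (\det A);
  unstable : exists F0 p0, [/\ class_of F0 = Some p0, fdisc F0 = 0 &
    forall delta eta : R, 0 < delta -> 0 < eta ->
      exists F1 (A : 'M[C]_n.+1) (c : C),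
      [/\ nrm (F1 - F0) < delta, A \in unitmx, substitute A F1 = c *: F1 &
          nrm (\det A) < eta * nrm A ^+ n.+1]]
}.

Section FamilyTheory.
Context {R : realType} {C : complexField R}.
Context {n d e : nat} (fam : weierstrass_family C n d e).
Local Notation S := (fS fam).
Local Notation T := (fT fam).
Local Notation W := (fW fam).
Local Notation form := (form C n d).
Implicit Types (F G : form).

Lemma ev_W a b v : ev (W a b) v = ev (fW0 fam) v + a * ev (fW1 fam) v + b * ev (fW2 fam) v.
Proof. by rewrite !evD !evZ. Qed.

Lemma dev_W a b v w : dev (W a b) v w =
  dev (fW0 fam) v w + a * dev (fW1 fam) v w + b * dev (fW2 fam) v w.
Proof. by rewrite !devD !devZ. Qed.

(** The pair [(c, A)] acts on the invariants [(S, T)] by the square and the cube of this character. *)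
Definition mu (c : C) (A : 'M[C]_n.+1) := c ^+ e * \det A ^+ 2.

Lemma S_act c A F : S (c *: substitute A F) = mu c A ^+ 2 * S F.
Proof. by rewrite SZ S_sub /mu [in RHS]exprMn -(exprM (\det A)) mulrA. Qed.

Lemma T_act c A F : T (c *: substitute A F) = mu c A ^+ 3 * T F.
Proof. by rewrite TZ T_sub /mu [in RHS]exprMn -(exprM (\det A)) mulrA. Qed.

Lemma mu_neq0 c (A : 'M[C]_n.+1) : c != 0 -> A \in unitmx -> mu c A != 0.
Proof. by move=> c0 uA; rewrite mulf_neq0 ?expf_neq0// -unitfE -unitmxE. Qed.

Lemma torus_equivalent (s a b : C) : s != 0 ->
  equivalent (W a b) (W (s ^+ 2 * a) (s ^+ 3 * b)).
Proof.
move=> s0; have [K hK] := torus fam (Num.max (nrm s) (nrm s^-1)).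
have [||A [c [c0 uA _ _ h]]] := hK s s0.
- by rewrite le_max lexx.
- by rewrite le_max lexx orbT.
by exists c, A.
Qed.

Lemma equivalent_ST F G : equivalent F G ->
  exists2 s : C, s != 0 & S G = s ^+ 2 * S F /\ T G = s ^+ 3 * T F.
Proof.
move=> [c [A [c0 uA ->]]]; exists (mu c A); first exact: mu_neq0.
by rewrite S_act T_act.
Qed.

(** Hence the class is determined by the two invariants. *)
Lemma class_ofE F p : class_of F = Some p ->
  ((S F != 0) || (T F != 0)) /\ equivalent F (W (S F) (T F)).
Proof.
move=> /(normal_form fam)[a [b [ab eF]]].
have [s s0 []] := equivalent_ST eF; rewrite S_W T_W => ea eb.
split.
  case/orP: ab => h; apply/orP; [left|right]; apply: contraNneq h => h0.
    by rewrite ea h0 mulr0.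
  by rewrite eb h0 mulr0.
apply: equivalent_trans eF _; rewrite ea eb.
have si0 : s^-1 != 0 by rewrite invr_eq0.
have := torus_equivalent (s ^+ 2 * S F) (s ^+ 3 * T F) si0.
have h k (z : C) : s^-1 ^+ k * (s ^+ k * z) = z.
  by rewrite mulrA exprVn mulVf ?mul1r// expf_neq0.
by rewrite !h.
Qed.

Lemma class_ofW F p : class_of F = Some p -> class_of (W (S F) (T F)) = Some p.
Proof. by move=> h; have [_ /class_of_equivalent <-] := class_ofE h. Qed.

Lemma ev_linear v : linear (fun F => ev F v).
Proof. by move=> c F G; rewrite evD evZ. Qed.

Lemma sdiff_evF v x : sdiff (fun F => ev F v) x (fun F => ev F v).
Proof. exact: sdiff_mx (ev_linear v). Qed.

(** [W_span] for the forms [E k] of an interpolation formula, extended by linearity. *)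
Lemma W_right_inverse a b : exists (B : form -> 'M[C]_n.+1) (x y : form -> C),
  [/\ linear B, linear x, linear y & forall G v,
     ev G v = dev (W a b) v (B G *m v) + x G * ev (fW1 fam) v + y G * ev (fW2 fam) v].
Proof.
have [N [P [E hE]]] := interpolation (ev_inj fam).
have /choice[B /choice[x /choice[y h]]] := fun k => W_span fam a b (E k).
exists (fun G => \sum_k ev G (P k) *: B k), (fun G => \sum_k ev G (P k) * x k),
  (fun G => \sum_k ev G (P k) * y k); split.
- move=> c F G; rewrite scaler_sumr -big_split; apply: eq_bigr => k _.
  by rewrite evD evZ scalerDl scalerA.
- move=> c F G; rewrite scaler_sumr -big_split; apply: eq_bigr => k _.
  by rewrite evD evZ /GRing.scale /=; ring.
- move=> c F G; rewrite scaler_sumr -big_split; apply: eq_bigr => k _.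
  by rewrite evD evZ /GRing.scale /=; ring.
move=> G v; rewrite [in LHS](hE G) ev_sum mulmx_suml.
have -> : dev (W a b) v (\sum_k ev G (P k) *: B k *m v) =
    \sum_k ev G (P k) * dev (W a b) v (B k *m v).
  elim/big_rec2: _ => [|k y1 y2 _ <-].
    by have := devZr (W a b) v 0 0; rewrite scale0r mul0r.
  by rewrite devDr -scalemxAl devZr.
rewrite !mulr_suml -!big_split; apply: eq_bigr => k _ /=.
by rewrite evZ h; ring.
Qed.

(** With [B], [x] and [y] as above, the map that sends [v] to [W (a + x v) (b + y v)] in the
    coordinates [1 + B v] has the identity as its differential at 0. By [local_onto] it reaches all
    forms near [W a b]. *)
Lemma local_normal_form (a b : C) (eps : R) : 0 < eps ->
  exists2 delta : R, 0 < delta & forall G, nrm (G - W a b) < delta ->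
  exists (A : 'M[C]_n.+1) (a' b' : C),
    [/\ A \in unitmx, nrm (A - 1%:M) < eps, nrm (a' - a) < eps, nrm (b' - b) < eps &
        G = substitute A (W a' b')].
Proof.
move=> eps0; have [B [x [y [lB lx ly hB]]]] := W_right_inverse a b.
have [N [P [E hE]]] := interpolation (ev_inj fam).
pose g (v : form) : form := substitute (1%:M + B v) (W (a + x v) (b + y v)).
have l0 (V : normedModType C) (l : form -> V) : linear l -> l 0 = 0.
  by move=> h; have := h (-1) 0 0; rewrite scaler0 addr0 scaleN1r addNr.
have s1 (c : C) (l : form -> C) : linear l -> sdiff (fun v => c + l v) 0 l.
  move=> ll; apply: sdiff_eq (sdiffD (sdiff_cst c 0) (sdiff_mx 0 ll)) _ _ => //.
  by move=> v; rewrite /= add0r.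
have sBi k i : sdiff (fun v => ((1%:M + B v) *m P k) i 0) 0 (fun v => (B v *m P k) i 0).
  have lBP : linear (fun v => (B v *m P k) i 0).
    by move=> c u v; rewrite lB mulmxDl -scalemxAl !mxE.
  by apply: sdiff_eq (s1 (P k i 0) _ lBP) _ _ => // v; rewrite mulmxDl mul1mx [RHS]mxE.
have [x0 y0] := (l0 _ _ lx, l0 _ _ ly).
have y0k k : (1%:M + B 0) *m P k = P k by rewrite l0// addr0 mul1mx.
have aux (p q r s t u z : C) : p + (a * q + r * s) + (b * t + u * z) =
  p + a * q + b * t + s * r + z * u by ring.
have sg : sdiff g 0 id.
  have sk k : sdiff (fun v => ev (g v) (P k)) 0 (fun v => ev v (P k)).
    have sW F := sdiff_ev F (sBi k).
    have h := sdiffD (sdiffD (sW (fW0 fam)) (sdiffM (s1 a x lx) (sW (fW1 fam))))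
       (sdiffM (s1 b y ly) (sW (fW2 fam))).
    apply: (sdiff_eq h) => v.
      by rewrite /g ev_subst ev_W.
    by rewrite y0k x0 y0 !addr0 [RHS]hB dev_W; exact: aux.
  apply: (@sdiff_eq _ _ _ _ (fun v => \sum_k ev (g v) (P k) *: E k)).
  - by apply: sdiff_sum => k; apply: sdiffZ; exact: sk.
  - by move=> v; rewrite -hE.
  - by move=> v; rewrite /= -hE.
have g0 : g 0 = W a b by rewrite /g !l0// !addr0 substitute1.
have bB := linear_bounded lB; have bx := linear_bounded lx; have by_ := linear_bounded ly.
case: bB => KB hKB; case: bx => Kx hKx; case: by_ => Ky hKy.
have [dd dd0 hdet] : exists2 dd : R, 0 < dd & forall A : 'M[C]_n.+1,
    nrm (A - 1%:M) < dd -> A \in unitmx.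
  have /continuous_nrmP := @det_continuous R C n.+1 1%:M.
  move=> /(_ 1 ltr01)[dd dd0 h]; exists dd => // A /h; rewrite det1 unitmxE unitfE.
  by apply: contraTneq => ->; rewrite sub0r nrmN nrm1 ltxx.
have [_ _ /(_ (1 / 2))] := sg; rewrite divr_gt0// => /(_ isT)[r0 r00 hr0].
pose K := `|KB| + `|Kx| + `|Ky| + 1.
have K0 : 0 < K by rewrite ltr_wpDl// !addr_ge0.
pose r := Num.min (r0 / 2) (Num.min (eps / K / 2) (dd / K / 2)).
have r_gt0 : 0 < r by rewrite !lt_min !divr_gt0.
have [rr0 re rd] : [/\ r <= r0 / 2, r <= eps / K / 2 & r <= dd / K / 2].
  by rewrite /r !ge_min !lexx !orbT.
have small (l : R) (z : R) (v : form) : z <= l * nrm v -> `|l| <= K -> nrm v <= r ->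
    z < eps /\ z < dd.
  move=> zl lK vr.
  have h : z <= K * r.
    apply: le_trans zl _; apply: le_trans (ler_wpM2r (nrm_ge0 _) (ler_norm l)) _.
    by rewrite ler_pM ?nrm_ge0.
  have hK (q : R) : 0 < q -> r <= q / K / 2 -> K * r < q.
    move=> q0 rq; rewrite mulrC -ltr_pdivlMr//; apply: le_lt_trans rq _.
    by rewrite ltr_pdivrMr// ltr_pMr ?divr_gt0// ltr1n.
  by split; apply: le_lt_trans h _; apply: hK.
exists (r / 4) => [|G hG]; first by rewrite divr_gt0.
have r_r0 (v : form) : nrm v <= r -> nrm (v - 0) < r0.
  rewrite subr0 => hv; apply: le_lt_trans hv _; apply: le_lt_trans rr0 _.
  by rewrite ltr_pdivrMr// ltr_pMr// ltr1n.
have hg v w : nrm v <= r -> nrm w <= r -> nrm (g v - g w - (v - w)) <= 1 / 2 * nrm (v - w).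
  by move=> hv hw; apply: hr0; exact: r_r0.
have hy : nrm (G - g 0) < r / 4 by rewrite g0.
have [v vr gv] := @local_onto R C _ g r r_gt0 (@mx_compact R C 1 _ r) hg G hy.
have [KB1 Kx1 Ky1] : [/\ `|KB| <= K, `|Kx| <= K & `|Ky| <= K].
  have := normr_ge0 KB; have := normr_ge0 Kx; have := normr_ge0 Ky; rewrite /K.
  by move: `|KB| `|Kx| `|Ky| => p q t; clear; split; lra.
have [hB1 hB2] := small _ _ _ (hKB v) KB1 vr.
have [hx1 _] := small _ _ _ (hKx v) Kx1 vr.
have [hy1 _] := small _ _ _ (hKy v) Ky1 vr.
have eB : 1%:M + B v - 1%:M = B v by rewrite addrC addKr.
exists (1%:M + B v), (a + x v), (b + y v).
have eC (c z : C) : c + z - c = z by rewrite addrC addKr.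
by rewrite eB !eC; split=> //; apply: hdet; rewrite eB.
Qed.

End FamilyTheory.

(** * Weak properness *)

Lemma finite_stabilizer_form (C : numClosedFieldType) n d (x : @finite_stabilizer C n d) :
  exists F (F0 : F != 0), \val x = \pi_(hypersurfaces C n d) (to_nonzero F0) /\
    class_of F = Some (\pi_(moduli C n d) x).
Proof.
have [G eG] : exists G : @nonzero_forms C n d, \val x = \pi_(hypersurfaces C n d) G.
  by exists (repr (\val x)); rewrite reprK.
have G0 := set_mem (valP G); exists (\val G), G0.
have e : to_nonzero G0 = G by exact: val_inj.
have fs : finite_stabilizer (\pi_(hypersurfaces C n d) (to_nonzero G0)).
  by rewrite e -eG; exact: set_mem (valP x).
rewrite e; split => //; apply/class_ofP; exists G0, fs; congr (\pi _).
by apply: val_inj => /=; rewrite e.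
Qed.

Lemma same_orbitP (C : numClosedFieldType) n d (x y : @finite_stabilizer C n d)
    F G (F0 : F != 0) (G0 : G != 0) :
  \val x = \pi_(hypersurfaces C n d) (to_nonzero F0) ->
  \val y = \pi_(hypersurfaces C n d) (to_nonzero G0) ->
  (same_orbit x y <-> equivalent F G).
Proof.
move=> ex ey; split=> [/asboolP[g eg]|/(act_piP F0 G0)[g eg]].
  by apply/(act_piP F0 G0); exists g; rewrite -ex -ey eg.
by apply/asboolP; exists g; apply: val_inj; rewrite /= ey ex.
Qed.

Section FamilyTheory.
Context {R : realType} {C : complexField R}.
Context {n d e : nat} (fam : weierstrass_family C n d e).
Local Notation S := (fS fam).
Local Notation T := (fT fam).
Local Notation W := (fW fam).
Local Notation disc := (fdisc fam).
Local Notation form := (form C n d).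
Implicit Types (F G : form).

Lemma act_bounded (c : C) (A : 'M[C]_n.+1) : exists2 K : R, 0 < K &
  forall F : form, nrm (c *: substitute A F) <= K * nrm F.
Proof.
have l : linear (fun F : form => c *: substitute A F).
  by move=> k F G; rewrite substitute_linear scalerDr !scalerA mulrC.
have [K hK] := linear_bounded l; exists (`|K| + 1); first by rewrite ltr_wpDl.
move=> F; apply: le_trans (hK F) _; rewrite ler_wpM2r ?nrm_ge0//.
by rewrite ler_wpDr// ler_norm.
Qed.

Lemma local_normal_form_at F p : class_of F = Some p ->
  exists (c0 : C) (A0 : 'M[C]_n.+1) (a0 b0 : C),
  [/\ c0 != 0, A0 \in unitmx, (a0 != 0) || (b0 != 0) &
   forall eps : R, 0 < eps -> exists2 delta : R, 0 < delta &
     forall G, nrm (G - F) < delta -> exists (A : 'M[C]_n.+1) (a b : C),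
     [/\ A \in unitmx, nrm (A - 1%:M) < eps, nrm (a - a0) < eps, nrm (b - b0) < eps &
         G = c0 *: substitute (A *m A0) (W a b)]].
Proof.
move=> /(normal_form fam)[a0 [b0 [ab0 /equivalent_sym[c0 [A0 [c00 uA0 eF]]]]]].
exists c0, A0, a0, b0; split=> // eps eps0.
have [delta delta0 h] := local_normal_form fam a0 b0 eps0.
have [K K0 hK] := act_bounded c0^-1 (invmx A0).
exists (delta / K) => [|G hG]; first by rewrite divr_gt0.
have [|A [a [b [uA hA ha hb eG]]]] := h (c0^-1 *: substitute (invmx A0) G).
  have -> : W a0 b0 = c0^-1 *: substitute (invmx A0) F.
    by rewrite eF substituteZr substituteK// scalerA mulVf// scale1r.
  rewrite -scalerBr.
  have -> : substitute (invmx A0) G - substitute (invmx A0) F = substitute (invmx A0) (G - F).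
    by rewrite substituteD -[in RHS]scaleN1r substituteZr scaleN1r.
  by apply: le_lt_trans (hK _) _; rewrite mulrC -ltr_pdivlMr.
exists A, a, b; split; [exact: uA|exact: hA|exact: ha|exact: hb|].
rewrite -substituteM -eG substituteZr substituteVK// scalerA mulfV// scale1r.
by [].
Qed.

Lemma nonzero_near (a0 b0 : C) : (a0 != 0) || (b0 != 0) ->
  exists2 eps : R, 0 < eps & forall a b : C, nrm (a - a0) < eps -> nrm (b - b0) < eps ->
    (a != 0) || (b != 0).
Proof.
have near0 (z0 : C) : z0 != 0 -> forall z, nrm (z - z0) < nrm z0 -> z != 0.
  by move=> z00 z; apply: contraTneq => ->; rewrite sub0r nrmN ltxx.
case/orP=> h.
  by exists (nrm a0) => [|a b ha hb]; rewrite ?nrm_gt0// (near0 _ h).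
by exists (nrm b0) => [|a b ha hb]; rewrite ?nrm_gt0// (near0 _ h b)// orbT.
Qed.

(** Near [F] the parameters of the normal forms stay away from [(0, 0)]. *)
Lemma finite_stabilizer_open F p : class_of F = Some p -> exists2 delta : R, 0 < delta &
  forall G, nrm (G - F) < delta -> exists q, class_of G = Some q.
Proof.
move=> /local_normal_form_at[c0 [A0 [a0 [b0 [c00 uA0 ab0 h]]]]].
have [eps eps0 heps] := nonzero_near ab0.
have [delta delta0 hd] := h _ eps0; exists delta => // G /hd[A [a [b [uA _ ha hb ->]]]].
have [q hq] := W_class fam (heps _ _ ha hb); exists q.
rewrite -hq; apply/esym/class_of_equivalent; exists c0, (A *m A0).
by rewrite unitmx_mul uA uA0.
Qed.

(** A bound for the inverse of [A] bounds [\det A] from below. *)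
Lemma PGL_exhaustion_of_bounded (A : 'M[C]_n.+1) (uA : A \in unitmx) (r : R) : 0 < r ->
  nrm A <= r -> nrm (invmx A) <= r ->
  PGL_exhaustion ((n.+1)`!%:R * r ^+ n.+1 * r ^+ n.+1)^-1 (\pi_(PGL C n) (toGL uA)).
Proof.
move=> r0 h1 h2; apply/PGL_exhaustionP => /=.
have f0 : (0 : R) < (n.+1)`!%:R by rewrite ltr0n fact_gt0.
have dA : 0 < nrm (\det A) by rewrite nrm_gt0 -unitfE -unitmxE.
have h3 : 1 <= (n.+1)`!%:R * r ^+ n.+1 * nrm (\det A).
  rewrite -[X in X <= _](mulVf (lt0r_neq0 dA)) -nrmV -det_inv ler_wpM2r ?nrm_ge0//.
  apply: le_trans (nrm_det _) _; rewrite ler_wpM2l ?(ltW f0)//.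
  by rewrite lerXn2r ?nnegrE ?nrm_ge0 ?(ltW r0).
rewrite mulrC ler_pdivrMr ?mulr_gt0 ?exprn_gt0//.
apply: (@le_trans _ _ (r ^+ n.+1)); first by rewrite lerXn2r ?nnegrE ?nrm_ge0 ?(ltW r0).
rewrite -[X in X <= _]mul1r [leRHS]mulrA ler_wpM2r ?exprn_ge0 ?(ltW r0)//.
by rewrite [leRHS]mulrC.
Qed.

Lemma nrm_mulmx_le (A B : 'M[C]_n.+1) (r s : R) : nrm A <= r -> nrm B <= s ->
  nrm (A *m B) <= n.+1%:R * (r * s).
Proof.
move=> h1 h2; apply: le_trans (nrm_mulmx _ _) _; rewrite ler_wpM2l ?ler0n//.
by rewrite ler_pM ?nrm_ge0.
Qed.

Lemma near1_bounded (A : 'M[C]_n.+1) : A \in unitmx ->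
  nrm (A - 1%:M) < 1 / (2 * n.+1%:R) -> nrm A <= 2 /\ nrm (invmx A) <= 2.
Proof.
move=> uA hA.
have q1 : 1 <= n.+1%:R :> R by rewrite ler1n.
have hq : n.+1%:R * nrm (A - 1%:M) <= 1 / 2.
  move: (ltW hA) q1; move: (nrm _) (n.+1%:R) => z q; clear => hz q1.
  have q0 : 0 < 2 * q by lra.
  by rewrite ler_pdivlMr// mulrCA in hz; lra.
split; last exact: nrm_invmx_near1.
have := nrmD (A - 1%:M) 1%:M; rewrite subrK.
have n1 := @nrm_scalar1 R C n.+1.
have : nrm (A - 1%:M) <= n.+1%:R * nrm (A - 1%:M) by rewrite ler_peMl ?nrm_ge0.
move: n1 hq; move: (nrm _) (nrm _) (nrm _) (_ * _) => u v w t; clear; lra.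
Qed.

(** The ratio of [a2] and [a1] has norm at most 3, and so has its root [s]. *)
Lemma scale_bound k (a0 a1 a2 s : C) : (0 < k)%N -> a0 != 0 -> a2 = s ^+ k * a1 ->
  nrm (a1 - a0) < nrm a0 / 2 -> nrm (a2 - a0) < nrm a0 / 2 -> nrm s <= 3.
Proof.
move=> k0 a00 ea h1 h2; have p0 : 0 < nrm a0 by rewrite nrm_gt0.
have l1 : nrm a0 / 2 < nrm a1.
  by have := nrmD (a0 - a1) a1; rewrite subrK nrmB_sym; lra.
have l2 : nrm a2 < nrm a0 * (3 / 2).
  by have := nrmD (a2 - a0) a0; rewrite subrK; lra.
rewrite leNgt; apply/negP => s3.
have sk : 3 <= nrm s ^+ k.
  case: k k0 {ea} => // k _; rewrite exprS; apply: le_trans (ltW s3) _.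
  by rewrite ler_peMr ?nrm_ge0// exprn_ege1//; lra.
have : nrm a2 = nrm s ^+ k * nrm a1 by rewrite ea nrmM nrmX.
have : 3 * nrm a1 <= nrm s ^+ k * nrm a1 by rewrite ler_wpM2r ?nrm_ge0.
lra.
Qed.

(** Two forms near [F] in one orbit have normal forms whose parameters are close to one nonzero pair
    and are related by some [s], which is therefore bounded, as is its inverse. The matrix that
    [torus] provides for [s], composed with the two changes of coordinates, joins the forms and
    stays in a compact set. *)
Lemma weakly_proper_everywhere (x : @finite_stabilizer C n d) : weakly_proper x.
Proof.
have [F [F0 [ex cF]]] := finite_stabilizer_form x.
have [c0 [A0 [a0 [b0 [c00 uA0 ab0 h]]]]] := local_normal_form_at cF.
(* For normal forms near W a0 b0, two in one orbit differ by a bounded parameter s of the torus. *)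
have [eps1 eps10 hs] : exists2 eps : R, 0 < eps & forall a1 b1 a2 b2 s : C,
   s != 0 -> a2 = s ^+ 2 * a1 -> b2 = s ^+ 3 * b1 ->
   nrm (a1 - a0) < eps -> nrm (b1 - b0) < eps ->
   nrm (a2 - a0) < eps -> nrm (b2 - b0) < eps -> nrm s <= 3 /\ nrm s^-1 <= 3.
  have inv k (s z w : C) : s != 0 -> w = s ^+ k * z -> z = s^-1 ^+ k * w.
    by move=> s0 ->; rewrite mulrA exprVn mulVf ?mul1r// expf_neq0.
  case/orP: ab0 => z0.
    exists (nrm a0 / 2); first by rewrite divr_gt0// nrm_gt0.
    move=> a1 b1 a2 b2 s s0 ea eb h1 _ h2 _; split.
      exact: (scale_bound _ z0 ea).
    exact: (scale_bound _ z0 (inv _ _ _ _ s0 ea)).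
  exists (nrm b0 / 2); first by rewrite divr_gt0// nrm_gt0.
  move=> a1 b1 a2 b2 s s0 ea eb _ h1 _ h2; split.
    exact: (scale_bound _ z0 eb).
  exact: (scale_bound _ z0 (inv _ _ _ _ s0 eb)).
pose q : R := n.+1%:R.
have q0 : 0 < q by rewrite ltr0n.
pose eps := Num.min eps1 (1 / (2 * q)).
have eps0 : 0 < eps by rewrite lt_min eps10 divr_gt0// mulr_gt0.
have [delta delta0 hd] := h _ eps0.
have [K hK] := torus fam 3.
pose U := [set y : @finite_stabilizer C n d | exists G (G0 : G != 0),
  \val y = \pi_(hypersurfaces C n d) (to_nonzero G0) /\ nrm (G - F) < delta].
pose r0 := `|K| + nrm A0 + nrm (invmx A0) + 2.
pose r : R := q * (q * (q * (q * (r0 * r0) * r0) * r0) * r0).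
have r00 : 0 < r0.
  by rewrite ltr_wpDl//; repeat apply: addr_ge0; rewrite ?nrm_ge0.
have r_gt0 : 0 < r by rewrite !mulr_gt0.
have [rK rA rAi r2] : [/\ K <= r0, nrm A0 <= r0, nrm (invmx A0) <= r0 & 2 <= r0].
  have := ler_norm K; have := normr_ge0 K; have := nrm_ge0 A0.
  have := nrm_ge0 (invmx A0); rewrite /r0.
  by move: (nrm A0) (nrm (invmx A0)) `|K| => u v w; clear; split; lra.
exists U, (PGL_exhaustion ((n.+1)`!%:R * r ^+ n.+1 * r ^+ n.+1)^-1); split.
- apply/(nbhs_fsP _ ex)/nbhs_nrmP; exists delta => // G hG G0 fG.
  by exists G, G0.
- by apply: PGL_exhaustion_compact; rewrite invr_gt0 !mulr_gt0 ?exprn_gt0// ltr0n fact_gt0.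
move=> x1 x2 [G1 [G10 [e1 h1]]] [G2 [G20 [e2 h2]]]; split; last first.
  by move=> [g _ ->]; apply/asboolP; exists g.
move=> /(same_orbitP e1 e2) eG.
have [A1 [a1 [b1 [uA1 hA1 ha1 hb1 eG1]]]] := hd _ h1.
have [A2 [a2 [b2 [uA2 hA2 ha2 hb2 eG2]]]] := hd _ h2.
have uA10 : A1 *m A0 \in unitmx by rewrite unitmx_mul uA1.
have uA20 : A2 *m A0 \in unitmx by rewrite unitmx_mul uA2.
have eW1 : equivalent (W a1 b1) G1 by exists c0, (A1 *m A0).
have eW2 : equivalent (W a2 b2) G2 by exists c0, (A2 *m A0).
have := equivalent_ST fam (equivalent_trans eW1 (equivalent_trans eG (equivalent_sym eW2))).
move=> [s s0]; rewrite !S_W !T_W => -[ea eb].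
have l1 (z : R) : z < eps -> z < eps1.
  by move=> hz; apply: lt_le_trans hz _; rewrite /eps ge_min lexx.
have [s3 si3] := hs _ _ _ _ s s0 ea eb (l1 _ ha1) (l1 _ hb1) (l1 _ ha2) (l1 _ hb2).
have [B [c [c00' uB [hB hBi] _ hBW]]] := hK s s0 s3 si3.
have small (A : 'M[C]_n.+1) : A \in unitmx -> nrm (A - 1%:M) < eps ->
    nrm A <= r0 /\ nrm (invmx A) <= r0.
  move=> uA hA; have [|hA1' hA2'] := near1_bounded uA.
    by apply: lt_le_trans hA _; rewrite /eps ge_min lexx orbT.
  by split; [exact: le_trans hA1' r2|exact: le_trans hA2' r2].
have [b11 b12] := small _ uA1 hA1; have [b21 b22] := small _ uA2 hA2.
have hBr := le_trans hB rK; have hBir := le_trans hBi rK.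
pose M := invmx A0 *m invmx A2 *m invmx B *m A1 *m A0.
have uM : M \in unitmx by rewrite !unitmx_mul !unitmx_inv uA0 uA2 uB uA1.
have eMi : invmx M = invmx A0 *m invmx A1 *m B *m A2 *m A0.
  apply: (can_inj (mulKmx uM)); rewrite mulmxV// /M !mulmxA.
  by rewrite (mulmxK uA0) (mulmxK uA1) (mulmxKV uB) (mulmxKV uA2) mulVmx.
have bnd (X1 X2 X3 : 'M[C]_n.+1) : nrm X1 <= r0 -> nrm X2 <= r0 -> nrm X3 <= r0 ->
    nrm (invmx A0 *m X1 *m X2 *m X3 *m A0) <= r.
  move=> hX1 hX2 hX3; rewrite /r.
  by do 4!(apply: nrm_mulmx_le => //).
exists (\pi_(PGL C n) (toGL uM)).
  apply: PGL_exhaustion_of_bounded => //; [exact: bnd|by rewrite eMi; exact: bnd].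
apply: val_inj; rewrite /= e1 e2 actE; apply/lines_eqP => /=.
exists c^-1; first by rewrite invr_eq0.
rewrite /transform eMi eG2 ea eb -hBW eG1 !substituteZr !scalerA !substituteM !mulmxA.
have -> : c^-1 * (c0 * c) = c0 by rewrite mulrCA mulVf ?mulr1.
have -> : A1 *m A0 *m invmx A0 = A1 by rewrite mulmxK.
have -> : A1 *m invmx A1 *m B = B by rewrite mulmxV ?mul1mx.
reflexivity.
Qed.

End FamilyTheory.

(** * Tangent spaces of the orbits *)

Section Calculus.
Context {R : realType} {C : complexField R}.

Lemma sdiff_comp (U V W : normedModType C) (g : U -> V) (f : V -> W) x l k :
  sdiff g x l -> sdiff f (g x) k -> sdiff (f \o g) x (k \o l).
Proof.
move=> sg sf; case: (sg) => [ll [L hL] hg]; case: (sf) => [lk [K hK] hf].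
have kB v w : k v - k w = k (v - w).
  by have := lk (-1) w v; rewrite !scaleN1r [- w + v]addrC => ->; rewrite addrC.
have [M M0 [d1 d10 hM]] := sdiff_lipschitz sg.
pose K1 := `|K| + 1; have K10 : 0 < K1 by rewrite ltr_wpDl.
have hK1 v : nrm (k v) <= K1 * nrm v.
  by apply: le_trans (hK v) _; rewrite ler_wpM2r ?nrm_ge0// ler_wpDr// ler_norm.
split.
- by move=> a u v; rewrite /= ll lk.
- exists (K1 * L) => v; apply: le_trans (hK1 _) _.
  by rewrite -mulrA ler_wpM2l// ltW.
move=> eps eps0.
have e1 : 0 < eps / 2 / M by rewrite !divr_gt0.
have e2 : 0 < eps / 2 / K1 by rewrite !divr_gt0.
have [d2 d20 h2] := hf _ e1; have [d3 d30 h3] := hg _ e2.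
have [d4 d40 h4] := sdiff_near sg d20.
exists (Num.min d1 (Num.min d3 d4)); first by rewrite !lt_min d10 d30.
move=> v w; rewrite !lt_min => /and3P[v1 v3 v4] /and3P[w1 w3 w4] /=.
have -> : f (g v) - f (g w) - k (l (v - w)) =
    (f (g v) - f (g w) - k (g v - g w)) + k (g v - g w - l (v - w)).
  by rewrite -(kB (g v - g w)) addrA subrK.
apply: le_trans (nrmD _ _) _.
have i1 := h2 _ _ (h4 _ v4) (h4 _ w4).
have i2 := le_trans (hK1 _) (ler_wpM2l (ltW K10) (h3 _ _ v3 w3)).
have i3 : eps / 2 / M * nrm (g v - g w) <= eps / 2 * nrm (v - w).
  apply: le_trans (ler_wpM2l (ltW e1) (hM _ _ v1 w1)) _.
  by rewrite mulrA divfK ?gt_eqF.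
have i4 : K1 * (eps / 2 / K1 * nrm (v - w)) = eps / 2 * nrm (v - w).
  by rewrite mulrA mulrCA divff ?gt_eqF// mulr1.
rewrite i4 in i2; apply: le_trans (lerD (le_trans i1 i3) i2) _.
by rewrite -mulrDl -splitr.
Qed.

(** Differentiability is local; this compares a function on classes with the composition that
    computes it. *)
Lemma differentiable_near (V W : normedModType C) (f g : V -> W) x :
  (\forall y \near x, f y = g y) -> differentiable f x -> differentiable g x.
Proof.
move=> fg df; have gx : f x = g x by exact: nbhs_singleton fg.
have e : g \o shift x = cst (g x) + 'd f x +o_ 0 id.
  have /diff_locallyP[_ /eqaddoP h] := df.
  apply/eqaddoP => eps eps0.
  have [r r0 hr] := (nbhs_nrmP x [set y | f y = g y]).1 fg.
  have fg0 : nbhs (0 : V) [set y | f (y + x) = g (y + x)].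
    by apply/nbhs_nrmP; exists r => // y; rewrite subr0 => hy; apply: hr; rewrite addrK.
  apply: filterS2 (h _ eps0) fg0 => y h1 h2; move: h1.
  rewrite /= -gx; congr (_ <= _); congr `|_|.
  by rewrite -[LHS]/(f (y + x) - _) -[RHS]/(g (y + x) - _) h2.
apply/diff_locallyP; have dg := diff_unique (diff_continuous df) e.
rewrite dg; split; [exact: diff_continuous|exact: e].
Qed.

End Calculus.

Section Lmodule.
Context (K : pzRingType) (V : lmodType K).
Implicit Types (x y z : V).

Lemma pencil_add1 x y z (a b h : K) : x + a *: y + b *: z + h *: y = x + (a + h) *: y + b *: z.
Proof. by rewrite scalerDl addrAC !addrA. Qed.

Lemma pencil_add2 x y z (a b h : K) : x + a *: y + b *: z + h *: z = x + a *: y + (b + h) *: z.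
Proof. by rewrite scalerDl !addrA. Qed.

Lemma pencil_scale x y z (a b k : K) : x + ((k * a) *: y + (k * b) *: z) = k *: (a *: y + b *: z) + x.
Proof. by rewrite scalerDr !scalerA addrC. Qed.

End Lmodule.

Section Ramification.
Context {R : realType} {C : complexField R}.
Context {n d e : nat} (fam : weierstrass_family C n d e).
Local Notation S := (fS fam).
Local Notation T := (fT fam).
Local Notation W := (fW fam).
Local Notation form := (form C n d).
Implicit Types (F G : form).
Local Notation mu := (@mu R C n e).

Lemma sdiff_S F : sdiff S F (fun G => 'D_G S F).
Proof.
have [l hl] := S_sdiff fam F; apply: sdiff_eq (hl) _ _ => // G.
by rewrite (sdiff_diff hl).2.
Qed.

Lemma sdiff_T F : sdiff T F (fun G => 'D_G T F).
Proof.
have [l hl] := T_sdiff fam F; apply: sdiff_eq (hl) _ _ => // G.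
by rewrite (sdiff_diff hl).2.
Qed.

(** Up to a factor, the differential of the absolute invariant [S^3 / T^2]. It vanishes on the
    tangent space of the orbit and is a coordinate on the normal line. *)
Definition nu F G : C := 3 * T F * 'D_G S F - 2 * S F * 'D_G T F.

Lemma nu_linear F : linear (nu F).
Proof.
have [lS _ _] := sdiff_S F; have [lT _ _] := sdiff_T F.
move=> c G H; rewrite /nu lS lT /GRing.scale /=.
move: ('D_G S F) ('D_H S F) ('D_G T F) ('D_H T F) (S F) (T F) => p q r s t u.
by ring.
Qed.

Lemma derive_invariants_act (c : C) (A : 'M[C]_n.+1) F G :
  'D_(c *: substitute A G) S (c *: substitute A F) = mu c A ^+ 2 * 'D_G S F /\
  'D_(c *: substitute A G) T (c *: substitute A F) = mu c A ^+ 3 * 'D_G T F.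
Proof.
pose L (H : form) : form := c *: substitute A H.
have lL : linear L.
  by move=> k H K; rewrite /L substitute_linear scalerDr !scalerA mulrC.
have sL := sdiff_mx F lL.
have s1 := sdiff_comp sL (sdiff_S (L F)); have s2 := sdiff_comp sL (sdiff_T (L F)).
have t1 := sdiffM (sdiff_cst (mu c A ^+ 2) F) (sdiff_S F).
have t2 := sdiffM (sdiff_cst (mu c A ^+ 3) F) (sdiff_T F).
have u1 := sdiff_unique s1 (sdiff_eq t1 (fun H => esym (S_act fam c A H)) (fun=> erefl)) G.
have u2 := sdiff_unique s2 (sdiff_eq t2 (fun H => esym (T_act fam c A H)) (fun=> erefl)) G.
by split; [rewrite [LHS]u1|rewrite [LHS]u2]; rewrite mulr0 addr0.
Qed.

(** The exponent is 5 because [S] and [T] have weights 2 and 3. *)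
Lemma nu_act (c : C) (A : 'M[C]_n.+1) F G :
  nu (c *: substitute A F) (c *: substitute A G) = mu c A ^+ 5 * nu F G.
Proof.
rewrite /nu (derive_invariants_act c A F G).1 (derive_invariants_act c A F G).2 S_act T_act.
by move: ('D_G S F) ('D_G T F) (S F) (T F) (mu c A) => p q s t m; ring.
Qed.

(** By interpolation, the orbit map is a finite sum of functions [ev F (A *m v)] of [A] times fixed
    forms. *)
Lemma sdiff_orbit F : sdiff (fun A => substitute A F) (1%:M : 'M[C]_n.+1)
  (fun B => 'D_B (fun A => substitute A F) (1%:M : 'M[C]_n.+1)) /\
  forall B v, ev ('D_B (fun A => substitute A F) (1%:M : 'M[C]_n.+1)) v = dev F v (B *m v).
Proof.
have [N [P [E hE]]] := interpolation (ev_inj fam).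
have lin v i : linear (fun A : 'M[C]_n.+1 => (A *m v) i (0 : 'I_1)).
  by move=> c A B; rewrite mulmxDl -scalemxAl !mxE.
have sv v : sdiff (fun A : 'M[C]_n.+1 => ev F (A *m v)) 1%:M (fun B => dev F v (B *m v)).
  have := sdiff_ev F (fun i => sdiff_mx (1%:M : 'M[C]_n.+1) (lin v i)).
  by rewrite mul1mx.
have s : sdiffable (fun A => substitute A F) (1%:M : 'M[C]_n.+1).
  eexists; apply: (@sdiff_eq _ _ _ _ (fun A : 'M[C]_n.+1 => \sum_k ev F (A *m P k) *: E k)).
  - by apply: sdiff_sum => k; apply: sdiffZ; exact: sv.
  - by move=> A; rewrite [RHS]hE; apply: eq_bigr => k _; rewrite ev_subst.
  - by [].
have [l hl] := s.
have sl : sdiff (fun A => substitute A F) (1%:M : 'M[C]_n.+1)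
    (fun B => 'D_B (fun A => substitute A F) (1%:M : 'M[C]_n.+1)).
  by apply: sdiff_eq (hl) _ _ => // B; rewrite (sdiff_diff hl).2.
split=> // B v; have h := sdiff_comp sl (sdiff_evF v (substitute 1%:M F)).
have h' := sdiff_eq (sv v) (fun A => esym (ev_subst A F v)) (fun=> erefl).
exact: (sdiff_unique h h' B).
Qed.

Lemma orbit_tangentP F G : orbit_tangent F G <->
  exists (c : C) (B : 'M[C]_n.+1), forall v, ev G v = c * ev F v + dev F v (B *m v).
Proof.
split=> -[c [B h]]; exists c, B.
  by move=> v; rewrite h evD evZ (sdiff_orbit F).2.
by apply: (ev_inj fam) => v; rewrite h evD evZ (sdiff_orbit F).2.
Qed.

Lemma orbit_tangent_lin F (k : C) G H :
  orbit_tangent F G -> orbit_tangent F H -> orbit_tangent F (k *: G + H).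
Proof.
move=> /orbit_tangentP[c [B hB]] /orbit_tangentP[b [D hD]]; apply/orbit_tangentP.
exists (k * c + b), (k *: B + D) => v.
rewrite evD evZ hB hD mulmxDl -scalemxAl devDr devZr.
by move: (ev F v) (dev _ _ _) (dev _ _ _) => p q r; ring.
Qed.

Lemma orbit_tangent_act (c : C) (A : 'M[C]_n.+1) F G : c != 0 -> A \in unitmx ->
  orbit_tangent F G -> orbit_tangent (c *: substitute A F) (c *: substitute A G).
Proof.
move=> c0 uA /orbit_tangentP[k [B h]]; apply/orbit_tangentP.
exists k, (invmx A *m B *m A) => v.
have -> : invmx A *m B *m A *m v = invmx A *m (B *m (A *m v)) by rewrite -!mulmxA.
rewrite [LHS]ev_act [X in _ * X + _]ev_act devZ dev_substitute h (mulKVmx uA).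
by move: (ev F _) (dev _ _ _) => p q; clear; ring.
Qed.

Lemma orbit_tangentZ (c : C) F G : c != 0 ->
  orbit_tangent F G -> orbit_tangent (c *: F) G.
Proof.
move=> c0 /orbit_tangentP[k [B h]]; apply/orbit_tangentP.
exists (c^-1 * k), (c^-1 *: B) => v.
rewrite evZ devZ -scalemxAl devZr h mulrAC -!mulrA mulVKf//.
by rewrite [ev F v * k]mulrC mulKf.
Qed.

(** Along the orbit [S] and [T] are multiplied by the square and the cube of one function, so that
    their derivatives are proportional to [2 S] and [3 T]. *)
Lemma nu_orbit F G : orbit_tangent F G -> nu F G = 0.
Proof.
move=> [c [B ->]]; rewrite [c *: F + _]/(c *: F + _) nu_linear.
set H := 'D_B _ _.
have sD := (sdiff_orbit F).1.
have -> : nu F H = 0.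
  have [dl hd] := sdiffable_det (1%:M : 'M[C]_n.+1).
  have hd2 := sdiffM hd hd; have hd4 := sdiffM hd2 hd2; have hd6 := sdiffM hd4 hd2.
  have tS := sdiff_eq (sdiffM hd4 (sdiff_cst (S F) (1%:M : 'M[C]_n.+1)))
    (g := fun A => S (substitute A F)) _ (fun=> erefl).
  have tT := sdiff_eq (sdiffM hd6 (sdiff_cst (T F) (1%:M : 'M[C]_n.+1)))
    (g := fun A => T (substitute A F)) _ (fun=> erefl).
  have eS : (fun A : 'M[C]_n.+1 => \det A * \det A * (\det A * \det A) * S F) =1
     (fun A => S (substitute A F)).
    by move=> A; rewrite S_sub -!expr2 -exprM.
  have eT : (fun A : 'M[C]_n.+1 =>
      \det A * \det A * (\det A * \det A) * (\det A * \det A) * T F) =1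
      (fun A => T (substitute A F)).
    by move=> A; rewrite T_sub -!expr2 -exprM -exprD.
  have sF := substitute1 F.
  have cS := sdiff_S (substitute 1%:M F); have cT := sdiff_T (substitute 1%:M F).
  have uS := sdiff_unique (sdiff_comp sD cS) (tS eS) B.
  have uT := sdiff_unique (sdiff_comp sD cT) (tT eT) B.
  rewrite /= sF det1 -/H in uS uT.
  rewrite /nu uS uT; move: (dl B) (S F) (T F) => p s t; ring.
have -> : nu F F = 0.
  have hx := sdiff_id (1 : C).
  have [l hl] := sdiffableX e (ex_intro _ _ hx : sdiffable (fun c : C => c) 1).
  have hl2 := sdiffM hl hl; have hl3 := sdiffM hl2 hl.
  have sZ := sdiffZ F hx.
  have tS := sdiff_eq (sdiffM hl2 (sdiff_cst (S F) (1 : C)))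
    (g := fun c : C => S (c *: F)) _ (fun=> erefl).
  have tT := sdiff_eq (sdiffM hl3 (sdiff_cst (T F) (1 : C)))
    (g := fun c : C => T (c *: F)) _ (fun=> erefl).
  have eS : (fun c : C => c ^+ e * c ^+ e * S F) =1 (fun c => S (c *: F)).
    by move=> c'; rewrite SZ expr2.
  have eT : (fun c : C => c ^+ e * c ^+ e * c ^+ e * T F) =1 (fun c => T (c *: F)).
    by move=> c'; rewrite TZ !exprS expr0 mulr1 mulrA.
  have uS := sdiff_unique (sdiff_comp sZ (sdiff_S (1 *: F))) (tS eS) 1.
  have uT := sdiff_unique (sdiff_comp sZ (sdiff_T (1 *: F))) (tT eT) 1.
  rewrite /= !scale1r expr1n in uS uT.
  rewrite /nu uS uT; move: (l 1) (S F) (T F) => p s t; ring.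
by rewrite scaler0 addr0.
Qed.

Lemma derive_invariants_W a b : [/\ 'D_(fW1 fam) S (W a b) = 1, 'D_(fW2 fam) S (W a b) = 0,
  'D_(fW1 fam) T (W a b) = 0 & 'D_(fW2 fam) T (W a b) = 1].
Proof.
have line (G : form) : sdiff (fun h : C => W a b + h *: G) 0 (fun h => h *: G).
  apply: sdiff_eq (sdiffD (sdiff_cst (W a b) 0) (sdiffZ G (sdiff_id (0 : C)))) _ _ => //.
  by move=> h; rewrite add0r.
have e1 h : W a b + h *: fW1 fam = W (a + h) b.
  exact: pencil_add1.
have e2 h : W a b + h *: fW2 fam = W a (b + h).
  exact: pencil_add2.
have chain (f : form -> C) (df : form -> form -> C) (G : form) (g : C -> C) (lg : C -> C) :
    (forall F, sdiff f F (df F)) -> sdiff g 0 lg -> (forall h, g h = f (W a b + h *: G)) ->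
    df (W a b) G = lg 1.
  move=> sf sg eg.
  have := sdiff_unique (sdiff_comp (line G) (sf _)) (sdiff_eq sg eg (fun=> erefl)) 1.
  by rewrite /= scale0r addr0 scale1r.
have sD (c : C) : sdiff (fun h : C => c + h) 0 (fun h => 0 + h).
  exact: sdiffD (sdiff_cst c 0) (sdiff_id _).
split.
- rewrite (chain _ _ _ _ _ sdiff_S (sD a)) ?add0r// => h.
  by rewrite e1 S_W.
- rewrite (chain _ _ _ _ _ sdiff_S (sdiff_cst a 0))// => h.
  by rewrite e2 S_W.
- rewrite (chain _ _ _ _ _ sdiff_T (sdiff_cst b 0))// => h.
  by rewrite e1 T_W.
- rewrite (chain _ _ _ _ _ sdiff_T (sD b)) ?add0r// => h.
  by rewrite e2 T_W.
Qed.

Lemma nu_W1 a b : nu (W a b) (fW1 fam) = 3 * b.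
Proof. by have [h1 h2 h3 h4] := derive_invariants_W a b; rewrite /nu h1 h3 S_W T_W mulr1 mulr0 subr0. Qed.

Lemma nu_W2 a b : nu (W a b) (fW2 fam) = - (2 * a).
Proof. by have [h1 h2 h3 h4] := derive_invariants_W a b; rewrite /nu h2 h4 S_W T_W mulr1 mulr0 sub0r. Qed.

(** Among the parameter directions, [nu] vanishes on the multiples of [(2 a, 3 b)] only, and this
    direction is tangent to the orbit by [W_euler]. *)
Lemma nu_W_kernel (a b : C) G : (a != 0) || (b != 0) -> nu (W a b) G = 0 ->
  orbit_tangent (W a b) G.
Proof.
move=> ab nG; have [B [x [y h]]] := W_span fam a b G.
pose H : form := 'D_B (fun A => substitute A (W a b)) (1%:M : 'M[C]_n.+1).
have oH : orbit_tangent (W a b) H by exists 0, B; rewrite scale0r add0r.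
have eG : G = H + (x *: fW1 fam + y *: fW2 fam).
  by apply: (ev_inj fam) => v; rewrite h !evD !evZ (sdiff_orbit _).2 addrA.
have exy : x * (3 * b) = y * (2 * a).
  move: nG; rewrite eG -[H]scale1r nu_linear (nu_orbit oH) scaler0 add0r.
  rewrite -[y *: _]addr0 nu_linear nu_linear nu_W1 nu_W2.
  have -> : nu (W a b) 0 = 0.
    by have := nu_linear (W a b) (-1) 0 0; rewrite scaler0 addr0 scaleN1r addNr.
  by rewrite addr0 /GRing.scale /= mulrN => /eqP; rewrite subr_eq0 => /eqP.
have [k ek] : exists k : C, x = k * (2 * a) /\ y = k * (3 * b).
  have n2 : (2 : C) != 0 by rewrite pnatr_eq0.
  have n3 : (3 : C) != 0 by rewrite pnatr_eq0.
  case/orP: ab => z0.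
    exists (x / (2 * a)); rewrite divfK ?mulf_neq0//; split=> //.
    by rewrite mulrAC exy mulfK// mulf_neq0.
  exists (y / (3 * b)); rewrite divfK ?mulf_neq0//; split=> //.
  by rewrite mulrAC -exy mulfK// mulf_neq0.
have oE : orbit_tangent (W a b) ((2 * a) *: fW1 fam + (3 * b) *: fW2 fam).
  have [c [D hD]] := W_euler fam a b; apply/orbit_tangentP; exists c, D => v.
  by rewrite evD !evZ hD.
rewrite eG ek.1 ek.2 pencil_scale.
exact: (orbit_tangent_lin k oE oH).
Qed.

Lemma orbit_tangentE F p G : class_of F = Some p -> nu F G = 0 -> orbit_tangent F G.
Proof.
move=> /(normal_form fam)[a [b [ab /equivalent_sym[c [A [c0 uA eF]]]]]] nG.
pose H : form := c^-1 *: substitute (invmx A) G.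
have eG : G = c *: substitute A H.
  by rewrite /H substituteZr substituteVK// scalerA mulfV// scale1r.
rewrite eF eG; apply: (orbit_tangent_act c0 uA); apply: (nu_W_kernel ab).
move: nG; rewrite eF eG nu_act => /eqP; rewrite mulf_eq0 expf_eq0 /=.
by rewrite (negPf (mu_neq0 (e := e) c0 uA)) /= => /eqP.
Qed.

Lemma nu_nonzero F p : class_of F = Some p -> exists G, nu F G != 0.
Proof.
move=> /(normal_form fam)[a [b [ab /equivalent_sym[c [A [c0 uA eF]]]]]].
have h G : nu (W a b) G != 0 -> exists G, nu F G != 0.
  move=> hG; exists (c *: substitute A G); rewrite eF nu_act mulf_neq0//.
  by rewrite expf_neq0// mu_neq0.
case/orP: ab => z0.
  by apply: (h (fW2 fam)); rewrite nu_W2 oppr_eq0 mulf_neq0// pnatr_eq0.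
by apply: (h (fW1 fam)); rewrite nu_W1 mulf_neq0// pnatr_eq0.
Qed.

End Ramification.

(** * Improper points, ramification and isomorphisms *)

Lemma substitute_conj (K : numClosedFieldType) n d (c0 c : K) (A0 A : 'M[K]_n.+1)
    (F : form K n d) : A0 \in unitmx -> substitute A F = c *: F ->
  substitute (invmx A0 *m A *m A0) (c0 *: substitute A0 F) = c *: (c0 *: substitute A0 F).
Proof.
move=> uA0 sA; rewrite substituteZr substituteM -mulmxA mulKVmx// -substituteM sA.
by rewrite substituteZr !scalerA mulrC.
Qed.

Lemma scaler_solve (K : fieldType) (V : lmodType K) (c : K) (x y : V) : c != 0 ->
  c *: x = y -> x = c^-1 *: y.
Proof. by move=> c0 <-; rewrite scalerA mulVf// scale1r. Qed.

Section Classes.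
Context {R : realType} {C : complexField R}.
Context {n d e : nat} (fam : weierstrass_family C n d e).
Local Notation S := (fS fam).
Local Notation T := (fT fam).
Local Notation W := (fW fam).
Local Notation disc := (fdisc fam).
Local Notation form := (form C n d).
Implicit Types (F G : form).

Lemma disc_equivalent F G : equivalent F G -> disc F = 0 -> disc G = 0.
Proof.
move=> /(equivalent_ST fam)[s s0 [eS eT]]; rewrite /fdisc eS eT => h.
by rewrite -[RHS](mulr0 (s ^+ 6)) -[X in _ = _ * X]h; ring.
Qed.

(** Away from the origin the curve [4 S^3 + 27 T^2 = 0] is a single orbit of the torus, parametrized
    by [T / S]. *)
Lemma disc0_equivalent F G p q : class_of F = Some p -> class_of G = Some q ->
  disc F = 0 -> disc G = 0 -> equivalent F G.
Proof.
move=> /(class_ofE fam)[F0 eF] /(class_ofE fam)[G0 eG].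
move=> dF dG; apply: (equivalent_trans eF); apply: equivalent_trans (equivalent_sym eG).
have [n4 n27] : (4 : C) != 0 /\ (27 : C) != 0 by rewrite !pnatr_eq0.
have nz H : (S H != 0) || (T H != 0) -> disc H = 0 ->
    [/\ S H != 0, T H != 0 & T H ^+ 2 = - 4 / 27 * S H ^+ 3].
  rewrite /fdisc => H0 h.
  have hh (u v : C) : 4 * u + 27 * v = 0 -> v = - 4 / 27 * u.
    move=> huv; have e27 : 27 * v = - (4 * u) by apply/eqP; rewrite -addr_eq0 addrC huv.
    by rewrite -[LHS](mulKf n27) e27; ring.
  have e2 : T H ^+ 2 = - 4 / 27 * S H ^+ 3 by exact: hh.
  suff SH : S H != 0.
    split=> //; rewrite -sqrf_eq0 e2 mulf_neq0 ?expf_neq0//.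
  apply: contraTneq H0 => SH; rewrite SH eqxx /= negbK -sqrf_eq0 e2 SH.
  by rewrite expr0n mulr0.
have [[SF TF eTF] [SG TG eTG]] := (nz _ F0 dF, nz _ G0 dG).
clear nz dF dG eF eG F0 G0.
have k0 : (- 4 / 27 : C) != 0 by rewrite mulf_neq0 ?invr_eq0 ?oppr_eq0.
move: (S F) (T F) (S G) (T G) SF TF eTF SG TG eTG => a b c t a0 b0 eb c0 t0 et.
move: (- 4 / 27) k0 eb et => k k0 eb et.
pose s : C := t * a / (c * b).
have s0 : s != 0 by rewrite /s !mulf_neq0 ?invr_eq0 ?mulf_neq0.
have e2 : s ^+ 2 * a = c.
  have -> : s ^+ 2 * a = t ^+ 2 * a ^+ 3 / (c ^+ 2 * b ^+ 2).
    by rewrite /s; field; rewrite c0 b0.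
  by rewrite eb et; field; rewrite k0 a0 c0.
have e3 : s ^+ 3 * b = t.
  have -> : s ^+ 3 * b = t * t ^+ 2 * a ^+ 3 / (c ^+ 3 * b ^+ 2).
    by rewrite /s; field; rewrite c0 b0.
  by rewrite eb et; field; rewrite k0 a0 c0.
rewrite -e2 -e3; exact: torus_equivalent.
Qed.

(** Where the discriminant vanishes, [F] is equivalent to the form in [unstable], near which some
    forms have symmetries outside any given compact set. Elsewhere [stable] puts all [g] for which
    [g U] meets [U] into one compact set. *)
Lemma locally_properP (x : @finite_stabilizer C n d) F (F0 : F != 0) :
  \val x = \pi_(hypersurfaces C n d) (to_nonzero F0) ->
  class_of F = Some (\pi_(moduli C n d) x) -> locally_proper x <-> disc F != 0.
Proof.
move=> ex cF; split=> [[U nU cU]|dF].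
  apply/negP => /eqP dF; have [eta eta0 hS] := compact_sub_PGL_exhaustion cU.
  have [Fu [pu [cFu dFu hFu]]] := unstable fam.
  have [c0 [A0 [c00 uA0 eF]]] := disc0_equivalent cFu cF dFu dF.
  have [r r0 hr] := (nbhs_nrmP _ _).1 ((nbhs_fsP _ ex).1 nU).
  have [r1 r10 hr1] := finite_stabilizer_open fam cF.
  have [K K0 hK] := act_bounded c0 A0 (d := d).
  pose k : R := n.+1%:R * (n.+1%:R * (nrm A0 + nrm (invmx A0) + 1) ^+ 2).
  have k0 : 0 < k.
    by rewrite /k !mulr_gt0 ?ltr0n ?exprn_gt0// ltr_wpDl// addr_ge0 ?nrm_ge0.
  have d0 : 0 < Num.min r r1 / K by rewrite divr_gt0// lt_min r0.
  have e0 : 0 < eta / k ^+ n.+1 by rewrite divr_gt0// exprn_gt0.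
  have [F1 [A [c [hF1 uA sA dA]]]] := hFu _ _ d0 e0.
  pose G := c0 *: substitute A0 F1.
  have hG : nrm (G - F) < Num.min r r1.
    have -> : G - F = c0 *: substitute A0 (F1 - Fu).
      rewrite eF /G -scalerBr substituteD; congr (_ *: (_ + _)).
      by rewrite -[in RHS]scaleN1r substituteZr scaleN1r.
    by apply: le_lt_trans (hK _) _; rewrite mulrC -ltr_pdivlMr.
  have [hG1 hG2] : nrm (G - F) < r /\ nrm (G - F) < r1.
    by move: hG; rewrite lt_min => /andP[].
  have [q cG] := hr1 _ hG2; have [G0 [fG _]] := (class_ofP _ _).1 cG.
  pose N := invmx A0 *m A *m A0.
  have uN : N \in unitmx by rewrite !unitmx_mul unitmx_inv uA0 uA.
  have sN : substitute N G = c *: G.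
    exact: substitute_conj.
  have : PGL_exhaustion eta (\pi_(PGL C n) (toGL uN)).
    apply: hS; exists (to_fs fG); split; last exact: hr.
    exists (to_fs fG); first exact: hr.
    by apply: val_inj => /=; apply/(stabilizerP G0); exists c.
  move=> /PGL_exhaustionP /= hN.
  have eA : A = A0 *m N *m invmx A0.
    by rewrite /N !mulmxA mulmxV// mul1mx mulmxK.
  have nA : nrm A <= k * nrm N.
    rewrite {1}eA; apply: le_trans (nrm_mulmx_le (nrm_mulmx_le (lexx _) (lexx _)) (lexx _)) _.
    have := nrm_ge0 A0; have := nrm_ge0 (invmx A0); have := nrm_ge0 N.
    have : (0 : R) <= n.+1%:R by rewrite ler0n.
    rewrite /k; move: (nrm A0) (nrm N) (nrm (invmx A0)) (n.+1%:R) => u v w t; clear.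
    move=> t0 v0 w0 u0.
    have h : u * w <= (u + w + 1) ^+ 2.
      rewrite -subr_ge0.
      have -> : (u + w + 1) ^+ 2 - u * w = u * u + u * w + w * w + u + u + w + w + 1 by ring.
      by repeat apply: addr_ge0 => //; exact: mulr_ge0.
    have -> : t * (t * (u * v) * w) = u * w * (t * t * v) by ring.
    have -> : t * (t * (u + w + 1) ^+ 2) * v = (u + w + 1) ^+ 2 * (t * t * v) by ring.
    by rewrite ler_wpM2r// !mulr_ge0.
  have dN : \det N = \det A.
    by rewrite /N !det_mulmx det_inv mulrAC mulVf ?mul1r// -unitfE -unitmxE.
  move: hN; rewrite dN => hN; have := le_lt_trans hN dA.
  rewrite mulrAC ltr_pdivlMr ?exprn_gt0// -mulrA -exprMn ltr_pM2l//.
  rewrite ltNge => /negP; apply.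
  rewrite [nrm N * k]mulrC; apply: lerXn2r => //; rewrite nnegrE ?nrm_ge0//.
  by rewrite mulr_ge0 ?nrm_ge0// ltW.
have [delta delta0 [eta eta0 h]] := stable dF.
exists [set y : @finite_stabilizer C n d | exists G (G0 : G != 0),
  \val y = \pi_(hypersurfaces C n d) (to_nonzero G0) /\ nrm (G - F) < delta].
  apply/(nbhs_fsP _ ex)/nbhs_nrmP; exists delta => // G hG G0 fG.
  by exists G, G0.
apply: (subclosed_compact (@closed_closure _ _) (PGL_exhaustion_compact eta0)).
rewrite [X in _ `<=` X]((closure_id _).1 (@PGL_exhaustion_closed _ _ _ eta)).
apply: closureS => g [y [[x1 [G1 [G10 [e1 h1]]] ey] [G2 [G20 [e2 h2]]]]].
elim/pgl_ind: g ey => M ey; apply/PGL_exhaustionP.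
move: e2; rewrite -ey /= e1 actE => /lines_eqP[c c0 /= e2].
apply: (h G2 G1 (\val M) c^-1 h2 h1 (GL_unit M)); first by rewrite invr_eq0.
by rewrite e2 /transform substituteZr substituteVK ?GL_unit// scalerA mulVf// scale1r.
Qed.

End Classes.

Section RamificationIndex.
Context {R : realType} {C : complexField R}.
Context {n d e : nat} (fam : weierstrass_family C n d e).
Local Notation S := (fS fam).
Local Notation T := (fT fam).
Local Notation W := (fW fam).
Local Notation form := (form C n d).
Local Notation mu := (@mu R C n e).
Implicit Types (F G : form) (g h : PGL C n).

(** The action of [g] on the invariants, for [g] in the stabilizer. Since [M] takes [F] to [c F],
    its inverse appears with [c^-1]; the value is independent of the representative
    ([normal_character_uniq]). *)
Definition normal_character F g (z : C) :=
  exists (M : GL C n) (c : C), [/\ g = \pi_(PGL C n) M, c != 0,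
    transform (\val M) F = c *: F & z = mu c^-1 (invmx (\val M))].

Lemma muM (c c' : C) (A B : 'M[C]_n.+1) : mu (c * c') (A *m B) = mu c A * mu c' B.
Proof. by rewrite /mu exprMn det_mulmx exprMn mulrACA. Qed.

(** This is where [de_eq] enters. *)
Lemma mu_scale (k : C) : k != 0 -> mu (k ^- d) k%:M = 1.
Proof.
move=> k0; rewrite /mu det_scalar -exprVn -!exprM (de_eq fam) [in LHS]mulnC.
by rewrite -exprMn mulVf// expr1n.
Qed.

Lemma normal_character_uniq F g z z' : F != 0 ->
  normal_character F g z -> normal_character F g z' -> z = z'.
Proof.
move=> F0 [M [c [-> c0 hM ->]]] [N [b [/lines_eqP[k k0 eN] b0 hN ->]]].
have eNi : invmx (\val N) = invmx (\val M) *m (k^-1)%:M.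
  by rewrite eN invmxZ ?unitmxZ ?unitfE ?GL_unit// mul_mx_scalar.
have eb : b^-1 = c^-1 * k^-1 ^- d.
  have : b *: F = (k^-1 ^+ d * c) *: F.
    rewrite -hN -[in RHS]scalerA -hM /transform eNi -substituteM substitute_scalar.
    by [].
  move=> /eqP; rewrite -subr_eq0 -scalerBl scaler_eq0 (negPf F0) orbF subr_eq0 => /eqP->.
  by rewrite invfM mulrC.
by rewrite eNi eb muM mu_scale ?mulr1// invr_eq0.
Qed.

Lemma invmxM (A B : 'M[C]_n.+1) : A \in unitmx -> B \in unitmx ->
  invmx (A *m B) = invmx B *m invmx A.
Proof. by move=> uA uB; exact: (@invrM 'M[C]_n.+1). Qed.

Lemma normal_characterM F g h z w : normal_character F g z -> normal_character F h w ->
  normal_character F (g * h)%g (z * w).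
Proof.
move=> [M [c [-> c0 hM ->]]] [N [b [-> b0 hN ->]]].
exists (toGL (GL_mul_unit M N)), (c * b); split.
- exact: pgl_mulE.
- exact: mulf_neq0.
- by rewrite /= transformM hN transformZr hM scalerA mulrC.
by rewrite mulrC -muM -invfM (mulrC b) /= invmxM ?GL_unit.
Qed.

Lemma normal_characterV F g z : normal_character F g z -> normal_character F g^-1%g z^-1.
Proof.
move=> [M [c [-> c0 hM ->]]]; exists (toGL (GL_inv_unit M)), c^-1; split.
- exact: pgl_invE.
- by rewrite invr_eq0.
- have := transform1 F; rewrite -{1}(mulVmx (GL_unit M)).
  rewrite -[invmx _]/(\val (toGL (GL_inv_unit M))) transformM hM transformZr => {2}<-.
  by rewrite scalerA mulVf// scale1r.
by rewrite /mu /= invmxK det_inv !exprVn !invfM !invrK.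
Qed.

Lemma normal_character_stab (x : @hypersurfaces C n d) F (F0 : F != 0) g :
  x = \pi_(hypersurfaces C n d) (to_nonzero F0) ->
  stabilizer x g <-> exists z, normal_character F g z.
Proof.
move=> ->; elim/pgl_ind: g => M; rewrite /stabilizer /= actE; split.
  move=> /lines_eqP[c c0 /= ec]; eexists; exists M, c^-1; split=> //.
    by rewrite invr_eq0.
  by rewrite [in RHS]ec scalerA mulVf// scale1r.
move=> [_ [N [c [eg c0 ec _]]]]; rewrite -(actE M (to_nonzero F0)) eg actE; apply/lines_eqP; exists c^-1.
  by rewrite invr_eq0.
by rewrite /= ec scalerA mulVf// scale1r.
Qed.

Lemma normal_character_eq F g z : normal_character F g z ->
  z ^+ 2 * S F = S F /\ z ^+ 3 * T F = T F.
Proof.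
move=> [M [c [_ c0 hM ->]]].
have eL : F = c^-1 *: substitute (invmx (\val M)) F.
  by rewrite -[substitute _ _]/(transform _ F) hM scalerA mulVf// scale1r.
by split; [rewrite -S_act -eL|rewrite -T_act -eL].
Qed.

(** An element with character [z] acts on the normal line to the orbit by [z^5]. It also fixes [S]
    and [T], so that [z^2 = 1] or [z^3 = 1]; together with [z^5 = 1] this gives [z = 1]. *)
Lemma normal_kernelP (x : @hypersurfaces C n d) F p (F0 : F != 0) g :
  x = \pi_(hypersurfaces C n d) (to_nonzero F0) -> class_of F = Some p ->
  normal_kernel x g <-> normal_character F g 1.
Proof.
move=> ex cF; split.
  move=> [M [F' [c [eg eF c0 hM hT]]]].
  have [k k0 eF'] : exists2 k : C, k != 0 & \val F' = k *: F.
    by apply/(lines_eqP (to_nonzero F0) F'); rewrite -ex -eF.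
  have hM1 : transform (\val M) F = c *: F.
    move: hM; rewrite eF' transformZr => h.
    by apply: (scalerI k0); rewrite h !scalerA mulrC.
  have ch : normal_character F g (mu c^-1 (invmx (\val M))) by exists M, c.
  move: (ch); suff -> : mu c^-1 (invmx (\val M)) = 1 by [].
  have [e2 e3] := normal_character_eq ch.
  have [G nG] := nu_nonzero fam cF.
  have e5 : mu c^-1 (invmx (\val M)) ^+ 5 = 1.
    have h : orbit_tangent F (c^-1 *: transform (\val M) G - G).
      have -> : F = k^-1 *: \val F' by rewrite eF' scalerA mulVf// scale1r.
      by apply: (orbit_tangentZ fam); rewrite ?invr_eq0.
    have := nu_orbit fam h; rewrite addrC -scaleN1r nu_linear.
    rewrite [GRing.scale _ _]mulN1r.
    have eL : F = c^-1 *: transform (\val M) F by rewrite hM1 scalerA mulVf// scale1r.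
    rewrite {2}eL /transform nu_act => /eqP; rewrite addrC subr_eq0 => /eqP h5.
    by apply: (mulIf nG); rewrite h5 mul1r.
  have [st _] := class_ofE fam cF; move: (mu _ _) e2 e3 e5 => m e2 e3 e5.
  have m0 : m != 0 by apply: contra_eq_neq e5 => ->; rewrite expr0n /= eq_sym oner_eq0.
  case/orP: st => z0.
    have m2 : m ^+ 2 = 1 by apply: (mulIf z0); rewrite e2 mul1r.
    by rewrite -e5 (exprD m 2 3) (exprD m 2 1) m2 !mul1r.
  have m3 : m ^+ 3 = 1 by apply: (mulIf z0); rewrite e3 mul1r.
  have m2 : m ^+ 2 = 1 by rewrite -e5 (exprD m 3 2) m3 mul1r.
  by rewrite -m3 (exprD m 2 1) m2 mul1r.
move=> [M [c [eg c0 hM e1]]]; exists M, (to_nonzero F0), c; split=> // G.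
change (orbit_tangent F (c^-1 *: transform (\val M) G - G)).
apply: (orbit_tangentE (fam := fam) cF); rewrite addrC -scaleN1r nu_linear [GRing.scale _ _]mulN1r.
have eL : F = c^-1 *: transform (\val M) F by rewrite hM scalerA mulVf// scale1r.
by rewrite {2}eL /transform nu_act -e1 expr1n mul1r addNr.
Qed.

(** Cosets of the kernel of the character correspond to its values, here listed by [z]. *)
Lemma ramification_index_eq (x : @finite_stabilizer C n d) F p (F0 : F != 0) k (z : nat -> C) :
  \val x = \pi_(hypersurfaces C n d) (to_nonzero F0) -> class_of F = Some p ->
  (forall g w, normal_character F g w -> exists2 i, (i < k)%N & w = z i) ->
  (forall i, (i < k)%N -> exists g, normal_character F g (z i)) ->
  (forall i j, (i < k)%N -> (j < k)%N -> z i = z j -> i = j) ->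
  has_ramification_index k x.
Proof.
move=> ex cF hz hg zi; rewrite /has_ramification_index.
have /choice[h hh] : forall i, exists g, (i < k)%N -> normal_character F g (z i).
  move=> i; case: (ltnP i k) => [/hg[g ?]|ik]; first by exists g.
  by exists 1%g.
set K := normal_kernel _.
have KP g : K g <-> normal_character F g 1 by exact: (normal_kernelP _ ex cF).
have cosE g g' w : normal_character F g w -> normal_character F g' w ->
    left_coset K g = left_coset K g'.
  have sub a b : normal_character F a w -> normal_character F b w ->
      left_coset K a `<=` left_coset K b.
    move=> ha hb _ [u Ku <-]; exists (b^-1 * (a * u))%g; last by rewrite mulgA mulgV mul1g.
    apply/KP; move/KP: Ku => Ku.
    have := normal_characterM (normal_characterV hb) (normal_characterM ha Ku).
    rewrite mulr1 mulVf//.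
    by have [M [c [_ c0 _ ->]]] := ha; rewrite mu_neq0 ?invr_eq0 ?GL_inv_unit.
  by move=> ha hb; apply/seteqP; split; exact: sub.
have -> : left_coset K @` stabilizer (\val x) = (fun i => left_coset K (h i)) @` `I_k.
  apply/seteqP; split=> [_ [g sg <-]|_ [i ik <-]].
    have [w hw] := (normal_character_stab _ ex).1 sg; have [i ik ew] := hz _ _ hw.
    by exists i => //; apply: (cosE _ _ (z i)); [exact: hh|rewrite -ew].
  exists (h i) => //; apply/(normal_character_stab _ ex); exists (z i); exact: hh.
apply: inj_card_eq => i j /set_mem /= ik /set_mem /= jk ec; apply: zi => //.
have hi := hh _ ik; have hj := hh _ jk.
have : left_coset K (h j) (h i).
  rewrite -ec; exists 1%g; last by rewrite mulg1.
  apply/KP; have := normal_characterM (normal_characterV hi) hi; rewrite mulVg mulVf//.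
  by have [M [c [_ c0 _ ->]]] := hi; rewrite mu_neq0 ?invr_eq0 ?GL_inv_unit.
move=> [u /KP hu eu]; have := normal_characterM hj hu.
by rewrite eu mulr1; exact: normal_character_uniq.
Qed.

(** The matrix that [torus] provides for [s] fixes the normal form of [F]. *)
Lemma normal_character_ex F p (s : C) : class_of F = Some p -> s != 0 ->
  s ^+ 2 * S F = S F -> s ^+ 3 * T F = T F -> exists g, normal_character F g s.
Proof.
move=> cF s0 eS eT; have [_ /equivalent_sym[c0 [A0 [c00 uA0 eF]]]] := class_ofE fam cF.
have [K hK] := torus fam (Num.max (nrm s) (nrm s^-1)).
have [||A [c [cn0 uA _ es h]]] := hK s s0.
- by rewrite le_max lexx.
- by rewrite le_max lexx orbT.
move: (h (S F) (T F)); rewrite {}eS {}eT => {}h.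
pose N := invmx A0 *m A *m A0.
have uN : N \in unitmx by rewrite !unitmx_mul unitmx_inv uA0 uA.
have uM : invmx N \in unitmx by rewrite unitmx_inv.
rewrite -es; exists (\pi_(PGL C n) (toGL uM)), (toGL uM), c^-1; split=> //=.
- by rewrite invr_eq0.
- rewrite /transform invmxK [in LHS]eF [in RHS]eF; apply: substitute_conj => //.
  exact: scaler_solve h.
rewrite !invrK invmxK /mu /N !det_mulmx det_inv mulrAC mulVf ?mul1r//.
by rewrite -unitfE -unitmxE.
Qed.

(** The values of the character are the [z] with [z^2 S = S] and [z^3 T = T]: all square roots of 1
    if [T = 0], all cube roots of 1 if [S = 0], and only 1 otherwise. *)
Lemma ramification_index (x : @finite_stabilizer C n d) F p (F0 : F != 0) :
  \val x = \pi_(hypersurfaces C n d) (to_nonzero F0) -> class_of F = Some p ->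
  [/\ S F != 0 -> T F != 0 -> has_ramification_index 1 x,
      T F = 0 -> has_ramification_index 2 x &
      S F = 0 -> has_ramification_index 3 x].
Proof.
move=> ex cF; have [st _] := class_ofE fam cF.
have sq (z : C) : z ^+ 2 * S F = S F -> S F != 0 -> z ^+ 2 = 1.
  by move=> h h0; apply: (mulIf h0); rewrite h mul1r.
have cu (z : C) : z ^+ 3 * T F = T F -> T F != 0 -> z ^+ 3 = 1.
  by move=> h h0; apply: (mulIf h0); rewrite h mul1r.
split.
- move=> S0 T0; apply: (ramification_index_eq (z := fun=> 1) ex cF).
  + move=> g w /normal_character_eq[/sq/(_ S0) h2 /cu/(_ T0) h3]; exists 0%N => //.
    by rewrite -h3 (exprD w 2 1) h2 mul1r.
  + by move=> i _; apply: normal_character_ex cF _ _ _; rewrite ?expr1n ?mul1r ?oner_eq0.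
  + by move=> [|i] [|j].
- move=> T0; move: st; rewrite T0 eqxx orbF => S0.
  apply: (ramification_index_eq (z := fun i => (-1) ^+ i) ex cF).
  + move=> g w /normal_character_eq[/sq/(_ S0) h2 _].
    have : (w - 1) * (w + 1) == 0.
      have -> : (w - 1) * (w + 1) = w ^+ 2 - 1 by ring.
      by rewrite h2 subrr.
    rewrite mulf_eq0 subr_eq0 addr_eq0.
    by case/orP=> /eqP->; [exists 0%N|exists 1%N].
  + move=> i _; apply: normal_character_ex cF _ _ _; rewrite ?T0 ?mulr0//.
      by rewrite signr_eq0.
    by rewrite sqrr_sign mul1r.
  + have h : (-1 : C) != 1 by rewrite eq_sym -addr_eq0 -[1 + 1]/(2%:R) pnatr_eq0.
    by move=> [|[|i]] [|[|j]] // _ _ /eqP; rewrite expr0 expr1 ?(negPf h)// eq_sym (negPf h).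
move=> S0; move: st; rewrite S0 eqxx /= => T0.
have [w w1 w3] : exists2 w : C, w != 1 & w ^+ 3 = 1.
  have s3 := sqrtCK (- 3 : C); exists ((sqrtC (- 3) - 1) / 2).
    apply/eqP => /(congr1 (fun x => x * 2)); rewrite divfK ?pnatr_eq0// mul1r.
    move=> /eqP; rewrite subr_eq => /eqP h3; move: s3; rewrite h3 => /eqP.
    have -> : (2 + 1 : C) ^+ 2 = 9 by ring.
    by rewrite -addr_eq0 -natrD pnatr_eq0.
  have : (sqrtC (- 3) - 1) ^+ 3 = 8 :> C.
    have -> : (sqrtC (- 3) - 1) ^+ 3 = sqrtC (- 3) ^+ 2 * sqrtC (- 3) -
       3 * sqrtC (- 3) ^+ 2 + 3 * sqrtC (- 3) - 1 :> C by ring.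
    by rewrite s3; ring.
  move=> h8; rewrite expr_div_n h8 -natrX divff// pnatr_eq0.
have e3 : 1 + w + w ^+ 2 = 0.
  have : (w - 1) * (1 + w + w ^+ 2) = 0.
    have -> : (w - 1) * (1 + w + w ^+ 2) = w ^+ 3 - 1 by ring.
    by rewrite w3 subrr.
  by move/eqP; rewrite mulf_eq0 subr_eq0 (negPf w1) /= => /eqP.
have w0 : w != 0 by apply: contra_eq_neq w3 => ->; rewrite expr0n eq_sym oner_eq0.
have w2 : w ^+ 2 != 1.
  by apply: contraNneq w1 => h; rewrite -w3 (exprD w 2 1) h mul1r.
apply: (ramification_index_eq (z := fun i => w ^+ i) ex cF).
- move=> g z /normal_character_eq[_ /cu/(_ T0) h3].
  have : (z - 1) * ((z - w) * (z - w ^+ 2)) = 0.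
    have -> : (z - 1) * ((z - w) * (z - w ^+ 2)) =
      z ^+ 3 - w ^+ 3 - (1 + w + w ^+ 2) * (z ^+ 2 - w * z) by ring.
    by rewrite e3 h3 w3 mul0r !subrr.
  move/eqP; rewrite !mulf_eq0 !subr_eq0.
  by case/or3P=> /eqP->; [exists 0%N|exists 1%N|exists 2].
- move=> i _; apply: normal_character_ex cF _ _ _; rewrite ?S0 ?mulr0 ?expf_neq0//.
  by rewrite -exprM mulnC exprM w3 expr1n mul1r.
have w12 : w != w ^+ 2 by rewrite -[X in X != _]mulr1 (inj_eq (mulfI w0)) eq_sym.
by move=> [|[|[|i]]] [|[|[|j]]] // _ _ /eqP; rewrite ?expr0 ?expr1 1?eq_sym;
  rewrite ?(negPf w1) ?(negPf w2) ?(negPf w12)// eq_sym ?(negPf w1) ?(negPf w2) ?(negPf w12).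
Qed.

End RamificationIndex.

Section SpecialPoints.
Context {R : realType} {C : complexField R}.
Context {n d e : nat} (fam : weierstrass_family C n d e).
Local Notation S := (fS fam).
Local Notation T := (fT fam).
Local Notation W := (fW fam).
Local Notation disc := (fdisc fam).
Local Notation form := (form C n d).
Implicit Types (F G : form).

Lemma equivalent_T0 F p : class_of F = Some p -> T F = 0 -> equivalent (W 1 0) F.
Proof.
move=> cF T0; have [st eF] := class_ofE fam cF.
move: st; rewrite T0 eqxx orbF => S0; apply: equivalent_trans (equivalent_sym eF).
have s0 : sqrtC (S F) != 0 by rewrite sqrtC_eq0.
by have := torus_equivalent fam 1 0 s0; rewrite sqrtCK mulr1 mulr0 T0.
Qed.

Lemma equivalent_S0 F p : class_of F = Some p -> S F = 0 -> equivalent (W 0 1) F.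
Proof.
move=> cF S0; have [st eF] := class_ofE fam cF.
move: st; rewrite S0 eqxx /= => T0; apply: equivalent_trans (equivalent_sym eF).
have [s s3] : exists s : C, s ^+ 3 = T F by exists (3.-root (T F)); exact: rootCK.
have s0 : s != 0 by apply: contraNneq T0 => s0; rewrite -s3 s0 expr0n.
by have := torus_equivalent fam 0 1 s0; rewrite s3 mulr1 mulr0 S0.
Qed.

Lemma ramification_pointP (p : moduli C n d) F : class_of F = Some p ->
  (ramification_point 2 p <-> T F = 0) /\ (ramification_point 3 p <-> S F = 0).
Proof.
move=> cF.
have idx x : \pi_(moduli C n d) x = p -> [/\ S F != 0 -> T F != 0 -> has_ramification_index 1 x,
      T F = 0 -> has_ramification_index 2 x & S F = 0 -> has_ramification_index 3 x].
  move=> ex; have [G [G0 [eG cG]]] := finite_stabilizer_form x; rewrite ex in cG.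
  have [s s0 [eS eT]] := equivalent_ST fam ((class_of_eqP G cF).1 cG).
  have [h1 h2 h3] := ramification_index fam eG cG.
  split=> [S0 T0|T0|S0]; [apply: h1|apply: h2; rewrite eT T0 mulr0|apply: h3; rewrite eS S0 mulr0] => //.
    by rewrite eS mulf_neq0// expf_neq0.
  by rewrite eT mulf_neq0// expf_neq0.
have ex : \pi_(moduli C n d) (repr p) = p by rewrite reprK.
have uniq k l (x : @finite_stabilizer C n d) : has_ramification_index k x -> has_ramification_index l x -> k = l.
  rewrite /has_ramification_index => h1 h2; apply/card_eq_II.
  by apply: card_eq_trans h2; rewrite card_eq_sym.
have [st _] := class_ofE fam cF.
split; split=> [h|h x hx].
- have [h1 _ h3] := idx _ ex; have h2 := h _ ex.
  have [//|T0] := eqVneq (T F) 0; have [S0|S0] := eqVneq (S F) 0.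
    by have := uniq _ _ _ h2 (h3 S0).
  by have := uniq _ _ _ h2 (h1 S0 T0).
- by have [_ + _] := idx _ hx; apply.
- have [h1 h2 _] := idx _ ex; have h3 := h _ ex.
  have [//|S0] := eqVneq (S F) 0; have [T0|T0] := eqVneq (T F) 0.
    by have := uniq _ _ _ h3 (h2 T0).
  by have := uniq _ _ _ h3 (h1 S0 T0).
- by have [_ _ +] := idx _ hx; apply.
Qed.

Lemma improper_pointP (p : moduli C n d) F : class_of F = Some p ->
  improper_point p <-> disc F = 0.
Proof.
move=> cF.
have lp x : \pi_(moduli C n d) x = p -> locally_proper x <-> disc F != 0.
  move=> ex; have [G [G0 [eG cG]]] := finite_stabilizer_form x; rewrite ex in cG.
  have eFG := (class_of_eqP G cF).1 cG; rewrite -ex in cG.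
  apply: (iff_trans (locally_properP fam eG cG)); split; apply: contraNN => /eqP h; apply/eqP.
    exact: disc_equivalent eFG h.
  exact: disc_equivalent (equivalent_sym eFG) h.
split=> [h|h x ex]; last by move/(lp x ex); rewrite h eqxx.
have ex : \pi_(moduli C n d) (repr p) = p by rewrite reprK.
by apply/eqP; apply: contraT => /(lp _ ex) /(h _ ex).
Qed.

Lemma special_points_family : special_points C n d.
Proof.
have n1 : (1 : C) != 0 by rewrite oner_eq0.
split.
- have [|p cp] := W_class fam (a := 1) (b := 0); first by rewrite n1.
  exists p; split; first by apply/(ramification_pointP cp).1; rewrite T_W.
  move=> q; have [F cF] := class_of_surj q; move/(ramification_pointP cF).1.
  by move=> /(equivalent_T0 cF)/class_of_equivalent; rewrite cp cF => -[].
- have [|p cp] := W_class fam (a := 0) (b := 1); first by rewrite n1 orbT.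
  exists p; split; first by apply/(ramification_pointP cp).2; rewrite S_W.
  move=> q; have [F cF] := class_of_surj q; move/(ramification_pointP cF).2.
  by move=> /(equivalent_S0 cF)/class_of_equivalent; rewrite cp cF => -[].
- have [Fu [p [cp dp _]]] := unstable fam.
  exists p; split; first by apply/(improper_pointP cp).
  move=> q; have [F cF] := class_of_surj q; move/(improper_pointP cF).
  by move=> dF; have /class_of_equivalent := disc0_equivalent cp cF dp dF; rewrite cp cF => -[].
- move=> p _ x _; exact: weakly_proper_everywhere fam x.
Qed.

End SpecialPoints.

Section Isomorphism.
Context {R : realType} {C : complexField R}.
Context {n d e n' d' e' : nat}.
Context (fam : weierstrass_family C n d e) (fam' : weierstrass_family C n' d' e').
Let h (F : form C n d) : form C n' d' := fW fam' (fS fam F) (fT fam F).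

(** Equivalent forms have parameters related by some [s], and then so are the corresponding normal
    forms of the other family. *)
Lemma map_class : exists phi : moduli C n d -> moduli C n' d',
  forall F p, class_of F = Some p -> class_of (h F) = Some (phi p).
Proof.
suff /choice[phi hphi] : forall p, exists q, forall F, class_of F = Some p ->
    class_of (h F) = Some q by exists phi => F p; exact: hphi.
move=> p; have [F cF] := class_of_surj p.
have [st _] := class_ofE fam cF; have [q hq] := W_class fam' st.
exists q => G cG; rewrite -hq; apply/esym/class_of_equivalent.
have [s s0 [eS eT]] := equivalent_ST fam ((class_of_eqP G cF).1 cG).
by rewrite /h eS eT; exact: torus_equivalent.
Qed.

Lemma sdiffable_h F : sdiffable h F.
Proof.
have [lS hS] := S_sdiff fam F; have [lT hT] := T_sdiff fam F.
eexists; apply: sdiffD (sdiffD (sdiff_cst (fW0 fam') F) (sdiffZ _ hS)) (sdiffZ _ hT).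
Qed.

Variable phi : moduli C n d -> moduli C n' d'.
Hypothesis phiE : forall F p, class_of F = Some p -> class_of (h F) = Some (phi p).

Lemma continuous_map_class : continuous phi.
Proof.
apply/continuousP => V /open_moduliP oV; apply/open_moduliP => F p cF Vp.
have [l hl] := sdiffable_h F.
have ch : {for F, continuous h} by apply: differentiable_continuous; exact: (sdiff_diff hl).1.
have := ch _ (oV _ _ (phiE cF) Vp).
by apply: (@filterS _ (nbhs F) _ (h @^-1` _)) => G hG q /phiE; exact: hG.
Qed.

Lemma analytic_map_class (Y : set (moduli C n' d')) f :
  analytic_on Y f -> analytic_on (phi @^-1` Y) (f \o phi).
Proof.
move=> aY F p cF Yp; have [l hl] := sdiffable_h F.
apply: (@differentiable_near _ _ _ _ ((fun G => oapp f 0 (class_of G)) \o h)).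
  have [delta delta0 hd] := finite_stabilizer_open fam cF.
  apply/nbhs_nrmP; exists delta => // G /hd[q cG].
  by rewrite /= cG (phiE cG).
apply: differentiable_comp; first exact: (sdiff_diff hl).1.
exact: aY (phiE cF) Yp.
Qed.

Lemma map_class_W (a b : C) :
  omap phi (class_of (fW fam a b)) = class_of (fW fam' a b).
Proof.
have [ab|] := boolP ((a != 0) || (b != 0)).
  have [p cp] := W_class fam ab; rewrite cp /= -(phiE cp).
  by rewrite /h S_W T_W.
move=> ab; case cp : (class_of _) => [p|].
  by have [] := class_ofE fam cp; rewrite S_W T_W (negPf ab).
case cq : (class_of _) => [q|] //.
by have [] := class_ofE fam' cq; rewrite S_W T_W (negPf ab).
Qed.

End Isomorphism.

Section Isomorphism2.
Context {R : realType} {C : complexField R}.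
Context {n d e n' d' e' : nat}.
Context (fam : weierstrass_family C n d e) (fam' : weierstrass_family C n' d' e').

(** Each family induces a map to the other. They are inverse to each other since [S] and [T] recover
    the parameters of the normal form. *)
Lemma isomorphism_family : exists phi : moduli C n d -> moduli C n' d',
  analytic_isomorphism phi /\
  forall a b : C, omap phi (class_of (fW fam a b)) = class_of (fW fam' a b).
Proof.
have [phi hphi] := map_class fam fam'; have [psi hpsi] := map_class fam' fam.
exists phi; split; last exact: map_class_W hphi.
have phiK : cancel phi psi.
  move=> p; have [F cF] := class_of_surj p.
  have := hpsi _ _ (hphi _ _ cF); rewrite /= S_W T_W (class_ofW fam cF) => -[//].
have psiK : cancel psi phi.
  move=> p; have [F cF] := class_of_surj p.
  have := hphi _ _ (hpsi _ _ cF); rewrite /= S_W T_W (class_ofW fam' cF) => -[//].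
split; last 1 first.
- move=> Y f _; split; first exact: analytic_map_class hphi _ _.
  move=> /(analytic_map_class hpsi).
  have -> : psi @^-1` (phi @^-1` Y) = Y.
    by apply/seteqP; split=> x; rewrite /= psiK.
  by have -> : (f \o phi) \o psi = f by apply/funext => x; rewrite /= psiK.
- by exists psi; split=> //; exact: continuous_map_class hpsi.
- exact: continuous_map_class hphi.
Qed.

End Isomorphism2.

(** * A criterion for properness *)

Section PolynomialFunctions.
Context {R : realType} {C : complexField R}.

Definition lipschitz_on_bounded (V W : normedModType C) (f : V -> W) :=
  forall M : R, exists2 L : R, 0 <= L & forall v w, nrm v <= M -> nrm w <= M ->
    nrm (f v - f w) <= L * nrm (v - w).

(** Polynomial functions on a normed space. Generating them by sums and products is enough for
    differentiability and for Lipschitz bounds on bounded sets. *)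
Inductive polyfun (V : normedModType C) : (V -> C) -> Prop :=
| polyfun_cst c : polyfun (fun=> c)
| polyfun_lin l : linear l -> (exists K : R, forall v, nrm (l v) <= K * nrm v) -> polyfun l
| polyfunD f g : polyfun f -> polyfun g -> polyfun (fun v => f v + g v)
| polyfunM f g : polyfun f -> polyfun g -> polyfun (fun v => f v * g v).

Lemma polyfunN (V : normedModType C) (f : V -> C) : polyfun f -> polyfun (fun v => - f v).
Proof.
move=> h; have := polyfunM (polyfun_cst _ (-1)) h.
by congr polyfun; apply/funext => v; rewrite mulN1r.
Qed.

Lemma polyfunX (V : normedModType C) (f : V -> C) k : polyfun f -> polyfun (fun v => f v ^+ k).
Proof.
move=> h; elim: k => [|k IH]; first exact: polyfun_cst.
have := polyfunM h IH; congr polyfun; apply/funext => v; exact: esym (exprS _ _).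
Qed.

Lemma polyfun_sdiffable (V : normedModType C) (f : V -> C) x : polyfun f -> sdiffable f x.
Proof.
elim=> [c|l ll bl|g h _ sg _ sh|g h _ sg _ sh].
- exact: sdiffable_cst.
- by exists l; exact: sdiff_lin.
- exact: sdiffableD.
- exact: sdiffableM.
Qed.

Lemma lip_bounded (V W : normedModType C) (f : V -> W) : lipschitz_on_bounded f ->
  forall M : R, 0 <= M -> exists2 B : R, 0 < B & forall v, nrm v <= M -> nrm (f v) <= B.
Proof.
move=> lf M M0; have [L L0 hL] := lf M; exists (nrm (f 0) + L * M + 1).
  by rewrite ltr_wpDl// addr_ge0 ?nrm_ge0// mulr_ge0.
move=> v vM; have h0 : nrm (0 : V) <= M by rewrite nrm0.
have := nrmD (f v - f 0) (f 0); rewrite subrK => h1.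
have h2 := hL v 0 vM h0; rewrite subr0 in h2.
have h3 : L * nrm v <= L * M by exact: ler_wpM2l.
move: h1 h2 h3; move: (nrm _) (nrm _) (nrm _) (L * _) (L * _) => p q r s t; clear; lra.
Qed.

Lemma polyfun_lip (V : normedModType C) (f : V -> C) : polyfun f -> lipschitz_on_bounded f.
Proof.
elim=> [c|l ll [K hK]|g h _ lg _ lh|g h _ lg _ lh] M.
- by exists 0 => // v w _ _; rewrite subrr nrm0 mul0r.
- exists `|K| => // v w _ _.
  have -> : l v - l w = l (v - w).
    by have := ll (-1) w v; rewrite !scaleN1r addrC [- w + v]addrC.
  by apply: le_trans (hK _) _; rewrite ler_wpM2r ?nrm_ge0// ler_norm.
- have [L L0 hL] := lg M; have [L' L'0 hL'] := lh M; exists (L + L'); first exact: addr_ge0.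
  move=> v w hv hw; rewrite opprD addrACA; apply: le_trans (nrmD _ _) _.
  by rewrite mulrDl lerD ?hL ?hL'.
have [M0|M0] := ltP M 0.
  by exists 0 => // v w /le_lt_trans/(_ M0); rewrite ltNge nrm_ge0.
have [L L0 hL] := lg M; have [L' L'0 hL'] := lh M.
have [B B0 hB] := lip_bounded lg M0; have [B' B'0 hB'] := lip_bounded lh M0.
exists (B * L' + L * B'); first by rewrite addr_ge0 ?mulr_ge0// ltW.
move=> v w hv hw.
have -> : g v * h v - g w * h w = g v * (h v - h w) + (g v - g w) * h w.
  by rewrite mulrBr mulrBl addrA subrK.
apply: le_trans (nrmD _ _) _; rewrite !nrmM mulrDl -(mulrA B) (mulrAC L).
apply: lerD; apply: ler_pM; rewrite ?nrm_ge0 ?mulr_ge0 ?nrm_ge0//.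
- exact: hB.
- exact: hL'.
- exact: hL.
- exact: hB'.
Qed.

End PolynomialFunctions.

Section Pivot.
Context {R : realType} {C : complexField R}.

Definition bibounded n (K : R) (U : 'M[C]_n) :=
  exists V : 'M[C]_n, [/\ U *m V = 1%:M, nrm U <= K & nrm V <= K].

Lemma biboundedM n (K L : R) (U V : 'M[C]_n.+1) : bibounded K U -> bibounded L V ->
  bibounded (n.+1%:R * (K * L)) (U *m V).
Proof.
move=> [U' [e h h']] [V' [f k k']]; exists (V' *m U'); split.
- by rewrite mulmxA -(mulmxA U) f mulmx1.
- exact: nrm_mulmx_le.
- by rewrite [K * L]mulrC; exact: nrm_mulmx_le.
Qed.

Lemma bibounded_le n (K L : R) (U : 'M[C]_n) : K <= L -> bibounded K U -> bibounded L U.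
Proof.
by move=> KL [V [e h h']]; exists V; split=> //; [exact: le_trans h KL|exact: le_trans h' KL].
Qed.

Lemma nrm_block_le m n p q (A : 'M[C]_(m, n)) (B : 'M[C]_(m, p)) (D : 'M[C]_(q, n))
    (E : 'M[C]_(q, p)) (r : R) : 0 <= r ->
  nrm A <= r -> nrm B <= r -> nrm D <= r -> nrm E <= r -> nrm (block_mx A B D E) <= r.
Proof.
move=> r0 hA hB hD hE; apply/nrm_mx_le => // i j.
case: (split_ordP i) => k ->; case: (split_ordP j) => l ->;
  rewrite ?block_mxEul ?block_mxEur ?block_mxEdl ?block_mxEdr;
  by apply: le_trans (nrm_mx_entry _ _ _) _.
Qed.

Lemma bibounded_lower m n (X : 'M[C]_(n, m)) : nrm X <= 1 ->
  bibounded 1 (block_mx (1%:M : 'M[C]_m) 0 X (1%:M : 'M[C]_n)).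
Proof.
move=> hX; exists (block_mx 1%:M 0 (- X) 1%:M); split.
- by rewrite mulmx_block !mul1mx !mul0mx !mulmx0 !mulmx1 !addr0 ?add0r subrr -scalar_mx_block.
- by apply: nrm_block_le; rewrite ?nrm_scalar1 ?nrm0.
- by apply: nrm_block_le; rewrite ?nrm_scalar1 ?nrm0 ?nrmN.
Qed.

Lemma bibounded_upper m n (X : 'M[C]_(m, n)) : nrm X <= 1 ->
  bibounded 1 (block_mx (1%:M : 'M[C]_m) X 0 (1%:M : 'M[C]_n)).
Proof.
move=> hX; exists (block_mx 1%:M (- X) 0 1%:M); split.
- by rewrite mulmx_block !mul1mx !mul0mx !mulmx0 !mulmx1 !addr0 !add0r addNr -scalar_mx_block.
- by apply: nrm_block_le; rewrite ?nrm_scalar1 ?nrm0.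
- by apply: nrm_block_le; rewrite ?nrm_scalar1 ?nrm0 ?nrmN.
Qed.

Lemma bibounded_diag m n (K : R) (U : 'M[C]_n) : 1 <= K -> bibounded K U ->
  bibounded K (block_mx (1%:M : 'M[C]_m) 0 0 U).
Proof.
move=> K1 [V [e h h']]; have K0 := le_trans ler01 K1.
exists (block_mx 1%:M 0 0 V); split.
- by rewrite mulmx_block !mul1mx !mul0mx !mulmx0 !addr0 !add0r e -scalar_mx_block.
- by apply: nrm_block_le; rewrite ?nrm0// (le_trans (nrm_scalar1 _)).
- by apply: nrm_block_le; rewrite ?nrm0// (le_trans (nrm_scalar1 _)).
Qed.

Lemma bibounded_tperm n (i j : 'I_n) : bibounded 1 (tperm_mx i j : 'M[C]_n).
Proof.
have h : nrm (tperm_mx i j : 'M[C]_n) <= 1.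
  apply/nrm_mx_le => // k l; rewrite !mxE; case: eqP => _; rewrite ?nrm1 ?nrm0//.
by exists (tperm_mx i j); split=> //; rewrite /tperm_mx -perm_mxM tperm2 perm_mx1.
Qed.

(** Gaussian elimination with complete pivoting, a substitute for the singular value decomposition.
    The multipliers have norm at most 1, and the remaining block at most twice the norm of the
    pivot, so that the bound [K] depends on the dimension only. *)
Lemma pivot_decomposition n : exists2 K : R, 1 <= K &
  forall A : 'M[C]_n.+1, exists (U V : 'M[C]_n.+1) (d : 'rV[C]_n.+1),
  [/\ bibounded K U, bibounded K V,
      forall i j : 'I_n.+1, (i <= j)%N -> nrm (d 0 j) <= K * nrm (d 0 i) &
      A = U *m diag_mx d *m V].
Proof.
elim: n => [|n [K K1 IH]].
  exists 1 => // A; exists 1%:M, 1%:M, A.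
  have b : bibounded 1 (1%:M : 'M[C]_1).
    by exists 1%:M; split; rewrite ?mulmx1 ?nrm_scalar1.
  split=> //; first by move=> i j _; rewrite !ord1 mul1r.
  by rewrite mul1mx mulmx1; apply/matrixP => i j; rewrite !ord1 !mxE eqxx mulr1n.
set q : R := n.+2%:R; have q1 : 1 <= q by rewrite ler1n.
have q0 : 0 < q by apply: lt_le_trans q1.
have K0 : 0 < K by apply: lt_le_trans K1.
pose L := q * (q * (2 * (K * K))).
have KK : K <= K * K by rewrite ler_peMr// ltW.
have [KL qKL] : K <= L /\ q * (1 * (q * (1 * K))) <= L.
  have h : q * (q * K) <= L.
    rewrite !ler_wpM2l ?(ltW q0)//; apply: le_trans KK _.
    by rewrite ler_peMl ?mulr_ge0 ?(ltW K0)// ler1n.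
  rewrite !mul1r; split=> //; apply: le_trans h; rewrite mulrA ler_peMl ?(ltW K0)//.
  exact: mulr_ege1.
have L1 : 1 <= L by exact: le_trans KL.
exists L => // A; have [->|A0] := eqVneq A 0.
  have b : bibounded L (1%:M : 'M[C]_n.+2).
    by exists 1%:M; split; rewrite ?mulmx1 ?(le_trans (nrm_scalar1 _)).
  exists 1%:M, 1%:M, 0; split=> //; first by move=> i j _; rewrite !mxE nrm0 mulr0.
  by rewrite mul1mx mulmx1; apply/matrixP => i j; rewrite !mxE mul0rn.
(* The pivot is an entry of maximal norm, so that the multipliers X and Y have norm at most 1. *)
have [[i0 j0] Amax] : exists ij : 'I_n.+2 * 'I_n.+2, forall i j,
    nrm (A i j) <= nrm (A ij.1 ij.2).
  have [ij _ h] := @Order.TotalTheory.arg_maxP _ _ _ (ord0, ord0) xpredT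
    (fun ij : 'I_n.+2 * 'I_n.+2 => nrm (A ij.1 ij.2)) isT.
  by exists ij => i j; have := h (i, j) isT.
rewrite /= in Amax; set al := A i0 j0 in Amax.
have al0 : al != 0.
  apply: contraNneq A0 => al0; apply/eqP/matrixP => i j; apply/eqP.
  by rewrite mxE -nrm_eq0 eq_le nrm_ge0 andbT; have := Amax i j; rewrite al0 nrm0.
pose P : 'M[C]_(1 + n.+1) := tperm_mx ord0 i0; pose Q : 'M[C]_(1 + n.+1) := tperm_mx ord0 j0.
pose B : 'M[C]_(1 + n.+1) := P *m A *m Q.
have PP : P *m P = 1%:M by rewrite /P /tperm_mx -perm_mxM tperm2 perm_mx1.
have QQ : Q *m Q = 1%:M by rewrite /Q /tperm_mx -perm_mxM tperm2 perm_mx1.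
have eA : A = P *m B *m Q.
  by rewrite /B !mulmxA PP mul1mx -mulmxA QQ mulmx1.
have BE i j : B i j = A (tperm ord0 i0 i) (tperm ord0 j0 j).
  by rewrite /B /P /Q -xrowE -xcolE !mxE.
have B0 : B ord0 ord0 = al by rewrite BE !tpermL.
have Bmax i j : nrm (B i j) <= nrm al by rewrite BE.
clearbody B; clear BE.
pose X := al^-1 *: dlsubmx B; pose Y := al^-1 *: ursubmx B.
pose D := drsubmx B - al *: (X *m Y).
have alp : 0 < nrm al by rewrite nrm_gt0.
have nX : nrm X <= 1.
  apply/nrm_mx_le => // i j; rewrite !mxE nrmM nrmV mulrC ler_pdivrMr// mul1r.
  exact: Bmax.
have nY : nrm Y <= 1.
  apply/nrm_mx_le => // i j; rewrite !mxE nrmM nrmV mulrC ler_pdivrMr// mul1r.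
  exact: Bmax.
have eB : B = block_mx 1%:M 0 X 1%:M *m block_mx al%:M 0 0 D *m block_mx 1%:M Y 0 1%:M.
  rewrite !mulmx_block !mul1mx !mul0mx !mulmx0 !mulmx1 !addr0 !add0r.
  rewrite -[LHS]submxK; congr block_mx.
  - apply/matrixP => i j; rewrite !ord1 !mxE eqxx mulr1n -B0; congr (B _ _); exact: val_inj.
  - by rewrite mul_scalar_mx scalerA mulfV// scale1r.
  - by rewrite mul_mx_scalar scalerA mulfV// scale1r.
  - by rewrite mul_mx_scalar -scalemxAl /D addrC subrK.
have nD : nrm D <= 2 * nrm al.
  apply/nrm_mx_le; first by rewrite mulr_ge0// ltW.
  move=> i j; rewrite /D mxE; apply: le_trans (nrmD _ _) _.
  rewrite mulr_natl mulr2n; apply: lerD; first by rewrite !mxE; exact: Bmax.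
  rewrite !mxE big_ord1 nrmN nrmM ler_piMr ?nrm_ge0// nrmM.
  have h1 := le_trans (nrm_mx_entry X i 0) nX; have h2 := le_trans (nrm_mx_entry Y 0 j) nY.
  by apply: mulr_ile1; rewrite ?nrm_ge0.
have [U [V [d [bU bV hd eD]]]] := IH D.
have hrow (i j : 'I_(1 + n.+1)) : (i <= j)%N ->
    nrm ((row_mx al%:M d : 'rV_(1 + n.+1)) 0 j) <= L * nrm ((row_mx al%:M d : 'rV_(1 + n.+1)) 0 i).
  case: (split_ordP i) => k ->;
    case: (split_ordP j) => l -> ij.
  + rewrite !row_mxEl !ord1 mxE eqxx mulr1n.
    by rewrite ler_peMl ?nrm_ge0.
  + rewrite row_mxEr row_mxEl ord1 [_%:M _ _]mxE eqxx mulr1n.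
    have [[U' [eU hU hU']] [V' [eV hV hV']]] := (bU, bV).
    have ed : diag_mx d = U' *m D *m V'.
      by rewrite eD -!mulmxA eV mulmx1 !mulmxA (mulmx1C eU) mul1mx.
    have -> : d 0 l = diag_mx d l l by rewrite mxE eqxx mulr1n.
    apply: le_trans (nrm_mx_entry _ _ _) _; rewrite ed.
    apply: le_trans (nrm_mulmx_le (nrm_mulmx_le hU' nD) hV') _.
    set m := n.+1%:R; have mq : 0 <= m <= q by rewrite ler0n ler_nat leqnSn.
    case/andP: mq => m0 mq; have al1 := ltW alp; have K2 := ltW K0.
    have -> : m * (m * (K * (2 * nrm al)) * K) = m * m * (2 * (K * K) * nrm al) by ring.
    have -> : L * nrm al = q * q * (2 * (K * K) * nrm al) by rewrite /L; ring.
    by rewrite ler_wpM2r ?mulr_ge0// ler_pM.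
  + by exfalso; move: ij; rewrite /= (ord1 l) /=.
  + rewrite !row_mxEr; apply: le_trans (hd k l _) _; first by move: ij; rewrite /= leq_add2l.
    by rewrite ler_wpM2r ?nrm_ge0.
have fin : (A : 'M[C]_(1 + n.+1)) = P *m (block_mx 1%:M 0 X 1%:M *m block_mx 1%:M 0 0 U) *m
  diag_mx (row_mx al%:M d) *m ((block_mx 1%:M 0 0 V *m block_mx 1%:M Y 0 1%:M) *m Q).
  rewrite diag_mx_row eA eB eD.
  have -> : diag_mx (al%:M : 'rV[C]_1) = al%:M :> 'M[C]_1 by apply/matrixP => i j; rewrite !ord1 !mxE eqxx mulr1n.
  have -> : block_mx al%:M 0 0 (U *m diag_mx d *m V) = block_mx (1%:M : 'M[C]_1) 0 0 U *m
      block_mx (al%:M : 'M[C]_1) 0 0 (diag_mx d) *m block_mx (1%:M : 'M[C]_1) 0 0 V.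
    by rewrite !mulmx_block !(mul1mx, mul0mx, mulmx0, mulmx1, addr0, add0r).
  by rewrite !mulmxA.
exists (P *m (block_mx 1%:M 0 X 1%:M *m block_mx 1%:M 0 0 U)),
  ((block_mx 1%:M 0 0 V *m block_mx 1%:M Y 0 1%:M) *m Q), (row_mx al%:M d); split.
- apply: bibounded_le qKL _; apply: biboundedM; first exact: bibounded_tperm.
  by apply: biboundedM; [exact: (bibounded_lower nX)|exact: (@bibounded_diag 1 n.+1 K U K1 bU)].
- apply: bibounded_le qKL _; rewrite [X in q * X]mulrC.
  apply: biboundedM; last exact: bibounded_tperm.
  by rewrite [1 * K]mulrC; apply: biboundedM; [exact: (@bibounded_diag 1 n.+1 K V K1 bV)|exact: (bibounded_upper nY)].
- exact: hrow.
exact: fin.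
Qed.

End Pivot.

Lemma substitute_decomposition (C : numClosedFieldType) n d (c : C) (U D V V' : 'M[C]_n.+1)
    (F : form C n d) : V *m V' = 1%:M ->
  substitute V' (c *: substitute (U *m D *m V) F) = c *: substitute D (substitute U F).
Proof. by move=> h; rewrite substituteZr !substituteM -!mulmxA h mulmx1. Qed.

Section Properness.
Context {R : realType} {C : complexField R} {n d e : nat}.
Local Notation form := (form C n d).
Local Notation mu := (@mu R C n e).

(** By interpolation the substituted form depends polynomially on the matrix. *)
Lemma substitute_bounded (sep : @separates_forms R C n d) (K M : R) : 0 <= M -> exists2 B : R, 0 < B &
  forall (U : 'M[C]_n.+1) (F : form), nrm U <= K -> nrm F <= M -> nrm (substitute U F) <= B.
Proof.
move=> M0; have [N [P [E hE]]] := interpolation sep.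
have bnd (F : form) (k : 'I_N) : exists b : R, forall U : 'M[C]_n.+1, nrm U <= K ->
    nrm (ev F (U *m P k)) <= b.
  have [K0|K0] := ltP K 0.
    by exists 0 => U /le_lt_trans/(_ K0); rewrite ltNge nrm_ge0.
  have lin i : linear (fun U : 'M[C]_n.+1 => (U *m P k) i 0).
    by move=> c U V; rewrite mulmxDl -scalemxAl !mxE.
  have pf : polyfun (fun U : 'M[C]_n.+1 => ev F (U *m P k)).
    apply: (@mpoly_ring_ind _ _
      (fun p => polyfun (fun U : 'M[C]_n.+1 => meval (fun i => (U *m P k) i 0) p))) => [c|i|p q hp hq|p q hp hq].
    - by under [X in polyfun X]eq_fun do rewrite mevalC; exact: polyfun_cst.
    - under [X in polyfun X]eq_fun do rewrite mevalXU.
      by apply: polyfun_lin; [exact: lin|exact: linear_bounded (lin i)].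
    - by under [X in polyfun X]eq_fun do rewrite mevalD; exact: polyfunD.
    - by under [X in polyfun X]eq_fun do rewrite mevalM; exact: polyfunM.
  by have [b _ hb] := lip_bounded (polyfun_lip pf) K0; exists b.
have /choice[b hb] := fun Fk : form * 'I_N => bnd Fk.1 Fk.2.
pose m := dim (dhomog n.+1 C d).
pose B := \sum_(i < m) \sum_k `|b (delta_mx 0 i, k)| * nrm (E k).
have B0 : 0 <= B by apply: sumr_ge0 => i _; apply: sumr_ge0 => k _; rewrite mulr_ge0 ?nrm_ge0.
exists (M * B + 1); first by rewrite ltr_wpDl// mulr_ge0.
move=> U F hU hF.
have -> : substitute U F = \sum_(i < m) F 0 i *: substitute U (delta_mx 0 i).
  rewrite {1}[F]row_sum_delta (big_morph _ (substituteD U) (@substitute0 _ _ _ U)).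
  by apply: eq_bigr => i _; rewrite substituteZr.
apply: le_trans (nrm_sum _ _ _) _; rewrite ler_wpDr// mulr_sumr; apply: ler_sum => i _.
rewrite nrmZ; apply: ler_pM; rewrite ?nrm_ge0//.
  by apply: le_trans hF; exact: nrm_mx_entry.
rewrite [substitute _ _]hE; apply: le_trans (nrm_sum _ _ _) _; apply: ler_sum => k _.
rewrite nrmZ ler_wpM2r ?nrm_ge0// ev_subst; apply: le_trans (ler_norm _).
exact: (hb (delta_mx 0 i, k)).
Qed.

(** Suppose that [A] takes [F1] to [F2], both close to [F], and that its determinant is small.
    Splitting the bounded factors of the pivot decomposition off [A] leaves a diagonal matrix
    between bounded forms [H] and [K], with decreasing entries whose product is small in comparison
    with the first one. By the hypothesis [D H] is then as small as one likes, whereas it is bounded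
    from below because [D F] is not zero. *)
Lemma stable_of_flat (D : form -> C) : @separates_forms R C n d -> polyfun D ->
  (forall c A F, D (c *: substitute A F) = mu c A ^+ 6 * D F) ->
  (forall M k rho : R, 1 <= M -> 0 < k -> 0 < rho -> exists2 eta : R, 0 < eta &
    forall (H K : form) (c : C) (v : 'rV[C]_n.+1), nrm H <= M -> nrm K <= M ->
    (forall i, v 0 i != 0) -> K = c *: substitute (diag_mx v) H ->
    k <= nrm (mu c (diag_mx v)) ->
    (forall i j : 'I_n.+1, (i <= j)%N -> nrm (v 0 j) <= M * nrm (v 0 i)) ->
    nrm (\prod_i v 0 i) <= eta * nrm (v 0 0) ^+ n.+1 -> nrm (D H) < rho) ->
  forall F, D F != 0 -> exists2 delta : R, 0 < delta &
    exists2 eta : R, 0 < eta & forall F1 F2 (A : 'M[C]_n.+1) (c : C),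
      nrm (F1 - F) < delta -> nrm (F2 - F) < delta -> A \in unitmx -> c != 0 ->
      F2 = c *: substitute A F1 -> eta * nrm A ^+ n.+1 <= nrm (\det A).
Proof.
move=> sep D_poly D_act flat F DF.
have DF0 : 0 < nrm (D F) by rewrite nrm_gt0.
have [L L0 hL] := polyfun_lip D_poly (nrm F + 1).
pose delta := Num.min 1 (nrm (D F) / 2 / (L + 1)).
have delta0 : 0 < delta by rewrite lt_min ltr01 !divr_gt0// ltr_wpDl.
exists delta => //.
have near G : nrm (G - F) < delta -> nrm G <= nrm F + 1 /\ nrm (D F) / 2 <= nrm (D G).
  rewrite lt_min => /andP[h1 h2].
  have hG : nrm G <= nrm F + 1.
    by have := nrmD (G - F) F; rewrite subrK => h; move: h h1; move: (nrm _) (nrm _) (nrm _) => x y z; clear; lra.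
  split=> //; have hF : nrm F <= nrm F + 1 by rewrite ler_wpDr.
  have := hL _ _ hF hG; have := nrmD (D F - D G) (D G); rewrite subrK (nrmB_sym F).
  have h3 : L * nrm (G - F) <= nrm (D F) / 2.
    have : (L + 1) * nrm (G - F) <= nrm (D F) / 2.
      by rewrite mulrC -ler_pdivlMr ?ltr_wpDl// ltW.
    by apply: le_trans; rewrite ler_wpM2r ?nrm_ge0// ler_wpDr.
  move: h3; move: (L * _) (nrm (D F - D G)) (nrm (D F)) (nrm (D G)) => x y z t; clear; lra.
have [K K1 hpivot] := @pivot_decomposition R C n.
have K0 : 0 < K by apply: lt_le_trans K1.
have [B B0 hB] := substitute_bounded sep K (addr_ge0 (nrm_ge0 F) ler01).
pose kap : R := ((n.+1)`!%:R * K ^+ n.+1)^-1.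
have kap0 : 0 < kap by rewrite invr_gt0 mulr_gt0 ?exprn_gt0// ltr0n fact_gt0.
have hdet (U : 'M[C]_n.+1) : bibounded K U -> kap <= nrm (\det U).
  move=> [V [e1 _ hV]]; have : nrm (\det U) * nrm (\det V) = 1.
    by rewrite -nrmM -det_mulmx e1 det1 nrm1.
  have hdV : nrm (\det V) <= kap^-1.
    rewrite invrK; apply: le_trans (nrm_det V) _; rewrite ler_wpM2l ?ler0n//.
    by rewrite lerXn2r ?nnegrE ?nrm_ge0 ?(ltW K0).
  move=> h; rewrite -[leLHS]mulr1 -h mulrCA ler_piMr ?nrm_ge0//.
  by rewrite -(mulVf (lt0r_neq0 kap0)) mulrC ler_wpM2r// ltW.
have [BD BD0 hBD] := lip_bounded (polyfun_lip D_poly) (ltW B0).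
pose rho := kap ^+ 12 * (nrm (D F) / 2).
have rho0 : 0 < rho by rewrite mulr_gt0 ?exprn_gt0// divr_gt0.
pose k := Num.min 1 (rho / BD).
have k0 : 0 < k by rewrite lt_min ltr01 divr_gt0.
pose M := Num.max K B.
have [MK MB] : K <= M /\ B <= M by rewrite /M !le_max !lexx orbT.
have M1 : 1 <= M by exact: le_trans MK.
have [eta eta0 heta] := flat M k rho M1 k0 rho0.
pose q : R := n.+1%:R; have q0 : 0 < q by rewrite ltr0n.
pose g := q * (q * (K * M) * K).
have g0 : 0 < g by rewrite !mulr_gt0// (lt_le_trans _ M1).
exists (eta * kap ^+ 2 / g ^+ n.+1); first by rewrite divr_gt0 ?exprn_gt0// mulr_gt0// exprn_gt0.
move=> F1 F2 A c h1 h2 uA c0 e2; rewrite leNgt; apply/negP => small.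
have [nF1 DF1] := near _ h1; have [nF2 DF2] := near _ h2.
have [U [V [v [bU bV hv eA]]]] := hpivot A.
have [[U' [eU nU nU']] [V' [eV nV nV']]] := (bU, bV).
have [dU dV] := (hdet _ bU, hdet _ bV).
have prodE : \det (diag_mx v) = \prod_i v 0 i by exact: det_diag.
have dA : \det A = \det U * (\prod_i v 0 i) * \det V.
  by rewrite {1}eA !det_mulmx prodE.
have dA0 : \det A != 0 by rewrite -unitfE -unitmxE.
have v0 i : v 0 i != 0.
  by apply: contraNneq dA0 => vi; rewrite dA (bigD1 i)//= vi mul0r mulr0 mul0r.
pose H := substitute U F1; pose G := substitute V' F2.
have eG : G = c *: substitute (diag_mx v) H.
  by rewrite /G e2 eA; exact: substitute_decomposition.
have nH : nrm H <= M by apply: le_trans MB; exact: hB.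
have nG : nrm G <= M by apply: le_trans MB; exact: hB.
have muX (z : 'M[C]_n.+1) : mu 1 z = \det z ^+ 2 by rewrite /mu expr1n mul1r.
have bnd (z : 'M[C]_n.+1) F' : kap <= nrm (\det z) -> nrm (D F) / 2 <= nrm (D F') ->
    rho <= nrm (D (substitute z F')).
  move=> hz hF; rewrite -[substitute _ _]scale1r D_act nrmM muX -exprM nrmX /rho.
  by rewrite ler_pM ?exprn_ge0 ?(ltW kap0) ?divr_ge0 ?nrm_ge0// lerXn2r ?nnegrE ?nrm_ge0 ?(ltW kap0).
have DH : rho <= nrm (D H) by exact: bnd.
have bV' : bibounded K V' by exists V; split=> //; exact: mulmx1C.
have DG : rho <= nrm (D G) by apply: bnd => //; exact: hdet.
have hmu : k <= nrm (mu c (diag_mx v)).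
  rewrite leNgt; apply/negP => hlt; move: DG; rewrite eG D_act nrmM nrmX leNgt => /negP; apply.
  move: hlt; rewrite lt_min => /andP[m1 m2].
  have m6 : nrm (mu c (diag_mx v)) ^+ 6 <= nrm (mu c (diag_mx v)).
    by rewrite exprS ler_piMr ?nrm_ge0// exprn_ile1 ?nrm_ge0// ltW.
  have hDH : nrm (D H) <= BD by apply: hBD; exact: hB.
  apply: le_lt_trans (ler_pM (exprn_ge0 _ (nrm_ge0 _)) (nrm_ge0 _) m6 hDH) _.
  by rewrite -ltr_pdivlMr.
have := heta H G c v nH nG v0 eG hmu _ _; rewrite ltNge DH => /(_ _ _)/negP; apply => //.
  by move=> i j ij; apply: le_trans (hv _ _ ij) _; rewrite ler_wpM2r ?nrm_ge0.
have nA : nrm A <= g * nrm (v 0 0).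
  have nD : nrm (diag_mx v) <= M * nrm (v 0 0).
    have Mv : 0 <= M * nrm (v 0 0) by rewrite mulr_ge0 ?nrm_ge0// (le_trans ler01).
    apply/nrm_mx_le => // i j; rewrite mxE; case: eqP => [_|_]; rewrite ?mulr0n ?nrm0//.
    by rewrite mulr1n; apply: le_trans (hv 0 i _) _; rewrite ?ler_wpM2r ?nrm_ge0.
  rewrite eA; apply: le_trans (nrm_mulmx_le (nrm_mulmx_le nU nD) nV) _.
  by rewrite /g -/q le_eqVlt; apply/orP; left; apply/eqP; ring.
have p1 : kap ^+ 2 * nrm (\prod_i v 0 i) <= nrm (\det A).
  rewrite dA !nrmM [X in _ <= X]mulrAC; apply: ler_wpM2r; first exact: nrm_ge0.
  by rewrite expr2; apply: ler_pM => //; exact: ltW.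
have p2 : nrm (\det A) <= eta * kap ^+ 2 * nrm (v 0 0) ^+ n.+1.
  apply: le_trans (ltW small) _; rewrite [X in X <= _]mulrAC ler_pdivrMr ?exprn_gt0//.
  rewrite -[leRHS]mulrA; apply: ler_wpM2l.
    by apply: mulr_ge0; [exact: ltW|exact: exprn_ge0 _ (ltW kap0)].
  rewrite -exprMn mulrC; apply: lerXn2r => //; rewrite nnegrE ?nrm_ge0//.
  by rewrite mulr_ge0 ?nrm_ge0// ltW.
have k2 : 0 < kap ^+ 2 by exact: exprn_gt0.
rewrite -(ler_pM2l k2); apply: le_trans p1 _; apply: le_trans p2 _.
by have -> : eta * kap ^+ 2 * nrm (v 0 0) ^+ n.+1 = kap ^+ 2 * (eta * nrm (v 0 0) ^+ n.+1) by ring.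
Qed.

End Properness.

(** * Binary quartics: coefficients, invariants, normal form *)

Section Monomials.
Context {K : numClosedFieldType} {n d : nat} {E : eqType}.
Variables (exps : seq E) (mon : E -> multinom n.+1).

(** An enumeration of the monomials of degree [d] by a convenient type of exponents. *)
Definition monomial_basis := [/\ uniq exps, injective mon,
  forall e, e \in exps -> mdeg (mon e) = d &
  forall m : multinom n.+1, mdeg m = d -> exists2 e, e \in exps & m = mon e].

Definition poly_sum (u : E -> K) : mpoly n.+1 K := \sum_(e <- exps) u e *: mpolyX K (mon e).

Definition make_form (u : E -> K) : form K n d := form_of d (poly_sum u).

Definition form_coef (F : form K n d) e : K := mcoeff (mon e) (poly_of F).

Hypothesis B : monomial_basis.

Lemma poly_sum_homog u : poly_sum u \is ishomog1 d mdeg.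
Proof.
have [_ _ h _] := B; rewrite /poly_sum big_seq; apply: rpred_sum => e he; apply: rpredZ.
by rewrite dhomogX /= h.
Qed.

Lemma mcoeff_poly_sum u e : e \in exps -> mcoeff (mon e) (poly_sum u) = u e.
Proof.
have [un im _ _] := B => he; rewrite /poly_sum linear_sum /= (bigD1_seq e)//=.
rewrite mcoeffZ mcoeffX eqxx mulr1 big1 ?addr0// => e' /negPf ne.
by rewrite mcoeffZ mcoeffX (inj_eq im) ne mulr0.
Qed.

Lemma poly_expand p : p \is ishomog1 d mdeg -> p = poly_sum (fun e => mcoeff (mon e) p).
Proof.
have [_ _ hd full] := B => hp; apply/mpolyP => m.
have [/eqP/full[e he ->]|md] := boolP (mdeg m == d); first by rewrite mcoeff_poly_sum.
have h q : q \is ishomog1 d mdeg -> mcoeff m q = 0.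
  move=> hq; apply/eqP; apply: contraNT md; rewrite -mcoeff_msupp => mq.
  by apply/eqP; exact: dhomogP hq _ mq.
by rewrite !h ?poly_sum_homog.
Qed.

Lemma meval_poly_sum u (v : 'cV[K]_n.+1) : meval (fun i => v i 0) (poly_sum u) =
  \sum_(e <- exps) u e * \prod_i v i 0 ^+ mon e i.
Proof.
rewrite /poly_sum linear_sum; apply: eq_bigr => e _ /=.
by rewrite mevalZ mevalX.
Qed.

Lemma ev_make_form u v : ev (make_form u) v = \sum_(e <- exps) u e * \prod_i v i 0 ^+ mon e i.
Proof. by rewrite ev_form_of ?poly_sum_homog// meval_poly_sum. Qed.

Lemma ev_expand F v : ev F v = \sum_(e <- exps) form_coef F e * \prod_i v i 0 ^+ mon e i.
Proof. by rewrite /ev {1}(poly_expand (poly_of_homog F)) meval_poly_sum. Qed.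

Lemma form_coef_ext F G : (forall e, e \in exps -> form_coef F e = form_coef G e) -> F = G.
Proof.
move=> h; rewrite -[F]poly_ofK -[G]poly_ofK; congr form_of.
rewrite (poly_expand (poly_of_homog F)) (poly_expand (poly_of_homog G)) /poly_sum.
by rewrite !big_seq; apply: eq_bigr => e he; rewrite -/(form_coef F e) h.
Qed.

End Monomials.
Arguments monomial_basis : clear implicits.

Definition multinom2 (e : nat * nat) : multinom 2 := Multinom [tuple e.1; e.2].
Definition exps4 : seq (nat * nat) := [:: (4, 0); (3, 1); (2, 2); (1, 3); (0, 4)]%N.

Lemma multinom2_basis : @monomial_basis 1 4 _ exps4 multinom2.
Proof.
have e0 e : multinom2 e 0 = e.1 by [].
have e1 e : multinom2 e 1 = e.2 by [].
split=> //.
- by move=> [a b] [c d] h; have := congr1 (fun m : multinom 2 => (m 0, m 1)) h.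
- move=> e; rewrite /exps4 !inE.
  by case/orP=> [|/orP[|/orP[|/orP[|]]]] /eqP->; rewrite mdegE !big_ord_recl big_ord0.
move=> m; rewrite mdegE !big_ord_recl big_ord0 addn0 => h.
exists (m 0, m 1).
  move: h; have -> : lift 0 0 = 1 :> 'I_2 by exact: val_inj.
  move: (m 0) (m 1) => a b.
  by case: a => [|[|[|[|[|a]]]]] //; case: b => [|[|[|[|[|b]]]]].
by apply/mnmP => -[[|[|i]] hi] //; congr (m _); apply: val_inj.
Qed.

Section Vectors2.
Context {K : numClosedFieldType}.
Implicit Types (x z p q r s : K).

Definition vec2 x z : 'cV[K]_2 := \col_(i < 2) (if val i == 0%N then x else z).

Definition mat2 p q r s : 'M[K]_2 := \matrix_(i < 2, j < 2)
  (if val i == 0%N then (if val j == 0%N then p else q)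
   else (if val j == 0%N then r else s)).

Lemma vec2E (v : 'cV[K]_2) : v = vec2 (v 0 0) (v 1 0).
Proof.
apply/matrixP => i j; rewrite !mxE ord1.
by case: i => [[|[|i]] hi] //=; congr (v _ _); apply: val_inj.
Qed.

Lemma mat2E (A : 'M[K]_2) : A = mat2 (A 0 0) (A 0 1) (A 1 0) (A 1 1).
Proof.
apply/matrixP => i j; rewrite !mxE.
by case: i => [[|[|i]] hi] //=; case: j => [[|[|j]] hj] //=; congr (A _ _); apply: val_inj.
Qed.

Lemma mul_mat2_vec2 p q r s x z :
  mat2 p q r s *m vec2 x z = vec2 (p * x + q * z) (r * x + s * z).
Proof.
apply/matrixP => i j; rewrite !mxE !big_ord_recl big_ord0 !mxE /= addr0.
by case: i => [[|[|i]] hi].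
Qed.

Lemma det_mat2 p q r s : \det (mat2 p q r s) = p * s - q * r.
Proof.
rewrite (expand_det_row _ 0) !big_ord_recl big_ord0 addr0 /cofactor !det_mx11 !mxE /=.
rewrite /bump /=; ring.
Qed.

End Vectors2.

Section QuarticForms.
Context {K : numClosedFieldType}.
Local Notation form := (form K 1 4).
Implicit Types (F G : form) (c : nat -> K) (v : 'cV[K]_2) (x z : K).

(** The coefficients are normalized by binomial coefficients, as is usual in invariant theory. *)
Definition quartic_val c x z :=
  c 0%N * x ^+ 4 + 4 * c 1%N * (x ^+ 3 * z) + 6 * c 2%N * (x ^+ 2 * z ^+ 2) +
  4 * c 3%N * (x * z ^+ 3) + c 4%N * z ^+ 4.

Definition quartic c : form :=
  make_form exps4 multinom2 (fun e => 'C(4, e.2)%:R * c e.2).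

Lemma ev_quartic_form c x z : ev (quartic c) (vec2 x z) = quartic_val c x z.
Proof.
rewrite (ev_make_form multinom2_basis) /exps4 !big_cons big_nil !big_ord_recl !big_ord0 !mxE /=.
rewrite /quartic_val; move: (c 0%N) (c 1%N) (c 2%N) (c 3%N) (c 4%N) => a b d e f.
have -> : multinom2 (4, 0)%N 0 = 4%N by [].
rewrite /binomial /=; ring.
Qed.

(** The coefficients in terms of the values at five points. *)
Definition quartic_coef F (i : nat) : K :=
  let f x z := ev F (vec2 x z) in
  let c0 := f 1 0 in let c4 := f 0 1 in
  let c2 := (f 1 1 + f 1 (-1) - 2 * c0 - 2 * c4) / 12 in
  let s := (f 1 1 - f 1 (-1)) / 8 in
  let c1 := (f 2 1 - 16 * c0 - 24 * c2 - c4 - 8 * s) / 24 in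
  [:: c0; c1; c2; s - c1; c4]`_i.

Lemma quartic_coef_uniq F c : (forall x z, ev F (vec2 x z) = quartic_val c x z) ->
  forall i, (i < 5)%N -> quartic_coef F i = c i.
Proof.
have n12 : (12 : K) != 0 by rewrite pnatr_eq0.
have n8 : (8 : K) != 0 by rewrite pnatr_eq0.
have n24 : (24 : K) != 0 by rewrite pnatr_eq0.
move=> h; rewrite /quartic_coef !h /quartic_val.
by case=> [|[|[|[|[|i]]]]] // _ /=; field.
Qed.

Lemma form_coef_quartic F e : e \in exps4 ->
  form_coef multinom2 F e = 'C(4, e.2)%:R * quartic_coef F e.2.
Proof.
have n4 : (4 : K) != 0 by rewrite pnatr_eq0.
have n6 : (6 : K) != 0 by rewrite pnatr_eq0.
pose u e := form_coef multinom2 F e.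
pose c i := u (4 - i, i)%N / 'C(4, i)%:R.
have h y t : ev F (vec2 y t) = quartic_val c y t.
  rewrite (ev_expand multinom2_basis) /exps4 !big_cons big_nil !big_ord_recl !big_ord0 !mxE /=.
  rewrite -!/(u _) /quartic_val /c /= /binomial /=.
  by move: (u _) (u _) (u _) (u _) (u _) => a b d e' f; field.
have hc := quartic_coef_uniq h.
rewrite /exps4 !inE => /orP[|/orP[|/orP[|/orP[|]]]] /eqP->; rewrite hc// /c /= -/(u _) mulrC divfK//
  /binomial /= ?(pnatr_eq0, oner_eq0)//.
Qed.

Lemma ev_quartic F x z : ev F (vec2 x z) = quartic_val (quartic_coef F) x z.
Proof.
rewrite (ev_expand multinom2_basis) /exps4 !big_cons big_nil !form_coef_quartic//.
rewrite !big_ord_recl !big_ord0 !mxE /= /quartic_val /binomial /=.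
by move: (quartic_coef _ _) (quartic_coef _ _) (quartic_coef _ _) (quartic_coef _ _)
  (quartic_coef _ _) => a b d e f; ring.
Qed.

Lemma quartic_ext F G : (forall x z, ev F (vec2 x z) = ev G (vec2 x z)) -> F = G.
Proof.
move=> h; apply: (form_coef_ext multinom2_basis) => e he; rewrite !form_coef_quartic//.
by rewrite /quartic_coef !h.
Qed.

Lemma quartic_coefZ k F i : quartic_coef (k *: F) i = k * quartic_coef F i.
Proof.
rewrite /quartic_coef !evZ; case: i => [|[|[|[|[|i]]]]] /=; by [ring|rewrite nth_nil mulr0].
Qed.

Lemma quartic_coef_form c i : (i < 5)%N -> quartic_coef (quartic c) i = c i.
Proof. by apply: quartic_coef_uniq => x z; rewrite ev_quartic_form. Qed.

Definition quartic_subst c p q r s (i : nat) : K :=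
  [:: c 0%N * p ^+ 4 + 4 * c 1%N * p ^+ 3 * r + 6 * c 2%N * p ^+ 2 * r ^+ 2 + 4 *
     c 3%N * p * r ^+ 3 + c 4%N * r ^+ 4;
     c 0%N * p ^+ 3 * q + 3 * c 1%N * p ^+ 2 * q * r + c 1%N * p ^+ 3 * s + 3 *
     c 2%N * p * q * r ^+ 2 + 3 * c 2%N * p ^+ 2 * r * s + c 3%N * q * r ^+ 3 +
     3 * c 3%N * p * r ^+ 2 * s + c 4%N * r ^+ 3 * s;
     c 0%N * p ^+ 2 * q ^+ 2 + 2 * c 1%N * p * q ^+ 2 * r + 2 * c 1%N * p ^+ 2 *
     q * s + c 2%N * q ^+ 2 * r ^+ 2 + 4 * c 2%N * p * q * r * s + c 2%N * p ^+
     2 * s ^+ 2 + 2 * c 3%N * q * r ^+ 2 * s + 2 * c 3%N * p * r * s ^+ 2 +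
     c 4%N * r ^+ 2 * s ^+ 2;
     c 0%N * p * q ^+ 3 + c 1%N * q ^+ 3 * r + 3 * c 1%N * p * q ^+ 2 * s + 3 *
     c 2%N * q ^+ 2 * r * s + 3 * c 2%N * p * q * s ^+ 2 + 3 * c 3%N * q * r * s
     ^+ 2 + c 3%N * p * s ^+ 3 + c 4%N * r * s ^+ 3;
     c 0%N * q ^+ 4 + 4 * c 1%N * q ^+ 3 * s + 6 * c 2%N * q ^+ 2 * s ^+ 2 + 4 *
     c 3%N * q * s ^+ 3 + c 4%N * s ^+ 4]`_i.

Lemma quartic_val_subst c p q r s x z :
  quartic_val c (p * x + q * z) (r * x + s * z) = quartic_val (quartic_subst c p q r s) x z.
Proof. rewrite /quartic_val /quartic_subst /=; ring. Qed.

Lemma quartic_coef_subst F p q r s i : (i < 5)%N ->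
  quartic_coef (substitute (mat2 p q r s) F) i = quartic_subst (quartic_coef F) p q r s i.
Proof.
apply: quartic_coef_uniq => x z.
by rewrite ev_subst mul_mat2_vec2 ev_quartic quartic_val_subst.
Qed.

(** The classical invariants I and J of degrees 2 and 3. *)
Definition quartic_I c := c 0%N * c 4%N - 4 * c 1%N * c 3%N + 3 * c 2%N ^+ 2.
Definition quartic_J c := c 0%N * c 2%N * c 4%N + 2 * c 1%N * c 2%N * c 3%N - c 2%N ^+ 3 -
  c 0%N * c 3%N ^+ 2 - c 1%N ^+ 2 * c 4%N.

Lemma quartic_I_subst c p q r s :
  quartic_I (quartic_subst c p q r s) = (p * s - q * r) ^+ 4 * quartic_I c.
Proof. rewrite /quartic_I /quartic_subst /=; ring. Qed.

Lemma quartic_J_subst c p q r s :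
  quartic_J (quartic_subst c p q r s) = (p * s - q * r) ^+ 6 * quartic_J c.
Proof. rewrite /quartic_J /quartic_subst /=; ring. Qed.

Definition quartic_S F := - 4 * quartic_I (quartic_coef F).
Definition quartic_T F := - 16 * quartic_J (quartic_coef F).

Lemma quartic_S_subst A F : quartic_S (substitute A F) = \det A ^+ 4 * quartic_S F.
Proof.
rewrite (mat2E A) det_mat2 /quartic_S mulrCA -quartic_I_subst.
by rewrite {1}/quartic_I !quartic_coef_subst.
Qed.

Lemma quartic_T_subst A F : quartic_T (substitute A F) = \det A ^+ 6 * quartic_T F.
Proof.
rewrite (mat2E A) det_mat2 /quartic_T mulrCA -quartic_J_subst.
by rewrite {1}/quartic_J !quartic_coef_subst.
Qed.

Lemma quartic_SZ k F : quartic_S (k *: F) = (k ^+ 1) ^+ 2 * quartic_S F.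
Proof. rewrite /quartic_S /quartic_I !quartic_coefZ expr1; ring. Qed.

Lemma quartic_TZ k F : quartic_T (k *: F) = (k ^+ 1) ^+ 3 * quartic_T F.
Proof. rewrite /quartic_T /quartic_J !quartic_coefZ expr1; ring. Qed.

End QuarticForms.

Section Closed.
Context {K : numClosedFieldType}.

Lemma finite_roots (p : {poly K}) : p != 0 -> finite_set [set x | root p x].
Proof.
move=> p0; have [rs ers] := closed_field_poly_normal p.
apply: (@sub_finite_set _ _ [set` rs]); last exact: finite_seq.
by move=> x /=; rewrite ers rootZ ?lead_coef_eq0// root_prod_XsubC.
Qed.

Lemma root_quartic (c0 c1 c2 c3 c4 : K) : c0 != 0 ->
  exists x, c0 * x ^+ 4 + c1 * x ^+ 3 + c2 * x ^+ 2 + c3 * x + c4 = 0.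
Proof.
move=> c00.
have [x hx] := @solve_monicpoly K 4 (fun i => - [:: c4; c3; c2; c1]`_i / c0) isT.
exists x; rewrite hx !big_ord_recl big_ord0 /= /bump /=.
by field.
Qed.

Lemma root_quadratic (c0 c1 c2 : K) : c0 != 0 ->
  exists x, c0 * x ^+ 2 + c1 * x + c2 = 0.
Proof.
move=> c00.
have [x hx] := @solve_monicpoly K 2 (fun i => - [:: c2; c1]`_i / c0) isT.
exists x; rewrite hx !big_ord_recl big_ord0 /= /bump /=.
by field.
Qed.

Lemma unit_mat2 (p q r s : K) : p * s - q * r != 0 -> mat2 p q r s \in unitmx.
Proof. by rewrite unitmxE unitfE det_mat2. Qed.

End Closed.

Section QuarticClasses.
Context {K : numClosedFieldType}.
Local Notation form := (form K 1 4).
Implicit Types (F G : form) (a b : K).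
Local Notation coef := quartic_coef.

Lemma quartic_coef_ext F G : (forall i, (i < 5)%N -> coef F i = coef G i) -> F = G.
Proof.
move=> h; apply: quartic_ext => x z.
by rewrite !ev_quartic /quartic_val !h.
Qed.

Lemma quartic_coef_scaled F (k p q r s : K) i : (i < 5)%N ->
  coef (k *: substitute (mat2 p q r s) F) i = k * quartic_subst (coef F) p q r s i.
Proof. by move=> i5; rewrite quartic_coefZ quartic_coef_subst. Qed.

Definition quartic_W a b : form := quartic (fun i => [:: 0; 1 / 4; 0; a / 4; b]`_i).

Lemma quartic_coef_W a b i : (i < 5)%N -> coef (quartic_W a b) i = [:: 0; 1 / 4; 0; a / 4; b]`_i.
Proof. exact: quartic_coef_form. Qed.

Lemma ev_quartic_W a b x z : ev (quartic_W a b) (vec2 x z) =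
  z * (x ^+ 3 + a * x * z ^+ 2 + b * z ^+ 3).
Proof.
have n4 : (4 : K) != 0 by rewrite pnatr_eq0.
by rewrite ev_quartic_form /quartic_val /=; field.
Qed.

Lemma class_of_nonzero n d (F : Defs.form K n d) p : class_of F = Some p -> F != 0.
Proof. by move=> /class_ofP[]. Qed.

(** A monomial is preserved by all diagonal matrices. *)
Lemma quartic_monomial_unstable F p k : class_of F = Some p -> (k < 5)%N ->
  exists2 i, (i < 5)%N & (i != k) && (coef F i != 0).
Proof.
move=> cF k5; apply: contrapT => no.
have z i : (i < 5)%N -> i != k -> coef F i = 0.
  move=> i5 ik; apply/eqP; apply: contrapT => h; apply: no; exists i => //.
  by rewrite ik; apply/negP.
suff : class_of F = None by rewrite cF.
apply: class_of_None; first exact: class_of_nonzero cF.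
have n2 j : (2 ^+ j : K) != 0 by rewrite expf_neq0// pnatr_eq0.
exists (fun j => mat2 (2 ^+ j) 0 0 1); split.
- by move=> j; apply: unit_mat2; rewrite mulr1 mul0r subr0.
- move=> j; exists ((2 ^+ j) ^+ (4 - k)); apply: quartic_coef_ext => i i5.
  rewrite quartic_coef_subst// quartic_coefZ.
  have e : quartic_subst (coef F) (2 ^+ j) 0 0 1 i = (2 ^+ j) ^+ (4 - i) * coef F i.
    move: (2 ^+ j) => t; rewrite /quartic_subst.
    by case: i i5 => [|[|[|[|[|i]]]]] // _; rewrite /= ?subn0 ?subSS ?subn0; ring.
  by rewrite e; have [->//|ik] := eqVneq i k; rewrite z// !mulr0.
move=> j l c /matrixP h; have := h 1 1; have := h 0 0; rewrite !mxE /= => h0.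
rewrite mulr1 => h1; move: h0; rewrite -h1 mul1r -!natrX => /eqP; rewrite eqr_nat.
by rewrite eqn_exp2l// => /eqP.
Qed.

(** A translation removes the coefficient of [x^2 z^2], and a scalar normalizes that of [x^3 z]. *)
Lemma quartic_simple_root F p : class_of F = Some p -> coef F 0 = 0 -> coef F 1 != 0 ->
  exists a b, ((a != 0) || (b != 0)) /\ equivalent F (quartic_W a b).
Proof.
move=> cF c0 c1.
have n4 : (4 : K) != 0 by rewrite pnatr_eq0.
have n2 : (2 : K) != 0 by rewrite pnatr_eq0.
pose u := - coef F 2 / (2 * coef F 1); pose k := (4 * coef F 1)^-1.
have k0 : k != 0 by rewrite invr_eq0 mulf_neq0.
pose G := k *: substitute (mat2 1 u 0 1) F.
have eFG : equivalent F G.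
  by exists k, (mat2 1 u 0 1); split=> //; apply: unit_mat2; rewrite mulr1 mulr0 subr0 oner_eq0.
have eG : G = quartic_W (4 * coef G 3) (coef G 4).
  apply: quartic_coef_ext => i i5; rewrite quartic_coef_W//.
  case: i i5 => [|[|[|[|[|i]]]]] // _; rewrite /= ?quartic_coef_scaled// /quartic_subst /= ?c0.
  - ring.
  - by rewrite /k; field.
  - by rewrite /u; field.
  - by field.
move: (4 * coef G 3) (coef G 4) eG => al be eG.
exists al, be; rewrite -eG; split=> //.
rewrite (class_of_equivalent eFG) in cF.
have [i i5 /andP[i1 ci]] := quartic_monomial_unstable cF (isT : (1 < 5)%N).
move: ci; rewrite eG quartic_coef_W//.
case: i i5 i1 => [|[|[|[|[|i]]]]] //= _ _; rewrite ?eqxx//.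
  by rewrite mulf_eq0 negb_or => /andP[->].
by move=> ->; rewrite orbT.
Qed.

(** A form all of whose roots are multiple, or with a triple root, is a monomial in suitable
    coordinates, so its stabilizer is infinite. Otherwise there is a simple root, which is moved to
    infinity. *)
Lemma quartic_normal_form F p : class_of F = Some p ->
  exists a b, ((a != 0) || (b != 0)) /\ equivalent F (quartic_W a b).
Proof.
suff main F1 q : class_of F1 = Some q -> coef F1 0 = 0 ->
    exists a b, ((a != 0) || (b != 0)) /\ equivalent F1 (quartic_W a b).
  move=> cF; have [c0|c0] := eqVneq (coef F 0) 0; first exact: main cF c0.
  have [r hr] := root_quartic (4 * coef F 1) (6 * coef F 2) (4 * coef F 3) (coef F 4) c0.
  have eF : equivalent F (substitute (mat2 r 1 1 0) F).
    by apply: equivalent_sub; apply: unit_mat2; rewrite mulr0 mulr1 sub0r oppr_eq0 oner_eq0.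
  have [||a [b [ab h]]] := main (substitute (mat2 r 1 1 0) F) p.
  - by rewrite -(class_of_equivalent eF).
  - by rewrite quartic_coef_subst// -hr /quartic_subst /=; ring.
  by exists a, b; split; [exact: ab|exact: equivalent_trans eF h].
clear F p; move=> cF c0.
have [c1|c1] := eqVneq (coef F1 1) 0; last exact: quartic_simple_root cF c0 c1.
have shift (u : K) : equivalent F1 (substitute (mat2 1 u 0 1) F1).
  by apply: equivalent_sub; apply: unit_mat2; rewrite mulr1 mulr0 subr0 oner_eq0.
have no (u : K) k : (k < 5)%N -> (forall i, (i < 5)%N -> i != k ->
    quartic_subst (coef F1) 1 u 0 1 i = 0) -> False.
  move=> k5 h; rewrite (class_of_equivalent (shift u)) in cF.
  have [i i5 /andP[ik]] := quartic_monomial_unstable cF k5.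
  by rewrite quartic_coef_subst// h// eqxx.
have n4 : (4 : K) != 0 by rewrite pnatr_eq0.
have n6 : (6 : K) != 0 by rewrite pnatr_eq0.
have [c2|c2] := eqVneq (coef F1 2) 0.
  exfalso; have [c3|c3] := eqVneq (coef F1 3) 0.
    apply: (no 0 4%N) => // i i5 i4; rewrite /quartic_subst.
    by case: i i5 i4 => [|[|[|[|[|i]]]]] //= _ _; rewrite c0 c1 c2 ?c3; ring.
  apply: (no (- coef F1 4 / (4 * coef F1 3)) 3%N) => // i i5 i4; rewrite /quartic_subst.
  by case: i i5 i4 => [|[|[|[|[|i]]]]] //= _ _; rewrite c0 c1 c2; field.
have [r hr] := root_quadratic (4 * coef F1 3) (coef F1 4) (mulf_neq0 n6 c2).
have [c3|c3] := eqVneq (3 * coef F1 2 * r + coef F1 3) 0.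
  exfalso; apply: (no r 2%N) => // i i5 i4; rewrite /quartic_subst.
  case: i i5 i4 => [|[|[|[|[|i]]]]] //= _ _; rewrite c0 c1.
  - ring.
  - ring.
  - by transitivity (3 * coef F1 2 * r + coef F1 3); [ring|exact: c3].
  - by rewrite -[RHS]hr; ring.
have eF : equivalent F1 (substitute (mat2 r 1 1 0) F1).
  by apply: equivalent_sub; apply: unit_mat2; rewrite mulr0 mulr1 sub0r oppr_eq0 oner_eq0.
have [|||a [b [ab h]]] := @quartic_simple_root (substitute (mat2 r 1 1 0) F1) q.
- by rewrite -(class_of_equivalent eF).
- rewrite quartic_coef_subst// /quartic_subst /= c0 c1.
  by rewrite -[RHS]hr; ring.
- rewrite quartic_coef_subst// /quartic_subst /= c0 c1.
  by apply: contraNneq c3 => <-; apply/eqP; ring.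
by exists a, b; split; [exact: ab|exact: equivalent_trans eF h].
Qed.

Lemma quartic_W_neq0 a b : quartic_W a b != 0.
Proof.
apply/negP => /eqP h; have := quartic_coef_W a b (isT : (1 < 5)%N).
rewrite h -(scale0r (quartic_W a b)) quartic_coefZ mul0r /= => /esym/eqP.
by rewrite mulf_eq0 oner_eq0 invr_eq0 pnatr_eq0.
Qed.

(** The marked points are the roots, and the chosen one is the point at infinity. A matrix that
    preserves the normal form and fixes infinity is triangular; comparing coefficients makes it
    diagonal, with a sixth root of 1 as the ratio of its entries. *)
Lemma quartic_W_class a b : (a != 0) || (b != 0) -> exists p, class_of (quartic_W a b) = Some p.
Proof.
move=> ab; have n4 : (4 : K) != 0 by rewrite pnatr_eq0.
apply: class_of_Some; first exact: quartic_W_neq0.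
pose P : {poly K} := 'X^3 + a *: 'X + b%:P.
have P0 : P != 0.
  apply/negP => /eqP /(congr1 (fun p : {poly K} => p`_3)) /eqP.
  by rewrite !coefD coefZ coefX coefC coefXn coef0 /= mulr0 !addr0 oner_eq0.
have h6 : ('X^6 - 1 : {poly K}) != 0.
  apply/negP => /eqP /(congr1 (fun p : {poly K} => p`_6)) /eqP.
  by rewrite coefB coefXn coefC coef0 /= subr0 oner_eq0.
exists (option K), ([set None] `|` Some @` [set x | root P x]),
  ((fun t => mat2 1 0 0 t) @` [set x | root ('X^6 - 1) x]),
  (fun A q => if q is Some r then invmx A 0 0 = r * invmx A 1 0 /\ invmx A 1 0 != 0
              else invmx A 1 0 = 0).
have inv_stab A (c : K) : A \in unitmx -> substitute A (quartic_W a b) = c *: quartic_W a b ->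
    substitute (invmx A) (quartic_W a b) = c^-1 *: quartic_W a b.
  by move=> uA h; have [] := stabilizer_inv (quartic_W_neq0 a b) uA h.
split.
- rewrite finite_setU; split; first exact: finite_set1.
  exact/finite_image/finite_roots.
- exact/finite_image/finite_roots.
- move=> A c uA /(inv_stab _ _ uA) h; set B := invmx A in h *.
  have : ev (substitute B (quartic_W a b)) (vec2 1 0) = 0.
    by rewrite h evZ ev_quartic_W mul0r mulr0.
  rewrite {1}(mat2E B) ev_subst mul_mat2_vec2 !mulr1 !mulr0 !addr0 ev_quartic_W.
  have [B10|B10] := eqVneq (B 1 0) 0.
    by move=> _; exists None => //; left.
  move=> /eqP; rewrite mulf_eq0 (negPf B10) /= => /eqP e.
  exists (Some (B 0 0 / B 1 0)); last by rewrite divfK.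
  right; exists (B 0 0 / B 1 0) => //=.
  rewrite /root /P !hornerE /= -[X in X == _](mulfK (expf_neq0 3 B10)) mulf_eq0.
  by apply/orP; left; rewrite -e; apply/eqP; field.
move=> A B c c' q uA hA uB hB _ kA kB.
pose N := B *m invmx A.
have uN : N \in unitmx by rewrite unitmx_mul uB unitmx_inv.
have hN : substitute N (quartic_W a b) = (c' * c^-1) *: quartic_W a b.
  by rewrite /N -substituteM hB substituteZr (inv_stab _ _ uA hA) scalerA.
have N10 : N 1 0 = 0.
  have e1 : A *m (invmx A *m vec2 1 0) = vec2 1 0 by rewrite mulKVmx.
  have e2 : B *m (invmx B *m vec2 1 0) = vec2 1 0 by rewrite mulKVmx.
  have e3 : N *m vec2 1 0 = B *m (invmx A *m vec2 1 0) by rewrite mulmxA.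
  have [k ek] : exists k : K, invmx A *m vec2 1 0 = k *: (invmx B *m vec2 1 0).
    rewrite (mat2E (invmx A)) (mat2E (invmx B)) !mul_mat2_vec2 !mulr1 !mulr0 !addr0.
    have col0 (D : 'M[K]_2) : D \in unitmx -> D 1 0 = 0 -> D 0 0 != 0.
      move=> uD D10; move: uD; rewrite (mat2E D) unitmxE unitfE det_mat2 D10 mulr0 subr0.
      by rewrite !mxE /= mulf_eq0 negb_or => /andP[].
    have vec2Z k x z : k *: vec2 x z = vec2 (k * x) (k * z) :> 'cV[K]_2.
      by apply/matrixP => i j; rewrite !mxE; case: ifP.
    have uB' : invmx B \in unitmx by rewrite unitmx_inv.
    case: q kA kB => [r [a0 a1] [b0 b1]|kA kB].
      by exists (invmx A 1 0 / invmx B 1 0); rewrite vec2Z a0 b0 mulrCA !divfK// mulrC.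
    exists (invmx A 0 0 / invmx B 0 0); rewrite vec2Z kA kB mulr0 divfK//.
    exact: col0.
  move: e3; rewrite ek -scalemxAr e2 => /matrixP/(_ 1 0).
  by rewrite (mat2E N) mul_mat2_vec2 !mxE /= mulr1 mulr0 addr0 mulr0.
have hc i : (i < 5)%N -> quartic_subst (coef (quartic_W a b)) (N 0 0) (N 0 1) 0 (N 1 1) i =
    c' * c^-1 * coef (quartic_W a b) i.
  by move=> i5; rewrite -quartic_coef_subst// -N10 -mat2E hN quartic_coefZ.
have [p0 s0] : N 0 0 != 0 /\ N 1 1 != 0.
  move: uN; rewrite (mat2E N) unitmxE unitfE det_mat2 N10 mulr0 subr0.
  by rewrite !mxE /= mulf_eq0 negb_or => /andP[].
have BN : B = N *m A by rewrite /N mulmxKV.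
move: (c' * c^-1) hc => k hc.
have := hc 4%N isT; have := hc 3%N isT; have := hc 2%N isT; have := hc 1%N isT.
rewrite /quartic_subst /= !quartic_coef_W//=; clear hc hN.
move: BN N10 p0 s0; move eN : N => M; rewrite {1}(mat2E M).
move: (M 0 0) (M 0 1) (M 1 0) (M 1 1) => p u r s BN r0 p0 s0 h1 h2 h3 h4.
rewrite {}r0 in BN.
have k1 : p ^+ 3 * s = k.
  by apply: (mulIf (_ : 1 / 4 != 0)); [rewrite mulf_neq0 ?oner_eq0 ?invr_eq0|rewrite -h1; ring].
have u0 : u = 0.
  have : p ^+ 2 * u * s = 0 by transitivity (2 * (k * 0)); [rewrite -h2; field|rewrite !mulr0].
  by move/eqP; rewrite !mulf_eq0 (negPf p0) (negPf s0) /= orbF => /eqP.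
have e3 : a * (p * s ^+ 3 - p ^+ 3 * s) = 0.
  rewrite k1; move: h3; rewrite u0 => h3.
  by transitivity (4 * (k * (a / 4)) - a * k); [rewrite -h3; field|field].
have e4 : b * (s ^+ 4 - p ^+ 3 * s) = 0.
  by rewrite k1; move: h4; rewrite u0 => h4; transitivity (k * b - b * k); [rewrite -h4; ring|ring].
exists (mat2 1 0 0 (s / p)).
  exists (s / p) => //=; rewrite /root !hornerE subr_eq0; apply/eqP.
  case/orP: ab => z0.
    have : s ^+ 2 = p ^+ 2.
      move/eqP: e3; rewrite mulf_eq0 (negPf z0) /= => /eqP e3.
      by apply: (mulfI (mulf_neq0 p0 s0)); apply/eqP; rewrite -subr_eq0 -[X in _ == X]e3; apply/eqP; ring.
    by move=> h; rewrite expr_div_n (exprM s 2 3) h -exprM divff// expf_neq0.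
  have : s ^+ 3 = p ^+ 3.
    move/eqP: e4; rewrite mulf_eq0 (negPf z0) /= => /eqP e4.
    by apply: (mulfI s0); apply/eqP; rewrite -subr_eq0 -[X in _ == X]e4; apply/eqP; ring.
  by move=> h; rewrite expr_div_n (exprM s 3 2) h -exprM divff// expf_neq0.
exists p => //; rewrite BN u0 scalemxAl; congr (_ *m _).
apply/matrixP => i j; rewrite !mxE; do 2 case: ifP => _; rewrite ?mulr1 ?mulr0//.
by rewrite mulrC divfK.
Qed.

End QuarticClasses.

(** * The family of binary quartics *)

Lemma homog_var (K : numClosedFieldType) n (i : 'I_n) :
  (mpolyX K (mnm1 i) : mpoly n K) \is ishomog1 1 mdeg.
Proof. by rewrite dhomogX /= mdeg1. Qed.

Lemma homog_varX (K : numClosedFieldType) n (i : 'I_n) k :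
  (mpolyX K (mnm1 i) ^+ k : mpoly n K) \is ishomog1 k mdeg.
Proof. by rewrite -[X in ishomog1 X]mul1n; apply: dhomogMn; exact: homog_var. Qed.

Lemma weierstrass_quarticE (K : numClosedFieldType) (a b : K) :
  weierstrass_quartic a b = quartic_W a b.
Proof.
apply: quartic_ext => x z; rewrite ev_quartic_W /weierstrass_quartic.
set X := mpolyX K (mnm1 0); set Z := mpolyX K (mnm1 (1 : 'I_2)).
have hX k : X ^+ k \is ishomog1 k mdeg := @homog_varX K 2 0 k.
have hZ k : Z ^+ k \is ishomog1 k mdeg := @homog_varX K 2 1 k.
have h1 : X * Z ^+ 2 \is ishomog1 3 mdeg := dhomogM (hX 1%N) (hZ 2%N).
have h3 : X ^+ 3 + a *: (X * Z ^+ 2) + b *: Z ^+ 3 \is ishomog1 3 mdeg.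
  by apply: rpredD; [apply: rpredD; [exact: hX|exact: rpredZ]|exact: rpredZ].
have h : Z * (X ^+ 3 + a *: (X * Z ^+ 2) + b *: Z ^+ 3) \is ishomog1 4 mdeg.
  exact: (dhomogM (hZ 1%N) h3).
have mX k : meval (fun i => vec2 x z i 0) (X ^+ k) = x ^+ k.
  by rewrite rmorphXn /= mevalXU mxE.
have mZ k : meval (fun i => vec2 x z i 0) (Z ^+ k) = z ^+ k.
  by rewrite rmorphXn /= mevalXU mxE.
have mX1 : meval (fun i => vec2 x z i 0) X = x := mX 1%N.
have mZ1 : meval (fun i => vec2 x z i 0) Z = z := mZ 1%N.
rewrite ev_form_of// (mevalM _ Z) !mevalD !mevalZ (mevalM _ X (Z ^+ 2)) !mX !mZ mX1 mZ1.
by rewrite mulrA.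
Qed.

Section DiscriminantSmall.
Context {R : realType} {C : complexField R} {n d : nat}.
Local Notation form := (form C n d).

(** Deleting from [H] its small coefficients of index in [I] gives a form where [D] vanishes, and
    [D] is Lipschitz on bounded sets. *)
Lemma small_coefs (D : form -> C) (coef : form -> nat -> C) (E : nat -> form) (I : seq nat) :
  polyfun D -> (forall i, polyfun (fun F => coef F i)) ->
  (forall H i, i \in I -> coef (H - \sum_(j <- I) coef H j *: E j) i = 0) ->
  (forall H, (forall i, i \in I -> coef H i = 0) -> D H = 0) ->
  forall M rho : R, 0 <= M -> 0 < rho -> exists2 eps : R, 0 < eps & forall H, nrm H <= M ->
    (forall i, i \in I -> nrm (coef H i) <= eps) -> nrm (D H) < rho.
Proof.
move=> pD pc hcoef hD M rho M0 rho0.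
pose e := \sum_(j <- I) nrm (E j).
have e0 : 0 <= e by apply: sumr_ge0 => j _; exact: nrm_ge0.
have [L L0 hL] := polyfun_lip pD (M + e).
exists (Num.min 1 (rho / (L * e + 1))).
  by rewrite lt_min ltr01 divr_gt0// ltr_wpDl// mulr_ge0.
move=> H HM hH; set P := \sum_(j <- I) coef H j *: E j.
have nP (r : R) : 0 <= r -> (forall i, i \in I -> nrm (coef H i) <= r) -> nrm P <= r * e.
  move=> r0 hr; apply: le_trans (nrm_sum _ _ _) _; rewrite mulr_sumr !big_seq.
  by apply: ler_sum => j jI; rewrite nrmZ ler_wpM2r ?nrm_ge0 ?hr.
have nP1 : nrm P <= e.
  rewrite -[X in _ <= X]mul1r; apply: nP => // i /hH hi.
  by apply: le_trans hi _; rewrite ge_min lexx.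
have rl : 0 < rho / (L * e + 1) by rewrite divr_gt0// ltr_wpDl// mulr_ge0.
have nP2 : nrm P <= rho / (L * e + 1) * e.
  apply: nP => [|i /hH hi]; first exact: ltW.
  by apply: le_trans hi _; rewrite ge_min lexx orbT.
have h1 : nrm (H - P) <= M + e.
  by apply: le_trans (nrmD _ _) _; rewrite nrmN lerD.
have h2 : nrm H <= M + e by rewrite ler_wpDr.
have := hL _ _ h2 h1; rewrite (hD (H - P)) ?subr0; last by move=> i iI; exact: hcoef.
have -> : H - (H - P) = P by rewrite opprB addrC subrK.
move=> h; apply: le_lt_trans h _; apply: le_lt_trans (ler_wpM2l L0 nP2) _.
rewrite mulrCA mulrAC ltr_pdivrMr ?ltr_wpDl ?mulr_ge0//.
by rewrite ltr_pM2l// ltrDl.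
Qed.

End DiscriminantSmall.

Section QuarticFamily.
Context {R : realType} {C : complexField R}.
Local Notation form := (form C 1 4).
Implicit Types (F G : form) (v : 'cV[C]_2) (a b x z : C).
Local Notation coef := quartic_coef.

Lemma quartic_coefD F G i : coef (F + G) i = coef F i + coef G i.
Proof.
rewrite /quartic_coef !evD; case: i => [|[|[|[|[|i]]]]] /=; by [ring|rewrite nth_nil addr0].
Qed.

Definition quartic_W0 : form := quartic (fun i => [:: 0; 1 / 4]`_i).
Definition quartic_W1 : form := quartic (fun i => [:: 0; 0; 0; 1 / 4]`_i).
Definition quartic_W2 : form := quartic (fun i => [:: 0; 0; 0; 0; 1]`_i).

Lemma four_neq0 : (4 : C) != 0. Proof. by rewrite pnatr_eq0. Qed.

Lemma quartic_W_split a b : quartic_W0 + a *: quartic_W1 + b *: quartic_W2 = quartic_W a b.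
Proof.
apply: quartic_ext => x z; rewrite !evD !evZ !ev_quartic_form /quartic_val /=; ring.
Qed.

Lemma quartic_separates : @separates_forms R C 1 4.
Proof. by move=> F G h; apply: quartic_ext => x z; exact: h. Qed.

Lemma polyfun_ev n d (v : 'cV[C]_n.+1) : polyfun (fun F : Defs.form C n d => ev F v).
Proof.
have l : linear (fun F : Defs.form C n d => ev F v) by move=> k F G; rewrite evD evZ.
by apply: polyfun_lin => //; exact: linear_bounded.
Qed.

Lemma polyfun_quartic_coef i : polyfun (fun F => coef F i).
Proof.
rewrite /quartic_coef; case: i => [|[|[|[|[|i]]]]] /=; repeat first
  [exact: polyfun_ev | exact: polyfun_cst
  | apply: polyfunD | apply: polyfunN | apply: polyfunM | apply: polyfunX].
Qed.

Lemma polyfun_quartic_S : polyfun (@quartic_S C).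
Proof.
rewrite /quartic_S /quartic_I; repeat first
  [exact: polyfun_quartic_coef | exact: polyfun_cst
  | apply: polyfunD | apply: polyfunN | apply: polyfunM | apply: polyfunX].
Qed.

Lemma polyfun_quartic_T : polyfun (@quartic_T C).
Proof.
rewrite /quartic_T /quartic_J; repeat first
  [exact: polyfun_quartic_coef | exact: polyfun_cst
  | apply: polyfunD | apply: polyfunN | apply: polyfunM | apply: polyfunX].
Qed.

Lemma quartic_SW a b : quartic_S (quartic_W0 + a *: quartic_W1 + b *: quartic_W2) = a.
Proof.
have n4 := four_neq0.
by rewrite quartic_W_split /quartic_S /quartic_I !quartic_coef_W //=; field.
Qed.

Lemma quartic_TW a b : quartic_T (quartic_W0 + a *: quartic_W1 + b *: quartic_W2) = b.
Proof.
have n4 := four_neq0.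
by rewrite quartic_W_split /quartic_T /quartic_J !quartic_coef_W //=; field.
Qed.

Lemma nrm_mat2 (p q r s : C) (k : R) : nrm p <= k -> nrm q <= k -> nrm r <= k -> nrm s <= k ->
  nrm (mat2 p q r s) <= k.
Proof.
move=> hp hq hr hs; apply/nrm_mx_le; first exact: le_trans (nrm_ge0 _) hp.
by move=> i j; rewrite mxE; do 2 case: ifP => _.
Qed.

Lemma invmx_eq m (A B : 'M[C]_m.+1) : A *m B = 1%:M -> A \in unitmx /\ invmx A = B.
Proof.
move=> h; have [uA _] := mulmx1_unit h; split=> //.
by rewrite -[LHS]mulmx1 -h mulKmx.
Qed.

Lemma mul_mat2 (p q r s p' q' r' s' : C) : mat2 p q r s *m mat2 p' q' r' s' =
  mat2 (p * p' + q * r') (p * q' + q * s') (r * p' + s * r') (r * q' + s * s').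
Proof.
apply/matrixP => i j; rewrite !mxE !big_ord_recl big_ord0 !mxE /= addr0.
by case: i => [[|[|i]] hi] //=; case: j => [[|[|j]] hj].
Qed.

Lemma mat2_1 : mat2 1 0 0 1 = 1%:M :> 'M[C]_2.
Proof.
by apply/matrixP => -[[|[|i]] hi] // [[|[|j]] hj] //; rewrite !mxE.
Qed.

Lemma quartic_torus (r : R) : exists K : R, forall s : C, s != 0 ->
    nrm s <= r -> nrm s^-1 <= r -> exists (A : 'M[C]_2) (c : C),
    [/\ c != 0, A \in unitmx, nrm A <= K /\ nrm (invmx A) <= K,
        c ^+ 1 * \det A ^+ 2 = s &
        forall a b, c *: substitute A (quartic_W0 + a *: quartic_W1 + b *: quartic_W2) =
          quartic_W0 + (s ^+ 2 * a) *: quartic_W1 + (s ^+ 3 * b) *: quartic_W2].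
Proof.
exists (`|r| + 1) => s s0 h1 h2; exists (mat2 1 0 0 s), s^-1.
have [|uA iA] := @invmx_eq 1 (mat2 1 0 0 s) (mat2 1 0 0 s^-1).
  by rewrite mul_mat2 !(mulr0, mul0r, mulr1, mul1r, addr0, add0r) mulfV// mat2_1.
have rr : r <= `|r| + 1 by rewrite ler_wpDr// ler_norm.
have r0 : 0 <= `|r| + 1 by rewrite addr_ge0.
have r1 : 1 <= `|r| + 1 by rewrite lerDr.
split=> //.
- by rewrite invr_eq0.
- by rewrite iA; split; apply: nrm_mat2; rewrite ?nrm1 ?nrm0//; exact: le_trans rr.
- by rewrite det_mat2; field.
move=> a b; rewrite !quartic_W_split; apply: quartic_ext => x z.
by rewrite evZ ev_subst mul_mat2_vec2 !ev_quartic_W; field.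
Qed.

Lemma dev_quartic_W a b x z (p q : C) : dev (quartic_W a b) (vec2 x z) (vec2 p q) =
  a * p * z ^+ 3 + 3 * a * q * x * z ^+ 2 + 4 * b * q * z ^+ 3 + 3 * p * x ^+ 2 * z + q * x ^+ 3.
Proof.
pose g1 := 3 * a * p * q * z ^+ 2 + 3 * a * q ^+ 2 * x * z + 6 * b * q ^+ 2 * z ^+ 2 + 3 * p ^+ 2 * x * z + 3 * p * q * x ^+ 2.
pose g2 := 3 * a * p * q ^+ 2 * z + a * q ^+ 3 * x + 4 * b * q ^+ 3 * z + p ^+ 3 * z + 3 * p ^+ 2 * q * x.
pose g3 := a * p * q ^+ 3 + b * q ^+ 4 + p ^+ 3 * q.
pose g h : C := (a * p * z ^+ 3 + 3 * a * q * x * z ^+ 2 + 4 * b * q * z ^+ 3 + 3 * p * x ^+ 2 * z + q * x ^+ 3) + h * (g1 + h * (g2 + h * g3)).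
have -> : a * p * z ^+ 3 + 3 * a * q * x * z ^+ 2 + 4 * b * q * z ^+ 3 + 3 * p * x ^+ 2 * z + q * x ^+ 3 = g 0 by rewrite /g mul0r addr0.
apply: (@dev_unique _ _ _ _ _ _ _ (ev (quartic_W a b) (vec2 x z)) g).
  have s1 : sdiffable (fun h : C => h) 0 by exists id; exact: sdiff_id.
  do 3!(apply: sdiffableD; [exact: sdiffable_cst|apply: sdiffableM; [exact: s1|]]).
  exact: sdiffable_cst.
move=> h.
have -> : vec2 x z + h *: vec2 p q = vec2 (x + h * p) (z + h * q).
  by apply/matrixP => i j; rewrite !mxE; case: ifP.
rewrite !ev_quartic_W /g /g1 /g2 /g3; ring.
Qed.

Lemma quartic_span a b G : exists (B : 'M[C]_2) (x y : C), forall v,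
  ev G v = dev (quartic_W0 + a *: quartic_W1 + b *: quartic_W2) v (B *m v) +
    x * ev quartic_W1 v + y * ev quartic_W2 v.
Proof.
have n4 := four_neq0; have n3 : (3 : C) != 0 by rewrite pnatr_eq0.
pose r := coef G 0; pose p := 4 * coef G 1 / 3.
pose q := (6 * coef G 2 - 3 * a * r) / 3.
exists (mat2 p q r 0), (4 * coef G 3 - a * p - 4 * b * r), (coef G 4 - a * q).
move=> v; rewrite quartic_W_split (vec2E v); move: (v 0 0) (v 1 0) => x z.
rewrite mul_mat2_vec2 dev_quartic_W ev_quartic !ev_quartic_form /quartic_val /= /q /p /r.
by field; rewrite ?n4 ?n3.
Qed.

Lemma quartic_euler a b : exists (c : C) (B : 'M[C]_2), forall v,
  2 * a * ev quartic_W1 v + 3 * b * ev quartic_W2 v =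
  c * ev (quartic_W0 + a *: quartic_W1 + b *: quartic_W2) v +
  dev (quartic_W0 + a *: quartic_W1 + b *: quartic_W2) v (B *m v).
Proof.
have n4 := four_neq0.
exists (-1), (mat2 0 0 0 1) => v.
rewrite quartic_W_split (vec2E v); move: (v 0 0) (v 1 0) => x z.
rewrite mul_mat2_vec2 dev_quartic_W ev_quartic_W !ev_quartic_form /quartic_val /=.
by field.
Qed.

Definition quartic_disc F := 4 * quartic_S F ^+ 3 + 27 * quartic_T F ^+ 2.

(** When the diagonal matrix in the criterion is nearly singular, the form [H] has small
    coefficients of [x^4] and [x^3 z]: it nearly has a double root. *)
Lemma quartic_stable F : quartic_disc F != 0 -> exists2 delta : R, 0 < delta &
    exists2 eta : R, 0 < eta & forall F1 F2 (A : 'M[C]_2) (c : C),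
      nrm (F1 - F) < delta -> nrm (F2 - F) < delta -> A \in unitmx -> c != 0 ->
      F2 = c *: substitute A F1 -> eta * nrm A ^+ 2 <= nrm (\det A).
Proof.
have pD : polyfun quartic_disc.
  rewrite /quartic_disc; apply: polyfunD; (apply: polyfunM; first exact: polyfun_cst);
  apply: polyfunX; [exact: polyfun_quartic_S|exact: polyfun_quartic_T].
apply: (@stable_of_flat R C 1 4 1 quartic_disc quartic_separates pD).
  move=> c A G; rewrite /quartic_disc quartic_SZ quartic_TZ quartic_S_subst quartic_T_subst /mu.
  move: (\det A) (quartic_S G) (quartic_T G) => u s t; ring.
move=> M k rho M1 k0 rho0.
have M0 : 0 <= M by exact: le_trans M1.
have [||eps eps0 heps] := @small_coefs R C 1 4 quartic_disc coef
    (fun i => quartic (fun j => (i == j)%:R)) [:: 0%N; 1%N] pD polyfun_quartic_coef _ _ M rho M0 rho0.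
- move=> H i iI.
  have e0 : coef (H - \sum_(j <- [:: 0%N; 1%N]) coef H j *: quartic (fun l => (j == l)%:R)) i =
      coef H i - \sum_(j <- [:: 0%N; 1%N]) coef H j * coef (quartic (fun l => (j == l)%:R)) i.
    rewrite !big_cons !big_nil !addr0; move: (coef H 0) (coef H 1) => u w.
    rewrite -scaleN1r quartic_coefD quartic_coefZ quartic_coefD !quartic_coefZ; ring.
  rewrite e0 !big_cons big_nil; move: iI; rewrite !inE => /orP[] /eqP->;
    rewrite !quartic_coef_form//=; ring.
- move=> H hH; have h0 : coef H 0 = 0 by apply: hH; rewrite inE.
  have h1 : coef H 1 = 0 by apply: hH; rewrite !inE orbT.
  rewrite /quartic_disc /quartic_S /quartic_T /quartic_I /quartic_J h0 h1; ring.
have [B B0 hB] : exists2 B : R, 0 < B & forall G, nrm G <= M ->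
    nrm (coef G 0) <= B /\ nrm (coef G 1) <= B.
  have [b0 b00 h0] := lip_bounded (polyfun_lip (polyfun_quartic_coef 0)) M0.
  have [b1 b10 h1] := lip_bounded (polyfun_lip (polyfun_quartic_coef 1)) M0.
  exists (b0 + b1); first exact: addr_gt0.
  move=> G hG; split; [apply: le_trans (h0 _ hG) _|apply: le_trans (h1 _ hG) _].
    by rewrite lerDl ltW.
  by rewrite lerDr ltW.
pose eta := Num.min 1 (eps * k / B).
have eta0 : 0 < eta by rewrite lt_min ltr01 divr_gt0// mulr_gt0.
exists eta => // H G c v nH nG v0 eG hmu hv hprod; apply: heps => // i iI.
pose t := nrm (v 0 1 / v 0 0).
have t0 : 0 <= t by exact: nrm_ge0.
have te : t <= eta.
  rewrite /t nrmM nrmV ler_pdivrMr ?nrm_gt0// -(ler_pM2l (_ : 0 < nrm (v 0 0))) ?nrm_gt0//.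
  move: hprod; rewrite !big_ord_recl big_ord0 mulr1 nrmM expr2 mulrCA.
  by have -> : lift 0 0 = 1 :> 'I_2 by exact: val_inj.
have [t1 tk] : t <= 1 /\ t <= eps * k / B.
  by split; apply: le_trans te _; rewrite /eta ge_min lexx ?orbT.
have dv : diag_mx v = mat2 (v 0 0) 0 0 (v 0 1).
  by rewrite [LHS]mat2E !mxE /= !mulr1n !mulr0n.
rewrite dv in eG hmu.
have [m0 cE0 cE1] : [/\ @mu R C 1 1 c (mat2 (v 0 0) 0 0 (v 0 1)) != 0,
    coef H 0 = coef G 0 * (v 0 1 / v 0 0) ^+ 2 / @mu R C 1 1 c (mat2 (v 0 0) 0 0 (v 0 1)) &
    coef H 1 = coef G 1 * (v 0 1 / v 0 0) / @mu R C 1 1 c (mat2 (v 0 0) 0 0 (v 0 1))].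
  have m0 : @mu R C 1 1 c (mat2 (v 0 0) 0 0 (v 0 1)) != 0.
    by rewrite -nrm_gt0; exact: lt_le_trans hmu.
  have c0 : c != 0 by apply: contraNneq m0 => c0; rewrite /mu c0 expr1 mul0r.
  split=> //.
    rewrite eG quartic_coef_scaled// /mu det_mat2 /quartic_subst /=.
    by field; rewrite c0 !v0.
  rewrite eG quartic_coef_scaled// /mu det_mat2 /quartic_subst /=.
  by field; rewrite c0 !v0.
have [hB0 hB1] := hB _ nG.
have mk : (nrm (@mu R C 1 1 c (mat2 (v 0 0) 0 0 (v 0 1))))^-1 <= k^-1.
  by rewrite lef_pV2 ?posrE// nrm_gt0.
have Bt : B * t / k <= eps.
  by rewrite ler_pdivrMr// mulrC -ler_pdivlMr.
move: iI; rewrite !inE => /orP[] /eqP->; [rewrite cE0|rewrite cE1]; rewrite nrmM nrmV (nrmM (coef G _)).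
- apply: le_trans Bt; apply: ler_pM; rewrite ?mulr_ge0 ?invr_ge0 ?nrm_ge0//.
  apply: ler_pM; rewrite ?nrm_ge0// nrmX -/t expr2 ler_piMr//.
- apply: le_trans Bt; apply: ler_pM; rewrite ?mulr_ge0 ?invr_ge0 ?nrm_ge0//.
  apply: ler_pM; rewrite ?nrm_ge0//.
Qed.

Lemma quartic_unstable : exists F0 p0, [/\ class_of F0 = Some p0, quartic_disc F0 = 0 &
    forall delta eta : R, 0 < delta -> 0 < eta ->
      exists F1 (A : 'M[C]_2) (c : C),
      [/\ nrm (F1 - F0) < delta, A \in unitmx, substitute A F1 = c *: F1 &
          nrm (\det A) < eta * nrm A ^+ 2]].
Proof.
(* x^2 (z^2 - x^2) has a double root; its deformations x^2 z^2 - x^4 - t z^4 are preserved by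
   the exchange of x and u z when t = u^4, which is far from the identity when u is small. *)
have n6 : (6 : C) != 0 by rewrite pnatr_eq0.
have n12 : (12 : C) != 0 by rewrite pnatr_eq0.
pose F (t : C) : form := quartic (fun i => [:: -1; 0; 1 / 6; 0; - t]`_i).
have evF t x z : ev (F t) (vec2 x z) = x ^+ 2 * z ^+ 2 - x ^+ 4 - t * z ^+ 4.
  by rewrite ev_quartic_form /quartic_val /=; field.
have a0 : (-3 != 0 :> C) || (2 != 0 :> C) by rewrite pnatr_eq0 orbT.
have [p0 hp0] := quartic_W_class a0.
exists (F 0), p0; split.
- rewrite -hp0; apply: class_of_equivalent; exists 12^-1, (mat2 1 (-1) 1 5).
  split; first by rewrite invr_eq0.
    by apply: unit_mat2; have -> : 1 * 5 - -1 * 1 = 6 :> C by ring.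
  apply: quartic_ext => x z; rewrite evZ ev_subst mul_mat2_vec2 evF ev_quartic_W; by field.
- rewrite /quartic_disc /quartic_S /quartic_T /quartic_I /quartic_J !quartic_coef_form//=; by field.
move=> delta eta d0 e0.
pose E : form := quartic (fun i => [:: 0; 0; 0; 0; -1]`_i).
pose s : R := Num.min 1 (Num.min (delta / (nrm E + 1)) (eta / 2)).
have s0 : 0 < s by rewrite !lt_min ltr01 !divr_gt0// ltr_wpDl ?nrm_ge0.
have [s1 sd se] : [/\ s <= 1, s <= delta / (nrm E + 1) & s <= eta / 2].
  by rewrite /s !ge_min !lexx !orbT.
pose u : C := rl s.
have nu : nrm u = s by rewrite nrm_real gtr0_norm.
have u0 : u != 0 by rewrite -nrm_gt0 nu.
exists (F (u ^+ 4)), (mat2 0 u u^-1 0), 1; split.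
- have -> : F (u ^+ 4) - F 0 = u ^+ 4 *: E.
    apply: quartic_ext => x z; rewrite evB !evF evZ ev_quartic_form /quartic_val /=; ring.
  rewrite nrmZ nrmX nu; have h : nrm E < nrm E + 1 by rewrite ltrDl.
  have h4 : s ^+ 4 <= s by rewrite exprS ler_piMr ?(ltW s0)// exprn_ile1// ltW.
  apply: (@le_lt_trans _ _ (s * nrm E)); first by rewrite ler_wpM2r ?nrm_ge0.
  apply: (@lt_le_trans _ _ (s * (nrm E + 1))); first by rewrite ltr_pM2l.
  by rewrite -ler_pdivlMr// ltr_wpDl ?nrm_ge0.
- by apply: unit_mat2; rewrite mulfV// mul0r sub0r oppr_eq0 oner_eq0.
- rewrite scale1r; apply: quartic_ext => x z.
  by rewrite ev_subst mul_mat2_vec2 !evF; field.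
rewrite det_mat2 mulfV// mul0r sub0r nrmN nrm1.
have h : s^-1 <= nrm (mat2 0 u u^-1 0).
  have -> : s^-1 = nrm (mat2 0 u u^-1 0 1 0) by rewrite mxE /= nrmV nu.
  exact: nrm_mx_entry.
apply: (@lt_le_trans _ _ (eta * s^-1 ^+ 2)); last first.
  by rewrite ler_pM2l// lerXn2r ?nnegrE ?nrm_ge0 ?invr_ge0 ?(ltW s0).
rewrite exprVn ltr_pdivlMr ?exprn_gt0// mul1r; apply: (@le_lt_trans _ _ s).
  by rewrite expr2 ler_piMr// ltW.
by apply: le_lt_trans se _; rewrite ltr_pdivrMr// ltr_pMr// ltr1n.
Qed.

Definition quartic_family : weierstrass_family C 1 4 1.
Proof.
apply: (@WeierstrassFamily R C 1 4 1 quartic_W0 quartic_W1 quartic_W2 (@quartic_S C) (@quartic_T C)).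
- exact: quartic_separates.
- by [].
- by [].
- by move=> F; apply: polyfun_sdiffable; exact: polyfun_quartic_S.
- by move=> F; apply: polyfun_sdiffable; exact: polyfun_quartic_T.
- exact: quartic_S_subst.
- exact: quartic_T_subst.
- exact: quartic_SZ.
- exact: quartic_TZ.
- exact: quartic_SW.
- exact: quartic_TW.
- exact: quartic_torus.
- move=> F p cF; have [a [b [ab h]]] := quartic_normal_form cF.
  by exists a, b; rewrite quartic_W_split.
- move=> a b ab; rewrite quartic_W_split; exact: quartic_W_class.
- exact: quartic_span.
- exact: quartic_euler.
- exact: quartic_stable.
- exact: quartic_unstable.
Defined.

End QuarticFamily.

(** * Plane cubics: coefficients and the Aronhold invariants *)

(** The invariants of Aronhold, of degrees 4 and 6. Here [cijk] is the coefficient of [x^i y^j z^k]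
    divided by the multinomial coefficient. *)
Definition aronholdS (R : comNzRingType)
    (c300 c210 c201 c120 c111 c102 c030 c021 c012 c003 : R) : R :=
  - c300 * c120 * c021 * c003 + c300 * c120 * c012 ^+ 2 + c300 * c111 * c030
  * c003 - c300 * c111 * c021 * c012 - c300 * c102 * c030 * c012 + c300 *
  c102 * c021 ^+ 2 + c210 ^+ 2 * c021 * c003 - c210 ^+ 2 * c012 ^+ 2 - c210
  * c201 * c030 * c003 + c210 * c201 * c021 * c012 - c210 * c120 * c111 *
  c003 + c210 * c120 * c102 * c012 + 2 * c210 * c111 ^+ 2 * c012 - 3 * c210
  * c111 * c102 * c021 + c210 * c102 ^+ 2 * c030 + c201 ^+ 2 * c030 * c012 -
  c201 ^+ 2 * c021 ^+ 2 + c201 * c120 ^+ 2 * c003 - 3 * c201 * c120 * c111 *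
  c012 + c201 * c120 * c102 * c021 + 2 * c201 * c111 ^+ 2 * c021 - c201 *
  c111 * c102 * c030 - c120 ^+ 2 * c102 ^+ 2 + 2 * c120 * c111 ^+ 2 * c102 -
  c111 ^+ 4.

Definition aronholdT (R : comNzRingType)
    (c300 c210 c201 c120 c111 c102 c030 c021 c012 c003 : R) : R :=
  - c300 ^+ 2 * c030 ^+ 2 * c003 ^+ 2 + 6 * c300 ^+ 2 * c030 * c021 * c012 *
  c003 - 4 * c300 ^+ 2 * c030 * c012 ^+ 3 - 4 * c300 ^+ 2 * c021 ^+ 3 * c003
  + 3 * c300 ^+ 2 * c021 ^+ 2 * c012 ^+ 2 + 6 * c300 * c210 * c120 * c030 *
  c003 ^+ 2 - 18 * c300 * c210 * c120 * c021 * c012 * c003 + 12 * c300 *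
  c210 * c120 * c012 ^+ 3 - 12 * c300 * c210 * c111 * c030 * c012 * c003 +
  24 * c300 * c210 * c111 * c021 ^+ 2 * c003 - 12 * c300 * c210 * c111 *
  c021 * c012 ^+ 2 - 6 * c300 * c210 * c102 * c030 * c021 * c003 + 12 * c300
  * c210 * c102 * c030 * c012 ^+ 2 - 6 * c300 * c210 * c102 * c021 ^+ 2 *
  c012 - 6 * c300 * c201 * c120 * c030 * c012 * c003 + 12 * c300 * c201 *
  c120 * c021 ^+ 2 * c003 - 6 * c300 * c201 * c120 * c021 * c012 ^+ 2 - 12 *
  c300 * c201 * c111 * c030 * c021 * c003 + 24 * c300 * c201 * c111 * c030 *
  c012 ^+ 2 - 12 * c300 * c201 * c111 * c021 ^+ 2 * c012 + 6 * c300 * c201 *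
  c102 * c030 ^+ 2 * c003 - 18 * c300 * c201 * c102 * c030 * c021 * c012 +
  12 * c300 * c201 * c102 * c021 ^+ 3 - 4 * c300 * c120 ^+ 3 * c003 ^+ 2 +
  24 * c300 * c120 ^+ 2 * c111 * c012 * c003 + 12 * c300 * c120 ^+ 2 * c102
  * c021 * c003 - 24 * c300 * c120 ^+ 2 * c102 * c012 ^+ 2 - 36 * c300 *
  c120 * c111 ^+ 2 * c021 * c003 - 12 * c300 * c120 * c111 ^+ 2 * c012 ^+ 2
  - 12 * c300 * c120 * c111 * c102 * c030 * c003 + 60 * c300 * c120 * c111 *
  c102 * c021 * c012 + 12 * c300 * c120 * c102 ^+ 2 * c030 * c012 - 24 *
  c300 * c120 * c102 ^+ 2 * c021 ^+ 2 + 20 * c300 * c111 ^+ 3 * c030 * c003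
  + 12 * c300 * c111 ^+ 3 * c021 * c012 - 36 * c300 * c111 ^+ 2 * c102 *
  c030 * c012 - 12 * c300 * c111 ^+ 2 * c102 * c021 ^+ 2 + 24 * c300 * c111
  * c102 ^+ 2 * c030 * c021 - 4 * c300 * c102 ^+ 3 * c030 ^+ 2 - 4 * c210 ^+
  3 * c030 * c003 ^+ 2 + 12 * c210 ^+ 3 * c021 * c012 * c003 - 8 * c210 ^+ 3
  * c012 ^+ 3 + 12 * c210 ^+ 2 * c201 * c030 * c012 * c003 - 24 * c210 ^+ 2
  * c201 * c021 ^+ 2 * c003 + 12 * c210 ^+ 2 * c201 * c021 * c012 ^+ 2 + 3 *
  c210 ^+ 2 * c120 ^+ 2 * c003 ^+ 2 - 12 * c210 ^+ 2 * c120 * c111 * c012 *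
  c003 - 6 * c210 ^+ 2 * c120 * c102 * c021 * c003 + 12 * c210 ^+ 2 * c120 *
  c102 * c012 ^+ 2 - 12 * c210 ^+ 2 * c111 ^+ 2 * c021 * c003 + 24 * c210 ^+
  2 * c111 ^+ 2 * c012 ^+ 2 + 24 * c210 ^+ 2 * c111 * c102 * c030 * c003 -
  36 * c210 ^+ 2 * c111 * c102 * c021 * c012 - 24 * c210 ^+ 2 * c102 ^+ 2 *
  c030 * c012 + 27 * c210 ^+ 2 * c102 ^+ 2 * c021 ^+ 2 + 12 * c210 * c201 ^+
  2 * c030 * c021 * c003 - 24 * c210 * c201 ^+ 2 * c030 * c012 ^+ 2 + 12 *
  c210 * c201 ^+ 2 * c021 ^+ 2 * c012 - 6 * c210 * c201 * c120 ^+ 2 * c012 *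
  c003 + 60 * c210 * c201 * c120 * c111 * c021 * c003 - 36 * c210 * c201 *
  c120 * c111 * c012 ^+ 2 - 18 * c210 * c201 * c120 * c102 * c030 * c003 + 6
  * c210 * c201 * c120 * c102 * c021 * c012 - 36 * c210 * c201 * c111 ^+ 2 *
  c030 * c003 + 12 * c210 * c201 * c111 ^+ 2 * c021 * c012 + 60 * c210 *
  c201 * c111 * c102 * c030 * c012 - 36 * c210 * c201 * c111 * c102 * c021
  ^+ 2 - 6 * c210 * c201 * c102 ^+ 2 * c030 * c021 - 12 * c210 * c120 ^+ 2 *
  c111 * c102 * c003 + 12 * c210 * c120 ^+ 2 * c102 ^+ 2 * c012 + 12 * c210
  * c120 * c111 ^+ 3 * c003 + 12 * c210 * c120 * c111 ^+ 2 * c102 * c012 -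
  36 * c210 * c120 * c111 * c102 ^+ 2 * c021 + 12 * c210 * c120 * c102 ^+ 3
  * c030 - 24 * c210 * c111 ^+ 4 * c012 + 36 * c210 * c111 ^+ 3 * c102 *
  c021 - 12 * c210 * c111 ^+ 2 * c102 ^+ 2 * c030 - 4 * c201 ^+ 3 * c030 ^+
  2 * c003 + 12 * c201 ^+ 3 * c030 * c021 * c012 - 8 * c201 ^+ 3 * c021 ^+ 3
  - 24 * c201 ^+ 2 * c120 ^+ 2 * c021 * c003 + 27 * c201 ^+ 2 * c120 ^+ 2 *
  c012 ^+ 2 + 24 * c201 ^+ 2 * c120 * c111 * c030 * c003 - 36 * c201 ^+ 2 *
  c120 * c111 * c021 * c012 - 6 * c201 ^+ 2 * c120 * c102 * c030 * c012 + 12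
  * c201 ^+ 2 * c120 * c102 * c021 ^+ 2 - 12 * c201 ^+ 2 * c111 ^+ 2 * c030
  * c012 + 24 * c201 ^+ 2 * c111 ^+ 2 * c021 ^+ 2 - 12 * c201 ^+ 2 * c111 *
  c102 * c030 * c021 + 3 * c201 ^+ 2 * c102 ^+ 2 * c030 ^+ 2 + 12 * c201 *
  c120 ^+ 3 * c102 * c003 - 12 * c201 * c120 ^+ 2 * c111 ^+ 2 * c003 - 36 *
  c201 * c120 ^+ 2 * c111 * c102 * c012 + 12 * c201 * c120 ^+ 2 * c102 ^+ 2
  * c021 + 36 * c201 * c120 * c111 ^+ 3 * c012 + 12 * c201 * c120 * c111 ^+
  2 * c102 * c021 - 12 * c201 * c120 * c111 * c102 ^+ 2 * c030 - 24 * c201 *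
  c111 ^+ 4 * c021 + 12 * c201 * c111 ^+ 3 * c102 * c030 - 8 * c120 ^+ 3 *
  c102 ^+ 3 + 24 * c120 ^+ 2 * c111 ^+ 2 * c102 ^+ 2 - 24 * c120 * c111 ^+ 4
  * c102 + 8 * c111 ^+ 6.

Section AronholdInvariance.
Context {R : comNzRingType}.
Implicit Types (c : nat -> R) (t : R).

(** The symmetric trilinear form of a cubic. Its values on the columns of a matrix are the
    coefficients of the substituted cubic ([cubic_subst]). *)
Definition cubic_polar c x1 y1 z1 x2 y2 z2 x3 y3 z3 : R :=
  c 0%N * (x1 * x2 * x3) + c 1%N * (x1 * x2 * y3 + x1 * y2 * x3 + y1 * x2 * x3) + c 2%N *
  (x1 * x2 * z3 + x1 * z2 * x3 + z1 * x2 * x3) + c 3%N * (x1 * y2 * y3 + y1 * x2 * y3 + y1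
  * y2 * x3) + c 4%N * (x1 * y2 * z3 + x1 * z2 * y3 + y1 * x2 * z3 + y1 * z2 * x3 + z1 *
  x2 * y3 + z1 * y2 * x3) + c 5%N * (x1 * z2 * z3 + z1 * x2 * z3 + z1 * z2 * x3) + c 6%N *
  (y1 * y2 * y3) + c 7%N * (y1 * y2 * z3 + y1 * z2 * y3 + z1 * y2 * y3) + c 8%N * (y1 * z2
  * z3 + z1 * y2 * z3 + z1 * z2 * y3) + c 9%N * (z1 * z2 * z3).

Definition cubic_subst c px qx rx py qy ry pz qz rz (i : nat) : R :=
  let polar := cubic_polar c in
  [:: polar px py pz px py pz px py pz;
     polar px py pz px py pz qx qy qz;
     polar px py pz px py pz rx ry rz;
     polar px py pz qx qy qz qx qy qz;
     polar px py pz qx qy qz rx ry rz;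
     polar px py pz rx ry rz rx ry rz;
     polar qx qy qz qx qy qz qx qy qz;
     polar qx qy qz qx qy qz rx ry rz;
     polar qx qy qz rx ry rz rx ry rz;
     polar rx ry rz rx ry rz rx ry rz]`_i.

Definition cubic_Sc c : R := aronholdS (c 0%N) (c 1%N) (c 2%N) (c 3%N) (c 4%N) (c 5%N)
  (c 6%N) (c 7%N) (c 8%N) (c 9%N).
Definition cubic_Tc c : R := aronholdT (c 0%N) (c 1%N) (c 2%N) (c 3%N) (c 4%N) (c 5%N)
  (c 6%N) (c 7%N) (c 8%N) (c 9%N).

(** Invariance is checked by computation for matrices that generate all others: two transpositions,
    the scaling of [x], and one transvection. *)
Lemma aronhold_swap_xy c :
  cubic_Sc (cubic_subst c 0 1 0 1 0 0 0 0 1) = cubic_Sc c /\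
  cubic_Tc (cubic_subst c 0 1 0 1 0 0 0 0 1) = cubic_Tc c.
Proof.
rewrite /cubic_Sc /cubic_Tc /cubic_subst /cubic_polar /=.
rewrite !(mulr0, mul0r, mulr1, mul1r, addr0, add0r).
move: (c 0%N) (c 1%N) (c 2%N) (c 3%N) (c 4%N) (c 5%N) (c 6%N) (c 7%N) (c 8%N) (c 9%N).
by rewrite /aronholdS /aronholdT => *; split; ring.
Qed.

Lemma aronhold_swap_yz c :
  cubic_Sc (cubic_subst c 1 0 0 0 0 1 0 1 0) = cubic_Sc c /\
  cubic_Tc (cubic_subst c 1 0 0 0 0 1 0 1 0) = cubic_Tc c.
Proof.
rewrite /cubic_Sc /cubic_Tc /cubic_subst /cubic_polar /=.
rewrite !(mulr0, mul0r, mulr1, mul1r, addr0, add0r).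
move: (c 0%N) (c 1%N) (c 2%N) (c 3%N) (c 4%N) (c 5%N) (c 6%N) (c 7%N) (c 8%N) (c 9%N).
by rewrite /aronholdS /aronholdT => *; split; ring.
Qed.

Lemma aronhold_scale c t :
  cubic_Sc (cubic_subst c t 0 0 0 1 0 0 0 1) = t ^+ 4 * cubic_Sc c /\
  cubic_Tc (cubic_subst c t 0 0 0 1 0 0 0 1) = t ^+ 6 * cubic_Tc c.
Proof.
rewrite /cubic_Sc /cubic_Tc /cubic_subst /cubic_polar /=.
rewrite !(mulr0, mul0r, mulr1, mul1r, addr0, add0r).
move: (c 0%N) (c 1%N) (c 2%N) (c 3%N) (c 4%N) (c 5%N) (c 6%N) (c 7%N) (c 8%N) (c 9%N).
by rewrite /aronholdS /aronholdT => *; split; ring.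
Qed.

Lemma aronhold_shear c t :
  cubic_Sc (cubic_subst c 1 t 0 0 1 0 0 0 1) = cubic_Sc c /\
  cubic_Tc (cubic_subst c 1 t 0 0 1 0 0 0 1) = cubic_Tc c.
Proof.
rewrite /cubic_Sc /cubic_Tc /cubic_subst /cubic_polar /=.
rewrite !(mulr0, mul0r, mulr1, mul1r, addr0, add0r).
move: (c 0%N) (c 1%N) (c 2%N) (c 3%N) (c 4%N) (c 5%N) (c 6%N) (c 7%N) (c 8%N) (c 9%N).
by rewrite /aronholdS /aronholdT => *; split; ring.
Qed.

End AronholdInvariance.

Definition multinom3 (e : nat * nat * nat) : multinom 3 := Multinom [tuple e.1.1; e.1.2; e.2].
Definition exps3 : seq (nat * nat * nat) :=
  [:: (3, 0, 0); (2, 1, 0); (2, 0, 1); (1, 2, 0); (1, 1, 1); (1, 0, 2);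
      (0, 3, 0); (0, 2, 1); (0, 1, 2); (0, 0, 3)]%N.

Lemma multinom3_basis : @monomial_basis 2 3 _ exps3 multinom3.
Proof.
have i1 : lift 0 (0 : 'I_2) = 1 :> 'I_3 by exact: val_inj.
have i2 : lift 0 (lift 0 (0 : 'I_1)) = (2 : 'I_3) :> 'I_3 by exact: val_inj.
split=> //.
- move=> [[a b] c] [[a' b'] c'] h.
  have := congr1 (fun m : multinom 3 => (m 0, m 1, m (2 : 'I_3))) h.
  by [].
- move=> e; rewrite /exps3 !inE.
  by do 9?[case/orP=> [/eqP->|]; first by rewrite mdegE !big_ord_recl big_ord0];
    move/eqP->; rewrite mdegE !big_ord_recl big_ord0.
move=> m; rewrite mdegE !big_ord_recl big_ord0 addn0 i1 i2 => h.
exists (m 0, m 1, m (2 : 'I_3)).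
  move: h; move: (m 0) (m 1) (m (2 : 'I_3)) => a b c.
  by case: a => [|[|[|[|a]]]] //; case: b => [|[|[|[|b]]]] //; case: c => [|[|[|[|c]]]].
by apply/mnmP => -[[|[|[|i]]] hi] //; congr (m _); apply: val_inj.
Qed.

Section Vectors3.
Context {K : numClosedFieldType}.
Implicit Types (x y z : K).

Definition vec3 x y z : 'cV[K]_3 :=
  \col_(i < 3) (if val i == 0%N then x else if val i == 1%N then y else z).

Definition mat3 (px qx rx py qy ry pz qz rz : K) : 'M[K]_3 := \matrix_(i < 3, j < 3)
  (if val i == 0%N then (if val j == 0%N then px else if val j == 1%N then qx else rx)
   else if val i == 1%N then (if val j == 0%N then py else if val j == 1%N then qy else ry)
   else (if val j == 0%N then pz else if val j == 1%N then qz else rz)).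

Lemma vec3E (v : 'cV[K]_3) : v = vec3 (v 0 0) (v 1 0) (v (2 : 'I_3) 0).
Proof.
apply/matrixP => i j; rewrite !mxE ord1.
by case: i => [[|[|[|i]]] hi] //=; congr (v _ _); apply: val_inj.
Qed.

Lemma mat3E (A : 'M[K]_3) : A = mat3 (A 0 0) (A 0 1) (A 0 (2 : 'I_3)) (A 1 0) (A 1 1) (A 1 (2 : 'I_3))
  (A (2 : 'I_3) 0) (A (2 : 'I_3) 1) (A (2 : 'I_3) (2 : 'I_3)).
Proof.
apply/matrixP => i j; rewrite !mxE.
by case: i => [[|[|[|i]]] hi] //=; case: j => [[|[|[|j]]] hj] //=; congr (A _ _); apply: val_inj.
Qed.

Lemma mul_mat3_vec3 px qx rx py qy ry pz qz rz x y z :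
  mat3 px qx rx py qy ry pz qz rz *m vec3 x y z =
  vec3 (px * x + qx * y + rx * z) (py * x + qy * y + ry * z) (pz * x + qz * y + rz * z).
Proof.
apply/matrixP => i j; rewrite !mxE !big_ord_recl big_ord0 !mxE /= addr0 addrA.
by case: i => [[|[|[|i]]] hi].
Qed.

Lemma mul_mat3 a b c d e f g h i a' b' c' d' e' f' g' h' i' :
  mat3 a b c d e f g h i *m mat3 a' b' c' d' e' f' g' h' i' =
  mat3 (a * a' + b * d' + c * g') (a * b' + b * e' + c * h') (a * c' + b * f' + c * i')
       (d * a' + e * d' + f * g') (d * b' + e * e' + f * h') (d * c' + e * f' + f * i')
       (g * a' + h * d' + i * g') (g * b' + h * e' + i * h') (g * c' + h * f' + i * i').
Proof.
apply/matrixP => k l; rewrite !mxE !big_ord_recl big_ord0 !mxE /= addr0 addrA.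
by case: k => [[|[|[|k]]] hk] //; case: l => [[|[|[|l]]] hl].
Qed.

Lemma det_mat3 a b c d e f g h i : \det (mat3 a b c d e f g h i) =
  a * (e * i - f * h) - b * (d * i - f * g) + c * (d * h - e * g).
Proof.
rewrite (expand_det_row _ 0) !big_ord_recl big_ord0 addr0 /cofactor.
rewrite !(expand_det_row _ (0 : 'I_2)) !big_ord_recl !big_ord0 !addr0 /cofactor !det_mx11 !mxE /=.
rewrite /bump /=; ring.
Qed.

Lemma unit_mat3 a b c d e f g h i :
  a * (e * i - f * h) - b * (d * i - f * g) + c * (d * h - e * g) != 0 ->
  mat3 a b c d e f g h i \in unitmx.
Proof. by rewrite unitmxE unitfE det_mat3. Qed.

End Vectors3.

Section CubicForms.
Context {K : numClosedFieldType}.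
Local Notation form := (form K 2 3).
Implicit Types (F G : form) (c : nat -> K) (x y z : K).

Definition cubic_val c x y z :=
  c 0%N * x ^+ 3 + 3 * c 1%N * (x ^+ 2 * y) + 3 * c 2%N * (x ^+ 2 * z) +
  3 * c 3%N * (x * y ^+ 2) + 6 * c 4%N * (x * y * z) + 3 * c 5%N * (x * z ^+ 2) +
  c 6%N * y ^+ 3 + 3 * c 7%N * (y ^+ 2 * z) + 3 * c 8%N * (y * z ^+ 2) + c 9%N * z ^+ 3.

(** The multinomial coefficients, in the order of [exps3]. *)
Definition trinomial (i : nat) : K := [:: 1; 3; 3; 3; 6; 3; 1; 3; 3; 1]`_i.

Definition cubic c : form :=
  make_form exps3 multinom3 (fun e => trinomial (index e exps3) * c (index e exps3)).

Lemma ev_cubic_form c x y z : ev (cubic c) (vec3 x y z) = cubic_val c x y z.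
Proof.
rewrite (ev_make_form multinom3_basis) /exps3 !big_cons big_nil !big_ord_recl !big_ord0 !mxE /=.
rewrite /cubic_val /trinomial /=.
move: (c 0%N) (c 1%N) (c 2%N) (c 3%N) (c 4%N) (c 5%N) (c 6%N) (c 7%N) (c 8%N) (c 9%N).
by move=> *; ring.
Qed.

(** The coefficients, divided by multinomial coefficients, in terms of the values at ten points. *)
Definition cubic_coef F (i : nat) : K :=
  let f x y z := ev F (vec3 x y z) in
  let c0 := f 1 0 0 in let c6 := f 0 1 0 in let c9 := f 0 0 1 in
  let c1 := (f 1 1 0 - f 1 (-1) 0 - 2 * c6) / 6 in
  let c3 := (f 1 1 0 + f 1 (-1) 0 - 2 * c0) / 6 in
  let c2 := (f 1 0 1 - f 1 0 (-1) - 2 * c9) / 6 in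
  let c5 := (f 1 0 1 + f 1 0 (-1) - 2 * c0) / 6 in
  let c7 := (f 0 1 1 - f 0 1 (-1) - 2 * c9) / 6 in
  let c8 := (f 0 1 1 + f 0 1 (-1) - 2 * c6) / 6 in
  let c4 := (f 1 1 1 - c0 - 3 * c1 - 3 * c2 - 3 * c3 - 3 * c5 - c6 - 3 * c7 - 3 * c8 - c9) / 6 in
  [:: c0; c1; c2; c3; c4; c5; c6; c7; c8; c9]`_i.

Lemma six_neq0 : (6 : K) != 0. Proof. by rewrite pnatr_eq0. Qed.

Lemma cubic_coef_uniq F c : (forall x y z, ev F (vec3 x y z) = cubic_val c x y z) ->
  forall i, (i < 10)%N -> cubic_coef F i = c i.
Proof.
have n6 := six_neq0.
move=> h; rewrite /cubic_coef !h /cubic_val.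
by case=> [|[|[|[|[|[|[|[|[|[|i]]]]]]]]]] // _ /=; field.
Qed.

Lemma form_coef_cubic F e : e \in exps3 ->
  form_coef multinom3 F e = trinomial (index e exps3) * cubic_coef F (index e exps3).
Proof.
have n6 := six_neq0; have n3 : (3 : K) != 0 by rewrite pnatr_eq0.
pose u e := form_coef multinom3 F e.
pose c i := u (nth (0, 0, 0)%N exps3 i) / trinomial i.
have h x y z : ev F (vec3 x y z) = cubic_val c x y z.
  rewrite (ev_expand multinom3_basis) /exps3 !big_cons big_nil !big_ord_recl !big_ord0 !mxE /=.
  rewrite -!/(u _) /cubic_val /c /trinomial /=.
  move: (u _) (u _) (u _) (u _) (u _) (u _) (u _) (u _) (u _) (u _).
  by move=> *; field.
have hc := cubic_coef_uniq h => he.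
have t0 : trinomial (index e exps3) != 0.
  move: he; rewrite /exps3 !inE; do 9?[case/orP=> [/eqP->|]; first by rewrite /trinomial /= ?oner_eq0].
  by move/eqP->; rewrite /trinomial /= oner_eq0.
by rewrite hc ?index_mem// /c nth_index// mulrC divfK.
Qed.

Lemma ev_cubic F x y z : ev F (vec3 x y z) = cubic_val (cubic_coef F) x y z.
Proof.
rewrite (ev_expand multinom3_basis) /exps3 !big_cons big_nil !form_coef_cubic//.
rewrite !big_ord_recl !big_ord0 !mxE /= /cubic_val /trinomial /=.
move: (cubic_coef F) => c.
move: (c 0%N) (c 1%N) (c 2%N) (c 3%N) (c 4%N) (c 5%N) (c 6%N) (c 7%N) (c 8%N) (c 9%N).
by move=> *; ring.
Qed.

Lemma cubic_ext F G : (forall x y z, ev F (vec3 x y z) = ev G (vec3 x y z)) -> F = G.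
Proof.
move=> h; apply: (form_coef_ext multinom3_basis) => e he; rewrite !form_coef_cubic//.
by rewrite /cubic_coef !h.
Qed.

Lemma cubic_coef_ext F G : (forall i, (i < 10)%N -> cubic_coef F i = cubic_coef G i) -> F = G.
Proof.
move=> h; apply: cubic_ext => x y z.
by rewrite !ev_cubic /cubic_val !h.
Qed.

Lemma cubic_coef_default F i : (10 <= i)%N -> cubic_coef F i = 0.
Proof. by move=> i10; rewrite /cubic_coef nth_default. Qed.

Lemma cubic_coefD F G i : cubic_coef (F + G) i = cubic_coef F i + cubic_coef G i.
Proof.
have [i10|i10] := ltnP i 10; last by rewrite !cubic_coef_default// addr0.
apply: (@cubic_coef_uniq _ (fun i => cubic_coef F i + cubic_coef G i)) => // x y z.
rewrite evD !ev_cubic /cubic_val; move: (cubic_coef F) (cubic_coef G) => c c'.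
ring.
Qed.

Lemma cubic_coefZ k F i : cubic_coef (k *: F) i = k * cubic_coef F i.
Proof.
have [i10|i10] := ltnP i 10; last by rewrite !cubic_coef_default// mulr0.
apply: (@cubic_coef_uniq _ (fun i => k * cubic_coef F i)) => // x y z.
rewrite evZ !ev_cubic /cubic_val; move: (cubic_coef F) => c.
ring.
Qed.

Lemma cubic_coef_form c i : (i < 10)%N -> cubic_coef (cubic c) i = c i.
Proof. by apply: cubic_coef_uniq => x y z; rewrite ev_cubic_form. Qed.

Lemma cubic_val_subst c px qx rx py qy ry pz qz rz x y z :
  cubic_val c (px * x + qx * y + rx * z) (py * x + qy * y + ry * z) (pz * x + qz * y + rz * z) =
  cubic_val (cubic_subst c px qx rx py qy ry pz qz rz) x y z.
Proof.
rewrite /cubic_val /cubic_subst /cubic_polar /=.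
move: (c 0%N) (c 1%N) (c 2%N) (c 3%N) (c 4%N) (c 5%N) (c 6%N) (c 7%N) (c 8%N) (c 9%N).
by move=> *; ring.
Qed.

Lemma cubic_coef_subst F px qx rx py qy ry pz qz rz i : (i < 10)%N ->
  cubic_coef (substitute (mat3 px qx rx py qy ry pz qz rz) F) i =
  cubic_subst (cubic_coef F) px qx rx py qy ry pz qz rz i.
Proof.
apply: cubic_coef_uniq => x y z.
by rewrite ev_subst mul_mat3_vec3 ev_cubic cubic_val_subst.
Qed.

End CubicForms.

(** * Plane cubics: normal form and stabilizers *)

Lemma lup_decomposition (K : fieldType) n (A : 'M[K]_n.+1) : exists P L U : 'M[K]_n.+1,
  [/\ is_perm_mx P, P *m A = L *m U,
    forall i j : 'I_n.+1, (i <= j)%N -> L i j = (i == j)%:R &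
    forall i j : 'I_n.+1, (j < i)%N -> U i j = 0].
Proof.
exists (cormen_lup A).1.1, (cormen_lup A).1.2, (cormen_lup A).2; split.
- exact: cormen_lup_perm.
- by have := cormen_lup_correct A; case: (cormen_lup A) => [[P L] U].
- exact: cormen_lup_lower.
- exact: cormen_lup_upper.
Qed.

Section CubicInvariants.
Context {K : numClosedFieldType}.
Local Notation form := (form K 2 3).
Implicit Types (F G : form) (c : nat -> K) (t : K) (A B : 'M[K]_3).
Local Notation coef := cubic_coef.

Definition cubic_S F := 27 * cubic_Sc (coef F).
Definition cubic_T F := 27 / 4 * cubic_Tc (coef F).

(** This property is stable under products, which reduces invariance to generators. *)
Definition invariant_under A := forall F,
  cubic_S (substitute A F) = \det A ^+ 4 * cubic_S F /\
  cubic_T (substitute A F) = \det A ^+ 6 * cubic_T F.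

Lemma invariant_underM A B : invariant_under A -> invariant_under B -> invariant_under (A *m B).
Proof.
move=> hA hB F; rewrite -substituteM (hB _).1 (hB _).2 (hA _).1 (hA _).2 det_mulmx.
by split; ring.
Qed.

Lemma invariant_underP (a b c d e f g h i : K) :
  (forall u, cubic_Sc (cubic_subst u a b c d e f g h i) =
    (a * (e * i - f * h) - b * (d * i - f * g) + c * (d * h - e * g)) ^+ 4 * cubic_Sc u) ->
  (forall u, cubic_Tc (cubic_subst u a b c d e f g h i) =
    (a * (e * i - f * h) - b * (d * i - f * g) + c * (d * h - e * g)) ^+ 6 * cubic_Tc u) ->
  invariant_under (mat3 a b c d e f g h i).
Proof.
move=> hS hT F; rewrite /cubic_S /cubic_T det_mat3.
rewrite {1}/cubic_Sc {1}/cubic_Tc !cubic_coef_subst//.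
rewrite -/(cubic_Sc (cubic_subst _ _ _ _ _ _ _ _ _ _)) -/(cubic_Tc (cubic_subst _ _ _ _ _ _ _ _ _ _)).
by rewrite hS hT; split; rewrite mulrCA.
Qed.

Lemma invariant_swap_xy : invariant_under (mat3 0 1 0 1 0 0 0 0 1).
Proof.
by apply: invariant_underP => u; [rewrite (aronhold_swap_xy u).1|rewrite (aronhold_swap_xy u).2]; ring.
Qed.

Lemma invariant_swap_yz : invariant_under (mat3 1 0 0 0 0 1 0 1 0).
Proof.
by apply: invariant_underP => u; [rewrite (aronhold_swap_yz u).1|rewrite (aronhold_swap_yz u).2]; ring.
Qed.

Lemma invariant_scale t : invariant_under (mat3 t 0 0 0 1 0 0 0 1).
Proof.
by apply: invariant_underP => u; [rewrite (aronhold_scale u t).1|rewrite (aronhold_scale u t).2]; ring.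
Qed.

Lemma invariant_shear t : invariant_under (mat3 1 t 0 0 1 0 0 0 1).
Proof.
by apply: invariant_underP => u; [rewrite (aronhold_shear u t).1|rewrite (aronhold_shear u t).2]; ring.
Qed.

Lemma invariant_under_eq A B : A = B -> invariant_under B -> invariant_under A.
Proof. by move=> ->. Qed.

Lemma congr_mat3 (a b c d e f g h i a' b' c' d' e' f' g' h' i' : K) :
  a = a' -> b = b' -> c = c' -> d = d' -> e = e' -> f = f' -> g = g' -> h = h' -> i = i' ->
  mat3 a b c d e f g h i = mat3 a' b' c' d' e' f' g' h' i'.
Proof. by do 9 move=> ->. Qed.

Lemma invariant_perm (s : 'S_3) : invariant_under (perm_mx s).
Proof.
have [ts -> _] := prod_tpermP s; elim: ts => [|[i j] ts IH].
  rewrite big_nil perm_mx1 => F; rewrite substitute1 det1 !expr1n !mul1r.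
  by [].
rewrite big_cons perm_mxM; apply: invariant_underM IH; rewrite /=.
have sw12 := invariant_underM invariant_swap_xy (invariant_underM invariant_swap_yz invariant_swap_xy).
have one : invariant_under (1%:M : 'M[K]_3).
  by move=> F; rewrite substitute1 det1 !expr1n !mul1r.
rewrite [perm_mx _]mat3E !mxE !permE /=.
move: sw12; rewrite !mul_mat3 !(mulr0, mul0r, mulr1, mul1r, addr0, add0r) => sw12.
have e1 : (1%:M : 'M[K]_3) = mat3 1 0 0 0 1 0 0 0 1 by rewrite [LHS]mat3E !mxE.
rewrite e1 in one.
case: i => [[|[|[|i]]] hi] //; case: j => [[|[|[|j]]] hj] //=;
  by [exact: one|exact: invariant_swap_xy|exact: invariant_swap_yz|exact: sw12].
Qed.

(** By the LU decomposition, every matrix is a product of permutation matrices, of matrices that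
    differ from the identity in one entry outside the diagonal, and of diagonal matrices with one
    arbitrary entry. Conjugation by transpositions yields all of these from the generators. *)
Lemma invariant_all A : invariant_under A.
Proof.
have sw := invariant_swap_xy; have sy := invariant_swap_yz.
pose conj (X Y : 'M[K]_3) := X *m (Y *m X).
have cj X Y : invariant_under X -> invariant_under Y -> invariant_under (conj X Y).
  by move=> hX hY; apply: invariant_underM => //; exact: invariant_underM.
have xy t : invariant_under (mat3 1 t 0 0 1 0 0 0 1) by exact: invariant_shear.
have xz t : invariant_under (mat3 1 0 t 0 1 0 0 0 1).
  apply: invariant_under_eq (cj _ _ sy (xy t)); rewrite /conj; (rewrite !mul_mat3; apply: congr_mat3; ring).
have yx t : invariant_under (mat3 1 0 0 t 1 0 0 0 1).
  apply: invariant_under_eq (cj _ _ sw (xy t)); rewrite /conj; (rewrite !mul_mat3; apply: congr_mat3; ring).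
have zx t : invariant_under (mat3 1 0 0 0 1 0 t 0 1).
  apply: invariant_under_eq (cj _ _ sy (yx t)); rewrite /conj; (rewrite !mul_mat3; apply: congr_mat3; ring).
have yz t : invariant_under (mat3 1 0 0 0 1 t 0 0 1).
  apply: invariant_under_eq (cj _ _ sw (xz t)); rewrite /conj; (rewrite !mul_mat3; apply: congr_mat3; ring).
have zy t : invariant_under (mat3 1 0 0 0 1 0 0 t 1).
  apply: invariant_under_eq (cj _ _ sy (yz t)); rewrite /conj; (rewrite !mul_mat3; apply: congr_mat3; ring).
have dx t : invariant_under (mat3 t 0 0 0 1 0 0 0 1) by exact: invariant_scale.
have dy t : invariant_under (mat3 1 0 0 0 t 0 0 0 1).
  apply: invariant_under_eq (cj _ _ sw (dx t)); rewrite /conj; (rewrite !mul_mat3; apply: congr_mat3; ring).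
have dz t : invariant_under (mat3 1 0 0 0 1 0 0 0 t).
  apply: invariant_under_eq (cj _ _ sy (dy t)); rewrite /conj; (rewrite !mul_mat3; apply: congr_mat3; ring).
have [P [L [U [hP eA hL hU]]]] := lup_decomposition A.
case/is_perm_mxP: hP => s eP.
have -> : A = perm_mx s^-1%g *m (L *m U).
  by rewrite -eA eP mulmxA -perm_mxM mulVg perm_mx1 mul1mx.
apply: invariant_underM; first exact: invariant_perm.
apply: invariant_underM.
  rewrite (mat3E L) (hL 0 0)// (hL 0 1)// (hL 0 (2 : 'I_3))// (hL 1 1)// (hL 1 (2 : 'I_3))//
    (hL (2 : 'I_3) (2 : 'I_3))//=; move: (L 1 0) (L (2 : 'I_3) 0) (L (2 : 'I_3) 1) => a b c.
  apply: invariant_under_eq (invariant_underM (yx a) (invariant_underM (zx b) (zy c))).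
  (rewrite !mul_mat3; apply: congr_mat3; ring).
rewrite (mat3E U) (hU 1 0)// (hU (2 : 'I_3) 0)// (hU (2 : 'I_3) 1)//=; move: (U 0 0) (U 0 1) (U 0 (2 : 'I_3)) (U 1 1) (U 1 (2 : 'I_3)) (U (2 : 'I_3) (2 : 'I_3)) => a b c d e f.
apply: invariant_under_eq (invariant_underM (dz f) (invariant_underM (yz e) (invariant_underM (xz c)
  (invariant_underM (dy d) (invariant_underM (xy b) (dx a)))))).
by rewrite !mul_mat3; apply: congr_mat3; ring.
Qed.

End CubicInvariants.

Lemma cube_eq0 (K : fieldType) (x : K) : x ^+ 3 = 0 -> x = 0.
Proof. by move/eqP; rewrite expf_eq0 /= => /eqP. Qed.

Section CubicClasses.
Context {K : numClosedFieldType}.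
Local Notation form := (form K 2 3).
Implicit Types (F G : form) (a b : K).
Local Notation coef := cubic_coef.

Lemma cubic_coef_scaled F (k a b c d e f g h i : K) j : (j < 10)%N ->
  coef (k *: substitute (mat3 a b c d e f g h i) F) j =
  k * cubic_subst (coef F) a b c d e f g h i j.
Proof. by move=> j10; rewrite cubic_coefZ cubic_coef_subst. Qed.

Definition cubic_W a b : form := cubic (fun i => [:: -1; 0; 0; 0; 0; - a / 3; 0; 1 / 3; 0; - b]`_i).

Lemma cubic_coef_W a b i : (i < 10)%N ->
  coef (cubic_W a b) i = [:: -1; 0; 0; 0; 0; - a / 3; 0; 1 / 3; 0; - b]`_i.
Proof. exact: cubic_coef_form. Qed.

Lemma three_neq0 : (3 : K) != 0. Proof. by rewrite pnatr_eq0. Qed.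

Lemma ev_cubic_W a b x y z : ev (cubic_W a b) (vec3 x y z) =
  y ^+ 2 * z - x ^+ 3 - a * x * z ^+ 2 - b * z ^+ 3.
Proof.
have n3 := three_neq0.
by rewrite ev_cubic_form /cubic_val /=; field.
Qed.

(** The weight of the monomial of index [i] under the one-parameter subgroup of exponents [w0],
    [w1], [w2]. *)
Definition cubic_weight (w0 w1 w2 i : nat) : nat :=
  let e := nth (0, 0, 0)%N exps3 i in (w0 * e.1.1 + w1 * e.1.2 + w2 * e.2)%N.

(** If all monomials of [F] had the same weight, a one-parameter group of diagonal matrices would
    preserve [F] up to scalars. *)
Lemma cubic_weight_unstable F p (w0 w1 w2 N : nat) : class_of F = Some p ->
  (w0 != w1) || (w1 != w2) ->
  exists2 i, (i < 10)%N & (cubic_weight w0 w1 w2 i != N) && (coef F i != 0).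
Proof.
move=> cF w; apply: contrapT => no.
have z i : (i < 10)%N -> cubic_weight w0 w1 w2 i != N -> coef F i = 0.
  move=> i5 ik; apply/eqP; apply: contrapT => h; apply: no; exists i => //.
  by rewrite ik; apply/negP.
suff : class_of F = None by rewrite cF.
apply: class_of_None; first exact: class_of_nonzero cF.
have n2 j : (2 ^+ j : K) != 0 by rewrite expf_neq0// pnatr_eq0.
exists (fun j => mat3 (2 ^+ j ^+ w0) 0 0 0 (2 ^+ j ^+ w1) 0 0 0 (2 ^+ j ^+ w2)); split.
- move=> j; apply: unit_mat3; rewrite !(mulr0, mul0r, subr0, addr0).
  by rewrite !mulf_neq0 ?expf_neq0.
- move=> j; exists ((2 ^+ j) ^+ N); apply: cubic_coef_ext => i i5.
  rewrite cubic_coef_subst// cubic_coefZ.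
  have e : cubic_subst (coef F) (2 ^+ j ^+ w0) 0 0 0 (2 ^+ j ^+ w1) 0 0 0 (2 ^+ j ^+ w2) i =
      (2 ^+ j) ^+ cubic_weight w0 w1 w2 i * coef F i.
    rewrite /cubic_weight !exprD !exprM; move: (2 ^+ j ^+ w0) (2 ^+ j ^+ w1) (2 ^+ j ^+ w2) => r s t.
    rewrite /cubic_subst /cubic_polar.
    by case: i i5 => [|[|[|[|[|[|[|[|[|[|i]]]]]]]]]] // _ /=; ring.
  by rewrite e; have [->//|ik] := eqVneq (cubic_weight w0 w1 w2 i) N; rewrite z// !mulr0.
move=> j l c /matrixP h; have := h (2 : 'I_3) (2 : 'I_3); have := h 1 1; have := h 0 0; rewrite !mxE /=.
move=> h0 h1 h2.
have key v v' : (2 ^+ j ^+ v) = c * (2 ^+ l ^+ v) -> (2 ^+ j ^+ v') = c * (2 ^+ l ^+ v') ->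
    v != v' -> j = l :> nat.
  move=> hw hw'; have : (2 ^+ j ^+ v) * (2 ^+ l ^+ v') = (2 ^+ j ^+ v') * (2 ^+ l ^+ v) :> K.
    by rewrite hw hw'; ring.
  rewrite -!exprM -!exprD -!natrX => /eqP; rewrite eqr_nat eqn_exp2l// => /eqP e ww.
  by nia.
by case/orP: w => hw; [exact: key h0 h1 hw|exact: key h1 h2 hw].
Qed.

Lemma cubic_equivalent F (a b c d e f g h i : K) :
  a * (e * i - f * h) - b * (d * i - f * g) + c * (d * h - e * g) != 0 ->
  equivalent F (substitute (mat3 a b c d e f g h i) F).
Proof. by move=> u; apply: equivalent_sub; exact: unit_mat3. Qed.

Definition has_normal_form F := exists a b, ((a != 0) || (b != 0)) /\ equivalent F (cubic_W a b).

Lemma has_normal_form_equivalent F G : equivalent F G -> has_normal_form G -> has_normal_form F.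
Proof. by move=> e [a [b [ab h]]]; exists a, b; split; [exact: ab|exact: equivalent_trans e h]. Qed.

(** The case of a smooth flex at (0:1:0) with tangent line [z = 0]. Completing the square in [y] and
    the cube in [x] leads to the Weierstrass form. *)
Lemma cubic_flex F p : class_of F = Some p -> coef F 6 = 0 -> coef F 3 = 0 -> coef F 1 = 0 ->
  coef F 0 != 0 -> coef F 7 != 0 -> has_normal_form F.
Proof.
move=> cF c6 c3 c1 c0 c7; have n3 := three_neq0; have n2 : (2 : K) != 0 by rewrite pnatr_eq0.
pose e := - coef F 4 / coef F 7; pose f0 := - coef F 8 / (2 * coef F 7).
pose u := coef F 2 + 2 * coef F 4 * e + coef F 7 * e ^+ 2.
pose m := - u / coef F 0; pose l := - coef F 0 / (3 * coef F 7); pose k := - (coef F 0)^-1.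
pose f := e * m + f0.
have l0 : l != 0 by rewrite /l mulf_neq0 ?invr_eq0 ?oppr_eq0// mulf_neq0.
have k0 : k != 0 by rewrite oppr_eq0 invr_eq0.
pose G := k *: substitute (mat3 1 0 (m * l) e 1 (f * l) 0 0 l) F.
have eFG : equivalent F G.
  exists k, (mat3 1 0 (m * l) e 1 (f * l) 0 0 l); split=> //.
  by apply: unit_mat3; rewrite !(mulr0, mul0r, mul1r, subr0, addr0).
have eG : G = cubic_W (- 3 * coef G 5) (- coef G 9).
  apply: cubic_coef_ext => i i5; rewrite cubic_coef_W//.
  case: i i5 => [|[|[|[|[|[|[|[|[|[|i]]]]]]]]]] // _ /=;
    rewrite ?cubic_coef_scaled// /cubic_subst /cubic_polar /= ?c6 ?c3 ?c1.
  - by rewrite /k; field.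
  - ring.
  - rewrite /f /f0 /m /u /e; field; rewrite ?c0 ?c7//.
  - ring.
  - by rewrite /e; field.
  - by field.
  - ring.
  - by rewrite /k /l; field; rewrite c0 c7.
  - by rewrite /f /f0 /e; field; rewrite ?c7.
  - by rewrite opprK.
move: (- 3 * coef G 5) (- coef G 9) eG => al be eG.
exists al, be; rewrite -eG; split=> //.
rewrite (class_of_equivalent eFG) in cF.
have [i i5 /andP[i1 ci]] := cubic_weight_unstable 6 cF (isT : (2%N != 3%N) || (3%N != 0%N)).
move: ci; rewrite eG cubic_coef_W//.
case: i i5 i1 => [|[|[|[|[|[|[|[|[|[|i]]]]]]]]]] //= _ _; rewrite ?eqxx//.
  by rewrite mulf_eq0 negb_or oppr_eq0 => /andP[->].
by rewrite oppr_eq0 => ->; rewrite orbT.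
Qed.

Definition singular_at_y F := [/\ coef F 6 = 0, coef F 3 = 0 & coef F 7 = 0].
Definition has_singular_point F := exists2 G, equivalent F G & singular_at_y G.

Lemma root_binary_quadratic (a b c : K) : exists x y : K,
  ((x != 0) || (y != 0)) /\ a * x ^+ 2 + b * x * y + c * y ^+ 2 = 0.
Proof.
have [->|a0] := eqVneq a 0.
  by exists 1, 0; split; [rewrite oner_eq0|ring].
have [x hx] := root_quadratic b c a0; exists x, 1.
by rewrite oner_eq0 orbT expr1n !mulr1.
Qed.

Lemma factor_binary_quadratic (a b c : K) : exists p q r s : K,
  forall x y, a * x ^+ 2 + b * x * y + c * y ^+ 2 = (p * x + q * y) * (r * x + s * y).
Proof.
have [a0|a0] := eqVneq a 0.
  by exists 0, 1, b, c => x y; rewrite a0; ring.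
have [t ht] := root_quadratic b c a0.
exists 1, (- t), a, (a * t + b) => x y.
have -> : c = - (a * t ^+ 2 + b * t) by apply/eqP; rewrite -addr_eq0 addrC ht.
ring.
Qed.

(** A cubic that contains the line [z = 0] is singular where this line meets the residual conic. *)
Lemma cubic_line_singular F : coef F 0 = 0 -> coef F 1 = 0 -> coef F 3 = 0 -> coef F 6 = 0 ->
  has_singular_point F.
Proof.
move=> c0 c1 c3 c6.
have [x [y [xy hxy]]] := root_binary_quadratic (coef F 2) (2 * coef F 4) (coef F 7).
have sing u v : x * v - y * u != 0 -> has_singular_point F.
  move=> uv; exists (substitute (mat3 0 x u 0 y v 1 0 0) F).
    apply: cubic_equivalent; rewrite !(mulr0, mul0r, mul1r, mulr1, subr0, addr0, add0r, sub0r).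
    by apply: contraNneq uv => h; apply/eqP; move: h; move=> <-; ring.
  split; rewrite cubic_coef_subst// /cubic_subst /cubic_polar /= c0 c1 c3 c6; try ring.
  by rewrite -[RHS]hxy; ring.
by case/orP: xy => h; [apply: (sing 0 1)|apply: (sing 1 0)];
  rewrite ?mulr0 ?mulr1 ?subr0 ?sub0r ?oppr_eq0.
Qed.

(** The singular cubics with finite stabilizer are nodal, and all equivalent to [x y z + x^3 + y^3].
    If the tangent cone is degenerate, or if a branch at the node is a line, then suitable
    coordinates make all monomials of equal weight for some one-parameter subgroup. *)
Lemma cubic_singular F p : class_of F = Some p -> has_singular_point F -> has_normal_form F.
Proof.
move=> cF [G eFG [g6 g3 g7]]; apply: (has_normal_form_equivalent eFG).
rewrite (class_of_equivalent eFG) in cF; clear F eFG.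
have n3 := three_neq0; have n2 : (2 : K) != 0 by rewrite pnatr_eq0.
have n6 : (6 : K) != 0 by rewrite pnatr_eq0.
have unstable w0 w1 w2 N H : equivalent G H -> (w0 != w1) || (w1 != w2) ->
    (forall i, (i < 10)%N -> cubic_weight w0 w1 w2 i != N -> coef H i = 0) -> False.
  move=> eGH w hH; have := cF; rewrite (class_of_equivalent eGH) => cH.
  have [i i10 /andP[h1 h2]] := cubic_weight_unstable N cH w.
  by move: h2; rewrite hH// eqxx.
have scale_cube (w : K) : exists u : K, u ^+ 3 = w by exists (3.-root w); exact: rootCK.
have [D|D] := eqVneq (coef G 4 ^+ 2) (coef G 1 * coef G 8).
  exfalso.
  have [H eGH [h6 h3 h7 h4 h8]] : exists2 H, equivalent G H & [/\ coef H 6 = 0, coef H 3 = 0,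
      coef H 7 = 0, coef H 4 = 0 & coef H 8 = 0].
    have [g8|g8] := eqVneq (coef G 8) 0.
      exists G; first exact: equivalent_refl.
      by split=> //; move/eqP: D; rewrite g8 mulr0 expf_eq0 => /eqP.
    pose u := - coef G 4 / coef G 8.
    have g1 : coef G 1 = coef G 4 ^+ 2 / coef G 8 by rewrite D mulfK.
    exists (substitute (mat3 0 0 1 0 1 0 1 0 u) G).
      apply: cubic_equivalent; rewrite !(mulr0, mul0r, mul1r, mulr1, subr0, addr0, add0r, sub0r).
      by rewrite oppr0 add0r oppr_eq0 oner_eq0.
    split; rewrite cubic_coef_subst// /cubic_subst /cubic_polar /= g6 g3 g7.
    - ring.
    - ring.
    - ring.
    - by rewrite /u; field.
    - by rewrite g1 /u; field.
  have [h1|h1] := eqVneq (coef H 1) 0.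
    apply: (unstable 0%N 1%N 0%N 0%N H eGH) => // i.
    by case: i => [|[|[|[|[|[|[|[|[|[|i]]]]]]]]]].
  pose sg := if coef H 9 == 0 then 0 else - coef H 5 / coef H 9.
  pose la := - (coef H 0 + 3 * coef H 2 * sg + 3 * coef H 5 * sg ^+ 2 + coef H 9 * sg ^+ 3) / (3 * coef H 1).
  pose m := - (coef H 2 + 2 * coef H 5 * sg + coef H 9 * sg ^+ 2) / coef H 1.
  pose H' := substitute (mat3 1 0 0 la 1 m sg 0 1) H.
  have eGH' : equivalent G H'.
    apply: equivalent_trans eGH _; apply: cubic_equivalent.
    by rewrite !(mulr0, mul0r, mul1r, mulr1, subr0, addr0) oner_eq0.
  have H'E i : (i < 10)%N -> coef H' i = [:: 0; coef H 1; 0; 0; 0; coef H 5 + coef H 9 * sg; 0; 0; 0; coef H 9]`_i.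
    move=> i10; rewrite /H' cubic_coef_subst// /cubic_subst /cubic_polar.
    case: i i10 => [|[|[|[|[|[|[|[|[|[|i]]]]]]]]]] // _ /=; rewrite h6 h3 h7 h4 h8; try ring.
      by rewrite /la; field; rewrite h1.
    by rewrite /m; field.
  have [h9|h9] := eqVneq (coef H 9) 0.
    apply: (unstable 0%N 2%N 1%N 2%N H' eGH') => // i i10; rewrite H'E//.
    by case: i i10 => [|[|[|[|[|[|[|[|[|[|i]]]]]]]]]] //= _ _; rewrite h9.
  apply: (unstable 0%N 6%N 2%N 6%N H' eGH') => // i i10; rewrite H'E//.
  case: i i10 => [|[|[|[|[|[|[|[|[|[|i]]]]]]]]]] //= _ _.
  by rewrite /sg (negPf h9); field.
have [q [r [s [t hq]]]] := factor_binary_quadratic (3 * coef G 1) (6 * coef G 4) (3 * coef G 8).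
have q1 : 3 * coef G 1 = q * s.
  by rewrite -[LHS]addr0 -[X in _ + X](mulr0 (6 * coef G 4)); have := hq 1 0; rewrite !(mulr1, mulr0, addr0, expr1n, expr0n) /= ?mulr0 ?addr0.
have q8 : 3 * coef G 8 = r * t.
  by have := hq 0 1; rewrite !(mulr1, mulr0, add0r, expr1n, expr0n) /= ?mulr0 ?mul0r ?add0r.
have q4 : 6 * coef G 4 = q * t + r * s.
  have := hq 1 1; rewrite !mulr1 !expr1n !mulr1 q1 q8 => h.
  by apply: (addrI (q * s)); apply: (addIr (r * t)); rewrite h; ring.
have dl : q * t - r * s != 0.
  have n36 : (36 : K) != 0 by rewrite pnatr_eq0.
  apply: contraNneq D => h; apply/eqP; apply: (mulfI n36).
  have -> : 36 * coef G 4 ^+ 2 = (6 * coef G 4) ^+ 2 by ring.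
  have -> : 36 * (coef G 1 * coef G 8) = 4 * ((3 * coef G 1) * (3 * coef G 8)) by ring.
  rewrite q1 q8 q4; have -> : q * t = r * s by apply/eqP; rewrite -subr_eq0 h.
  have e : r * s * (q * t - r * s) = 0 by rewrite h mulr0.
  by transitivity (4 * (r * s * (q * t - r * s)) + 4 * (q * s * (r * t)) + 4 * (r * s) ^+ 2 - 4 * (r * s * (q * t))); [rewrite e; ring|ring].
pose dd := q * t - r * s.
pose G1 := substitute (mat3 (t / dd) 0 (- r / dd) 0 1 0 (- s / dd) 0 (q / dd)) G.
have eG1 : equivalent G G1.
  apply: cubic_equivalent; rewrite !(mulr0, mul0r, mul1r, mulr1, subr0, addr0, add0r, sub0r).
  have -> : t / dd * (q / dd) + - r / dd * - (- s / dd) = dd^-1 by rewrite /dd; field.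
  by rewrite invr_eq0.
have g1 : coef G 1 = q * s / 3 by rewrite -q1 mulrC mulKf.
have g8 : coef G 8 = r * t / 3 by rewrite -q8 mulrC mulKf.
have g4 : coef G 4 = (q * t + r * s) / 6 by rewrite -q4 mulrC mulKf.
have G1E i : (i < 10)%N -> coef G1 i = [:: coef G1 0; 0; coef G1 2; 0; 1 / 6; coef G1 5; 0; 0; 0; coef G1 9]`_i.
  case: i => [|[|[|[|[|[|[|[|[|[|i]]]]]]]]]] // _ /=; rewrite {1}/G1;
    rewrite cubic_coef_subst// /cubic_subst /cubic_polar /= g1 g8 g4 g6 g3 g7; try ring.
  - by rewrite /dd; field; rewrite ?n3 ?n6.
  - by rewrite /dd; field; rewrite ?n3 ?n6.
  - by rewrite /dd; field; rewrite ?n3 ?n6.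
clearbody G1; clear dd g1 g8 g4.
pose G2 := substitute (mat3 1 0 0 (- 3 * coef G1 2) 1 (- 3 * coef G1 5) 0 0 1) G1.
have eG2 : equivalent G G2.
  apply: equivalent_trans eG1 _; apply: cubic_equivalent.
  by rewrite !(mulr0, mul0r, mul1r, mulr1, subr0, addr0) oner_eq0.
have G2E i : (i < 10)%N -> coef G2 i = [:: coef G1 0; 0; 0; 0; 1 / 6; 0; 0; 0; 0; coef G1 9]`_i.
  move=> i10; rewrite /G2 cubic_coef_subst// /cubic_subst /cubic_polar.
  have [e1 e3 e4] := And3 (G1E 1%N isT) (G1E 3%N isT) (G1E 4%N isT).
  have [e6 e7 e8] := And3 (G1E 6%N isT) (G1E 7%N isT) (G1E 8%N isT).
  rewrite /= in e1 e3 e4 e6 e7 e8; clear -e1 e3 e4 e6 e7 e8 n6 i10.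
  move: (coef G1) e1 e3 e4 e6 e7 e8 => u e1 e3 e4 e6 e7 e8.
  case: i i10 => [|[|[|[|[|[|[|[|[|[|i]]]]]]]]]] // _ /=; rewrite e1 e3 e4 e6 e7 e8;
    by [ring|field].
clearbody G2.
have [a0|a0] := eqVneq (coef G1 0) 0.
  exfalso; apply: (unstable 2%N 0%N 1%N 3%N G2 eG2) => // i i10; rewrite G2E//.
  by case: i i10 => [|[|[|[|[|[|[|[|[|[|i]]]]]]]]]] //= _ _; rewrite a0.
have [b0|b0] := eqVneq (coef G1 9) 0.
  exfalso; apply: (unstable 1%N 0%N 2%N 3%N G2 eG2) => // i i10; rewrite G2E//.
  by case: i i10 => [|[|[|[|[|[|[|[|[|[|i]]]]]]]]]] //= _ _; rewrite b0.
have [u u3] := scale_cube (coef G1 0); have [w w3] := scale_cube (coef G1 9).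
have u0 : u != 0 by apply: contraNneq a0 => e; rewrite -u3 e expr0n.
have w0 : w != 0 by apply: contraNneq b0 => e; rewrite -w3 e expr0n.
exists (- 1 / 3), (2 / 27); split.
  by rewrite mulf_neq0 ?invr_eq0 ?oppr_eq0 ?oner_eq0.
apply: equivalent_trans eG2 _.
have -> : cubic_W (- 1 / 3) (2 / 27) = substitute (mat3 (- 1 / 2) (1 / 2) (1 / 6) (- 3) 0 (- 3) (- 1 / 2) (- 1 / 2) (1 / 6))
    (substitute (mat3 u^-1 0 0 0 (u * w) 0 0 0 w^-1) G2).
  apply: cubic_ext => x y z; rewrite !ev_subst !mul_mat3_vec3 ev_cubic_W ev_cubic.
  rewrite /cubic_val !G2E//= -u3 -w3; field.
  by rewrite ?u0 ?w0 ?n2 ?n3 ?pnatr_eq0.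
apply: equivalent_trans; last first.
  apply: cubic_equivalent.
  have -> : - 1 / 2 * (0 * (1 / 6) - - 3 * (- 1 / 2)) - 1 / 2 * (- 3 * (1 / 6) - - 3 * (- 1 / 2)) +
    1 / 6 * (- 3 * (- 1 / 2) - 0 * (- 1 / 2)) = 2 :> K by field.
  by [].
apply: cubic_equivalent; rewrite !(mulr0, mul0r, mul1r, mulr1, subr0, addr0).
by rewrite !mulf_neq0 ?invr_eq0.
Qed.

(** Consider the curve [(2 y z + x^2)^2 = D], where [D = x^4 + d2 x^2 z^2 + d1 x z^3 + d0 z^4]. The
    line [2 y = u x + v z] meets it where [D = (x^2 + u x + v)^2] (with [z = 1]), and a flex amounts
    to [D - (x^2 + u x + v)^2 = - 2 u (x - e)^3]. Elimination of [v] and [e = f - u / 2] leaves this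
    equation for [u], of degree 9 after simplification and with a root other than 0 unless [D] is a
    square. *)
Lemma flex_polynomial_root (d2 d1 d0 : K) : (d1 != 0) || (d2 ^+ 2 != 4 * d0) ->
  exists2 u : K, u != 0 &
   6 * u * (5 / 4 * u ^+ 4 + 2 * d2 * u ^+ 2 - d1 * u + d2 ^+ 2 / 4 - d0) ^+ 2 =
   (- 13 / 3 * u ^+ 3 - 8 / 3 * d2 * u - d1 / 3) ^+ 2 * (u ^+ 3 / 2 + u * d2 - d1).
Proof.
have n3 := three_neq0; have n2 : (2 : K) != 0 by rewrite pnatr_eq0.
have n4 : (4 : K) != 0 by rewrite pnatr_eq0.
have [d10 /= h|d10 _] := eqVneq d1 0.
  have [u hu] := @solve_monicpoly K 8 (fun i => [::
      432 * d0 ^+ 2 - 216 * d2 ^+ 2 * d0 + 27 * d2 ^+ 4;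
      0;
      - 1728 * d2 * d0 - 80 * d2 ^+ 3;
      0;
      - 1080 * d0 + 78 * d2 ^+ 2;
      0;
      - 24 * d2;
      0]`_i) isT.
  exists u.
    apply: contraNneq h => u0; move: hu; rewrite u0 !big_ord_recl big_ord0 /= /bump /= => hu.
    have : (d2 ^+ 2 - 4 * d0) ^+ 2 = 0.
      have -> : (d2 ^+ 2 - 4 * d0) ^+ 2 = (27 * d2 ^+ 4 - 216 * d2 ^+ 2 * d0 + 432 * d0 ^+ 2) / 27.
        by field.
      rewrite [X in X / _](_ : _ = 0) ?mul0r//; move: hu; rewrite expr0n /= => hu.
      by rewrite [RHS]hu; ring.
    by move/eqP; rewrite expf_eq0 /= subr_eq0.
  apply/eqP; rewrite -subr_eq0; apply/eqP.
  have e : u ^+ 8 - \sum_(i < 8) [::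
      432 * d0 ^+ 2 - 216 * d2 ^+ 2 * d0 + 27 * d2 ^+ 4;
      0;
      - 1728 * d2 * d0 - 80 * d2 ^+ 3;
      0;
      - 1080 * d0 + 78 * d2 ^+ 2;
      0;
      - 24 * d2;
      0]`_i * u ^+ i = 0 by rewrite -hu subrr.
  transitivity (- u / 72 * (u ^+ 8 - \sum_(i < 8) [::
      432 * d0 ^+ 2 - 216 * d2 ^+ 2 * d0 + 27 * d2 ^+ 4;
      0;
      - 1728 * d2 * d0 - 80 * d2 ^+ 3;
      0;
      - 1080 * d0 + 78 * d2 ^+ 2;
      0;
      - 24 * d2;
      0]`_i * u ^+ i)); last by rewrite e mulr0.
  rewrite d10 !big_ord_recl big_ord0 /= /bump /=; field.
  by rewrite ?n3 ?n4 ?pnatr_eq0.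
have [u hu] := @solve_monicpoly K 9 (fun i => [::
      8 * d1 ^+ 3;
      432 * d0 ^+ 2 + 120 * d2 * d1 ^+ 2 - 216 * d2 ^+ 2 * d0 + 27 * d2 ^+ 4;
      864 * d1 * d0 + 168 * d2 ^+ 2 * d1;
      636 * d1 ^+ 2 - 1728 * d2 * d0 - 80 * d2 ^+ 3;
      - 336 * d2 * d1;
      - 1080 * d0 + 78 * d2 ^+ 2;
      168 * d1;
      - 24 * d2;
      0]`_i) isT.
exists u.
  apply: contraNneq d10 => u0; move: hu; rewrite u0 !big_ord_recl big_ord0 /= /bump /= expr0n /= => hu.
  apply/eqP; apply: cube_eq0; apply: (mulfI (_ : 8 != 0)); first by rewrite pnatr_eq0.
  by rewrite mulr0 [RHS]hu; ring.
apply/eqP; rewrite -subr_eq0; apply/eqP.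
have e : u ^+ 9 - \sum_(i < 9) [::
      8 * d1 ^+ 3;
      432 * d0 ^+ 2 + 120 * d2 * d1 ^+ 2 - 216 * d2 ^+ 2 * d0 + 27 * d2 ^+ 4;
      864 * d1 * d0 + 168 * d2 ^+ 2 * d1;
      636 * d1 ^+ 2 - 1728 * d2 * d0 - 80 * d2 ^+ 3;
      - 336 * d2 * d1;
      - 1080 * d0 + 78 * d2 ^+ 2;
      168 * d1;
      - 24 * d2;
      0]`_i * u ^+ i = 0 by rewrite -hu subrr.
transitivity (- 1 / 72 * (u ^+ 9 - \sum_(i < 9) [::
      8 * d1 ^+ 3;
      432 * d0 ^+ 2 + 120 * d2 * d1 ^+ 2 - 216 * d2 ^+ 2 * d0 + 27 * d2 ^+ 4;
      864 * d1 * d0 + 168 * d2 ^+ 2 * d1;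
      636 * d1 ^+ 2 - 1728 * d2 * d0 - 80 * d2 ^+ 3;
      - 336 * d2 * d1;
      - 1080 * d0 + 78 * d2 ^+ 2;
      168 * d1;
      - 24 * d2;
      0]`_i * u ^+ i)); last by rewrite e mulr0.
rewrite !big_ord_recl big_ord0 /= /bump /=; field.
by rewrite ?n3 ?n4 ?pnatr_eq0.
Qed.

(** The curve of [flex_polynomial_root], written with [4 z F = (2 y z + x^2)^2 - D]. If [D] is a
    square, it is singular. Otherwise [u] determines [e] and [v], hence a flex that is moved to
    (0:1:0). *)
Lemma cubic_depressed F p (d2 d1 d0 : K) : class_of F = Some p ->
  (forall i, (i < 10)%N -> coef F i =
    [:: 0; 1 / 3; - d2 / 12; 0; 0; - d1 / 12; 0; 1 / 3; 0; - d0 / 4]`_i) ->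
  has_normal_form F.
Proof.
move=> cF hF.
have n3 := three_neq0; have n2 : (2 : K) != 0 by rewrite pnatr_eq0.
have n4 : (4 : K) != 0 by rewrite pnatr_eq0.
have n12 : (12 : K) != 0 by rewrite pnatr_eq0.
have n6 : (6 : K) != 0 by rewrite pnatr_eq0.
have [nd|] := boolP ((d1 != 0) || (d2 ^+ 2 != 4 * d0)); last first.
  rewrite negb_or !negbK => /andP[/eqP d10 /eqP d20].
  apply: (cubic_singular cF).
  pose x0 := sqrtC (- d2 / 2).
  have e2 : d2 = - 2 * x0 ^+ 2 by rewrite /x0 sqrtCK; field.
  have e0 : d0 = x0 ^+ 4 by apply: (mulfI n4); rewrite -d20 e2; ring.
  exists (substitute (mat3 1 x0 0 0 (- x0 ^+ 2 / 2) 1 0 1 0) F).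
    apply: cubic_equivalent; rewrite !(mulr0, mul0r, mul1r, mulr1, subr0, addr0, add0r, sub0r).
    by rewrite oppr_eq0 oner_eq0.
  split; rewrite cubic_coef_subst// /cubic_subst /cubic_polar /= !hF//= d10 e0 e2; by field.
have [u u0 hu] := flex_polynomial_root nd.
pose A := 5 / 4 * u ^+ 4 + 2 * d2 * u ^+ 2 - d1 * u + d2 ^+ 2 / 4 - d0.
pose B := - 13 / 3 * u ^+ 3 - 8 / 3 * d2 * u - d1 / 3.
pose P := u ^+ 2 / 12 + d2 / 6 - d1 / (6 * u).
have AP : A ^+ 2 = B ^+ 2 * P.
  apply: (mulfI (mulf_neq0 n6 u0)); rewrite -/A -/B in hu; rewrite hu /P; field.
  by rewrite u0 ?n6 ?n12.
have [f f2 fA] : exists2 f : K, f ^+ 2 = P & A + f * B = 0.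
  have [B0|B0] := eqVneq B 0.
    exists (sqrtC P); first exact: sqrtCK.
    move/eqP: AP; rewrite B0 expr0n mul0r expf_eq0 /= => /eqP->.
    by rewrite mulr0 addr0.
  exists (- A / B); last by rewrite divfK// subrr.
  by rewrite expr_div_n sqrrN AP mulrAC mulfV ?mul1r// expf_neq0.
pose e := f - u / 2; pose v := (d2 - u ^+ 2 - 6 * u * e) / 2.
have ed1 : d1 = u ^+ 3 / 2 + u * d2 - 6 * u * f ^+ 2.
  by rewrite f2 /P; field; rewrite ?u0 ?n6 ?n12 ?n2.
have ed0 : d0 = 5 / 4 * u ^+ 4 + 2 * d2 * u ^+ 2 - d1 * u + d2 ^+ 2 / 4 + f * B.
  by apply/eqP; rewrite -subr_eq0 -oppr_eq0 -fA /A; apply/eqP; ring.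
have k2 : d2 = u ^+ 2 + 2 * v + 6 * u * e by rewrite /v; field.
have k1 : d1 = 2 * u * v - 6 * u * e ^+ 2 by rewrite ed1 /v /e; field; rewrite ?n2.
have k0 : d0 = v ^+ 2 + 2 * u * e ^+ 3.
  by rewrite ed0 /B ed1 /v /e; field; rewrite ?n2 ?n3 ?n4.
clearbody v e; clear ed1 ed0 fA f2 f AP P B A hu nd.
pose G := substitute (mat3 1 e 0 (u / 2) ((u * e + v) / 2) 1 0 1 0) F.
have eFG : equivalent F G.
  apply: cubic_equivalent; rewrite !(mulr0, mul0r, mul1r, mulr1, subr0, addr0, add0r, sub0r).
  by rewrite oppr_eq0 oner_eq0.
have G6 : coef G 6 = 0.
  by rewrite /G cubic_coef_subst// /cubic_subst /cubic_polar /= !hF//= k2 k1 k0; field; rewrite ?n2 ?n3 ?n4 ?n12.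
have G3 : coef G 3 = 0.
  by rewrite /G cubic_coef_subst// /cubic_subst /cubic_polar /= !hF//= k2 k1 k0; field; rewrite ?n2 ?n3 ?n4 ?n12.
have G1 : coef G 1 = 0.
  by rewrite /G cubic_coef_subst// /cubic_subst /cubic_polar /= !hF//= k2 k1 k0; field; rewrite ?n2 ?n3 ?n4 ?n12.
have G0 : coef G 0 = u / 2.
  by rewrite /G cubic_coef_subst// /cubic_subst /cubic_polar /= !hF//=; field; rewrite ?n2 ?n3 ?n4 ?n12.
apply: (has_normal_form_equivalent eFG).
rewrite (class_of_equivalent eFG) in cF.
have [G7|G7] := eqVneq (coef G 7) 0.
  by apply: (cubic_singular cF); exists G; [exact: equivalent_refl|].
by apply: (cubic_flex cF) => //; rewrite G0 mulf_neq0 ?invr_eq0.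
Qed.

(** A point of the curve is moved to (0:1:0) and its tangent line to [z = 0]. If it is neither
    singular nor a flex, the equation can be put in the form of [cubic_depressed], where a flex is
    found. *)
Lemma cubic_normal_form F p : class_of F = Some p -> has_normal_form F.
Proof.
move=> cF.
have n3 := three_neq0; have n2 : (2 : K) != 0 by rewrite pnatr_eq0.
have n4 : (4 : K) != 0 by rewrite pnatr_eq0.
have n12 : (12 : K) != 0 by rewrite pnatr_eq0.
(* Some point of the curve on the line z = 0 is moved to (0:1:0). *)
have [F1 eF1 f6] : exists2 F1, equivalent F F1 & coef F1 6 = 0.
  have [c0|c0] := eqVneq (coef F 0) 0.
    exists (substitute (mat3 0 1 0 1 0 0 0 0 1) F).
      apply: cubic_equivalent; rewrite !(mulr0, mul0r, mul1r, mulr1, subr0, addr0, sub0r).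
      by rewrite oppr_eq0 oner_eq0.
    by rewrite cubic_coef_subst// /cubic_subst /cubic_polar /= c0; ring.
  have [r hr] : exists r, coef F 0 * r ^+ 3 + 3 * coef F 1 * r ^+ 2 + 3 * coef F 3 * r + coef F 6 = 0.
    have [x hx] := @solve_monicpoly K 3 (fun i => - [:: coef F 6; 3 * coef F 3; 3 * coef F 1]`_i / coef F 0) isT.
    exists x; rewrite hx !big_ord_recl big_ord0 /= /bump /=.
    by field.
  exists (substitute (mat3 1 r 0 0 1 0 0 0 1) F).
    apply: cubic_equivalent; rewrite !(mulr0, mul0r, mul1r, mulr1, subr0, addr0, sub0r).
    by rewrite oner_eq0.
  by rewrite cubic_coef_subst// /cubic_subst /cubic_polar /= -[RHS]hr; ring.
apply: (has_normal_form_equivalent eF1); rewrite (class_of_equivalent eF1) in cF; clear F eF1.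
(* Either (0:1:0) is singular, or the tangent line there is made z = 0. *)
have [[f3 f7]|[F2 eF2 [g6 g3 g7]]] : coef F1 3 = 0 /\ coef F1 7 = 0 \/
    exists2 F2, equivalent F1 F2 & [/\ coef F2 6 = 0, coef F2 3 = 0 & coef F2 7 != 0].
  have [f7|f7] := eqVneq (coef F1 7) 0; last first.
    right; exists (substitute (mat3 1 0 0 0 1 0 (- coef F1 3 / coef F1 7) 0 1) F1).
      apply: cubic_equivalent; rewrite !(mulr0, mul0r, mul1r, mulr1, subr0, addr0, sub0r).
      by rewrite oner_eq0.
    split; rewrite ?cubic_coef_subst// /cubic_subst /cubic_polar /= ?f6.
    - ring.
    - by field.
    - by apply: contraNneq f7 => <-; apply/eqP; ring.
  have [f3|f3] := eqVneq (coef F1 3) 0; first by left.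
  right; exists (substitute (mat3 0 0 1 0 1 0 1 0 0) F1).
    apply: cubic_equivalent; rewrite !(mulr0, mul0r, mul1r, mulr1, subr0, addr0, add0r, sub0r).
    by rewrite oppr0 add0r oppr_eq0 oner_eq0.
  split; rewrite ?cubic_coef_subst// /cubic_subst /cubic_polar /= ?f6 ?f7.
  - ring.
  - ring.
  - by apply: contraNneq f3 => <-; apply/eqP; ring.
- by apply: (cubic_singular cF); exists F1; [exact: equivalent_refl|].
apply: (has_normal_form_equivalent eF2); rewrite (class_of_equivalent eF2) in cF; clear F1 eF2 f6.
have [g1|g1] := eqVneq (coef F2 1) 0.
  have [g0|g0] := eqVneq (coef F2 0) 0; last exact: cubic_flex cF _ _ _ _ _.
  by apply: (cubic_singular cF); exact: cubic_line_singular.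
(* If (0:1:0) is not a flex, normalize the coefficients of y^2 z and x^2 y, and complete the square
   in y to remove those of x y z and y z^2. *)
pose m := coef F2 1 / coef F2 7; pose k := (3 * coef F2 1)^-1.
pose al := - coef F2 4 / coef F2 7; pose be := - coef F2 8 / (2 * coef F2 7).
have m0 : m != 0 by rewrite mulf_neq0 ?invr_eq0.
pose F3 := k *: substitute (mat3 1 0 0 al 1 (be * m) 0 0 m) F2.
have eF3 : equivalent F2 F3.
  exists k, (mat3 1 0 0 al 1 (be * m) 0 0 m); split; first by rewrite invr_eq0 mulf_neq0.
    by apply: unit_mat3; rewrite !(mulr0, mul0r, mul1r, mulr1, subr0, addr0).
  by [].
have F3E i : (i < 10)%N -> coef F3 i =
    [:: coef F3 0; 1 / 3; coef F3 2; 0; 0; coef F3 5; 0; 1 / 3; 0; coef F3 9]`_i.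
  case: i => [|[|[|[|[|[|[|[|[|[|i]]]]]]]]]] // _ /=; rewrite {1}/F3 cubic_coef_scaled//
    /cubic_subst /cubic_polar /= g6 g3 ?mulr0 /k ?/m ?/al ?/be; try ring; by field; rewrite ?n2 ?n3 ?g1 ?g7.
apply: (has_normal_form_equivalent eF3); rewrite (class_of_equivalent eF3) in cF.
clearbody F3; clear F2 eF3 g6 g3 g7 g1 m k al be m0.
pose t := coef F3 0.
pose F4 := substitute (mat3 1 0 t (- t) 1 (- t ^+ 2 / 2) 0 0 1) F3.
have eF4 : equivalent F3 F4.
  apply: cubic_equivalent; rewrite !(mulr0, mul0r, mul1r, mulr1, subr0, addr0).
  by rewrite oner_eq0.
apply: (has_normal_form_equivalent eF4); rewrite (class_of_equivalent eF4) in cF.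
apply: (@cubic_depressed F4 p (- 12 * coef F4 2) (- 12 * coef F4 5) (- 4 * coef F4 9) cF).
have [e1 e3 e4] := And3 (F3E 1%N isT) (F3E 3%N isT) (F3E 4%N isT).
have [e6 e7 e8] := And3 (F3E 6%N isT) (F3E 7%N isT) (F3E 8%N isT).
rewrite /= in e1 e3 e4 e6 e7 e8.
have hF4 i : (i < 10)%N -> coef F4 i =
    cubic_subst (coef F3) 1 0 t (- t) 1 (- t ^+ 2 / 2) 0 0 1 i by exact: cubic_coef_subst.
rewrite !hF4//; rewrite /t in hF4 *; clear - hF4 e1 e3 e4 e6 e7 e8 n2 n3 n4 n12.
move=> i i10; rewrite hF4//; clear hF4.
move: (coef F3) e1 e3 e4 e6 e7 e8 => u e1 e3 e4 e6 e7 e8; rewrite /cubic_subst /cubic_polar.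
case: i i10 => [|[|[|[|[|[|[|[|[|[|i]]]]]]]]]] // _ /=; rewrite e1 e3 e4 e6 e7 e8;
  by field; rewrite ?n2 ?n3 ?n4 ?n12.
Qed.

Lemma cubic_W_neq0 a b : cubic_W a b != 0.
Proof.
apply/negP => /eqP h; have := cubic_coef_W a b (isT : (0 < 10)%N).
rewrite h -(scale0r (cubic_W a b)) cubic_coefZ mul0r /= => /esym/eqP.
by rewrite oppr_eq0 oner_eq0.
Qed.

(** The first equation is that of the 3-division polynomial. *)
Definition affine_flexes a b : set (K * K) :=
  [set q | 3 * q.1 ^+ 4 + 6 * a * q.1 ^+ 2 + 12 * b * q.1 - a ^+ 2 = 0 /\
    q.2 ^+ 2 = q.1 ^+ 3 + a * q.1 + b].

Lemma finite_affine_flexes a b : finite_set (affine_flexes a b).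
Proof.
pose P : {poly K} := 3%:P * 'X^4 + (6 * a)%:P * 'X^2 + (12 * b)%:P * 'X - (a ^+ 2)%:P.
have P0 : P != 0.
  apply/negP => /eqP /(congr1 (fun p : {poly K} => p`_4)) /eqP.
  rewrite coefB !coefD !coefCM !coefXn coefX coefC coef0 /= !mulr0 !addr0 subr0 mulr1.
  by rewrite pnatr_eq0.
pose Q x : {poly K} := 'X^2 - (x ^+ 3 + a * x + b)%:P.
have Q0 x : Q x != 0.
  apply/negP => /eqP /(congr1 (fun p : {poly K} => p`_2)) /eqP.
  by rewrite coefB coefXn coefC coef0 /= subr0 oner_eq0.
apply: (@sub_finite_set _ _ (\bigcup_(x in [set x | root P x]) (pair x @` [set y | root (Q x) y]))).
  move=> [x y] [/= h1 h2]; exists x.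
    by rewrite /= /root /P !(hornerD, hornerN, hornerCM, hornerXn, hornerX, hornerC) h1.
  by exists y => //=; rewrite /root /Q !hornerE h2 subrr.
apply: bigcup_finite => [|x _]; first exact: finite_roots.
by apply: finite_image; exact: finite_roots.
Qed.

(** Here [(u, v)] is a tangent direction at [(x0, y0)], along which the equation vanishes to third
    order. *)
Lemma cubic_W_flex a b (x0 y0 u v : K) : (u != 0) || (v != 0) ->
  y0 ^+ 2 = x0 ^+ 3 + a * x0 + b -> 2 * y0 * v = (3 * x0 ^+ 2 + a) * u ->
  v ^+ 2 = 3 * x0 * u ^+ 2 -> affine_flexes a b (x0, y0).
Proof.
move=> uv h0 h1 h2.
have u0 : u != 0.
  case/orP: uv => // v0; apply: contraNneq v0 => u0.
  by move/eqP: h2; rewrite u0 expr0n mulr0 expf_eq0.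
split=> //=; apply: (mulIf (expf_neq0 2 u0)); rewrite mul0r.
have e : (2 * y0 * v) ^+ 2 = 4 * (x0 ^+ 3 + a * x0 + b) * (3 * x0 * u ^+ 2).
  by rewrite -h0 -h2; ring.
transitivity (4 * (x0 ^+ 3 + a * x0 + b) * (3 * x0 * u ^+ 2) - ((3 * x0 ^+ 2 + a) * u) ^+ 2); first by ring.
by rewrite -h1 -e subrr.
Qed.

Lemma mat3Z (k a b c d e f g h i : K) : k *: mat3 a b c d e f g h i =
  mat3 (k * a) (k * b) (k * c) (k * d) (k * e) (k * f) (k * g) (k * h) (k * i).
Proof. by apply/matrixP => x y; rewrite mxE /mat3 !mxE; repeat case: ifP => _. Qed.

(** The marked points are the flexes, and the chosen one is (0:1:0). A matrix that preserves the
    normal form and fixes this flex is diagonal, and its entries are determined by a twelfth root of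
    1. *)
Lemma cubic_W_class a b : (a != 0) || (b != 0) -> exists p, class_of (cubic_W a b) = Some p.
Proof.
move=> ab; have n3 := three_neq0; have n2 : (2 : K) != 0 by rewrite pnatr_eq0.
apply: class_of_Some; first exact: cubic_W_neq0.
have h12 : ('X^12 - 1 : {poly K}) != 0.
  apply/negP => /eqP /(congr1 (fun p : {poly K} => p`_12)) /eqP.
  by rewrite coefB coefXn coefC coef0 /= subr0 oner_eq0.
exists (option (K * K)), ([set None] `|` Some @` affine_flexes a b),
  ((fun t => mat3 1 0 0 0 t 0 0 0 (t ^- 2)) @` [set x | root ('X^12 - 1) x]),
  (fun A q => if q is Some r then [/\ invmx A 0 1 = r.1 * invmx A (2 : 'I_3) 1,
       invmx A 1 1 = r.2 * invmx A (2 : 'I_3) 1 & invmx A (2 : 'I_3) 1 != 0]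
     else invmx A (2 : 'I_3) 1 = 0 /\ invmx A 0 1 = 0).
split.
- rewrite finite_setU; split; first exact: finite_set1.
  exact/finite_image/finite_affine_flexes.
- exact/finite_image/finite_roots.
- move=> A c uA /(stabilizer_inv (cubic_W_neq0 a b) uA)[h c0].
  have uB : invmx A \in unitmx by rewrite unitmx_inv.
  set B := invmx A in uB h *.
  have hc i : (i < 10)%N -> cubic_subst (coef (cubic_W a b)) (B 0 0) (B 0 1) (B 0 (2 : 'I_3))
      (B 1 0) (B 1 1) (B 1 (2 : 'I_3)) (B (2 : 'I_3) 0) (B (2 : 'I_3) 1) (B (2 : 'I_3) (2 : 'I_3)) i =
      c^-1 * coef (cubic_W a b) i.
    by move=> i10; rewrite -cubic_coef_subst// -mat3E h cubic_coefZ.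
  have := hc 6%N isT; have := hc 3%N isT; have := hc 1%N isT.
  rewrite /cubic_subst /cubic_polar /= !cubic_coef_W//=; clear hc h.
  move: uB; rewrite {1}(mat3E B) unitmxE unitfE det_mat3.
  move: (B 0 0) (B 0 1) (B 0 (2 : 'I_3)) (B 1 0) (B 1 1) (B 1 (2 : 'I_3)) (B (2 : 'I_3) 0)
    (B (2 : 'I_3) 1) (B (2 : 'I_3) (2 : 'I_3)) => p l r q m s w n t dB k1 k3 k6.
  have [n0|n0] := eqVneq n 0.
    exists None; first by left.
    split=> //; apply: cube_eq0; apply: oppr_inj; rewrite oppr0.
    by rewrite -[RHS](mulr0 c^-1) -k6 n0; ring.
  exists (Some (l / n, m / n)); last by rewrite /= !divfK.
  right; exists (l / n, m / n) => //.
  have e6 : m ^+ 2 * n - l ^+ 3 - a * l * n ^+ 2 - b * n ^+ 3 = 0.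
    by rewrite -[RHS](mulr0 c^-1) -k6; field.
  have e3 : 2 * q * m * n + w * m ^+ 2 - 3 * p * l ^+ 2 - a * (p * n ^+ 2 + 2 * w * l * n)
      - 3 * b * w * n ^+ 2 = 0.
    by transitivity (3 * (c^-1 * 0)); [rewrite -k3; field|rewrite !mulr0].
  have e1 : q ^+ 2 * n + 2 * q * w * m - 3 * p ^+ 2 * l - a * (w ^+ 2 * l + 2 * p * w * n)
      - 3 * b * w ^+ 2 * n = 0.
    by transitivity (3 * (c^-1 * 0)); [rewrite -k1; field|rewrite !mulr0].
  clear k1 k3 k6; apply: (@cubic_W_flex a b (l / n) (m / n) (p - w * l / n) (q - w * m / n)).
  + apply: contraNT dB; rewrite negb_or !negbK !subr_eq0 => /andP[/eqP-> /eqP->].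
    by apply/eqP; field.
  + apply: (mulIf (expf_neq0 3 n0)); apply/eqP; rewrite -subr_eq0; apply/eqP.
    by rewrite -[RHS]e6; field.
  + apply: (mulIf (expf_neq0 3 n0)); apply/eqP; rewrite -subr_eq0; apply/eqP.
    transitivity (n * 0 - 3 * w * 0 : K); last by rewrite !mulr0 subr0.
    by rewrite -{1}e3 -e6; field.
  + apply: (mulIf (expf_neq0 3 n0)); apply/eqP; rewrite -subr_eq0; apply/eqP.
    transitivity (n ^+ 2 * 0 - 2 * w * n * 0 + 3 * w ^+ 2 * 0 : K); last by rewrite !mulr0 subr0 addr0.
    by rewrite -{1}e1 -{1}e3 -e6; field.
move=> A B c c' q uA hA uB hB _ kA kB.
have [hA' c0] := stabilizer_inv (cubic_W_neq0 a b) uA hA.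
pose N := B *m invmx A.
have uN : N \in unitmx by rewrite unitmx_mul uB unitmx_inv.
have hN : substitute N (cubic_W a b) = (c' * c^-1) *: cubic_W a b.
  by rewrite /N -substituteM hB substituteZr hA' scalerA.
have [N01 N21] : N 0 1 = 0 /\ N (2 : 'I_3) 1 = 0.
  have e2 : B *m (invmx B *m vec3 0 1 0) = vec3 0 1 0 by rewrite mulKVmx.
  have e3 : N *m vec3 0 1 0 = B *m (invmx A *m vec3 0 1 0) by rewrite mulmxA.
  have [k ek] : exists k : K, invmx A *m vec3 0 1 0 = k *: (invmx B *m vec3 0 1 0).
    rewrite (mat3E (invmx A)) (mat3E (invmx B)) !mul_mat3_vec3 !mulr1 !mulr0 !addr0 !add0r.
    have col1 (D : 'M[K]_3) : D \in unitmx -> D (2 : 'I_3) 1 = 0 -> D 0 1 = 0 -> D 1 1 != 0.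
      move=> uD D21 D01; apply: contraTneq uD => D11.
      by rewrite (mat3E D) unitmxE unitfE det_mat3 D21 D01 D11 negbK; apply/eqP; ring.
    have vec3Z k x y z : k *: vec3 x y z = vec3 (k * x) (k * y) (k * z) :> 'cV[K]_3.
      by apply/matrixP => i j; rewrite !mxE; do 2 case: ifP => //.
    have uB' : invmx B \in unitmx by rewrite unitmx_inv.
    case: q kA kB => [r [a0 a1 a2] [b0 b1 b2]|[kA kA'] [kB kB']].
      exists (invmx A (2 : 'I_3) 1 / invmx B (2 : 'I_3) 1); rewrite vec3Z a0 b0 a1 b1.
      by rewrite !(mulrCA (_ / _)) !divfK.
    exists (invmx A 1 1 / invmx B 1 1); rewrite vec3Z kA kB kA' kB' mulr0 divfK//.
    exact: col1.
  have e4 : N *m vec3 0 1 0 = vec3 (N 0 1) (N 1 1) (N (2 : 'I_3) 1).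
    by rewrite {1}(mat3E N) mul_mat3_vec3 !mulr0 !mulr1 !addr0 !add0r.
  move: e3; rewrite ek -scalemxAr e2 e4 => e3.
  have := congr1 (fun D : 'cV[K]_3 => D 0 0) e3; have := congr1 (fun D : 'cV[K]_3 => D (2 : 'I_3) 0) e3.
  by rewrite !mxE /= !mulr0 => -> ->.
have hc i : (i < 10)%N -> cubic_subst (coef (cubic_W a b)) (N 0 0) 0 (N 0 (2 : 'I_3))
    (N 1 0) (N 1 1) (N 1 (2 : 'I_3)) (N (2 : 'I_3) 0) 0 (N (2 : 'I_3) (2 : 'I_3)) i =
    c' * c^-1 * coef (cubic_W a b) i.
  by move=> i10; rewrite -cubic_coef_subst// -{1}N01 -N21 -mat3E hN cubic_coefZ.
have BN : B = N *m A by rewrite /N mulmxKV.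
move: (c' * c^-1) hc => k hc.
have := hc 9%N isT; have := hc 7%N isT; have := hc 5%N isT; have := hc 0%N isT.
have := hc 2%N isT; have := hc 8%N isT; have := hc 4%N isT; have := hc 3%N isT.
rewrite /cubic_subst /cubic_polar /= !cubic_coef_W//=; clear hc hN hA' hA hB kA kB.
move: uN BN; rewrite {1 2}(mat3E N) N01 N21 unitmxE unitfE det_mat3; clear N01 N21.
move: (N 0 0) (N 0 (2 : 'I_3)) (N 1 0) (N 1 1) (N 1 (2 : 'I_3)) (N (2 : 'I_3) 0)
  (N (2 : 'I_3) (2 : 'I_3)) => p r u m s w t dN BN k3 k4 k8 k2 k0 k5 k7 k9.
have m0 : m != 0 by apply: contraNneq dN => ->; apply/eqP; ring.
have w0 : w = 0.
  have : w * m ^+ 2 = 0 by transitivity (3 * (k * 0)); [rewrite -k3; field|rewrite !mulr0].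
  by move/eqP; rewrite mulf_eq0 expf_eq0 (negPf m0) orbF => /eqP.
subst w.
have [p0 t0] : p != 0 /\ t != 0.
  by split; apply: contraNneq dN => ->; apply/eqP; ring.
have u0 : u = 0.
  have : u * (m * t) = 0 by transitivity (3 * (k * 0)); [rewrite -k4; field|rewrite !mulr0].
  by move/eqP; rewrite !mulf_eq0 (negPf m0) (negPf t0) !orbF => /eqP.
subst u.
have s0 : s = 0.
  have : s * (m * t) = 0 by transitivity (3 / 2 * (k * 0)); [rewrite -k8; field; rewrite ?n2 ?n3|rewrite !mulr0].
  by move/eqP; rewrite !mulf_eq0 (negPf m0) (negPf t0) !orbF => /eqP.
subst s.
have r0 : r = 0.
  have : r * p ^+ 2 = 0 by rewrite -[RHS](mulr0 (- k)) mulNr -k2; field.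
  by move/eqP; rewrite mulf_eq0 expf_eq0 (negPf p0) orbF => /eqP.
subst r.
have ek : k = p ^+ 3 by apply: oppr_inj; rewrite -mulN1r mulrC -k0; ring.
have e7 : m ^+ 2 * t = p ^+ 3 by rewrite -ek; transitivity (3 * (k * (1 / 3))); [rewrite -k7; field|field].
have e5 : a * (p * t ^+ 2 - p ^+ 3) = 0.
  rewrite -ek; transitivity (a * k - a * k); last by rewrite subrr.
  by rewrite mulrBr; congr (_ - _); transitivity (- 3 * (k * (- a / 3))); [rewrite -k5; field|field].
have e9 : b * (t ^+ 3 - p ^+ 3) = 0.
  rewrite -ek; transitivity (b * k - b * k); last by rewrite subrr.
  by rewrite mulrBr; congr (_ - _); transitivity (- (k * (- b))); [rewrite -k9; ring|ring].
have e26 : (p / t) ^+ 6 = 1.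
  case/orP: ab => z0.
    have h : t ^+ 2 = p ^+ 2.
      move/eqP: e5; rewrite mulf_eq0 (negPf z0) /= => /eqP e5.
      by apply: (mulfI p0); apply/eqP; rewrite -subr_eq0 -[X in _ == X]e5; apply/eqP; ring.
    by rewrite expr_div_n (exprM t 2 3) h -exprM divff// expf_neq0.
  have h : t ^+ 3 = p ^+ 3.
    by move/eqP: e9; rewrite mulf_eq0 (negPf z0) /= subr_eq0 => /eqP.
  by rewrite expr_div_n (exprM t 3 2) h -exprM divff// expf_neq0.
have e2 : (m / p) ^+ 2 = p / t.
  by apply: (mulIf t0); rewrite divfK// expr_div_n mulrAC e7; field.
exists (mat3 1 0 0 0 (m / p) 0 0 0 ((m / p) ^- 2)).
  exists (m / p) => //=; rewrite /root !hornerE (exprM _ 2 6) e2 e26 subrr//.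
exists p => //; rewrite BN scalemxAl; congr (_ *m _).
rewrite mat3Z; apply: congr_mat3; rewrite ?mulr1 ?mulr0//.
  by rewrite mulrC divfK.
by rewrite e2; field; rewrite p0 t0.
Qed.

End CubicClasses.

(** * The family of plane cubics *)

Lemma weierstrass_cubicE (K : numClosedFieldType) (a b : K) :
  weierstrass_cubic a b = cubic_W a b.
Proof.
apply: cubic_ext => x y z; rewrite ev_cubic_W /weierstrass_cubic.
set X := mpolyX K (mnm1 0); set Y := mpolyX K (mnm1 (1 : 'I_3)).
set Z := mpolyX K (mnm1 (2 : 'I_3)).
have hX k : X ^+ k \is ishomog1 k mdeg := @homog_varX K 3 0 k.
have hY k : Y ^+ k \is ishomog1 k mdeg := @homog_varX K 3 1 k.
have hZ k : Z ^+ k \is ishomog1 k mdeg := @homog_varX K 3 (2 : 'I_3) k.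
have h1 : X * Z ^+ 2 \is ishomog1 3 mdeg := dhomogM (hX 1%N) (hZ 2%N).
have h2 : Y ^+ 2 * Z \is ishomog1 3 mdeg := dhomogM (hY 2%N) (hZ 1%N).
have h : Y ^+ 2 * Z - X ^+ 3 - a *: (X * Z ^+ 2) - b *: Z ^+ 3 \is ishomog1 3 mdeg.
  apply: rpredB; [apply: rpredB; [apply: rpredB; [exact: h2|exact: hX]|]|].
    exact: rpredZ.
  by apply: rpredZ; exact: hZ.
have mX k : meval (fun i => vec3 x y z i 0) (X ^+ k) = x ^+ k.
  by rewrite rmorphXn /= mevalXU mxE.
have mY k : meval (fun i => vec3 x y z i 0) (Y ^+ k) = y ^+ k.
  by rewrite rmorphXn /= mevalXU mxE.
have mZ k : meval (fun i => vec3 x y z i 0) (Z ^+ k) = z ^+ k.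
  by rewrite rmorphXn /= mevalXU mxE.
have mX1 : meval (fun i => vec3 x y z i 0) X = x := mX 1%N.
have mZ1 : meval (fun i => vec3 x y z i 0) Z = z := mZ 1%N.
rewrite ev_form_of// !mevalB !mevalZ (mevalM _ X (Z ^+ 2)) (mevalM _ (Y ^+ 2) Z).
by rewrite !mX !mY !mZ mX1 mZ1 mulrA.
Qed.

Section CubicFamily.
Context {R : realType} {C : complexField R}.
Local Notation form := (form C 2 3).
Implicit Types (F G : form) (v : 'cV[C]_3) (a b x y z : C).
Local Notation coef := cubic_coef.

Definition cubic_W0 : form := cubic (fun i => [:: -1; 0; 0; 0; 0; 0; 0; 1 / 3]`_i).
Definition cubic_W1 : form := cubic (fun i => [:: 0; 0; 0; 0; 0; - 1 / 3]`_i).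
Definition cubic_W2 : form := cubic (fun i => [:: 0; 0; 0; 0; 0; 0; 0; 0; 0; -1]`_i).

Lemma cubic_W_split a b : cubic_W0 + a *: cubic_W1 + b *: cubic_W2 = cubic_W a b.
Proof.
apply: cubic_ext => x y z; rewrite !evD !evZ !ev_cubic_form /cubic_val /=; ring.
Qed.

Lemma cubic_separates : @separates_forms R C 2 3.
Proof. by move=> F G h; apply: cubic_ext => x y z; exact: h. Qed.

Lemma polyfun_cubic_coef i : polyfun (fun F => coef F i).
Proof.
rewrite /cubic_coef; case: i => [|[|[|[|[|[|[|[|[|[|i]]]]]]]]]] /=; repeat first
  [exact: polyfun_ev | exact: polyfun_cst
  | apply: polyfunD | apply: polyfunN | apply: polyfunM | apply: polyfunX].
Qed.

Lemma polyfun_cubic_S : polyfun (@cubic_S C).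
Proof.
rewrite /cubic_S /cubic_Sc /aronholdS; repeat first
  [exact: polyfun_cubic_coef | exact: polyfun_cst
  | apply: polyfunD | apply: polyfunN | apply: polyfunM | apply: polyfunX].
Qed.

Lemma polyfun_cubic_T : polyfun (@cubic_T C).
Proof.
rewrite /cubic_T /cubic_Tc /aronholdT; repeat first
  [exact: polyfun_cubic_coef | exact: polyfun_cst
  | apply: polyfunD | apply: polyfunN | apply: polyfunM | apply: polyfunX].
Qed.

Lemma cubic_SZ (c : C) F : cubic_S (c *: F) = (c ^+ 2) ^+ 2 * cubic_S F.
Proof.
rewrite /cubic_S /cubic_Sc !cubic_coefZ.
move: (coef F 0) (coef F 1) (coef F 2) (coef F 3) (coef F 4) (coef F 5) (coef F 6) (coef F 7)
  (coef F 8) (coef F 9) => *; rewrite /aronholdS; ring.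
Qed.

Lemma cubic_TZ (c : C) F : cubic_T (c *: F) = (c ^+ 2) ^+ 3 * cubic_T F.
Proof.
rewrite /cubic_T /cubic_Tc !cubic_coefZ.
move: (coef F 0) (coef F 1) (coef F 2) (coef F 3) (coef F 4) (coef F 5) (coef F 6) (coef F 7)
  (coef F 8) (coef F 9) => *; rewrite /aronholdT; ring.
Qed.

Lemma cubic_SW a b : cubic_S (cubic_W0 + a *: cubic_W1 + b *: cubic_W2) = a.
Proof.
have n3 := @three_neq0 C.
by rewrite cubic_W_split /cubic_S /cubic_Sc !cubic_coef_W //= /aronholdS; field.
Qed.

Lemma cubic_TW a b : cubic_T (cubic_W0 + a *: cubic_W1 + b *: cubic_W2) = b.
Proof.
have n3 := @three_neq0 C; have n4 := @four_neq0 R C.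
by rewrite cubic_W_split /cubic_T /cubic_Tc !cubic_coef_W //= /aronholdT; field; rewrite ?n3 ?n4.
Qed.

Lemma nrm_mat3 (a b c d e f g h i : C) (k : R) : nrm a <= k -> nrm b <= k -> nrm c <= k ->
  nrm d <= k -> nrm e <= k -> nrm f <= k -> nrm g <= k -> nrm h <= k -> nrm i <= k ->
  nrm (mat3 a b c d e f g h i) <= k.
Proof.
move=> h1 h2 h3 h4 h5 h6 h7 h8 h9; apply/nrm_mx_le; first exact: le_trans (nrm_ge0 _) h1.
by move=> x y; rewrite mxE; repeat case: ifP => _.
Qed.

Lemma mat3_1 : mat3 1 0 0 0 1 0 0 0 1 = 1%:M :> 'M[C]_3.
Proof. by rewrite [RHS]mat3E !mxE. Qed.

(** The entry [q] is a square root of [s^-1], so that its norm is at most 1 or at most that of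
    [s^-1]. *)
Lemma cubic_torus (r : R) : exists K : R, forall s : C, s != 0 ->
    nrm s <= r -> nrm s^-1 <= r -> exists (A : 'M[C]_3) (c : C),
    [/\ c != 0, A \in unitmx, nrm A <= K /\ nrm (invmx A) <= K,
        c ^+ 2 * \det A ^+ 2 = s &
        forall a b, c *: substitute A (cubic_W0 + a *: cubic_W1 + b *: cubic_W2) =
          cubic_W0 + (s ^+ 2 * a) *: cubic_W1 + (s ^+ 3 * b) *: cubic_W2].
Proof.
exists (`|r| + 1) => s s0 h1 h2; pose q : C := sqrtC s^-1.
have q2 : q ^+ 2 = s^-1 by exact: sqrtCK.
have q0 : q != 0 by apply: contraNneq s0 => q0; rewrite -invr_eq0 -q2 q0 expr0n.
clearbody q; exists (mat3 1 0 0 0 q 0 0 0 s), 1.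
have [|uA iA] := @invmx_eq R C 2 (mat3 1 0 0 0 q 0 0 0 s) (mat3 1 0 0 0 q^-1 0 0 0 s^-1).
  by rewrite mul_mat3 !(mulr0, mul0r, mulr1, mul1r, addr0, add0r) !mulfV// mat3_1.
have rr : r <= `|r| + 1 by rewrite ler_wpDr// ler_norm.
have r0 : 0 <= `|r| + 1 by rewrite addr_ge0.
have r1 : 1 <= `|r| + 1 by rewrite lerDr.
have sq (t : C) : nrm (t ^+ 2) <= r -> nrm t <= `|r| + 1.
  rewrite nrmX => h; have [t1|t1] := leP (nrm t) 1; first exact: le_trans r1.
  by apply: le_trans rr; apply: le_trans h; rewrite expr2 ler_peMr ?nrm_ge0// ltW.
have hq : nrm q <= `|r| + 1 by apply: sq; rewrite q2.
have hq' : nrm q^-1 <= `|r| + 1 by apply: sq; rewrite exprVn q2 invrK.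
split=> //.
- by rewrite iA; split; apply: nrm_mat3; rewrite ?nrm1 ?nrm0//; exact: le_trans rr.
- transitivity (q ^+ 2 * s ^+ 2); first by rewrite det_mat3; ring.
  by rewrite q2; field.
move=> a b; rewrite !cubic_W_split scale1r; apply: cubic_ext => x y z.
rewrite ev_subst mul_mat3_vec3 !ev_cubic_W.
transitivity (q ^+ 2 * (y ^+ 2 * z * s) - x ^+ 3 - s ^+ 2 * a * x * z ^+ 2 - s ^+ 3 * b * z ^+ 3); first by ring.
by rewrite q2; field.
Qed.

Lemma dev_cubic_W a b x y z (p q l : C) : dev (cubic_W a b) (vec3 x y z) (vec3 p q l) =
  2 * y * z * q + y ^+ 2 * l - 3 * x ^+ 2 * p - a * (z ^+ 2 * p + 2 * x * z * l) - 3 * b * z ^+ 2 * l.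
Proof.
pose g0 := 2 * y * z * q + y ^+ 2 * l - 3 * x ^+ 2 * p - a * (z ^+ 2 * p + 2 * x * z * l) - 3 * b * z ^+ 2 * l.
pose g1 := q ^+ 2 * z + 2 * y * q * l - 3 * x * p ^+ 2 - a * (x * l ^+ 2 + 2 * p * z * l) - 3 * b * z * l ^+ 2.
pose g2 := q ^+ 2 * l - p ^+ 3 - a * p * l ^+ 2 - b * l ^+ 3.
pose g h : C := g0 + h * (g1 + h * g2).
have -> : 2 * y * z * q + y ^+ 2 * l - 3 * x ^+ 2 * p - a * (z ^+ 2 * p + 2 * x * z * l) - 3 * b * z ^+ 2 * l = g 0 by rewrite /g mul0r addr0.
apply: (@dev_unique _ _ _ _ _ _ _ (ev (cubic_W a b) (vec3 x y z)) g).
  have s1 : sdiffable (fun h : C => h) 0 by exists id; exact: sdiff_id.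
  do 2!(apply: sdiffableD; [exact: sdiffable_cst|apply: sdiffableM; [exact: s1|]]).
  exact: sdiffable_cst.
move=> h.
have -> : vec3 x y z + h *: vec3 p q l = vec3 (x + h * p) (y + h * q) (z + h * l).
  by apply/matrixP => i j; rewrite !mxE; repeat case: ifP.
rewrite !ev_cubic_W /g /g0 /g1 /g2; ring.
Qed.

Lemma cubic_span a b G : exists (B : 'M[C]_3) (x y : C), forall v,
  ev G v = dev (cubic_W0 + a *: cubic_W1 + b *: cubic_W2) v (B *m v) +
    x * ev cubic_W1 v + y * ev cubic_W2 v.
Proof.
have n3 := @three_neq0 C; have n2 : (2 : C) != 0 by rewrite pnatr_eq0.
exists (mat3 (- coef G 0 / 3) (- coef G 1) (- coef G 2 - 2 * a * coef G 3)
             (3 * coef G 4 + a * coef G 6) (3 * coef G 7 / 2)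
               ((3 * coef G 8 - a * coef G 1 + 3 * b * coef G 6) / 2)
             (3 * coef G 3) (coef G 6) 0),
  (a * coef G 0 / 3 - 9 * b * coef G 3 - 3 * coef G 5),
  (a * (coef G 2 + 2 * a * coef G 3) - coef G 9).
move=> v; rewrite cubic_W_split (vec3E v); move: (v 0 0) (v 1 0) (v (2 : 'I_3) 0) => x y z.
rewrite mul_mat3_vec3 dev_cubic_W ev_cubic !ev_cubic_form /cubic_val /=.
move: (coef G 0) (coef G 1) (coef G 2) (coef G 3) (coef G 4) (coef G 5) (coef G 6) (coef G 7)
  (coef G 8) (coef G 9) => *.
by field; rewrite ?n2 ?n3.
Qed.

Lemma cubic_euler a b : exists (c : C) (B : 'M[C]_3), forall v,
  2 * a * ev cubic_W1 v + 3 * b * ev cubic_W2 v =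
  c * ev (cubic_W0 + a *: cubic_W1 + b *: cubic_W2) v +
  dev (cubic_W0 + a *: cubic_W1 + b *: cubic_W2) v (B *m v).
Proof.
have n3 := @three_neq0 C; have n2 : (2 : C) != 0 by rewrite pnatr_eq0.
exists 0, (mat3 0 0 0 0 (- 1 / 2) 0 0 0 1) => v.
rewrite cubic_W_split (vec3E v); move: (v 0 0) (v 1 0) (v (2 : 'I_3) 0) => x y z.
rewrite mul_mat3_vec3 dev_cubic_W ev_cubic_W !ev_cubic_form /cubic_val /=.
by field; rewrite ?n2 ?n3.
Qed.

Definition cubic_disc F := 4 * cubic_S F ^+ 3 + 27 * cubic_T F ^+ 2.

Lemma polyfun_cubic_disc : polyfun cubic_disc.
Proof.
rewrite /cubic_disc; apply: polyfunD; (apply: polyfunM; first exact: polyfun_cst);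
  apply: polyfunX; [exact: polyfun_cubic_S|exact: polyfun_cubic_T].
Qed.

(** Such a cubic is singular at (1:0:0). *)
Lemma cubic_disc_singular F : coef F 0 = 0 -> coef F 1 = 0 -> coef F 2 = 0 -> cubic_disc F = 0.
Proof.
rewrite /cubic_disc /cubic_S /cubic_T /cubic_Sc /cubic_Tc => -> -> ->.
have n4 := @four_neq0 R C.
move: (coef F 3) (coef F 4) (coef F 5) (coef F 6) (coef F 7)
  (coef F 8) (coef F 9) => *; rewrite /aronholdS /aronholdT; by field.
Qed.

(** Such a cubic contains the line [z = 0]. *)
Lemma cubic_disc_line F : coef F 0 = 0 -> coef F 1 = 0 -> coef F 3 = 0 -> coef F 6 = 0 ->
  cubic_disc F = 0.
Proof.
rewrite /cubic_disc /cubic_S /cubic_T /cubic_Sc /cubic_Tc => -> -> -> ->.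
have n4 := @four_neq0 R C.
move: (coef F 2) (coef F 4) (coef F 5) (coef F 7)
  (coef F 8) (coef F 9) => *; rewrite /aronholdS /aronholdT; by field.
Qed.

Lemma cubic_small_coefs (I : seq nat) : uniq I -> (forall i, i \in I -> (i < 10)%N) ->
  (forall H, (forall i, i \in I -> coef H i = 0) -> cubic_disc H = 0) ->
  forall M rho : R, 0 <= M -> 0 < rho -> exists2 eps : R, 0 < eps & forall H : form, nrm H <= M ->
    (forall i, i \in I -> nrm (coef H i) <= eps) -> nrm (cubic_disc H) < rho.
Proof.
move=> uI I10 hI; apply: (@small_coefs R C 2 3 cubic_disc coef
    (fun i => cubic (fun j => (i == j)%:R)) I polyfun_cubic_disc polyfun_cubic_coef _ hI).
move=> H i iI.
have e (J : seq nat) : coef (\sum_(j <- J) coef H j *: cubic (fun l => (j == l)%:R)) i =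
    \sum_(j <- J) coef H j * (j == i)%:R.
  elim: J => [|j J IH].
    by rewrite !big_nil -(scale0r (0 : form)) cubic_coefZ mul0r.
  by rewrite !big_cons cubic_coefD cubic_coefZ IH cubic_coef_form// I10.
rewrite cubic_coefD -scaleN1r cubic_coefZ e (bigD1_seq i)//= eqxx mulr1.
rewrite big1 ?addr0 ?mulN1r ?subrr// => j /negPf ->; exact: mulr0.
Qed.

(** With [e1] and [e2] the norms of the ratios of the entries of a diagonal matrix to its first
    entry: either both are small, or [e1] is bounded from below and [e2] remains small after
    division by [e1 ^+ 2]. *)
Lemma ratio_bounds (M th e1 e2 : R) : 1 <= M -> 0 < th -> th <= 1 -> 0 < e1 -> 0 < e2 ->
  e2 <= M * e1 -> e1 * e2 <= th * (th / M) ^+ 3 ->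
  [/\ e1 <= th, e2 <= th & e1 * e2 <= th] \/
  [/\ e2 <= th, e1 * e2 <= th, e2 / e1 <= th & e2 / e1 ^+ 2 <= th].
Proof.
move=> M1 th0 th1 e10 e20 h h'; have M0 : 0 < M by exact: lt_le_trans M1.
pose t := th / M; have t0 : 0 < t by exact: divr_gt0.
have tth : t <= th by rewrite ler_pdivrMr// ler_peMr// ltW.
have t1 : t <= 1 by exact: le_trans th1.
have [a|a] := leP e1 t; [left|right].
  have h1 : e1 <= th by exact: le_trans tth.
  have h2 : e2 <= th.
    by apply: le_trans h _; rewrite mulrC -ler_pdivlMr.
  by split=> //; apply: le_trans h1; rewrite ler_piMr ?(ltW e10)// (le_trans h2).
have key k : (k <= 3)%N -> e1 * e2 <= th * e1 ^+ k.
  move=> k3; apply: le_trans h' _; rewrite -/t ler_pM2l//.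
  apply: (@le_trans _ _ (t ^+ k)); last by rewrite lerXn2r ?nnegrE ?ltW.
  by apply: ler_wiXn2l => //; exact: ltW.
have e1k k : 0 < e1 ^+ k by exact: exprn_gt0.
have := key 0%N isT; have := key 1%N isT; have := key 2%N isT; have := key 3%N isT.
rewrite expr0 expr1 mulr1 => k3 k2 k1 k0; split=> //.
- by rewrite -(ler_pM2l e10) (mulrC e1 th).
- by rewrite ler_pdivrMr// -(ler_pM2l e10) mulrCA -expr2.
- by rewrite ler_pdivrMr// -(ler_pM2l e10) mulrCA -exprS.
Qed.

(** In the first case of [ratio_bounds] the form [H] of the criterion is nearly singular at (1:0:0),
    because its coefficients of [x^3], [x^2 y] and [x^2 z] are small. In the second case those of
    [x^3], [x^2 y], [x y^2] and [y^3] are small and it nearly contains the line [z = 0]. *)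
Lemma cubic_stable F : cubic_disc F != 0 -> exists2 delta : R, 0 < delta &
    exists2 eta : R, 0 < eta & forall F1 F2 (A : 'M[C]_3) (c : C),
      nrm (F1 - F) < delta -> nrm (F2 - F) < delta -> A \in unitmx -> c != 0 ->
      F2 = c *: substitute A F1 -> eta * nrm A ^+ 3 <= nrm (\det A).
Proof.
apply: (@stable_of_flat R C 2 3 2 cubic_disc cubic_separates polyfun_cubic_disc).
  move=> c A G; rewrite /cubic_disc cubic_SZ cubic_TZ (invariant_all _ _).1 (invariant_all _ _).2 /mu.
  move: (\det A) (cubic_S G) (cubic_T G) => u s t; ring.
move=> M k rho M1 k0 rho0.
have M0 : 0 <= M by exact: le_trans M1.
have [||H hH|e1 e10 he1] := @cubic_small_coefs [:: 0; 1; 2]%N _ _ _ M rho M0 rho0.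
- by [].
- by move=> i; rewrite !inE => /or3P[] /eqP->.
- by apply: cubic_disc_singular; apply: hH; rewrite !inE.
have [||H hH|e2 e20 he2] := @cubic_small_coefs [:: 0; 1; 3; 6]%N _ _ _ M rho M0 rho0.
- by [].
- by move=> i; rewrite !inE => /or4P[] /eqP->.
- by apply: cubic_disc_line; apply: hH; rewrite !inE.
have [B B0 hB] : exists2 B : R, 0 < B & forall G, nrm G <= M ->
    forall i, (i < 10)%N -> nrm (coef G i) <= B.
  have : forall m, exists2 B : R, 0 < B & forall G, nrm G <= M ->
    forall i, (i < m)%N -> nrm (coef G i) <= B.
    elim=> [|m [B B0 hB]]; first by exists 1.
    have [b b0 hb] := lip_bounded (polyfun_lip (polyfun_cubic_coef m)) M0.
    exists (B + b); first exact: addr_gt0.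
    move=> G hG i; rewrite ltnS leq_eqVlt => /orP[/eqP->|im].
      by apply: le_trans (hb _ hG) _; rewrite lerDr ltW.
    by apply: le_trans (hB _ hG _ im) _; rewrite lerDl ltW.
  by move/(_ 10%N).
(* [m] below has square mu, hence norm at least [kk]. *)
pose kk := Num.min 1 k; have kk0 : 0 < kk by rewrite lt_min ltr01.
pose e := Num.min e1 e2; have e0 : 0 < e by rewrite lt_min e10.
pose th := Num.min 1 (e * kk / B).
have th0 : 0 < th by rewrite lt_min ltr01 divr_gt0// mulr_gt0.
have th1 : th <= 1 by rewrite ge_min lexx.
have thB : B * th / kk <= e.
  rewrite ler_pdivrMr// mulrC -ler_pdivlMr//.
  by rewrite ge_min lexx orbT.
have [ee1 ee2] : e <= e1 /\ e <= e2 by rewrite !ge_min !lexx orbT.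
exists (th * (th / M) ^+ 3); first by rewrite mulr_gt0// exprn_gt0// divr_gt0// (lt_le_trans _ M1).
move=> H G c v nH nG v0 eG hmu hv hprod.
have dv : diag_mx v = mat3 (v 0 0) 0 0 0 (v 0 1) 0 0 0 (v 0 (2 : 'I_3)).
  by rewrite [LHS]mat3E !mxE /= !mulr1n !mulr0n.
rewrite dv in eG hmu.
have [x0 y0 z0] := And3 (v0 0) (v0 1) (v0 (2 : 'I_3)).
have hyz : nrm (v 0 (2 : 'I_3)) <= M * nrm (v 0 1) by exact: hv.
have hp : nrm (v 0 0 * v 0 1 * v 0 (2 : 'I_3)) <= th * (th / M) ^+ 3 * nrm (v 0 0) ^+ 3.
  apply: le_trans hprod; rewrite !big_ord_recl big_ord0 mulr1 mulrA.
  have -> : lift 0 (0 : 'I_2) = 1 :> 'I_3 by exact: val_inj.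
  by have -> : lift 0 (lift 0 (0 : 'I_1)) = (2 : 'I_3) :> 'I_3 by exact: val_inj.
have hco i : (i < 10)%N -> coef G i =
    c * cubic_subst (coef H) (v 0 0) 0 0 0 (v 0 1) 0 0 0 (v 0 (2 : 'I_3)) i.
  by move=> i10; rewrite eG cubic_coef_scaled.
clear eG dv hv hprod v0.
move: (v 0 0) (v 0 1) (v 0 (2 : 'I_3)) x0 y0 z0 hyz hp hco hmu => x y z x0 y0 z0 hyz hp hco hmu.
pose m := c * x * y * z.
have mk : kk <= nrm m.
  rewrite leNgt; apply/negP => h; move: hmu; apply/negP; rewrite -ltNge.
  have -> : @mu R C 2 2 c (mat3 x 0 0 0 y 0 0 0 z) = m ^+ 2 by rewrite /mu det_mat3 /m; ring.
  have [h1 hk] : nrm m < 1 /\ nrm m < k by apply/andP; rewrite -lt_min.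
  by rewrite nrmX; apply: le_lt_trans hk; rewrite expr2 ler_piMr ?nrm_ge0// ltW.
have m0 : m != 0 by rewrite -nrm_gt0; exact: lt_le_trans mk.
have c0 : c != 0 by apply: contraNneq m0 => c0; rewrite /m c0 !mul0r.
pose r1 := nrm (y / x); pose r2 := nrm (z / x).
have r10 : 0 < r1 by rewrite nrm_gt0 mulf_neq0 ?invr_eq0.
have r20 : 0 < r2 by rewrite nrm_gt0 mulf_neq0 ?invr_eq0.
have nx : 0 < nrm x by rewrite nrm_gt0.
have r21 : r2 <= M * r1.
  by rewrite /r1 /r2 !nrmM nrmV mulrA ler_pM2r ?invr_gt0.
have r12 : r1 * r2 <= th * (th / M) ^+ 3.
  have -> : r1 * r2 = nrm (x * y * z) / nrm x ^+ 3.
    by rewrite -nrmX -nrmV -nrmM /r1 /r2 -nrmM; congr nrm; field.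
  by rewrite ler_pdivrMr// exprn_gt0.
(* Substituting diag v, v = (x, y, z), multiplies the coefficient of index (i, j, k) by x^i y^j z^k:
   to undo it is to divide by m and to multiply by a monomial in y / x and z / x. *)
have small i (q : C) : (i < 10)%N -> coef H i = coef G i * q / m -> nrm q <= th -> nrm (coef H i) <= e.
  move=> i10 -> hq; apply: le_trans thB; rewrite !nrmM nrmV.
  apply: ler_pM; rewrite ?mulr_ge0 ?invr_ge0 ?nrm_ge0//; last by rewrite lef_pV2 ?posrE// nrm_gt0.
  by apply: ler_pM; rewrite ?nrm_ge0// hB.
have s0 : coef H 0 = coef G 0 * (y / x * (z / x)) / m.
  by rewrite hco// /m /cubic_subst /cubic_polar /=; field; rewrite ?x0 ?y0 ?z0 ?c0.
have s1 : coef H 1 = coef G 1 * (z / x) / m.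
  by rewrite hco// /m /cubic_subst /cubic_polar /=; field; rewrite ?x0 ?y0 ?z0 ?c0.
have s2 : coef H 2 = coef G 2 * (y / x) / m.
  by rewrite hco// /m /cubic_subst /cubic_polar /=; field; rewrite ?x0 ?y0 ?z0 ?c0.
have s3 : coef H 3 = coef G 3 * ((z / x) / (y / x)) / m.
  by rewrite hco// /m /cubic_subst /cubic_polar /=; field; rewrite ?x0 ?y0 ?z0 ?c0.
have s6 : coef H 6 = coef G 6 * ((z / x) / (y / x) ^+ 2) / m.
  by rewrite hco// /m /cubic_subst /cubic_polar /=; field; rewrite ?x0 ?y0 ?z0 ?c0.
have := ratio_bounds M1 th0 th1 r10 r20 r21 r12.
rewrite /r1 /r2 -nrmX -!nrmV -!nrmM => -[[b1 b2 b12]|[b2 b12 b3 b6]].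
- apply: he1 => // i; rewrite !inE => /or3P[] /eqP->; apply: le_trans ee1.
  + exact: small s0 b12.
  + exact: small s1 b2.
  + exact: small s2 b1.
- apply: he2 => // i; rewrite !inE => /or4P[] /eqP->; apply: le_trans ee2.
  + exact: small s0 b12.
  + exact: small s1 b2.
  + exact: small s3 b3.
  + exact: small s6 b6.
Qed.

Lemma cubic_unstable : exists F0 p0, [/\ class_of F0 = Some p0, cubic_disc F0 = 0 &
    forall delta eta : R, 0 < delta -> 0 < eta ->
      exists F1 (A : 'M[C]_3) (c : C),
      [/\ nrm (F1 - F0) < delta, A \in unitmx, substitute A F1 = c *: F1 &
          nrm (\det A) < eta * nrm A ^+ 3]].
Proof.
(* The nodal cubic x y z + x^3 + y^3 deforms to x y z + x^3 + y^3 + t z^3, which is preserved by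
   the exchange of x and u z when t = u^3. *)
have n6 := @six_neq0 C; have n3 := @three_neq0 C; have n2 : (2 : C) != 0 by rewrite pnatr_eq0.
have n27 : (27 : C) != 0 by rewrite pnatr_eq0.
pose F (t : C) : form := cubic (fun i => [:: 1; 0; 0; 0; 1 / 6; 0; 1; 0; 0; t]`_i).
have evF t x y z : ev (F t) (vec3 x y z) = x * y * z + x ^+ 3 + y ^+ 3 + t * z ^+ 3.
  by rewrite ev_cubic_form /cubic_val /=; field.
have a0 : (- (1 / 3) != 0 :> C) || (2 / 27 != 0 :> C).
  by rewrite oppr_eq0 mulf_neq0 ?oner_neq0 ?invr_eq0.
have [p0 hp0] := cubic_W_class a0.
exists (F 0), p0; split.
- rewrite -hp0; apply: class_of_equivalent.
  exists 1, (mat3 (-1 / 2) (1 / 2) (1 / 6) (-1 / 2) (-1 / 2) (1 / 6) (-3) 0 (-3)).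
  split; first exact: oner_neq0.
    apply: unit_mat3.
    have -> : -1 / 2 * (-1 / 2 * -3 - 1 / 6 * 0) - 1 / 2 * (-1 / 2 * -3 - 1 / 6 * -3) +
      1 / 6 * (-1 / 2 * 0 - -1 / 2 * -3) = - 2 :> C by field.
    by rewrite oppr_eq0.
  by rewrite scale1r; apply: cubic_ext => x y z; rewrite ev_subst mul_mat3_vec3 evF ev_cubic_W; field; rewrite ?n2 ?n3 ?n6 ?n27.
- rewrite /cubic_disc /cubic_S /cubic_T /cubic_Sc /cubic_Tc !cubic_coef_form//= /aronholdS /aronholdT.
  by field; rewrite ?n6 ?(@four_neq0 R C).
move=> delta eta d0 e0.
pose E : form := cubic (fun i => [:: 0; 0; 0; 0; 0; 0; 0; 0; 0; 1]`_i).
pose s : R := Num.min 1 (Num.min (delta / (nrm E + 1)) (eta / 2)).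
have s0 : 0 < s by rewrite !lt_min ltr01 !divr_gt0// ltr_wpDl ?nrm_ge0.
have [s1 sd se] : [/\ s <= 1, s <= delta / (nrm E + 1) & s <= eta / 2].
  by rewrite /s !ge_min !lexx !orbT.
pose u : C := rl s.
have nu : nrm u = s by rewrite nrm_real gtr0_norm.
have u0 : u != 0 by rewrite -nrm_gt0 nu.
have s3 : s ^+ 3 <= s by rewrite exprS ler_piMr ?(ltW s0)// exprn_ile1// ltW.
exists (F (u ^+ 3)), (mat3 0 0 u 0 1 0 u^-1 0 0), 1.
have dA : 0 * (1 * 0 - 0 * 0) - 0 * (0 * 0 - 0 * u^-1) + u * (0 * 0 - 1 * u^-1) = -1 by field.
split.
- have -> : F (u ^+ 3) - F 0 = u ^+ 3 *: E.
    apply: cubic_ext => x y z; rewrite evB !evF evZ ev_cubic_form /cubic_val /=; ring.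
  rewrite nrmZ nrmX nu; have h : nrm E < nrm E + 1 by rewrite ltrDl.
  apply: (@le_lt_trans _ _ (s * nrm E)); first by rewrite ler_wpM2r ?nrm_ge0.
  apply: (@lt_le_trans _ _ (s * (nrm E + 1))); first by rewrite ltr_pM2l.
  by rewrite -ler_pdivlMr// ltr_wpDl ?nrm_ge0.
- by apply: unit_mat3; rewrite dA oppr_eq0 oner_eq0.
- rewrite scale1r; apply: cubic_ext => x y z.
  by rewrite ev_subst mul_mat3_vec3 !evF; field.
rewrite det_mat3 dA nrmN nrm1.
have h : s^-1 <= nrm (mat3 0 0 u 0 1 0 u^-1 0 0).
  have -> : s^-1 = nrm (mat3 0 0 u 0 1 0 u^-1 0 0 (2 : 'I_3) 0) by rewrite mxE /= nrmV nu.
  exact: nrm_mx_entry.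
apply: (@lt_le_trans _ _ (eta * s^-1 ^+ 3)); last first.
  by rewrite ler_pM2l// lerXn2r ?nnegrE ?nrm_ge0 ?invr_ge0 ?(ltW s0).
rewrite exprVn ltr_pdivlMr ?exprn_gt0// mul1r; apply: (le_lt_trans s3).
by apply: le_lt_trans se _; rewrite ltr_pdivrMr// ltr_pMr// ltr1n.
Qed.

Definition cubic_family : weierstrass_family C 2 3 2.
Proof.
apply: (@WeierstrassFamily R C 2 3 2 cubic_W0 cubic_W1 cubic_W2 (@cubic_S C) (@cubic_T C)).
- exact: cubic_separates.
- by [].
- by [].
- by move=> F; apply: polyfun_sdiffable; exact: polyfun_cubic_S.
- by move=> F; apply: polyfun_sdiffable; exact: polyfun_cubic_T.
- by move=> A F; exact: (invariant_all A F).1.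
- by move=> A F; exact: (invariant_all A F).2.
- exact: cubic_SZ.
- exact: cubic_TZ.
- exact: cubic_SW.
- exact: cubic_TW.
- exact: cubic_torus.
- move=> F p cF; have [a [b [ab h]]] := cubic_normal_form cF.
  by exists a, b; rewrite cubic_W_split.
- move=> a b ab; rewrite cubic_W_split; exact: cubic_W_class.
- exact: cubic_span.
- exact: cubic_euler.
- exact: cubic_stable.
- exact: cubic_unstable.
Defined.

End CubicFamily.

Theorem lemma5p4 (R : realType) :
  (exists phi : moduli R[i] 2 3 -> moduli R[i] 1 4,
     analytic_isomorphism phi /\
     forall a b : R[i],
       omap phi (class_of (weierstrass_cubic a b)) =
       class_of (weierstrass_quartic a b)) /\
  special_points R[i] 2 3 /\
  special_points R[i] 1 4.
Proof.
pose cub := @cubic_family R (complex_field R); pose qua := @quartic_family R (complex_field R).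
split; last by split; [exact: special_points_family cub|exact: special_points_family qua].
have [phi [iso h]] := isomorphism_family cub qua; exists phi; split; first exact: iso.
move=> a b; rewrite weierstrass_cubicE weierstrass_quarticE.
have := h a b; rewrite /fW /=.
by rewrite (@cubic_W_split R (complex_field R) a b) (@quartic_W_split R (complex_field R) a b).
Qed.
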